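(* Let $N\ge2$ and let $(A_1,\dots,A_N)$ be nonnegative random variables satisfying $P\{\sum_{i}\mathbf{1}\{A_i>0\}\in\{0,1\}\}<1$, $\mathbb{E}[\sum_i\mathbf{1}\{A_i>0\}]>1$, $P\{A_i\in\{0,1\}\ \forall i\}<1$. Let $F_0$ satisfy $(\mathbf{H}_\gamma)$ (see context) for some $\gamma\in(0,2]$, let $X_0$ have distribution function $F_0$, and assume $\mu(\delta)<\mu(\gamma)$ for some $\delta>\gamma$. Let $V_t$ be a random variable whose characteristic function is $\phi(t,\cdot)$, the solution of the Cauchy problem in the context with initial datum the characteristic function of $F_0$, and let $V_\infty$ be a random variable with characteristic function $\xi\mapsto\int_{[0,\infty)}\hat g_\gamma(\xi z^{1/\gamma})\zeta_{\infty,\gamma}(dz)$. Then for every $t\ge0$ $$\mathcal{Z}_\delta(e^{-\mu(\gamma)t}V_t,V_\infty)\le\mathcal{Z}_\delta(X_0,V_\infty)e^{-t\delta[\mu(\gamma)-\mu(\delta)]}.$$ In particular, if $\gamma=2$, $\delta\le3$ and $\mathbb{E}|X_0|^\delta<+\infty$, then $\mathcal{Z}_\delta(e^{-\mu(\gamma)t}V_t,V_\infty)\le c\,e^{-t\delta[\mu(\gamma)-\mu(\delta)]}$, where $c:=\frac{1}{\Gamma(1+\delta)}(\mathbb{E}|X_0|^\delta+\mathbb{E}|V_\infty|^\delta)<+\infty$.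
   Context: $\mathcal{Q}(s)=\mathbb{E}[\sum_{j=1}^N A_j^s]-1$ ($0^0=0$), $\mu(s)=\mathcal{Q}(s)/s$. Cauchy problem: $\phi(t,\cdot)$ characteristic functions with $\partial_t\phi(t,\xi)+\phi(t,\xi)=\mathbb{E}[\prod_{i=1}^N\phi(t,A_i\xi)]$, $\phi(0,\cdot)=\phi_0$ (unique solution). $(\mathbf{H}_\gamma)$: if $\gamma=1$: either (a) $\int|v|dF_0<\infty$, $m_0=\int v\,dF_0$, or (b) $F_0$ symmetric, $\lim_{x\to+\infty}x(1-F_0(x))=c_0^+=\lim_{x\to-\infty}|x|F_0(x)$, $0<c_0^+<\infty$. If $\gamma=2$: $0<\sigma_0^2:=\int v^2dF_0<\infty$ and $\int v\,dF_0=0$. If $\gamma\in(0,1)\cup(1,2)$: $\lim_{x\to+\infty}x^\gamma(1-F_0(x))=c_0^+<\infty$, $\lim_{x\to-\infty}|x|^\gamma F_0(x)=c_0^-<\infty$, $c_0^++c_0^->0$, and $\int v\,dF_0=0$ if $\gamma>1$. $\hat g_\gamma(\xi)$: $e^{im_0\xi}$ if $\gamma=1$, (a); $e^{-\pi c_0^+|\xi|}$ if $\gamma=1$, (b); $e^{-\sigma_0^2\xi^2/2}$ if $\gamma=2$; $\exp\{-k_0|\xi|^\gamma(1-i\eta_0\tan(\pi\gamma/2)\mathrm{sign}\,\xi)\}$ otherwise, with $k_0=(c_0^++c_0^-)\frac{\pi}{2\Gamma(\gamma)\sin(\pi\gamma/2)}$, $\eta_0=\frac{c_0^+-c_0^-}{c_0^++c_0^-}$.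 $\zeta_{\infty,\gamma}$: the unique probability on $[0,\infty)$ with mean $1$ whose Fourier–Stieltjes transform $v$ solves $v(\xi)=\int_0^1\mathbb{E}[\prod_{i=1}^N v(\xi A_i^\gamma\tau^{\mathcal{Q}(\gamma)})]d\tau$. Zolotarev metric: for $s=m+\alpha$ with $m\ge0$ integer and $0<\alpha\le1$, $\mathcal{Z}_s(X,Y)=\sup\{\mathbb{E}[f(X)-f(Y)]:f\in\mathcal{F}_s\}$, where $\mathcal{F}_s$ is the set of real functions on $\mathbb{R}$ having an $m$-th derivative everywhere with $|f^{(m)}(x)-f^{(m)}(y)|\le|x-y|^\alpha$. *)

(* Defs.v *)
From HB Require Import structures.
From mathcomp Require Import all_boot all_order all_algebra.
From mathcomp Require Import all_classical all_reals all_analysis.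
From mathcomp Require Import complex.

Set Implicit Arguments.
Unset Strict Implicit.
Unset Printing Implicit Defensive.
Import Order.TTheory GRing.Theory Num.Theory.
Import numFieldNormedType.Exports.

Local Open Scope classical_set_scope.
Local Open Scope ring_scope.
Local Open Scope complex_scope.

Section Defs.
Variable R : realType.

(* a^s with the convention 0^0 = 0 (in fact 0^s = 0 for every s) *)
Definition pw (a s : R) : R := if a == 0 then 0 else a `^ s.

Definition cint d (T : measurableType d) (mu : {measure set T -> \bar R})
  (D : set T) (F : T -> R[i]) : R[i] :=
  (\int[mu]_(x in D) complex.Re (F x)) +i* (\int[mu]_(x in D) complex.Im (F x)).

Definition cexpect d (T : measurableType d) (P : probability T R)
  (F : T -> R[i]) : R[i] := cint P setT F.

Definition cexpi (th : R) : R[i] := (cos th) +i* (sin th).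

Definition charfun (mu : probability R R) (xi : R) : R[i] :=
  cexpect mu (fun x => cexpi (xi * x)).

Definition distrfun (mu : probability R R) (x : R) : R :=
  fine (mu `]-oo, x]%classic).

Definition Gamma (s : R) : R :=
  \int[@lebesgue_measure R]_(x in `]0, +oo[%classic) (x `^ (s - 1) * expR (- x)).

Definition Qfun d (T : measurableType d) (P : probability T R) (N : nat)
  (A : 'I_N -> T -> R) (s : R) : \bar R :=
  ((\int[P]_x (\sum_(j < N) pw (A j x) s)%:E) - 1)%E.

Definition mufun d (T : measurableType d) (P : probability T R) (N : nat)
  (A : 'I_N -> T -> R) (s : R) : \bar R :=
  (Qfun P A s * (s^-1)%:E)%E.

Definition zol_class (s : R) (f : R -> R) : Prop :=
  exists (m : nat) (alpha : R),
    [/\ s = m%:R + alpha, 0 < alpha <= 1,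
        (forall k x, (k < m)%N -> derivable (derive1n k f) x 1) &
        (forall x y, `|derive1n m f x - derive1n m f y| <= `|x - y| `^ alpha)].

Definition zolotarev (s : R) d1 (T1 : measurableType d1) (P1 : probability T1 R)
  (X : T1 -> R) d2 (T2 : measurableType d2) (P2 : probability T2 R)
  (Y : T2 -> R) : \bar R :=
  ereal_sup [set (\int[P1]_x (f (X x))%:E - \int[P2]_y (f (Y y))%:E)%E
            | f in zol_class s].

(* Hypothesis (H_gamma) on the law mu0 (distribution function F0), together
   with the statement that g is the corresponding function \hat g_gamma. *)
Definition Hgamma (mu0 : probability R R) (gamma : R) (g : R -> R[i]) : Prop :=
  let F0 := distrfun mu0 in
  (gamma = 1 /\
     ( (mu0.-integrable setT (fun v => (v : R)%:E) /\
        let m0 := \int[mu0]_v v in g = fun xi => cexpi (m0 * xi))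
     \/ (exists c0p : R,
          [/\ (forall x : R, mu0 `]-oo, - x]%classic = mu0 `[x, +oo[%classic),
              (fun x => x * (1 - F0 x)) @ +oo --> c0p,
              (fun x => `|x| * F0 x) @ -oo --> c0p,
              0 < c0p &
              g = fun xi => (expR (- pi * c0p * `|xi|))%:C]) ))
  \/ (gamma = 2 /\
      exists sigma2 : R,
        [/\ mu0.-integrable setT (fun v => (v ^+ 2 : R)%:E),
            sigma2 = \int[mu0]_v (v ^+ 2),
            0 < sigma2,
            (\int[mu0]_v (v : R)%:E = 0)%E &
            g = fun xi => (expR (- sigma2 * xi ^+ 2 / 2))%:C])
  \/ ([/\ 0 < gamma < 2 & gamma != 1] /\
      exists c0p c0m : R,
        let k0 := (c0p + c0m) * (pi / (2 * Gamma gamma * sin (pi * gamma / 2))) in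
        let eta0 := (c0p - c0m) / (c0p + c0m) in
        [/\ (fun x => x `^ gamma * (1 - F0 x)) @ +oo --> c0p,
            (fun x => `|x| `^ gamma * F0 x) @ -oo --> c0m,
            0 < c0p + c0m,
            (1 < gamma -> (\int[mu0]_v (v : R)%:E = 0)%E) &
            g = fun xi =>
              (expR (- k0 * `|xi| `^ gamma))%:C *
              cexpi (k0 * `|xi| `^ gamma * eta0 * tan (pi * gamma / 2) * Num.sg xi)]).

End Defs.

(* Main.v *)
(** Idea. Write [m] for [mu(gamma)]. As [g(xi (y + z)^(1/gamma))] factorizes, the fixed point equation
    of [zeta] says that [V_infty] has the law of [tau^m (A_1 V_1 + ... + A_N V_N)] with [tau] uniform on
    [[0,1]] and [V_i] independent copies of [V_infty]. Hence [e^(m t) V_infty] solves the same Cauchy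
    problem. Both flows are limits of the Euler scheme [nu |-> (1 - h) nu + h S nu], [S] being the smoothing
    transform, and one step multiplies Zolotarev distances of order [delta] by at most [1 + h Q(delta)]; the
    limit is taken on cosines, which control all regular test functions (smoothing by a Cauchy kernel).

    This settles bounded, integrable test functions. Any [f] is multiplied by [exp(-(s ln(1+x^2))^2)], which
    alters its class by a factor tending to 1 with [s], and the limit [s -> 0] is harmless except when
    [E f^-(V_infty) = +oo > E f^-(e^(-m t) V_infty)]. To exclude this, one compares tails: finiteness of the
    distance gives [V_infty] the tails of [X_0]. A tail [o(x^-gamma)] propagates through the fixed point
    equation to a finite moment of order [delta], since [E (sum_i (tau^m A_i)^delta) < 1]. On a side where
    the tail is of exact order [x^-gamma], [V_infty^(1/m)] has a nonincreasing density, whose values at [y]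
    and [e^t y] are then comparable.

    For [gamma = 2] the first two moments of [X_0] and [V_infty] agree, so Taylor's formula bounds the
    distance by [(E|X_0|^delta + E|V_infty|^delta) / ((1 + a)(2 + a))], [a = delta - 2], and
    [Gamma(3 + a) <= (1 + a)(2 + a)]. *)

Require Import Defs.
From HB Require Import structures.
From mathcomp Require Import all_boot all_order all_algebra.
From mathcomp Require Import all_classical all_reals all_analysis.
From mathcomp Require Import measurable_realfun complex ring lra.
Import Order.TTheory GRing.Theory Num.Theory.
Import numFieldNormedType.Exports.
Local Open Scope classical_set_scope.
Local Open Scope ring_scope.
Local Open Scope complex_scope.

Set Implicit Arguments.
Unset Strict Implicit.
Unset Printing Implicit Defensive.

(** The rate has two sources: a Gronwall estimate at order [delta] gives [exp (t Q(delta))] with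
    [Q(delta) = delta mu(delta)], and undoing the dilation [e^(-mu(gamma) t)] in a class homogeneous
    of degree [delta] gives [exp (- t delta mu(gamma))]. The obstacle is that a distance of order
    [delta > gamma] may be finite although neither law has a moment of order [delta]. Hence no
    argument can start from moments, and laws are compared on one bounded function at a time: the
    property that is propagated concerns only the affine images of that function, which stay in the
    class with a factor [a^delta]. Cosines suit the passage to the limit because they determine laws
    without any moment, and because an affine image of a cosine is a cosine, so that errors stay
    uniform in frequency and phase. The sign of [mu(gamma)] is arbitrary, so [tau^mu(gamma)] may be
    unbounded. What matters is that, once it is absorbed into the weights, their moments of order
    [gamma] sum to 1, and those of order [delta] to [(Q(delta) + 1) / (delta mu(gamma) + 1)], which
    is below 1 because [mu(delta) < mu(gamma)]. *)

Ltac nneg := repeat first [ assumption | (by apply: ltW) | rewrite invr_ge0 | apply: mulr_ge0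
  | apply: sqr_ge0 | apply: normr_ge0 | apply: powR_ge0
  | apply: exprn_ge0 | apply: addr_ge0 | done ].

(** Such functions are integrable for every finite measure, so their real valued integrals can be
    added, scaled and swapped without integrability side conditions. Laws are compared on this class
    as long as possible. *)
Definition bdm (R : realType) d (T : measurableType d) (f : T -> R) : Prop :=
  measurable_fun setT f /\ exists M, forall x, `|f x| <= M.

Section bdm_closure.
Context (R : realType) d (T : measurableType d).
Implicit Types f g : T -> R.

Lemma bdm_cst c : bdm (fun _ : T => c : R).
Proof. by split; [exact: measurable_cst|exists `|c| => x]. Qed.

Lemma bdmD f g : bdm f -> bdm g -> bdm (fun x => f x + g x).
Proof.
move=> [mf [M hM]] [mg [K hK]]; split; first exact: measurable_funD.
by exists (M + K) => x; rewrite (le_trans (ler_normD _ _))// lerD.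
Qed.

Lemma bdmM f g : bdm f -> bdm g -> bdm (fun x => f x * g x).
Proof.
move=> [mf [M hM]] [mg [K hK]]; split; first exact: measurable_funM.
by exists (M * K) => x; rewrite normrM ler_pM.
Qed.

Lemma bdmZ c f : bdm f -> bdm (fun x => c * f x).
Proof. exact: bdmM (bdm_cst c). Qed.

Lemma bdmN f : bdm f -> bdm (fun x => - f x).
Proof. by move=> /(bdmZ (-1)); under eq_fun do rewrite mulN1r. Qed.

Lemma bdmB f g : bdm f -> bdm g -> bdm (fun x => f x - g x).
Proof. by move=> bf /bdmN; exact: bdmD. Qed.

Lemma bdm_comp d' (T' : measurableType d') (f : T' -> R) (h : T -> T') :
  bdm f -> measurable_fun setT h -> bdm (fun x => f (h x)).
Proof.
by move=> [mf [M hM]] mh; split; [exact: measurableT_comp|exists M => x].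
Qed.

Lemma bdm_int (m : {finite_measure set T -> \bar R}) f : bdm f -> m.-integrable setT (EFin \o f).
Proof.
move=> [mf [M hM]]; apply: measurable_bounded_integrable => //.
  by rewrite ltey_eq fin_num_measure.
exists M; split; first by rewrite num_real.
by move=> K MK x _ /=; rewrite (le_trans (hM x))// ltW.
Qed.

End bdm_closure.

Section bdm_integral.
Context (R : realType) d (T : measurableType d) (P : probability T R).
Implicit Types f g : T -> R.

Lemma bdm_RintD f g : bdm f -> bdm g ->
  \int[P]_x (f x + g x) = \int[P]_x f x + \int[P]_x g x.
Proof. by move=> bf bg; rewrite RintegralD//; exact: bdm_int. Qed.

Lemma bdm_RintB f g : bdm f -> bdm g ->
  \int[P]_x (f x - g x) = \int[P]_x f x - \int[P]_x g x.
Proof. by move=> bf bg; rewrite RintegralB//; exact: bdm_int. Qed.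

Lemma bdm_RintZ c f : bdm f -> \int[P]_x (c * f x) = c * \int[P]_x f x.
Proof. by move=> bf; rewrite RintegralZl//; exact: bdm_int. Qed.

Lemma Rint_cst (c : R) : \int[P]_x c = c.
Proof. rewrite (Rintegral_cst P).
2: exact: measurableT.
suff -> : fine (P [set: T]) = 1 by rewrite mulr1.
by rewrite -[RHS]/(fine 1%E); congr fine; exact: probability_setT. Qed.

Lemma bdm_le f g : bdm f -> bdm g -> (forall x, f x <= g x) ->
  \int[P]_x f x <= \int[P]_x g x.
Proof. by move=> bf bg fg; apply: le_Rintegral => //; exact: bdm_int. Qed.

Lemma bdm_norm_le f M : bdm f -> (forall x, `|f x| <= M) -> `|\int[P]_x f x| <= M.
Proof.
move=> bf fM; rewrite ler_norml -{1}(Rint_cst (- M)) -{2}(Rint_cst M).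
by rewrite !bdm_le//; try exact: bdm_cst; move=> x; have := fM x; rewrite ler_norml => /andP[].
Qed.

Lemma bdm_abs f : bdm f -> bdm (fun x => `|f x|).
Proof.
move=> [mf [M hM]]; split; first exact: measurableT_comp.
by exists M => x; rewrite normr_id.
Qed.

Lemma bdm_EFin f : bdm f -> (\int[P]_x (f x)%:E)%E = (\int[P]_x f x)%:E.
Proof. by move=> bf; rewrite fineK//; exact/integrable_fin_num/bdm_int. Qed.

End bdm_integral.

Section bdm_fubini.
Context (R : realType) d1 d2 (T1 : measurableType d1) (T2 : measurableType d2).
Context (P : probability T1 R) (Q : probability T2 R).
Variable f : T1 * T2 -> R.
Hypothesis bf : bdm f.
Let PQ : probability (T1 * T2)%type R := (P \x Q)%E.

Lemma bdm_intX : (P \x Q)%E.-integrable setT (EFin \o f).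
Proof. exact: (bdm_int PQ bf). Qed.

Lemma bdm_slice x : bdm (fun y => f (x, y)).
Proof. exact: bdm_comp bf (pair1_measurable x). Qed.

Lemma bdm_slice2 y : bdm (fun x => f (x, y)).
Proof. exact: bdm_comp bf (pair2_measurable y). Qed.

Lemma bdm_fubini_F : bdm (fun x => \int[Q]_y f (x, y)).
Proof.
split; last first.
  have [mf [M hM]] := bf; exists M => x; apply: bdm_norm_le => //.
  exact: bdm_slice.
have := measurable_fubini_F bdm_intX.
by move=> mF; apply: (measurableT_comp _ mF); exact: fine_measurable.
Qed.

Lemma bdm_fubini : \int[(P \x Q)%E]_z f z = \int[P]_x \int[Q]_y f (x, y).
Proof.
rewrite {1}/Rintegral -integral12_prod_meas1; last exact: bdm_intX.
congr fine; apply: eq_integral => x _; rewrite -bdm_EFin//.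
exact: bdm_slice.
Qed.

Lemma bdm_fubini2 : \int[(P \x Q)%E]_z f z = \int[Q]_y \int[P]_x f (x, y).
Proof.
rewrite {1}/Rintegral -integral21_prod_meas1; last exact: bdm_intX.
congr fine; apply: eq_integral => x _; rewrite -bdm_EFin//.
exact: bdm_slice2.
Qed.

End bdm_fubini.

Section law.
Context (R : realType) d1 d2 (T1 : measurableType d1) (T2 : measurableType d2).
Variables (P : probability T1 R) (X : T1 -> T2) (mX : measurable_fun setT X).

(** Sums, dilations and mixtures are all handled through their laws, so that independent copies
    never require a common space of random variables. *)
Definition law : probability T2 R := distribution P (mfun_Sub (mem_set mX)).

Lemma ge0_int_law (f : T2 -> \bar R) : measurable_fun setT f -> (forall y, 0 <= f y)%E ->
  (\int[law]_y f y = \int[P]_x f (X x))%E.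
Proof. by move=> mf f0; rewrite /law ge0_integral_distribution. Qed.

Lemma bdm_law (f : T2 -> R) : bdm f -> \int[law]_y f y = \int[P]_x f (X x).
Proof.
move=> bf; rewrite /Rintegral integral_distribution//.
  by apply/measurable_EFinP; case: bf.
apply: (@bdm_int _ _ _ P (f \o X)); exact: bdm_comp bf mX.
Qed.

End law.

Lemma pushforward_ex (R : realType) d1 d2 (X : measurableType d1) (Y : measurableType d2)
  (h : X -> Y) (m : {measure set X -> \bar R}) : measurable_fun setT h ->
  exists ph : {measure set Y -> \bar R}, (forall B, ph B = m (h @^-1` B)) /\
   (forall G : Y -> \bar R, measurable_fun setT G -> (forall y, 0 <= G y)%E ->
     \int[ph]_y G y = \int[m]_x G (h x))%E.
Proof.
move=> mh; exists (pushforward m h); split; first by move=> B.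
move=> G mG G0; rewrite (ge0_integral_pushforward mh)//.
Unshelve. exact: mh.
Qed.

(** * Cosines determine a law, quantitatively *)

Section lebesgue_affine.
Context (R : realType).
Local Notation leb := (@lebesgue_measure R).

(** [a] times the image of Lebesgue measure under [x |-> a x + b] gives []p, q]] the mass [q - p],
    hence is Lebesgue measure by uniqueness. *)
Lemma ge0_int_lebesgue_affine (a b : R) (G : R -> \bar R) : 0 < a ->
  measurable_fun setT G -> (forall x, 0 <= G x)%E ->
  (\int[leb]_x G x = a%:E * \int[leb]_x G (a * x + b)%R)%E.
Proof.
move=> a0 mG G0; have ha := ltW a0.
have mab : measurable_fun setT (fun x : measurableTypeR R => a * x + b : measurableTypeR R).
  by apply: measurable_funD => //; exact: mulrl_measurable.
pose h : measurableTypeR R -> measurableTypeR R := fun x => a * x + b.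
have mh : measurable_fun setT h := mab.
have [ph [phE /(_ G mG G0) phI]] := pushforward_ex leb mh.
rewrite (eq_measure_integral (mscale (NngNum ha) ph)); last first.
  move=> A mA _; apply: (@lebesgue_measure_unique _ (mscale (NngNum ha) ph)) mA => _ [[p q]] _ <-.
  rewrite -[RHS]/(a%:E * ph `]p, q]%classic)%E phE /=.
  have -> : h @^-1` `]p, q] = `](p - b) / a, (q - b) / a]%classic.
    by apply/seteqP; split => x /=; rewrite !in_itv/= ltr_pdivrMr// ler_pdivlMr// ltrBlDr lerBrDr mulrC.
  rewrite !lebesgue_measure_itv/= !lte_fin ltr_pM2r ?invr_gt0// ltrD2r.
  case: ifP => _; last by rewrite mule0.
  by rewrite -EFinB -EFinM; congr EFin; field; rewrite gt_eqF.
by rewrite ge0_integral_mscale//= phI.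
Qed.

Lemma ge0_int_lebesgue_opp (G : R -> \bar R) :
  measurable_fun setT G -> (forall x, 0 <= G x)%E ->
  (\int[leb]_x G x = \int[leb]_x G (- x)%R)%E.
Proof.
move=> mG G0.
rewrite (eq_measure_integral (pushforward leb (-%R : measurableTypeR R -> measurableTypeR R))); last first.
  by move=> A mA _; exact: esym (lebesgue_measureN mA).
by rewrite ge0_integral_pushforward.
Qed.

Lemma ge0_int_lebesgue_reflect (a b : R) (G : R -> \bar R) : 0 < a ->
  measurable_fun setT G -> (forall x, 0 <= G x)%E ->
  (\int[leb]_x G (b - a * x)%R = a^-1%:E * \int[leb]_x G x)%E.
Proof.
move=> a0 mG G0.
have mN : measurable_fun setT (fun x : R => G (- x)) by apply: (measurableT_comp mG); exact: oppr_measurable.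
rewrite [in RHS]ge0_int_lebesgue_opp// (ge0_int_lebesgue_affine (- b) a0 mN)//.
rewrite muleA -EFinM mulVf ?gt_eqF// mul1e.
by apply: eq_integral => x _; congr G; rewrite opprD opprK addrC.
Qed.

End lebesgue_affine.

(** * The Cauchy kernel as a mixture of cosines *)

Section cauchy_kernel.
Context (R : realType).
Local Notation leb := (@lebesgue_measure R).

(** Cauchy density of scale [a^-1] without its factor [a / pi]. It is positive, has an explicit
    integral, and is itself a mixture of cosines, which is why it is the smoothing kernel used
    here. *)
Definition ck (a v : R) : R := (1 + (a * v) ^+ 2)^-1.

Lemma ck_gt0 a v : 0 < ck a v.
Proof. by rewrite invr_gt0 ltr_wpDr// sqr_ge0. Qed.

Lemma ck_ge0 a v : 0 <= ck a v. Proof. exact/ltW/ck_gt0. Qed.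

Lemma ck_le1 a v : ck a v <= 1.
Proof. by rewrite invf_le1 ?ltr_wpDr ?sqr_ge0// lerDl sqr_ge0. Qed.

Lemma continuous_ck a : continuous (ck a).
Proof.
move=> x; apply: cvgV; first by rewrite gt_eqF// ltr_wpDr// sqr_ge0.
apply: cvgD; first exact: cvg_cst.
apply: cvgM; apply: cvgM; try exact: cvg_cst; exact: cvg_id.
Qed.

Lemma bdm_ck a : bdm (ck a).
Proof.
split; first by apply: continuous_measurable_fun; exact: continuous_ck.
by exists 1 => x; rewrite ger0_norm ?ck_ge0// ck_le1.
Qed.

Lemma int_ck1 : (\int[leb]_x (ck 1 x)%:E = pi%:E)%E.
Proof.
rewrite ge0_symfun_integralT; last 3 first.
- exact: ck_ge0.
- exact: continuous_ck.
- by move=> x /=; rewrite /ck !mul1r sqrrN.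
rewrite -set_itvcy (_ : (\int[leb]_(x in `[0%R, +oo[) (ck 1 x)%:E = (pi / 2)%:E)%E); last first.
  by rewrite -integral0y_oneDsqr; apply: eq_integral => x _; rewrite /ck mul1r.
by rewrite -EFinM mulrC divfK// pnatr_eq0.
Qed.

Lemma int_ck a x : 0 < a -> (\int[leb]_y (ck a (x - y))%:E = (pi / a)%:E)%E.
Proof.
move=> a0; rewrite (_ : (fun y => (ck a (x - y))%:E) = fun y => (EFin \o ck 1) (a * x - a * y)); last first.
  by apply/funext => y /=; rewrite /ck mul1r mulrBr.
rewrite (@ge0_int_lebesgue_reflect _ a (a * x) (EFin \o ck 1) a0).
- by rewrite int_ck1 -EFinM mulrC.
- by apply/measurable_EFinP; case: (bdm_ck 1).
- by move=> y; rewrite lee_fin ck_ge0.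
Qed.

(** Once denominators are cleared, this reads [0 <= (a^2 d^2 - 1) (v^2 - d^2)]. The tail of the
    narrow kernel is thus bounded by a wide kernel of known integral, with a constant that vanishes
    as [a d] grows. *)
Lemma ck_tail (a d v : R) : 0 < a -> 0 < d -> 1 <= a * d -> d <= `|v| ->
  ck a v <= 2 / (1 + (a * d) ^+ 2) * ck d^-1 v.
Proof.
move=> a0 d0 ad1 dv.
have hd : d ^+ 2 <= v ^+ 2.
  by rewrite -(real_normK (num_real v)) lerXn2r// nnegrE ltW.
have p1 : 0 < 1 + (a * v) ^+ 2 by rewrite ltr_wpDr// sqr_ge0.
have p2 : 0 < 1 + (a * d) ^+ 2 by rewrite ltr_wpDr// sqr_ge0.
have p3 : 0 < 1 + (d^-1 * v) ^+ 2 by rewrite ltr_wpDr// sqr_ge0.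
have -> : 2 / (1 + (a * d) ^+ 2) * ck d^-1 v =
    ((1 + (a * d) ^+ 2) * (1 + (d^-1 * v) ^+ 2) / 2)^-1.
  by rewrite invf_div invfM mulrA.
rewrite /ck lef_pV2 ?posrE//; last by rewrite divr_gt0// mulr_gt0.
rewrite ler_pdivrMr// !exprMn exprVn.
have d2 : 0 < d ^+ 2 by rewrite exprn_gt0.
set D := d ^+ 2 in hd d2 *; set V := v ^+ 2 in hd *; set A := a ^+ 2.
have A0 : 0 <= A by rewrite /A sqr_ge0.
have -> : 1 + D^-1 * V = (D + V) / D by field; rewrite gt_eqF.
rewrite mulrA ler_pdivrMr//.
have AD1 : 1 <= A * D by rewrite /A /D -exprMn exprn_ege1.
have AVD : 0 <= (A * D - 1) * (V - D) by rewrite mulr_ge0// subr_ge0.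
by nra.
Qed.

(* For [s] uniform, [2 s ds] makes [-2 ln s] exponential, whose cosine transform is the Cauchy kernel [ck]; the cut at 1 only serves boundedness. *)
Definition pw01 (s : R) : R := Num.min 1 `|s|.

Lemma bdm_pw01 : bdm pw01.
Proof.
split; first by apply: measurable_minr => //; exact: normr_measurable.
by exists 1 => x; rewrite ger0_norm ?ge_min ?lexx// le_min ler01 normr_ge0.
Qed.

Lemma bdm_cos d (T : measurableType d) (f : T -> R) : measurable_fun setT f -> bdm (fun x => cos (f x)).
Proof.
move=> mf; split.
  apply: (measurableT_comp _ mf); by apply: continuous_measurable_fun; exact: continuous_cos.
by exists 1 => x; rewrite ler_norml cos_geN1 cos_le1.
Qed.

Lemma near0_normr_le1 (u : R -> R) : (forall s, `|u s| <= 1) ->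
  (fun s => s * u s) x @[x --> 0^'+] --> (0 : R).
Proof.
move=> u1; apply/cvgr0Pnorm_le => e e0; near=> s.
have s0 : 0 < s by near: s; exact: nbhs_right_gt.
rewrite normrM gtr0_norm// (le_trans (ler_wpM2l (ltW s0) (u1 s)))// mulr1.
by near: s; exact: nbhs_right_le.
Unshelve. all: by end_near. Qed.

Lemma cosln_cont (v x : R) : 0 < x -> {for x, continuous (fun s : R => cos (v * ln s))}.
Proof.
move=> x0; apply: (@continuous_comp _ _ _ (fun s => v * ln s) cos); last exact: continuous_cos.
by apply: cvgM; [exact: cvg_cst|exact: continuous_ln].
Qed.

Lemma sinln_cont (v x : R) : 0 < x -> {for x, continuous (fun s : R => sin (v * ln s))}.
Proof.
move=> x0; apply: (@continuous_comp _ _ _ (fun s => v * ln s) sin); last exact: continuous_sin.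
by apply: cvgM; [exact: cvg_cst|exact: continuous_ln].
Qed.

(** Integration by parts yields the primitive of [2 s cos (v ln s)] that appears in [F]. The summand
    2 makes the integrand nonnegative, as needed to transfer the integral to the uniform law; at
    [s = 0] the factor [s] restores continuity. *)
Lemma int_cosln (v : R) :
  (\int[leb]_(s in `[0%R, 1%R]) (2 * (1 + s * cos (v * ln s)))%:E = (2 + 4 / (4 + v ^+ 2))%:E)%E.
Proof.
pose f := fun s : R => 2 * (1 + s * cos (v * ln s)).
pose u := fun s : R => 2 * cos (v * ln s) + v * sin (v * ln s).
pose F := fun s : R => 2 * s + 2 / (4 + v ^+ 2) * (s * (s * u s)).
have v4 : 4 + v ^+ 2 != 0 by rewrite gt_eqF// ltr_pwDl// sqr_ge0.
rewrite (@continuous_FTC2 _ f F) //.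
- rewrite /F /u ln1 !mulr0 !mul0r mulr0 addr0 sin0 cos0 -EFinB; congr EFin; field.
  by rewrite v4.
- apply/continuous_within_itvP; first exact: ltr01.
  have pt (x : R) : 0 < x -> {for x, continuous f}.
    move=> x0; apply: cvgM; first exact: cvg_cst.
    apply: cvgD; first exact: cvg_cst.
    by apply: cvgM; [exact: cvg_id|exact: cosln_cont].
  split.
  + by move=> x; rewrite in_itv/= => /andP[x0 _]; exact: pt.
  + rewrite /f mul0r; apply: cvgM; first exact: cvg_cst.
    apply: cvgD; first exact: cvg_cst.
    by apply: near0_normr_le1 => s; exact: cos_max.
  + exact/cvg_at_left_filter/pt/ltr01.
- have pt (x : R) : 0 < x -> {for x, continuous F}.
    move=> x0; apply: cvgD; first by apply: cvgM; [exact: cvg_cst|exact: cvg_id].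
    apply: cvgM; first exact: cvg_cst.
    apply: cvgM; first exact: cvg_id.
    apply: cvgM; first exact: cvg_id.
    apply: cvgD; (apply: cvgM; first exact: cvg_cst).
      exact: cosln_cont.
    exact: sinln_cont.
  split.
  + move=> x; rewrite in_itv/= => /andP[x0 _].
    have := @is_derive1_ln R _ x0 => dln.
    exact: ex_derive.
  + rewrite /F !(mulr0, mul0r) addr0 -[X in _ --> X]add0r; apply: cvgD.
      rewrite -[X in _ --> X](mulr0 2); apply: cvgM; first exact: cvg_cst.
      by apply: cvg_at_right_filter; exact: cvg_id.
    rewrite -[X in _ --> X](mulr0 (2 / (4 + v ^+ 2))); apply: cvgM; first exact: cvg_cst.
    rewrite -[X in _ --> X](mulr0 0); apply: cvgM.
      by apply: cvg_at_right_filter; exact: cvg_id.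
    apply/cvgr0Pnorm_le => e e0; near=> s.
    have s0 : 0 < s by near: s; exact: nbhs_right_gt.
    have hu : `|u s| <= 2 + `|v|.
      rewrite /u (le_trans (ler_normD _ _))// !normrM lerD//.
        by rewrite ger0_norm// ler_piMr// cos_max.
      by rewrite ler_piMr// sin_max.
    rewrite normrM gtr0_norm// (le_trans (ler_wpM2l (ltW s0) hu))// -ler_pdivlMr; last by rewrite ltr_pwDl.
    near: s; apply: nbhs_right_le; rewrite divr_gt0// ltr_pwDl//.
  + exact/cvg_at_left_filter/pt/ltr01.
- move=> x; rewrite in_itv/= => /andP[x0 _].
  have := @is_derive1_ln R _ x0 => dln.
  suff h : is_derive x 1 F (f x) by rewrite derive1E derive_val.
  rewrite /F /u; apply: is_derive_eq; rewrite /f /GRing.scale/=.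
  by field; rewrite v4 gt_eqF.
Unshelve. all: by end_near.
Qed.

Lemma measurable_idR : measurable_fun setT (id : measurableTypeR R -> R).
Proof. exact: measurable_id. Qed.

Definition U01 : probability R R := law (uniform_prob (@ltr01 R)) measurable_idR.

Lemma ge0_int_U01 (f : R -> \bar R) : measurable_fun setT f -> (forall x, 0 <= f x)%E ->
  (\int[U01]_x f x = \int[leb]_(x in `[0%R, 1%R]) f x)%E.
Proof. by move=> mf f0; rewrite ge0_int_law// integral_uniform// subr0 invr1 mul1e. Qed.

Lemma measurable_cosln (v : R) : measurable_fun setT (fun s : R => v * ln s).
Proof. by apply: measurable_funM => //; exact: measurable_ln. Qed.

Lemma bdm_cosln (v : R) : bdm (fun s : R => 2 * (pw01 s * cos (v * ln s))).
Proof. apply: bdmZ; apply: bdmM; first exact: bdm_pw01.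
by apply: bdm_cos; exact: measurable_cosln. Qed.

Lemma uniform_cosln (v : R) :
  \int[U01]_s (2 * (pw01 s * cos (v * ln s))) = 4 / (4 + v ^+ 2).
Proof.
apply: (addrI 2).
have -> : 2 + \int[U01]_s (2 * (pw01 s * cos (v * ln s))) = \int[U01]_s (2 + 2 * (pw01 s * cos (v * ln s))).
  by rewrite bdm_RintD ?Rint_cst//; [exact: bdm_cst|exact: bdm_cosln].
apply: EFin_inj; rewrite -bdm_EFin; last by apply: bdmD; [exact: bdm_cst|exact: bdm_cosln].
rewrite ge0_int_U01.
- rewrite -int_cosln; apply: eq_integral => s.
  rewrite inE/= in_itv/= => /andP[s0 s1]; congr EFin.
  by rewrite /pw01 ger0_norm// min_r// mulrDr mulr1.
- by apply/measurable_EFinP; case: (bdmD (bdm_cst _ 2) (bdm_cosln v)).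
- move=> s; rewrite lee_fin -[X in X + _]mulr1 -mulrDr mulr_ge0// -lerBlDl sub0r.
  have : `|pw01 s * cos (v * ln s)| <= 1.
    by rewrite normrM mulr_ile1// ?cos_max// ger0_norm /pw01 ?ge_min ?lexx// le_min ler01 normr_ge0.
  by rewrite ler_norml => /andP[].
Qed.

Lemma ckE (a w : R) : ck a w = \int[U01]_s (2 * (pw01 s * cos (2 * a * w * ln s))).
Proof.
rewrite uniform_cosln /ck.
have -> : 4 + (2 * a * w) ^+ 2 = 4 * (1 + (a * w) ^+ 2) by ring.
by rewrite invfM mulrA divff ?mul1r// pnatr_eq0.
Qed.

End cauchy_kernel.

(** * Comparison of laws through their integrals of cosines *)

Section cosine_distance.
Context (R : realType).
Local Notation leb := (@lebesgue_measure R).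
Local Notation U01 := (@U01 R).

Definition ccos (nu : probability R R) (xi th : R) : R := \int[nu]_x cos (xi * x + th).

(* Cosines with a phase replace complex exponentials, so that all test functions are real. *)
Definition cosnear (mu nu : probability R R) (eta : R) : Prop :=
  forall xi th, `|ccos mu xi th - ccos nu xi th| <= eta.

Lemma bdm_cos_affine (xi th : R) : bdm (fun x : R => cos (xi * x + th)).
Proof. by apply: bdm_cos; apply: measurable_funD => //; exact: mulrl_measurable. Qed.

Lemma int_ckE (mu : probability R R) (a y : R) : \int[mu]_x ck a (x - y) =
  \int[U01]_s (2 * (pw01 s * ccos mu (2 * a * ln s) (- (2 * a * ln s * y)))).
Proof.
pose F := fun z : R * R => 2 * (pw01 z.2 * cos (2 * a * (z.1 - y) * ln z.2)).
have bF : bdm F.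
  apply/bdmZ/bdmM; first by apply: (bdm_comp (bdm_pw01 R)); exact: measurable_snd.
  apply: bdm_cos; apply: measurable_funM.
    apply: measurable_funM => //; apply: measurable_funB => //; exact: measurable_fst.
  by apply: (measurableT_comp (@measurable_ln R)); exact: measurable_snd.
transitivity (\int[mu]_x \int[U01]_s F (x, s)).
  by apply: eq_Rintegral => x _; rewrite ckE.
rewrite -bdm_fubini// bdm_fubini2//; apply: eq_Rintegral => s _.
rewrite /F/=; under eq_Rintegral do rewrite mulrA.
rewrite bdm_RintZ; last first.
  apply: bdm_cos; apply: measurable_funM => //; apply: measurable_funM => //.
  exact: measurable_funB.
rewrite mulrA; congr (_ * _); apply: eq_Rintegral => x _; congr cos; ring.
Qed.

(** The kernel mixes cosines with weights [2 * pw01 s <= 2], so the bound holds uniformly in the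
    width [a] and the centre [y]. *)
Lemma int_ck_near (mu nu : probability R R) (eta a y : R) : cosnear mu nu eta ->
  \int[mu]_x ck a (x - y) <= \int[nu]_x ck a (x - y) + 2 * eta.
Proof.
move=> mn; have e0 : 0 <= eta := le_trans (normr_ge0 _) (mn 0 0).
pose G (m : probability R R) := fun s => 2 * (pw01 s * ccos m (2 * a * ln s) (- (2 * a * ln s * y))).
have bG m : bdm (G m).
  apply/bdmZ/bdmM; first exact: bdm_pw01.
  have bH : bdm (fun z : R * R => cos (2 * a * ln z.1 * z.2 + - (2 * a * ln z.1 * y))).
    apply: bdm_cos; have ml : measurable_fun setT (fun z : R * R => 2 * a * ln z.1).
      by apply: measurable_funM => //; apply: (measurableT_comp (@measurable_ln R)); exact: measurable_fst.
    by apply: measurable_funD; [|apply: measurable_funN]; apply: measurable_funM => //; exact: measurable_snd.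
  exact (bdm_fubini_F U01 m bH).
have GE (m : probability R R) : \int[m]_x ck a (x - y) = \int[U01]_s G m s by exact: int_ckE.
rewrite !GE -lerBlDl -bdm_RintB//.
rewrite -[leRHS](Rint_cst U01); apply: bdm_le; [exact: bdmB|exact: bdm_cst|move=> s].
rewrite /G -mulrBr -mulrBr ler_pM2l// (le_trans (ler_norm _))// normrM -[leRHS]mul1r.
apply: ler_pM => //.
by rewrite ger0_norm /pw01 ?ge_min ?lexx// le_min ler01 normr_ge0.
Qed.

(** Near the diagonal the modulus of continuity is used; away from it the oscillation of [f] is at
    most [F] and [ck_tail] makes the kernel small. *)
Lemma smoothing_pointwise (f : R -> R) (F e d a x y : R) : 0 <= F -> 0 < d -> 0 < a -> 1 <= a * d -> 0 <= e ->
  (forall z, 0 <= f z <= F) -> (forall z w, `|z - w| <= d -> `|f z - f w| <= e) ->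
  `|f x - f y| * ck a (x - y) <= e * ck a (x - y) + 2 * F / (1 + (a * d) ^+ 2) * ck d^-1 (x - y).
Proof.
move=> F0 d0 a0 ad e0 f0 fe; have q0 : 0 <= 2 * F / (1 + (a * d) ^+ 2) * ck d^-1 (x - y).
  by rewrite mulr_ge0 ?ck_ge0// divr_ge0 ?mulr_ge0// addr_ge0 ?sqr_ge0.
have q1 : 0 <= e * ck a (x - y) by rewrite mulr_ge0 ?ck_ge0.
have [xy|/ltW xy] := leP `|x - y| d.
  by rewrite ler_wpDr// ler_wpM2r ?ck_ge0 ?fe.
rewrite ler_wpDl//.
apply: (@le_trans _ _ (F * ck a (x - y))).
  rewrite ler_wpM2r ?ck_ge0// ler_norml.
  have /andP[? ?] := f0 x; have /andP[? ?] := f0 y; lra.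
apply: (le_trans (ler_wpM2l F0 (ck_tail a0 d0 ad xy))).
by rewrite mulrA mulrA [F * 2]mulrC.
Qed.

Lemma measurable_ck_sub (a : R) : measurable_fun setT (fun z : R * measurableTypeR R => ck a (z.1 - z.2)).
Proof.
apply: (measurableT_comp (proj1 (bdm_ck a))).
apply: measurable_funB; first exact: measurable_fst.
exact: measurable_snd.
Qed.

Section smoothing.
Variables (f : R -> R) (F : R).
Hypotheses (F0 : 0 <= F) (mf : measurable_fun setT f) (f0F : forall z, 0 <= f z <= F).

Let f0 z : 0 <= f z. Proof. by case/andP: (f0F z). Qed.

Definition smooth (a x : R) : \bar R := (\int[leb]_y (f y * ck a (x - y))%:E)%E.

Lemma measurable_smooth_arg (a x : R) : measurable_fun setT (fun y : measurableTypeR R => (f y * ck a (x - y))%:E).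
Proof.
apply/measurable_EFinP; apply: measurable_funM => //.
apply: (measurableT_comp (proj1 (bdm_ck a))); exact: measurable_funB.
Qed.

Lemma measurable_ck_argR (a x : R) : measurable_fun setT (fun y : measurableTypeR R => ck a (x - y)).
Proof. apply: (measurableT_comp (proj1 (bdm_ck a))); exact: measurable_funB. Qed.

Lemma measurable_ck_arg (a x : R) : measurable_fun setT (fun y : measurableTypeR R => (ck a (x - y))%:E).
Proof. by apply/measurable_EFinP; exact: measurable_ck_argR. Qed.

Lemma int_ckZ (k a x : R) : 0 <= k -> 0 < a -> (\int[leb]_y (k * ck a (x - y))%:E = (k * (pi / a))%:E)%E.
Proof.
move=> k0 a0; under eq_integral do rewrite EFinM.
rewrite ge0_integralZl_EFin//.
- by rewrite int_ck.
- by move=> y _; rewrite lee_fin ck_ge0.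
- exact: measurable_ck_arg.
Qed.

Lemma smooth_close (e d a x : R) : 0 < d -> 0 < a -> 1 <= a * d -> 0 <= e ->
  (forall z w, `|z - w| <= d -> `|f z - f w| <= e) ->
  let r := e * (pi / a) + 2 * F / (1 + (a * d) ^+ 2) * (pi * d) in
  ((f x * (pi / a))%:E <= smooth a x + r%:E /\ smooth a x <= (f x * (pi / a) + r)%:E)%E.
Proof.
move=> d0 a0 ad e0 fe r.
have K0 : 0 <= 2 * F / (1 + (a * d) ^+ 2).
  by rewrite divr_ge0 ?mulr_ge0// addr_ge0 ?sqr_ge0.
pose H y := e * ck a (x - y) + 2 * F / (1 + (a * d) ^+ 2) * ck d^-1 (x - y).
have H0 y : 0 <= H y by rewrite addr_ge0// mulr_ge0// ck_ge0.
have mH : measurable_fun setT (fun y : measurableTypeR R => (H y)%:E).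
  apply/measurable_EFinP; apply: measurable_funD; apply: measurable_funM => //;
    exact: measurable_ck_argR.
have intH : (\int[leb]_y (H y)%:E = r%:E)%E.
  rewrite /H; under eq_integral do rewrite EFinD.
  rewrite ge0_integralD//.
  - by rewrite !int_ckZ ?invr_gt0// -EFinD invrK.
  - by move=> y _; rewrite lee_fin mulr_ge0 ?ck_ge0.
  - by apply/measurable_EFinP; apply: measurable_funM => //; exact: measurable_ck_argR.
  - by move=> y _; rewrite lee_fin mulr_ge0 ?ck_ge0.
  - by apply/measurable_EFinP; apply: measurable_funM => //; exact: measurable_ck_argR.
have pt y := @smoothing_pointwise f F e d a x y F0 d0 a0 ad e0 f0F fe.
have pt1 y : f x * ck a (x - y) <= f y * ck a (x - y) + H y.
  rewrite -lerBlDl -mulrBl (le_trans _ (pt y))// ler_wpM2r ?ck_ge0// ler_norm//.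
have pt2 y : f y * ck a (x - y) <= f x * ck a (x - y) + H y.
  by rewrite -lerBlDl -mulrBl (le_trans _ (pt y))// ler_wpM2r ?ck_ge0// distrC ler_norm.
split.
- rewrite -(int_ckZ x)// -intH /smooth -ge0_integralD//.
  + apply: ge0_le_integral => //.
    * by move=> y _; rewrite lee_fin mulr_ge0 ?ck_ge0.
    * by apply/measurable_EFinP; apply: measurable_funM => //; exact: measurable_ck_argR.
    * by apply: emeasurable_funD => //; exact: measurable_smooth_arg.
    * by move=> y _; rewrite -EFinD lee_fin.
  + by move=> y _; rewrite lee_fin mulr_ge0 ?ck_ge0.
  + exact: measurable_smooth_arg.
  + by move=> y _; rewrite lee_fin.
- rewrite EFinD -(int_ckZ x)// -intH /smooth -ge0_integralD//.
  + apply: ge0_le_integral => //.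
    * by move=> y _; rewrite lee_fin mulr_ge0 ?ck_ge0.
    * exact: measurable_smooth_arg.
    * by apply: emeasurable_funD => //; apply/measurable_EFinP; apply: measurable_funM => //; exact: measurable_ck_argR.
    * by move=> y _; rewrite -EFinD lee_fin.
  + by move=> y _; rewrite lee_fin mulr_ge0 ?ck_ge0.
  + by apply/measurable_EFinP; apply: measurable_funM => //; exact: measurable_ck_argR.
  + by move=> y _; rewrite lee_fin.
Qed.

Hypothesis f1 : (\int[leb]_y (f y)%:E < +oo)%E.

(** By Tonelli the law is integrated first, against a translated kernel, where [int_ck_near]
    applies. The pointwise error [2 * eta] is then weighted by [f], whose Lebesgue integral is
    finite. *)
Lemma int_smooth_near (mu nu : probability R R) (eta a : R) : 0 < a -> cosnear mu nu eta ->
  (\int[mu]_x smooth a x <= \int[nu]_x smooth a x + (2 * eta * fine (\int[leb]_y (f y)%:E))%:E)%E.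
Proof.
move=> a0 mn; have e0 : 0 <= eta := le_trans (normr_ge0 _) (mn 0 0).
have mg : measurable_fun setT (fun z : R * measurableTypeR R => (f z.2 * ck a (z.1 - z.2))%:E).
  apply/measurable_EFinP; apply: measurable_funM; last exact: measurable_ck_sub.
  apply: (@measurableT_comp _ _ _ _ _ _ f) => //; exact: measurable_snd.
have g0 (z : R * measurableTypeR R) : (0 <= (f z.2 * ck a (z.1 - z.2))%:E)%E.
  by rewrite lee_fin mulr_ge0 ?ck_ge0.
have key (m : probability R R) : (\int[m]_x smooth a x =
    \int[leb]_y (f y * \int[m]_x ck a (x - y))%:E)%E.
  transitivity (\int[(m \x (leb : {sigma_finite_measure set (measurableTypeR R) -> \bar R}))]_z
     (f z.2 * ck a (z.1 - z.2))%:E)%E.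
    by rewrite (fubini_tonelli1 _ mg g0).
  rewrite (fubini_tonelli2 _ mg g0); apply: eq_integral => y _ /=.
  rewrite /fubini_G/=.
  have bk : bdm (fun x : R => ck a (x - y)).
    by apply: (bdm_comp (bdm_ck a)); exact: measurable_funB.
  by rewrite -(bdm_RintZ _ _ bk) -bdm_EFin//; apply: bdmZ.
have mK (m : probability R R) : measurable_fun setT (fun y : measurableTypeR R => f y * \int[m]_x ck a (x - y)).
  apply: measurable_funM => //.
  have bk : bdm (fun z : measurableTypeR R * R => ck a (z.2 - z.1)).
    by apply: (bdm_comp (bdm_ck a)); apply: measurable_funB; [exact: measurable_snd|exact: measurable_fst].
  exact: proj1 (bdm_fubini_F (uniform_prob (@ltr01 R)) m bk).
have K0 (m : probability R R) y : 0 <= \int[m]_x ck a (x - y).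
  by apply: Rintegral_ge0 => x _; exact: ck_ge0.
have fint : (\int[leb]_y (f y)%:E = (fine (\int[leb]_y (f y)%:E))%:E)%E.
  by rewrite fineK// ge0_fin_numE// integral_ge0// => y _; rewrite lee_fin.
rewrite !key EFinM -fint -ge0_integralZl_EFin//; last 3 first.
- by move=> y _; rewrite lee_fin.
- by apply/measurable_EFinP.
- by rewrite mulr_ge0.
rewrite -ge0_integralD//; last 4 first.
- by move=> y _; rewrite lee_fin mulr_ge0.
- exact/measurable_EFinP.
- by move=> y _; rewrite -EFinM lee_fin !mulr_ge0.
- by apply/measurable_EFinP; apply: measurable_funM.
apply: ge0_le_integral => //.
- by move=> y _; rewrite lee_fin mulr_ge0.
- exact/measurable_EFinP.
- by apply/measurable_EFinP; apply: measurable_funD => //; apply: measurable_funM.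
- move=> y _; rewrite -EFinM -EFinD lee_fin [_ * f y]mulrC -mulrDr ler_wpM2l//.
  exact: int_ck_near.
Qed.

Lemma ge0_cosnear_int (mu nu : probability R R) (eta e d a : R) : 0 < d -> 0 < a -> 1 <= a * d -> 0 <= e ->
  (forall z w, `|z - w| <= d -> `|f z - f w| <= e) ->
  cosnear mu nu eta ->
  \int[mu]_x f x <= \int[nu]_x f x + 2 * (e + 2 * F * (a * d) / (1 + (a * d) ^+ 2)) +
    2 * eta * fine (\int[leb]_y (f y)%:E) * (a / pi).
Proof.
move=> d0 a0 ad e0 fe mn.
have bf : bdm f by split => //; exists F => x; rewrite ger0_norm//; case/andP: (f0F x).
have pi0 := @pi_gt0 R.
have cl x := smooth_close x d0 a0 ad e0 fe.
pose r := e * (pi / a) + 2 * F / (1 + (a * d) ^+ 2) * (pi * d).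
rewrite -/r /= in cl.
have msm : measurable_fun setT (smooth a).
  have mg : measurable_fun setT (fun z : R * measurableTypeR R => (f z.2 * ck a (z.1 - z.2))%:E).
    apply/measurable_EFinP; apply: measurable_funM; last exact: measurable_ck_sub.
    apply: (@measurableT_comp _ _ _ _ _ _ f) => //; exact: measurable_snd.
  apply: (@measurable_fun_fubini_tonelli_F _ _ _ _ R leb _ mg) => z.
  by rewrite lee_fin mulr_ge0 ?ck_ge0.
have s0 x : (0 <= smooth a x)%E by apply: integral_ge0 => y _; rewrite lee_fin mulr_ge0 ?ck_ge0.
have r0 : 0 <= r.
  have A1 : 0 <= 2 * F by rewrite mulr_ge0.
  have A2 : 0 <= 1 + (a * d) ^+ 2 by rewrite addr_ge0 ?sqr_ge0.
  have A3 : 0 <= pi * d by rewrite mulr_ge0 ?ltW.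
  have A4 : 0 <= pi / a by rewrite divr_ge0 ?ltW.
  by rewrite /r; nneg.
have fz x : 0 <= f x * (pi / a) by rewrite mulr_ge0// divr_ge0// ltW.
have h1 : (\int[mu]_x (f x * (pi / a))%:E <= \int[mu]_x smooth a x + r%:E)%E.
  rewrite (_ : r%:E = \int[mu]_x r%:E)%E; last by rewrite bdm_EFin ?Rint_cst//; exact: bdm_cst.
  rewrite -ge0_integralD//.
  apply: ge0_le_integral => //.
  - by move=> y _; rewrite lee_fin.
  - by apply/measurable_EFinP; apply: measurable_funM.
  - exact: emeasurable_funD.
  - by move=> x _; case: (cl x).
have h2 : (\int[nu]_x smooth a x <= \int[nu]_x (f x * (pi / a) + r)%:E)%E.
  apply: ge0_le_integral => //.
  - by apply/measurable_EFinP; apply: measurable_funD => //; apply: measurable_funM.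
  - by move=> x _; case: (cl x).
have h3 := int_smooth_near a0 mn.
have bz : bdm (fun x => f x * (pi / a)) by apply: bdmM => //; exact: bdm_cst.
have := le_trans h1 (leeD (le_trans h3 (leeD h2 (lexx _))) (lexx r%:E)).
rewrite !bdm_EFin//; last by apply: bdmD => //; exact: bdm_cst.
rewrite bdm_RintD ?Rint_cst//; last exact: bdm_cst.
rewrite -!EFinD lee_fin !RintegralZr//; last 2 first.
- exact: bdm_int.
- exact: bdm_int.
set I1 := \int[mu]_x f x; set I2 := \int[nu]_x f x.
set L := fine _.
rewrite /r; clear -pi0 a0 d0; clearbody I1 I2 L; move: pi0; move: (pi : R) => p p0 h.
have pa : 0 < a / p by rewrite divr_gt0.
have := ler_wpM2r (ltW pa) h.
have -> : I1 * (p / a) * (a / p) = I1 by field; rewrite !gt_eqF.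
move=> h'; apply: (le_trans h').
rewrite le_eqVlt; apply/orP; left; apply/eqP.
field; rewrite !gt_eqF//.
by rewrite ltr_wpDr// sqr_ge0.
Qed.

Hypothesis unif : forall e : R, 0 < e -> exists2 d : R, 0 < d & forall z w, `|z - w| <= d -> `|f z - f w| <= e.

Lemma ge0_cosnear_intE (eps : R) : 0 < eps -> exists2 C, 0 <= C &
  forall (mu nu : probability R R) eta, cosnear mu nu eta ->
  \int[mu]_x f x <= \int[nu]_x f x + eps + C * eta.
Proof.
move=> eps0; have e8 : 0 < eps / 4 by rewrite divr_gt0.
have [d d0 fe] := unif e8.
(* [k] is the product [a d]; since [k * eps >= 8 * F], the tail term [2 F k / (1 + k^2)] is at most
   [eps / 4]. *)
pose k := 1 + 8 * F / eps.
have k1 : 1 <= k by rewrite lerDl divr_ge0 ?mulr_ge0// ltW.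
have k0 : 0 < k by exact: lt_le_trans k1.
have a0 : 0 < k / d by rewrite divr_gt0.
have adE : k / d * d = k by rewrite divfK// gt_eqF.
have ad : 1 <= k / d * d by rewrite adE.
have L0 : 0 <= fine (\int[leb]_y (f y)%:E)%E.
  by rewrite fine_ge0// integral_ge0// => y _; rewrite lee_fin.
have pi0 := @pi_gt0 R.
exists (2 * fine (\int[leb]_y (f y)%:E)%E * (k / d / pi)).
  by nneg.
move=> mu nu eta mn.
apply: (le_trans (ge0_cosnear_int d0 a0 ad (ltW e8) fe mn)).
rewrite -2!addrA lerD2l lerD//; last by rewrite le_eqVlt; apply/orP; left; apply/eqP; ring.
rewrite adE.
have kk : 0 < 1 + k ^+ 2 by rewrite ltr_wpDr// sqr_ge0.
have h : 2 * F * k / (1 + k ^+ 2) <= eps / 4.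
  rewrite ler_pdivrMr//.
  have kE : k * eps = eps + 8 * F by rewrite /k mulrDl mul1r divfK// gt_eqF.
  have : 0 <= (k * eps - 8 * F) * k by rewrite kE addrK mulr_ge0 ?ltW.
  nra.
by lra.
Qed.

End smoothing.

(** [C] depends on [f] and [eps] but not on the two laws; the precision of an Euler scheme can
    therefore be chosen after [C]. The positive and negative parts of [f] inherit its modulus of
    continuity. *)
Lemma cosnear_intE (f : R -> R) (F eps : R) : measurable_fun setT f -> (forall z, `|f z| <= F) ->
  (\int[leb]_y `|f y|%:E < +oo)%E ->
  (forall e : R, 0 < e -> exists2 d : R, 0 < d & forall z w, `|z - w| <= d -> `|f z - f w| <= e) ->
  0 < eps -> exists2 C, 0 <= C &
  forall (mu nu : probability R R) eta, cosnear mu nu eta ->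
  `|\int[mu]_x f x - \int[nu]_x f x| <= eps + C * eta.
Proof.
move=> mf fF f1 unif eps0; have F0 : 0 <= F := le_trans (normr_ge0 _) (fF 0).
pose p := fun x => Num.max (f x) 0; pose m := fun x => Num.max (- f x) 0.
have mp : measurable_fun setT p by apply: measurable_maxr.
have mN : measurable_fun setT (fun x => - f x) by exact: measurable_funN.
have mm : measurable_fun setT m by apply: measurable_maxr.
have p0F x : 0 <= p x <= F.
  have := fF x; rewrite /p le_max lexx orbT/= ge_max F0 andbT; exact: le_trans (ler_norm _).
have m0F x : 0 <= m x <= F.
  have := fF x; rewrite /m le_max lexx orbT/= ge_max F0 andbT -normrN; exact: le_trans (ler_norm _).
have lt (g : R -> R) : measurable_fun setT g -> (forall x, 0 <= g x <= `|f x|) -> (\int[leb]_y (g y)%:E < +oo)%E.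
  move=> mg gf; apply: le_lt_trans f1; apply: ge0_le_integral => //.
  - by move=> x _; rewrite lee_fin; case/andP: (gf x).
  - exact/measurable_EFinP.
  - by apply/measurable_EFinP; apply: measurableT_comp.
  - by move=> x _; rewrite lee_fin; case/andP: (gf x).
have hp := lt p mp; have hm := lt m mm.
have p1 : (\int[leb]_y (p y)%:E < +oo)%E.
  by apply: hp => x; rewrite /p le_max lexx orbT/= ge_max normr_ge0 ler_norm.
have m1 : (\int[leb]_y (m y)%:E < +oo)%E.
  by apply: hm => x; rewrite /m le_max lexx orbT/= ge_max normr_ge0 -normrN ler_norm.
have maxl (x y : R) : `|Num.max x 0 - Num.max y 0| <= `|x - y|.
  by rewrite !maxEle; case: (leP x 0); case: (leP y 0) => ? ?; rewrite ?subrr ?normr0// ler_norml;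
     have := ler_norm (x - y); have := ler_norm (- (x - y)); rewrite normrN; lra.
have up : forall e : R, 0 < e -> exists2 d : R, 0 < d & forall z w, `|z - w| <= d -> `|p z - p w| <= e.
  move=> e /unif[d d0 h]; exists d => // z w /h; exact: le_trans (maxl _ _).
have um : forall e : R, 0 < e -> exists2 d : R, 0 < d & forall z w, `|z - w| <= d -> `|m z - m w| <= e.
  move=> e /unif[d d0 h]; exists d => // z w /h; apply: le_trans.
  by rewrite (le_trans (maxl _ _))// -opprD normrN.
have e2 : 0 < eps / 2 by rewrite divr_gt0.
have [C1 C10 H1] := ge0_cosnear_intE F0 mp p0F p1 up e2.
have [C2 C20 H2] := ge0_cosnear_intE F0 mm m0F m1 um e2.
exists (C1 + C2); first exact: addr_ge0.
move=> mu nu eta mn.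
have nm : cosnear nu mu eta by move=> xi th; rewrite distrC.
have bp : bdm p by split => //; exists F => x; have /andP[? ?] := p0F x; rewrite ger0_norm.
have bm : bdm m by split => //; exists F => x; have /andP[? ?] := m0F x; rewrite ger0_norm.
have fE (P : probability R R) : \int[P]_x f x = \int[P]_x p x - \int[P]_x m x.
  rewrite -bdm_RintB//; apply: eq_Rintegral => x _; rewrite /p /m !maxEle.
  by case: (leP (f x) 0); case: (leP (- f x) 0) => ? ?; lra.
rewrite !fE mulrDl ler_norml.
have := H1 _ _ _ mn; have := H1 _ _ _ nm; have := H2 _ _ _ mn; have := H2 _ _ _ nm.
move: (\int[mu]_x p x) (\int[nu]_x p x) (\int[mu]_x m x) (\int[nu]_x m x) => a b c d.
by move: (C1 * eta) (C2 * eta) => u v; lra.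
Qed.

Lemma cosnear0_int (f : R -> R) (F : R) (mu nu : probability R R) : measurable_fun setT f -> (forall z, `|f z| <= F) ->
  (\int[leb]_y `|f y|%:E < +oo)%E ->
  (forall e : R, 0 < e -> exists2 d : R, 0 < d & forall z w, `|z - w| <= d -> `|f z - f w| <= e) ->
  cosnear mu nu 0 -> \int[mu]_x f x = \int[nu]_x f x.
Proof.
move=> mf fF f1 unif mn; apply/eqP; rewrite -subr_eq0 -normr_le0; apply/ler_addgt0Pr => e e0.
have [C _ /(_ _ _ _ mn)] := cosnear_intE mf fF f1 unif e0.
by rewrite mulr0 add0r addr0.
Qed.

Lemma charfun_ccos (nu : probability R R) (xi th : R) :
  ccos nu xi th = cos th * complex.Re (charfun nu xi) - sin th * complex.Im (charfun nu xi).
Proof.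
have mx : measurable_fun setT (fun x : R => xi * x) by exact: mulrl_measurable.
have bc : bdm (fun x : R => cos (xi * x)) by exact: bdm_cos.
have bs : bdm (fun x : R => sin (xi * x)).
  split; last by exists 1 => x; exact: sin_max.
  apply: (measurableT_comp _ mx); by apply: continuous_measurable_fun; exact: continuous_sin.
rewrite /charfun /cexpect /cint/= -!bdm_RintZ//.
rewrite -bdm_RintB; [|exact: bdmZ|exact: bdmZ].
by apply: eq_Rintegral => x _; rewrite cosD mulrC [X in _ - X]mulrC.
Qed.

Lemma charfun_cosnear (mu nu : probability R R) : (forall xi, charfun mu xi = charfun nu xi) -> cosnear mu nu 0.
Proof. by move=> h xi th; rewrite !charfun_ccos h subrr normr0. Qed.

Lemma Rint_dct d (T : measurableType d) (m : {measure set T -> \bar R}) (f_ : nat -> T -> R) (f g : T -> R) :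
  (forall n, measurable_fun setT (f_ n)) -> measurable_fun setT f ->
  m.-integrable setT (EFin \o g) -> (forall n x, `|f_ n x| <= g x) ->
  (forall x, f_ n x @[n --> \oo] --> f x) ->
  m.-integrable setT (EFin \o f) /\ \int[m]_x f_ n x @[n --> \oo] --> \int[m]_x f x.
Proof.
move=> mf_ mf ig fM cf.
have [||||| fi _ c] := @dominated_convergence _ _ _ m setT measurableT (fun n x => (f_ n x)%:E) (EFin \o f) (EFin \o g).
- by move=> n; exact/measurable_EFinP.
- exact/measurable_EFinP.
- by apply: aeW => x _; apply: cvg_EFin; [exact: nearW|exact: cf].
- exact: ig.
- by apply: aeW => x n _; rewrite lee_fin.
split => //; apply: fine_cvg.
by rewrite /Rintegral fineK//; exact: integrable_fin_num.
Qed.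

Lemma bdm_dct d (T : measurableType d) (P : probability T R) (f_ : nat -> T -> R) (f : T -> R) (M : R) :
  (forall n, measurable_fun setT (f_ n)) -> measurable_fun setT f -> (forall n x, `|f_ n x| <= M) ->
  (forall x, f_ n x @[n --> \oo] --> f x) ->
  \int[P]_x f_ n x @[n --> \oo] --> \int[P]_x f x.
Proof.
move=> mf_ mf fM cf.
have iM : P.-integrable setT (EFin \o (fun _ : T => M)) by apply: bdm_int; exact: bdm_cst.
by have [] := Rint_dct mf_ mf iM fM cf.
Qed.

Definition ramp (n : nat) (c x : R) : R := Num.min 1 (Num.max 0 (n%:R * (x - c))).

Lemma ramp01 n c x : 0 <= ramp n c x <= 1.
Proof. by rewrite /ramp le_min ler01 le_max lexx/= ge_min lexx. Qed.

Lemma clamp_lip (u v : R) : `|Num.min 1 (Num.max 0 u) - Num.min 1 (Num.max 0 v)| <= `|u - v|.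
Proof.
have := ler_norm (u - v); have := ler_norm (- (u - v)); rewrite normrN.
move: `|u - v| => d h1 h2; rewrite ler_norml !minEle !maxEle.
by case: (leP 0 u) => ?; case: (leP 0 v) => ?; case: (leP 1 u) => ?; case: (leP 1 v) => ?; case: (leP (1:R) 0) => ?; lra.
Qed.

Lemma ramp_lip n c x y : `|ramp n c x - ramp n c y| <= n%:R * `|x - y|.
Proof.
rewrite (le_trans (clamp_lip _ _))// -mulrBr normrM ger0_norm// ler_wpM2l//.
by rewrite opprB addrA subrK.
Qed.

Lemma measurable_ramp n c : measurable_fun setT (ramp n c).
Proof.
by apply: measurable_minr => //; apply: measurable_maxr => //; apply: measurable_funM => //; exact: measurable_funB.
Qed.

Lemma ramp_out n c x : x <= c -> ramp n c x = 0.
Proof.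
move=> xc; rewrite /ramp max_l; first by rewrite min_r.
by rewrite mulr_ge0_le0// subr_le0.
Qed.

Lemma ramp_in n c x : 1 <= n%:R * (x - c) -> ramp n c x = 1.
Proof. by move=> h; rewrite /ramp max_r ?(le_trans _ h)// min_l. Qed.

Lemma ramp_cvg (c x : R) : ramp n.+1 c x @[n --> \oo] --> (if c < x then 1 else 0 : R).
Proof.
case: ltP => cx; last first.
  by under eq_cvg do rewrite ramp_out//; exact: cvg_cst.
apply: cvg_near_cst; near=> n; apply: ramp_in.
rewrite -ler_pdivrMr ?subr_gt0// (@le_trans _ _ n%:R)// ?ler_nat//.
near: n; exact: nbhs_infty_ger.
Unshelve. all: by end_near. Qed.

(** Differences of two ramps are Lipschitz, supported in [[a, b + 1]], and converge pointwise to the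
    indicator of []a, b]]. *)
Lemma cosnear0_ocitv (mu nu : probability R R) (a b : R) : cosnear mu nu 0 -> a <= b ->
  mu `]a, b]%classic = nu `]a, b]%classic.
Proof.
move=> mn ab; pose r n x := ramp n.+1 a x - ramp n.+1 b x.
have rb n x : `|r n x| <= 1.
  have /andP[? ?] := ramp01 n.+1 a x; have /andP[? ?] := ramp01 n.+1 b x; rewrite ler_norml /r; lra.
have mr n : measurable_fun setT (r n) by apply: measurable_funB; exact: measurable_ramp.
have mi : measurable_fun setT (\1_(`]a, b]%classic) : R -> R) by exact: measurable_indic.
have cr x : r n x @[n --> \oo] --> (\1_(`]a, b]%classic) x : R).
  rewrite indicE mem_setE/= in_itv/=.
  rewrite (_ : _%:R = (if a < x then 1 else 0) - (if b < x then 1 else 0)).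
    by apply: cvgB; exact: ramp_cvg.
  by case: (ltP a x) => ax; case: (leP x b) => xb; rewrite ?subr0 ?subrr//=; move: (lt_le_trans xb (le_trans ax ab)); rewrite ?ltxx//; lra.
have key n : \int[mu]_x r n x = \int[nu]_x r n x.
  apply: (cosnear0_int (mr n) (rb n)) => //.
  - apply: (@le_lt_trans _ _ (\int[leb]_y (\1_(`[a, b + 1]%classic) y)%:E)%E); last first.
      rewrite integral_indic// setIT/= lebesgue_measure_itv/=; case: ifP => _; by rewrite ?ltry// -EFinB ltry.
    apply: ge0_le_integral => //.
    - by apply/measurable_EFinP; apply: measurableT_comp => //; exact: mr.
    - by apply/measurable_EFinP; exact: measurable_indic.
    move=> x _; rewrite lee_fin indicE mem_setE/= in_itv/=.
    case: (leP a x) => ax; case: (leP x (b + 1)) => xb //=; rewrite normr_le0 /r.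
    + rewrite !ramp_in ?subrr//.
        rewrite -[leLHS]mulr1 ler_pM// ?ler1n//; lra.
      rewrite -[leLHS]mulr1 ler_pM// ?ler1n//; lra.
    + by rewrite !ramp_out ?subrr//; lra.
    + by rewrite !ramp_out ?subrr//; lra.
  - move=> e e0; have n0' : 0 < n.+1%:R :> R by rewrite ltr0n.
    exists (e / (2 * n.+1%:R)); first by rewrite divr_gt0// mulr_gt0.
    move=> z w zw; rewrite /r opprB addrACA [X in _ + X]addrC.
    apply: (le_trans (_ : _ <= n.+1%:R * `|z - w| + n.+1%:R * `|z - w|)).
      rewrite addrAC addrA -addrA (le_trans (ler_normD _ _))// lerD//; first exact: ramp_lip.
      by rewrite addrC distrC ramp_lip.
    move: n0' zw; move: (n.+1%:R : R) => k k0; rewrite ler_pdivlMr ?mulr_gt0// => h.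
    by move: `|z - w| h => t h; lra.
have c1 := @bdm_dct _ _ mu _ _ _ mr mi rb cr.
have c2 := @bdm_dct _ _ nu _ _ _ mr mi rb cr.
rewrite (_ : (fun n => \int[nu]_x r n x) = (fun n => \int[mu]_x r n x)) in c2; last first.
  by apply/funext => n; rewrite key.
have : \int[mu]_x (\1_(`]a, b]%classic) x : R) = \int[nu]_x (\1_(`]a, b]%classic) x : R).
  exact: (cvg_unique (@Rhausdorff R) c1 c2).
rewrite /Rintegral !integral_indic// !setIT => h'.
by rewrite -[LHS]fineK ?fin_num_measure// -[RHS]fineK ?fin_num_measure// h'.
Qed.

Lemma cosnear0_eq (mu nu : probability R R) : cosnear mu nu 0 ->
  forall A : set R, measurable A -> mu A = nu A.
Proof.
move=> mn A mA.
apply: (@measure_unique _ R R (@ocitv R) (fun n : nat => `](- n%:R), n%:R]%classic)) => //.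
- by move=> C D; exact: ocitvI.
- by move=> n; exact: is_ocitv.
- rewrite -subTset => x _; have := archi_boundP (normr_ge0 x).
  set n := Num.bound _ => h; exists n => //=; rewrite in_itv/=.
  by move: h; rewrite ltr_norml => /andP[-> /ltW ->].
- move=> B /ocitvP[->|[[a b]/= ab ->]]; first by rewrite !measure0.
  exact/cosnear0_ocitv/ltW.
- by move=> n; rewrite ltey_eq fin_num_measure.
Qed.

Lemma charfun_inj (mu nu : probability R R) : (forall xi, charfun mu xi = charfun nu xi) ->
  forall A : set R, measurable A -> mu A = nu A.
Proof. by move=> /charfun_cosnear; exact: cosnear0_eq. Qed.

End cosine_distance.

(** * The smoothing transform *)

Section smoothing_transform.
Context (R : realType) (I : Type) d (T : measurableType d) (P : probability T R).
Variables (A : I -> T -> R) (mA : forall i, measurable_fun setT (A i)).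

Lemma measurable_start : measurable_fun setT (fun x : T => (x, 0 : R)).
Proof. exact: measurable_fun_pair. Qed.

(** The sample point is carried along because all the weights [A i x] depend on it jointly; only the
    new factor [z.2] is independent of the past. *)
Definition sstep (i : I) (z : (T * R) * R) : T * R := (z.1.1, z.1.2 + A i z.1.1 * z.2).

Lemma measurable_sstep i : measurable_fun setT (sstep i).
Proof.
have m11 : measurable_fun setT (fun z : (T * R) * R => z.1.1).
  by apply: (measurableT_comp (@measurable_fst _ _ _ _)); exact: measurable_fst.
have m12 : measurable_fun setT (fun z : (T * R) * R => z.1.2).
  by apply: (measurableT_comp (@measurable_snd _ _ _ _)); exact: measurable_fst.
apply: measurable_fun_pair => //; apply: measurable_funD => //.
apply: measurable_funM; first exact: (measurableT_comp (mA i)).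
exact: measurable_snd.
Qed.

Section fixed_law.
Variable nu : probability R R.

(* Joint law of [x] and [\sum_(i <- s) A i x * V_i], with [V_i] independent of law [nu] and independent of [x]. *)
Fixpoint smk (s : seq I) : probability (T * R)%type R :=
  if s is i :: s' then law (smk s' \x nu)%E (measurable_sstep i) else law P measurable_start.

Lemma bdm_shift (F : T * R -> R) (i : I) : bdm F ->
  bdm (fun z : (T * R) * R => F (z.1.1, z.1.2 + A i z.1.1 * z.2)).
Proof. by move=> bF; exact: bdm_comp bF (measurable_sstep i). Qed.

Lemma bdm_avg (F : T * R -> R) (i : I) : bdm F ->
  bdm (fun z : T * R => \int[nu]_v F (z.1, z.2 + A i z.1 * v)).
Proof. by move=> /(bdm_shift i) bF; exact: (bdm_fubini_F (smk [::]) nu bF). Qed.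

Lemma int_smk_nil (F : T * R -> R) : bdm F -> \int[smk [::]]_z F z = \int[P]_x F (x, 0).
Proof. by move=> bF; rewrite bdm_law. Qed.

Lemma int_smk_cons i s (F : T * R -> R) : bdm F ->
  \int[smk (i :: s)]_z F z = \int[smk s]_z \int[nu]_v F (z.1, z.2 + A i z.1 * v).
Proof. by move=> bF; rewrite /= bdm_law// bdm_fubini//; exact: bdm_shift. Qed.

Lemma ge0_int_smk_nil (F : T * R -> \bar R) : measurable_fun setT F -> (forall z, 0 <= F z)%E ->
  (\int[smk [::]]_z F z = \int[P]_x F (x, 0%R))%E.
Proof. by move=> bF F0; rewrite ge0_int_law. Qed.

Lemma ge0_int_smk_cons i s (F : T * R -> \bar R) : measurable_fun setT F -> (forall z, 0 <= F z)%E ->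
  (\int[smk (i :: s)]_z F z = \int[smk s]_z \int[nu]_v F (z.1, z.2 + A i z.1 * v)%R)%E.
Proof.
move=> mF F0; have mG := measurableT_comp mF (measurable_sstep i).
by rewrite /= ge0_int_law// (fubini_tonelli1 _ mG)//= => z; exact: F0.
Qed.

Lemma ge0_int_smk_fst s (h : T -> \bar R) : measurable_fun setT h -> (forall x, 0 <= h x)%E ->
  (\int[smk s]_z h z.1 = \int[P]_x h x)%E.
Proof.
move=> mh h0; have mh1 : measurable_fun setT (fun z : T * R => h z.1).
  by apply: (measurableT_comp mh); exact: measurable_fst.
elim: s => [|i s IH]; first by rewrite ge0_int_smk_nil.
rewrite ge0_int_smk_cons// -IH; apply: eq_integral => z _ /=.
by rewrite integral_cst//= [X in (_ * X)%E](_ : _ = 1%E) ?mule1//; exact: probability_setT.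
Qed.

Definition sm (s : seq I) : probability R R := law (smk s) (@measurable_snd _ _ T R).

Lemma bdm_snd (f : R -> R) : bdm f -> bdm (fun z : T * R => f z.2).
Proof. by move=> bf; exact: bdm_comp bf (@measurable_snd _ _ _ _). Qed.

Lemma int_sm s (f : R -> R) : bdm f -> \int[sm s]_y f y = \int[smk s]_z f z.2.
Proof. by move=> bf; rewrite bdm_law. Qed.

End fixed_law.

(** Lindeberg replacement: the copies of [nu] are exchanged one by one for copies of [nu']. Given
    the rest, an exchange costs [w (A i x) * Z], of mean [W i * Z]. A general [w] serves both
    cosines ([w = 1]) and functions of the class of order [delta] ([w a = a^delta]). *)
Lemma smk_contract (nu nu' : probability R R) (w : R -> R) (W : I -> R) (Z : R) s (F : T * R -> R) :
  0 <= Z -> measurable_fun setT w -> (forall a, 0 <= w a) ->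
  (forall i x, 0 <= A i x) ->
  (forall i, (\int[P]_x (w (A i x))%:E = (W i)%:E)%E) -> bdm F ->
  (forall x a b, 0 <= a -> `|\int[nu]_v F (x, b + a * v) - \int[nu']_v F (x, b + a * v)| <= w a * Z) ->
  `|\int[smk nu s]_z F z - \int[smk nu' s]_z F z| <= (\sum_(i <- s) W i) * Z.
Proof.
move=> Z0 mw w0 A0 hW; elim: s F => [|i s IH] F bF hF.
  by rewrite !int_smk_nil// subrr normr0 big_nil mul0r.
rewrite !int_smk_cons// big_cons mulrDl.
set G := fun z : T * R => \int[nu]_v F (z.1, z.2 + A i z.1 * v).
set G' := fun z : T * R => \int[nu']_v F (z.1, z.2 + A i z.1 * v).
have bG : bdm G by exact: bdm_avg.
have bG' : bdm G' by exact: bdm_avg.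
(* The head summand is exchanged under the old law of the others; the others are then exchanged
   under the averaged function [G']. *)
rewrite -(subrKA (\int[smk nu s]_z G' z)) (le_trans (ler_normD _ _))// lerD//.
  rewrite -bdm_RintB// -lee_fin.
  have bD : bdm (fun z => G z - G' z) by exact: bdmB.
  rewrite (le_trans (y := \int[smk nu s]_z (`|G z - G' z|)%:E)%E)//.
    by rewrite bdm_EFin ?lee_fin; [|exact: bdm_abs]; rewrite le_normr_Rintegral//; exact: bdm_int.
  rewrite EFinM -hW.
  have mwA : measurable_fun setT (fun x => (w (A i x))%:E).
    by apply/measurable_EFinP; exact: (measurableT_comp mw).
  rewrite -(ge0_int_smk_fst nu s mwA)//; last by move=> x; rewrite lee_fin.
  rewrite muleC -ge0_integralZl_EFin//; last 2 first.
  - by move=> x _; rewrite lee_fin.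
  - by apply: (measurableT_comp mwA); exact: measurable_fst.
  apply: ge0_le_integral => //.
  - by apply/measurable_EFinP; case: (bdm_abs bD).
  - apply: measurable_funeM; by apply: (measurableT_comp mwA); exact: measurable_fst.
  - by move=> z _; rewrite -EFinM lee_fin mulrC; exact: hF.
(* [G'] inherits the hypothesis: by Fubini its differences are averages over [u] of those of [F],
   with base point [b + A i x * u]. *)
apply: IH => // x a b a0.
have bH : bdm (fun z : R * R => F (x, b + a * z.1 + A i x * z.2)).
  apply: (bdm_comp bF); apply: measurable_fun_pair => //.
  by do ?[apply: measurable_funD|apply: measurable_funM] => //.
have E (m : probability R R) : \int[m]_v G' (x, b + a * v) =
    \int[nu']_u \int[m]_v F (x, b + A i x * u + a * v).
  rewrite /G'/= -(bdm_fubini m nu' bH) (bdm_fubini2 m nu' bH).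
  by apply: eq_Rintegral => u _; apply: eq_Rintegral => v _; rewrite addrAC.
have bE (m : probability R R) : bdm (fun u => \int[m]_v F (x, b + A i x * u + a * v)).
  have bH' : bdm (fun z : R * R => F (x, b + A i x * z.1 + a * z.2)).
    apply: (bdm_comp bF); apply: measurable_fun_pair => //.
    by do ?[apply: measurable_funD|apply: measurable_funM] => //.
  exact: (bdm_fubini_F nu m bH').
rewrite !E -bdm_RintB//; apply: bdm_norm_le; first exact: bdmB.
by move=> u; exact: hF.
Qed.

Lemma sm_contract (nu nu' : probability R R) (w : R -> R) (W : I -> R) (Z : R) s (f : R -> R) :
  0 <= Z -> measurable_fun setT w -> (forall a, 0 <= w a) ->
  (forall i x, 0 <= A i x) ->
  (forall i, (\int[P]_x (w (A i x))%:E = (W i)%:E)%E) -> bdm f ->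
  (forall a b, 0 <= a -> `|\int[nu]_v f (b + a * v) - \int[nu']_v f (b + a * v)| <= w a * Z) ->
  `|\int[sm nu s]_y f y - \int[sm nu' s]_y f y| <= (\sum_(i <- s) W i) * Z.
Proof.
move=> Z0 mw w0 A0 hW bf hf; rewrite !int_sm//.
by apply: (smk_contract (w := w)) => //; exact: bdm_snd.
Qed.

Lemma smk_scale (nu nu' : probability R R) (c : R) s (F : T * R -> R) :
  (forall g : R -> R, bdm g -> \int[nu']_v g v = \int[nu]_v g (c * v)) -> bdm F ->
  \int[smk nu' s]_z F z = \int[smk nu s]_z F (z.1, c * z.2).
Proof.
move=> hc; elim: s F => [|i s IH] F bF.
  rewrite !int_smk_nil//=; first by apply: eq_Rintegral => x _; rewrite mulr0.
  by apply: (bdm_comp bF); apply: measurable_fun_pair => //; exact: measurable_funM.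
have mc : measurable_fun setT (fun z : T * R => (z.1, c * z.2)).
  by apply: measurable_fun_pair => //; exact: measurable_funM.
have bFc : bdm (fun z : T * R => F (z.1, c * z.2)) by exact: bdm_comp bF mc.
rewrite !int_smk_cons// IH; last exact: bdm_avg.
apply: eq_Rintegral => z _ /=; rewrite hc.
  by apply: eq_Rintegral => v _; congr (F (_, _)); ring.
apply: (bdm_comp bF); apply: measurable_fun_pair => //.
by do ?[apply: measurable_funD|apply: measurable_funM] => //.
Qed.

Lemma sm_scale (nu nu' : probability R R) (c : R) s (f : R -> R) :
  (forall g : R -> R, bdm g -> \int[nu']_v g v = \int[nu]_v g (c * v)) -> bdm f ->
  \int[sm nu' s]_y f y = \int[sm nu s]_y f (c * y).
Proof.
move=> hc bf; rewrite !int_sm//.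
  by rewrite (smk_scale _ hc)//; exact: bdm_snd.
by apply: (bdm_comp bf); exact: measurable_funM.
Qed.

Local Notation Re := complex.Re.
Local Notation Im := complex.Im.

Definition cbdm d' (T' : measurableType d') (H : T' -> R[i]) :=
  bdm (fun x => Re (H x)) /\ bdm (fun x => Im (H x)).

Lemma ReM (a b : R[i]) : Re (a * b) = Re a * Re b - Im a * Im b.
Proof. by case: a => ? ?; case: b. Qed.

Lemma ImM (a b : R[i]) : Im (a * b) = Re a * Im b + Im a * Re b.
Proof. by case: a => ? ?; case: b. Qed.

Lemma cbdmM d' (T' : measurableType d') (H K : T' -> R[i]) : cbdm H -> cbdm K -> cbdm (fun x => H x * K x).
Proof.
move=> [h1 h2] [k1 k2]; split.
  by under eq_fun do rewrite ReM; apply: bdmB; exact: bdmM.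
by under eq_fun do rewrite ImM; apply: bdmD; exact: bdmM.
Qed.

Lemma cexpiD (a b : R) : cexpi (a + b) = cexpi a * cexpi b.
Proof. by rewrite /cexpi cosD sinD /GRing.mul/=; congr (_ +i* _)%C; rewrite addrC. Qed.

Lemma cbdm_cexpi d' (T' : measurableType d') (h : T' -> R) : measurable_fun setT h -> cbdm (fun x => cexpi (h x)).
Proof.
move=> mh; split; first exact: bdm_cos.
split; last by exists 1 => x; exact: sin_max.
by apply: (measurableT_comp _ mh); apply: continuous_measurable_fun; exact: continuous_sin.
Qed.

Lemma cbdm_charfun (nu : probability R R) d' (T' : measurableType d') (P' : probability T' R) (h : T' -> R) :
  measurable_fun setT h -> cbdm (fun x => charfun nu (h x)).
Proof.
move=> mh; have mH : measurable_fun setT (fun z : T' * R => h z.1 * z.2).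
  apply: measurable_funM => //; apply: (measurableT_comp mh); exact: measurable_fst.
have [b1 b2] := cbdm_cexpi mH.
by split; [exact: (bdm_fubini_F P' nu b1)|exact: (bdm_fubini_F P' nu b2)].
Qed.

(** The factor [H] collects the characteristic functions already integrated out, which closes the
    induction. Taking [H = 1] and [H = - 'i] later gives the real and the imaginary part. *)
Lemma smk_cexpi (nu : probability R R) s (xi : R) (H : T -> R[i]) : cbdm H ->
  \int[smk nu s]_z Re (H z.1 * cexpi (xi * z.2)) =
  \int[P]_x Re (H x * \prod_(i <- s) charfun nu (A i x * xi)).
Proof.
elim: s H => [|i s IH] H cH.
  have c1 : cbdm (fun z : T * R => H z.1 * cexpi (xi * z.2)).
    apply: cbdmM; last by apply: cbdm_cexpi; exact: measurable_funM.
    by case: cH => b1 b2; split; [apply: (bdm_comp b1)|apply: (bdm_comp b2)]; exact: measurable_fst.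
  rewrite int_smk_nil//; last exact: proj1 c1.
  by apply: eq_Rintegral => x _ /=; rewrite mulr0 big_nil /cexpi cos0 sin0.
have mAx : measurable_fun setT (fun x => A i x * xi) by exact: measurable_funM.
have cK : cbdm (fun x => H x * charfun nu (A i x * xi)).
  by apply: cbdmM => //; exact: (cbdm_charfun nu P).
have c1 : cbdm (fun z : T * R => H z.1 * cexpi (xi * z.2)).
  apply: cbdmM; last by apply: cbdm_cexpi; exact: measurable_funM.
  by case: cH => b1 b2; split; [apply: (bdm_comp b1)|apply: (bdm_comp b2)]; exact: measurable_fst.
rewrite int_smk_cons//; last exact: proj1 c1.
under [RHS]eq_Rintegral do rewrite big_cons mulrA.
rewrite -IH//; apply: eq_Rintegral => z _ /=.
set a := H z.1 * cexpi (xi * z.2).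
rewrite [H z.1 * _ * _]mulrAC -/a.
have cv : cbdm (fun v : R => cexpi (A i z.1 * xi * v)) by apply: cbdm_cexpi; exact: measurable_funM.
transitivity (\int[nu]_v (Re a * Re (cexpi (A i z.1 * xi * v)) - Im a * Im (cexpi (A i z.1 * xi * v)))).
  apply: eq_Rintegral => v _; rewrite -ReM; congr Re.
  by rewrite /a -mulrA -cexpiD; congr (_ * cexpi _); ring.
case: cv => b1 b2.
rewrite bdm_RintB; [|exact: bdmZ|exact: bdmZ].
by rewrite (bdm_RintZ nu (Re a) b1) (bdm_RintZ nu (Im a) b2) [RHS]ReM.
Qed.

Lemma charfun_sm (nu : probability R R) s (xi : R) :
  charfun (sm nu s) xi = cexpect P (fun x => \prod_(i <- s) charfun nu (A i x * xi)).
Proof.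
have cx : cbdm (fun v : R => cexpi (xi * v)) by apply: cbdm_cexpi; exact: measurable_funM.
have c1 : cbdm (fun _ : T => 1 : R[i]) by split; exact: bdm_cst.
have c2 : cbdm (fun _ : T => - 'i : R[i]) by split; exact: bdm_cst.
rewrite /charfun /cexpect /cint; congr (_ +i* _)%C.
  rewrite int_sm; last by case: cx.
  have := smk_cexpi nu s xi c1.
  by under eq_Rintegral do rewrite mul1r; move=> ->; apply: eq_Rintegral => x _; rewrite mul1r.
rewrite int_sm; last by case: cx.
have hI (z : R[i]) : Re (- 'i * z) = Im z by case: z => a b /=; ring.
have := smk_cexpi nu s xi c2.
by under eq_Rintegral do rewrite hI; move=> ->; apply: eq_Rintegral => x _; rewrite hI.
Qed.

End smoothing_transform.

(** * Comparison of flows by the Euler scheme *)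

Section mixture.
Context (R : realType) (mu nu : probability R R) (h : R) (h01 : 0 <= h <= 1).

Let h0 : 0 <= h. Proof. by case/andP: h01. Qed.
Let h1 : 0 <= 1 - h. Proof. by rewrite subr_ge0; case/andP: h01. Qed.

Definition mix : set R -> \bar R := measure_add (mscale (NngNum h1) mu) (mscale (NngNum h0) nu).

HB.instance Definition _ := Measure.on mix.

Let mix_setT : mix setT = 1%E.
Proof.
rewrite /mix measure_addE /mscale/=.
transitivity ((1 - h)%:E * 1 + h%:E * 1)%E; last by rewrite !mule1 -EFinD subrK.
by congr (_ * _ + _ * _)%E; exact: probability_setT.
Qed.

HB.instance Definition _ := Measure_isProbability.Build _ _ R mix mix_setT.

Definition mixp : probability R R := mix.

Lemma ge0_int_mixp (f : R -> \bar R) : measurable_fun setT f -> (forall x, 0 <= f x)%E ->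
  (\int[mixp]_x f x = (1 - h)%:E * \int[mu]_x f x + h%:E * \int[nu]_x f x)%E.
Proof.
move=> mf f0; rewrite /mixp /mix ge0_integral_measure_add//.
by rewrite !ge0_integral_mscale.
Qed.

Lemma int_mixp (f : R -> R) : bdm f ->
  \int[mixp]_x f x = (1 - h) * \int[mu]_x f x + h * \int[nu]_x f x.
Proof.
move=> bf; have [mf [M fM]] := bf.
have bfM : bdm (fun x => f x + M) by apply: bdmD => //; exact: bdm_cst.
have : (\int[mixp]_x (f x + M)%:E = (1 - h)%:E * \int[mu]_x (f x + M)%:E + h%:E * \int[nu]_x (f x + M)%:E)%E.
  apply: ge0_int_mixp; first by apply/measurable_EFinP; case: bfM.
  by move=> x; rewrite lee_fin; have := fM x; rewrite ler_norml => /andP[]; lra.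
rewrite !bdm_EFin// -!EFinM -EFinD => -[].
by rewrite !bdm_RintD ?Rint_cst//; try exact: bdm_cst; lra.
Qed.

End mixture.

Lemma mul_div_succ_le (R : realFieldType) (C x : R) : 0 <= C -> 0 <= x -> C * (x / (C + 1)) <= x.
Proof. by move=> C0 x0; rewrite mulrA ler_pdivrMr ?ltr_wpDl//; lra. Qed.

Section euler.
Context (R : realType) (I : Type) d (T : measurableType d) (P : probability T R).
Variables (A : I -> T -> R) (mA : forall i, measurable_fun setT (A i)) (A0 : forall i x, 0 <= A i x).
Variable s : seq I.

Local Notation S nu := (sm P mA nu s).

(** A weight rescales the frequency and the other summands shift the phase, so closeness uniform in
    both is what propagates; each summand costs [eta]. *)
Lemma cosnear_sm (nu nu' : probability R R) (eta : R) : cosnear nu nu' eta ->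
  cosnear (S nu) (S nu') ((size s)%:R * eta).
Proof.
move=> h xi th; have e0 : 0 <= eta := le_trans (normr_ge0 _) (h 0 0).
have -> : (size s)%:R = \sum_(i <- s) (1 : R) by rewrite big_const_seq count_predT iter_addr addr0.
apply: (sm_contract mA (w := fun _ => 1)) => //.
- by move=> i; rewrite bdm_EFin ?Rint_cst//; exact: bdm_cst.
- exact: bdm_cos_affine.
move=> a b _; rewrite mul1r.
have E (m : probability R R) : \int[m]_v cos (xi * (b + a * v) + th) = ccos m (xi * a) (xi * b + th).
  by apply: eq_Rintegral => v _; congr cos; ring.
by rewrite !E.
Qed.

Section step.
Variables (h : R) (h01 : 0 <= h <= 1).

Fixpoint eul (n : nat) (nu : probability R R) : probability R R :=
  if n is m.+1 then mixp (eul m nu) (S (eul m nu)) h01 else nu.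

(** Only the part of the mass that never undergoes the smoothing transform is kept. *)
Lemma eul_ge (n : nat) (nu : probability R R) (f : R -> R) : bdm f -> (forall x, 0 <= f x) ->
  (1 - h) ^+ n * \int[nu]_x f x <= \int[eul n nu]_x f x.
Proof.
move=> bf f0; have /andP[h0 h1] := h01.
elim: n => [|n IH]; first by rewrite expr0 mul1r.
rewrite /= int_mixp// exprS -mulrA ler_wpDr//.
  by rewrite mulr_ge0// Rintegral_ge0.
by rewrite ler_wpM2l// subr_ge0.
Qed.

(* [f] sees the difference of two laws at most as the Zolotarev class of order [delta] does. *)
Definition good (delta Z : R) (nu nu' : probability R R) (f : R -> R) : Prop :=
  forall a b, 0 <= a -> `|\int[nu]_v f (b + a * v) - \int[nu']_v f (b + a * v)| <= a `^ delta * Z.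

Lemma bdm_affine (f : R -> R) (a b : R) : bdm f -> bdm (fun v => f (b + a * v)).
Proof. by move=> bf; apply: (bdm_comp bf); apply: measurable_funD => //; exact: mulrl_measurable. Qed.

Variables (delta : R) (W : I -> R).
Hypothesis hW : forall i, (\int[P]_x (A i x `^ delta)%:E = (W i)%:E)%E.

Lemma good_sm (Z : R) (nu nu' : probability R R) (f : R -> R) : 0 <= Z -> bdm f -> good delta Z nu nu' f ->
  good delta ((\sum_(i <- s) W i) * Z) (S nu) (S nu') f.
Proof.
move=> Z0 bf gf a b a0; rewrite mulrCA.
apply: (sm_contract mA (w := fun u => u `^ delta)) => //.
- by rewrite mulr_ge0 ?powR_ge0.
- by move=> ?; exact: powR_ge0.
- exact: bdm_affine.
- move=> a' b' a'0; rewrite mulrA -powRM//.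
  have E (m : probability R R) : \int[m]_v f (b + a * (b' + a' * v)) = \int[m]_v f ((b + a * b') + (a' * a) * v).
    by apply: eq_Rintegral => v _; congr f; ring.
  by rewrite !E; apply: gf; rewrite mulr_ge0.
Qed.

(** A step is a convex combination, so its constant is [(1 - h) + h * \sum W = 1 + h * (\sum W -
    1)], where [\sum W - 1] stands for [Q(delta)]. *)
Lemma good_eul (Z : R) n (nu nu' : probability R R) (f : R -> R) : 0 <= Z -> bdm f -> good delta Z nu nu' f ->
  0 <= \sum_(i <- s) W i ->
  good delta ((1 + h * (\sum_(i <- s) W i - 1)) ^+ n * Z) (eul n nu) (eul n nu') f.
Proof.
move=> Z0 bf gf W0; have /andP[h0 h1] := h01.
elim: n => [|n IH]; first by rewrite expr0 mul1r.
set k := 1 + h * _ in IH *.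
have k0 : 0 <= k.
  have := mulr_ge0 h0 W0; rewrite /k; lra.
have Zn : 0 <= k ^+ n * Z by rewrite mulr_ge0// exprn_ge0.
have gs := good_sm Zn bf IH.
move=> a b a0; have ba := bdm_affine a b bf.
rewrite /= !int_mixp//.
have := IH a b a0; have := gs a b a0.
move: (\int[eul n nu]_v _) (\int[eul n nu']_v _) (\int[S _]_v _) (\int[S _]_v _) => u u' v' v.
move=> hs hu.
have -> : (1 - h) * u + h * v - ((1 - h) * u' + h * v') = (1 - h) * (u - u') + h * (v - v') by ring.
rewrite (le_trans (ler_normD _ _))// !normrM (ger0_norm h0) ger0_norm ?subr_ge0//.
apply: (le_trans (lerD (ler_wpM2l _ hu) (ler_wpM2l h0 hs))); first by rewrite subr_ge0.
by rewrite le_eqVlt; apply/orP; left; apply/eqP; rewrite exprS /k; ring.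
Qed.

End step.

Section flow.
Variables (kappa : R -> probability R R) (K : R).
(* Local error [O(h^2)] of one Euler step, uniformly in the frequency and the phase. *)
Definition consistent := 0 <= K /\ forall t h xi th, 0 <= t -> 0 <= h <= 1 ->
  `|ccos (kappa (t + h)) xi th - ((1 - h) * ccos (kappa t) xi th + h * ccos (S (kappa t)) xi th)| <= K * h ^+ 2.
Hypothesis cons : consistent.

(** Discrete Gronwall inequality: the [n] local errors [K h^2] are each amplified by at most
    [1 + h * size s] per step, because the smoothing transform multiplies [cosnear] errors by at
    most [size s]. *)
Lemma eul_flow (h : R) (h01 : 0 <= h <= 1) (n : nat) :
  cosnear (eul h01 n (kappa 0)) (kappa (n%:R * h)) (n%:R * (K * h ^+ 2) * (1 + h * (size s)%:R) ^+ n).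
Proof.
have [K0 ck] := cons; have /andP[h0 h1] := h01.
set N := (size s)%:R; have N0 : 0 <= N by [].
elim: n => [|n IH]; first by move=> xi th; rewrite !mul0r/= subrr normr0.
set e := n%:R * _ * _ in IH.
have e0 : 0 <= e by rewrite /e; nneg.
have sn := cosnear_sm IH.
move=> xi th.
have -> : n.+1%:R * h = n%:R * h + h by rewrite -natr1 mulrDl mul1r.
have := ck (n%:R * h) h xi th (mulr_ge0 (ler0n _ _) h0) h01.
have := IH xi th; have := sn xi th.
have -> : ccos (eul h01 n.+1 (kappa 0)) xi th = (1 - h) * ccos (eul h01 n (kappa 0)) xi th + h * ccos (S (eul h01 n (kappa 0))) xi th.
  by rewrite /ccos/= int_mixp//; exact: bdm_cos_affine.
move: (ccos _ _ _) (ccos _ _ _) (ccos _ _ _) (ccos _ _ _) (ccos _ _ _) => v v' u u' w.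
move=> hv hu hw.
have -> : (1 - h) * u + h * w - v = (1 - h) * (u - v') + h * (w - u') - (v - ((1 - h) * v' + h * u')) by ring.
rewrite (le_trans (ler_normB _ _))//.
apply: (@le_trans _ _ ((1 - h) * e + h * (N * e) + K * h ^+ 2)).
  rewrite lerD// (le_trans (ler_normD _ _))// !normrM (ger0_norm h0) ger0_norm ?subr_ge0//.
  by rewrite lerD// ler_wpM2l// subr_ge0.
set q := 1 + h * N.
have q1 : 1 <= q by rewrite /q lerDl mulr_ge0.
have q0 : 0 <= q by exact: le_trans q1.
apply: (@le_trans _ _ (q * e + K * h ^+ 2)).
  have := mulr_ge0 h0 e0; rewrite /q; lra.
have -> : n.+1%:R * (K * h ^+ 2) * q ^+ n.+1 = q * e + K * h ^+ 2 * q ^+ n.+1.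
  by rewrite /e -/q [q ^+ n.+1]exprS -natr1; ring.
rewrite lerD2l -[leLHS]mulr1 ler_wpM2l//; first by nneg.
by rewrite exprn_ege1.
Qed.

Lemma expR_exprn (x : R) n : 0 <= 1 + x -> (1 + x) ^+ n <= expR (n%:R * x).
Proof. by move=> x0; rewrite expRM_natl lerXn2r ?nnegrE ?expR_ge0// expR_ge1Dx. Qed.

Lemma eul_flow_near (t eta : R) : 0 <= t -> 0 < eta -> exists n0 : nat, forall n (h01 : 0 <= t / n.+1%:R <= 1),
  (n0 <= n)%N -> cosnear (eul h01 n.+1 (kappa 0)) (kappa t) eta.
Proof.
move=> t0 eta0; have [K0 _] := cons.
set N := (size s)%:R : R; have N0 : 0 <= N by [].
pose M := K * t ^+ 2 * expR (t * N).
have M0 : 0 <= M by rewrite /M; nneg; exact: expR_ge0.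
exists (Num.bound (M / eta)) => n h01 nn xi th.
have nb : M / eta <= n.+1%:R.
  by rewrite (le_trans (ltW (archi_boundP _)))//; [nneg|rewrite ler_nat leqW].
have np : 0 < n.+1%:R :> R by rewrite ltr0n.
have p0 : 0 <= 1 + t / n.+1%:R * N by nneg.
have pe : (1 + t / n.+1%:R * N) ^+ n.+1 <= expR (t * N).
  by apply: (le_trans (expR_exprn n.+1 p0)); rewrite mulrA [n.+1%:R * _]mulrC divfK// gt_eqF.
have := eul_flow h01 n.+1 xi th; rewrite -/N.
move: (n.+1%:R : R) (h01) nb np p0 pe => k h01' nb np p0 pe.
have -> : k * (t / k) = t by rewrite mulrC divfK// gt_eqF.
move=> h; apply: (le_trans h).
apply: (@le_trans _ _ (k * (K * (t / k) ^+ 2) * expR (t * N))).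
  by apply: ler_wpM2l => //; nneg.
have -> : k * (K * (t / k) ^+ 2) * expR (t * N) = M / k.
  by rewrite /M; field; rewrite gt_eqF.
by rewrite ler_pdivrMr// mulrC -ler_pdivrMr.
Qed.

(** The factor [(1 - h)^n] of [eul_ge] is compared with [exp (-2 n h)], using [1 - h >= exp (-2 h)]
    for [h <= 1 / 2]. The constant 2 is crude, but any positive factor allows integrability to be
    carried back to time 0. *)
Lemma flow_lower (t : R) (f : R -> R) (F : R) : 0 <= t -> measurable_fun setT f -> (forall z, 0 <= f z <= F) ->
  (\int[@lebesgue_measure R]_y (f y)%:E < +oo)%E ->
  (forall e : R, 0 < e -> exists2 d : R, 0 < d & forall z w, `|z - w| <= d -> `|f z - f w| <= e) ->
  expR (- 2 * t) * \int[kappa 0]_x f x <= \int[kappa t]_x f x.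
Proof.
move=> t0 mf f0F f1 unif.
have f0 z : 0 <= f z by case/andP: (f0F z).
have fF z : `|f z| <= F by rewrite ger0_norm//; case/andP: (f0F z).
have bf : bdm f by split => //; exists F.
have f1' : (\int[@lebesgue_measure R]_y `|f y|%:E < +oo)%E.
  by apply: le_lt_trans f1; under eq_integral do rewrite ger0_norm//.
apply/ler_addgt0Pr => eps eps0; have e2 : 0 < eps / 2 by rewrite divr_gt0.
have [C C0 hC] := cosnear_intE mf fF f1' unif e2.
have eta0 : 0 < eps / 2 / (C + 1) by rewrite divr_gt0// ltr_wpDl.
have [n0 hn] := eul_flow_near t0 eta0.
pose n := maxn n0 (Num.bound (2 * t)).
have nb : 2 * t <= n.+1%:R.
  rewrite (le_trans (ltW (archi_boundP _)))//; last by rewrite ler_nat leqW// leq_maxr.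
  by nneg.
have np : 0 < n.+1%:R :> R by rewrite ltr0n.
have h2 : t / n.+1%:R <= 1 / 2 by rewrite ler_pdivrMr//; lra.
have h0 : 0 <= t / n.+1%:R by nneg.
have h01 : 0 <= t / n.+1%:R <= 1 by rewrite h0 (le_trans h2)//; lra.
have := hC _ _ _ (hn n h01 (leq_maxl _ _)).
have low : expR (- 2 * t) * \int[kappa 0]_x f x <= \int[eul h01 n.+1 (kappa 0)]_x f x.
  apply: le_trans (eul_ge h01 n.+1 (kappa 0) bf f0); rewrite ler_wpM2r//.
    by apply: Rintegral_ge0.
  set h := t / _ in h0 h2 *.
  have -> : - 2 * t = n.+1%:R * (- (2 * h)) by rewrite /h; field; rewrite gt_eqF.
  rewrite expRM_natl lerXn2r ?nnegrE ?expR_ge0 ?subr_ge0//; first by lra.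
  rewrite expRN -[leRHS]invrK lef_pV2 ?posrE ?expR_gt0 ?invr_gt0; last by lra.
  apply: le_trans (expR_ge1Dx _); rewrite -[leLHS]mul1r ler_pdivrMr; first nra.
    by lra.
  by [].
rewrite ler_norml => /andP[_ h].
have cC : C * (eps / 2 / (C + 1)) <= eps / 2.
  by rewrite mul_div_succ_le// ltW.
lra.
Qed.

End flow.

Section two_flows.
Variables (kappa kappa' : R -> probability R R) (K K' : R).
Hypotheses (cons : consistent kappa K) (cons' : consistent kappa' K').
Variables (delta : R) (W : I -> R).
Hypothesis hW : forall i, (\int[P]_x (A i x `^ delta)%:E = (W i)%:E)%E.

(** With a common step size both flows are close to their Euler schemes, to which [good_eul]
    applies; then [(1 + x)^n <= exp (n x)]. *)
Lemma flow_contract (t Z : R) (f : R -> R) (F : R) : 0 <= t -> 0 <= Z -> measurable_fun setT f -> (forall z, `|f z| <= F) ->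
  (\int[@lebesgue_measure R]_y `|f y|%:E < +oo)%E ->
  (forall e : R, 0 < e -> exists2 d : R, 0 < d & forall z w, `|z - w| <= d -> `|f z - f w| <= e) ->
  good delta Z (kappa 0) (kappa' 0) f ->
  `|\int[kappa t]_x f x - \int[kappa' t]_x f x| <= expR (t * (\sum_(i <- s) W i - 1)) * Z.
Proof.
move=> t0 Z0 mf fF f1 unif gf.
have bf : bdm f by split => //; exists F.
have W0 i : 0 <= W i.
  by rewrite -lee_fin -hW integral_ge0// => x _; rewrite lee_fin powR_ge0.
have SW0 : 0 <= \sum_(i <- s) W i by rewrite sumr_ge0.
apply/ler_addgt0Pr => eps eps0; have e2 : 0 < eps / 4 by rewrite divr_gt0.
have [C C0 hC] := cosnear_intE mf fF f1 unif e2.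
have eta0 : 0 < eps / 4 / (C + 1) by rewrite divr_gt0// ltr_wpDl.
have [n0 hn] := eul_flow_near cons t0 eta0.
have [n1 hn1] := eul_flow_near cons' t0 eta0.
pose n := maxn (maxn n0 n1) (Num.bound t).
have nb : t <= n.+1%:R.
  by rewrite (le_trans (ltW (archi_boundP _)))//; last by rewrite ler_nat leqW// leq_maxr.
have np : 0 < n.+1%:R :> R by rewrite ltr0n.
have h0 : 0 <= t / n.+1%:R by nneg.
have h01 : 0 <= t / n.+1%:R <= 1 by rewrite h0 ler_pdivrMr// mul1r.
have nn0 : (n0 <= n)%N by rewrite !leq_max leqnn.
have nn1 : (n1 <= n)%N by rewrite !leq_max leqnn orbT.
have := hC _ _ _ (hn n h01 nn0).
have := hC _ _ _ (hn1 n h01 nn1).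
have := good_eul h01 hW n.+1 Z0 bf gf SW0 0 ler01.
rewrite powR1 mul1r.
have E (m : probability R R) : \int[m]_v f (0 + 1 * v) = \int[m]_v f v.
  by apply: eq_Rintegral => v _; rewrite add0r mul1r.
rewrite !E.
set x := t / n.+1%:R * _.
have x0 : 0 <= 1 + x.
  have /andP[_ h1] := h01; have := mulr_ge0 h0 SW0; rewrite /x.
  move: (t / n.+1%:R) h1 => g h1; move: (\sum_(i <- s) W i) => w; lra.
have kx : (1 + x) ^+ n.+1 * Z <= expR (t * (\sum_(i <- s) W i - 1)) * Z.
  rewrite ler_wpM2r// (le_trans (expR_exprn _ x0))// /x mulrA [n.+1%:R * _]mulrC divfK// gt_eqF//.
have cC : C * (eps / 4 / (C + 1)) <= eps / 4.
  by rewrite mul_div_succ_le// ltW.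
move: (\int[_]_v f v) (\int[_]_v f v) (\int[_]_v f v) (\int[_]_v f v) kx cC => a b c e.
move: ((1 + x) ^+ n.+1 * Z) (C * _) (expR _ * Z) => X Y Q kx cC.
by rewrite !ler_norml => /andP[? ?] /andP[? ?] /andP[? ?]; apply/andP; split; lra.
Qed.

End two_flows.

End euler.

(** * The two flows *)

Section uniform_split.
Context (R : realType).
Local Notation leb := (@lebesgue_measure R).
Local Notation U01 := (@U01 R).

Lemma U01_leb (G : R -> \bar R) : measurable_fun setT G -> (forall x, 0 <= G x)%E ->
  (\int[U01]_x G x = \int[leb]_x (G x * (\1_`[0%R, 1%R] x)%:E))%E.
Proof.
move=> mG G0; rewrite ge0_int_U01// integral_mkcond; apply: eq_integral => x _.
rewrite patchE indicE; case: ifPn => _; first by rewrite mule1.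
by rewrite mule0.
Qed.

Lemma ge0_U01_affine (a b : R) (G : R -> \bar R) : 0 < a -> measurable_fun setT G -> (forall x, 0 <= G x)%E ->
  (\int[U01]_x G (a * x + b)%R = a^-1%:E * \int[leb]_x (G x * (\1_`[b, (a + b)%R] x)%:E))%E.
Proof.
move=> a0 mG G0.
have mG1 : measurable_fun setT (fun x => G x * (\1_`[b, (a + b)%R] x)%:E)%E.
  by apply: emeasurable_funM => //; apply/measurable_EFinP; exact: measurable_indic.
rewrite U01_leb//; last first.
  by apply: (measurableT_comp mG); apply: measurable_funD => //; exact: mulrl_measurable.
rewrite (ge0_int_lebesgue_affine b a0 mG1); last by move=> x; rewrite mule_ge0// lee_fin.
rewrite muleA -EFinM mulVf ?gt_eqF// mul1e; apply: eq_integral => x _; congr (_ * _%:E)%E.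
rewrite !indicE !mem_setE/= !in_itv/= lerDr lerD2r.
by rewrite pmulr_rge0// -{2}[a]mulr1 ler_pM2l.
Qed.

(** A uniform variable on [[0, c]] is, with probability [c^-1], uniform on [[0, 1]], and otherwise
    uniform on [[1, c]]. *)
Lemma U01_split (c : R) (G : R -> R) : 1 <= c -> bdm G ->
  \int[U01]_x G (c * x) = c^-1 * \int[U01]_x G x + (1 - c^-1) * \int[U01]_x G (1 + (c - 1) * x).
Proof.
move=> c1 bG; have c0 : 0 < c by exact: lt_le_trans c1.
move: c1; rewrite le_eqVlt => /predU1P[<-|c1].
  by rewrite invr1 mul1r subrr mul0r addr0; apply: eq_Rintegral => x _; rewrite mul1r.
have [mG [M GM]] := bG.
have bGM : bdm (fun x => G x + M) by apply: bdmD => //; exact: bdm_cst.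
have cm : 0 < c - 1 by rewrite subr_gt0.
pose H x := ((G x + M)%:E : \bar R).
have mH : measurable_fun setT H by apply/measurable_EFinP; case: bGM.
have H0 x : (0 <= H x)%E by rewrite lee_fin; have := GM x; rewrite ler_norml => /andP[]; lra.
have mI (i : interval R) : measurable_fun setT (fun x => H x * (\1_[set` i] x)%:E)%E.
  by apply: emeasurable_funM => //; apply/measurable_EFinP; exact: measurable_indic.
have I0 (i : interval R) x : (0 <= H x * (\1_[set` i] x)%:E)%E by rewrite mule_ge0// lee_fin.
have key : (\int[U01]_x H (c * x)%R = c^-1%:E * \int[U01]_x H x + (1 - c^-1)%:E * \int[U01]_x H (1 + (c - 1) * x)%R)%E.
  transitivity (\int[U01]_x H (c * x + 0)%R)%E; first by apply: eq_integral => x _; rewrite addr0.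
  rewrite ge0_U01_affine// addr0.
  transitivity (c^-1%:E * (\int[leb]_x (H x * (\1_`[0%R, 1%R] x)%:E) + \int[leb]_x (H x * (\1_`[1%R, c] x)%:E)))%E.
    congr (_ * _)%E.
    transitivity (\int[leb]_x (H x * (\1_`[0%R, 1%R] x)%:E + H x * (\1_`[1%R, c] x)%:E))%E; last first.
      by rewrite ge0_integralD//; exact: mI.
    apply: ae_eq_integral => //; [exact: mI|by apply: emeasurable_funD; exact: mI|].
    exists [set 1]; split => //; first exact: lebesgue_measure_set1.
    move=> x /=; apply: contra_notP => /eqP x1 _.
    rewrite -ge0_muleDr ?lee_fin//; congr (_ * _)%E; rewrite -EFinD; congr EFin.
    rewrite !indicE !mem_setE/= !in_itv/=.
    case: (leP 0 x) => x0; case: (leP x c) => xc; case: (leP x 1) => xl; case: (leP 1 x) => xg //=; rewrite ?addr0 ?add0r//; lra.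
  rewrite ge0_muleDr ?integral_ge0//; congr (_ + _)%E; first by rewrite U01_leb.
  transitivity ((1 - c^-1)%:E * \int[U01]_x H ((c - 1) * x + 1)%R)%E; last first.
    by congr (_ * _)%E; apply: eq_integral => x _; rewrite addrC.
  rewrite ge0_U01_affine// subrK muleA -EFinM; congr (_%:E * _)%E.
  by field; rewrite !gt_eqF.
have baff (a b : R) : bdm (fun x => G (b + a * x)) by exact: bdm_affine.
have b1 : bdm (fun x => G (c * x)) by under eq_fun do rewrite -[c * _]add0r.
move: key; rewrite /H !bdm_EFin//; try by apply: bdmD => //; exact: bdm_cst.
rewrite -!EFinM -EFinD => -[].
rewrite !bdm_RintD ?Rint_cst//; try exact: bdm_cst.
by lra.
Qed.

End uniform_split.

(** * The Euler scheme approximates the solution of the Cauchy problem *)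

Section ode_flow.
Context (R : realType).
Context d (T : measurableType d) (P : probability T R) (N : nat).
Variables (A : 'I_N -> T -> R) (mA : forall i, measurable_fun setT (A i)) (A0 : forall i x, 0 <= A i x).
Local Notation s := (index_enum 'I_N).
Local Notation S nu := (sm P mA nu s).

Lemma ccos_le1 (nu : probability R R) xi th : `|ccos nu xi th| <= 1.
Proof. by apply: bdm_norm_le => [|x]; [exact: bdm_cos_affine|exact: cos_max]. Qed.

Variables (mu0 : probability R R) (nu : R -> probability R R).
Hypotheses (Hinit : charfun (nu 0) = charfun mu0)
  (Hcont : forall xi,
      (complex.Re (charfun (nu t) xi) @[t --> 0^'+] --> complex.Re (charfun mu0 xi)) /\
      (complex.Im (charfun (nu t) xi) @[t --> 0^'+] --> complex.Im (charfun mu0 xi)))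
  (Hode : forall xi t, 0 < t ->
      let rhs := - charfun (nu t) xi
                 + cexpect P (fun x => \prod_(i < N) charfun (nu t) (A i x * xi)) in
      is_derive t 1 (fun s => complex.Re (charfun (nu s) xi)) (complex.Re rhs) /\
      is_derive t 1 (fun s => complex.Im (charfun (nu s) xi)) (complex.Im rhs)).

Let D t xi th := ccos (S (nu t)) xi th - ccos (nu t) xi th.

Lemma ode_ccos (xi th t : R) : 0 < t -> is_derive t 1 (fun u => ccos (nu u) xi th) (D t xi th).
Proof.
move=> t0; have [] := Hode xi t0; rewrite -(charfun_sm P mA) => d1 d2.
rewrite (_ : (fun u => ccos (nu u) xi th) = (fun u => cos th * complex.Re (charfun (nu u) xi) - sin th * complex.Im (charfun (nu u) xi))); last first.
  by apply/funext => u; rewrite charfun_ccos.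
apply: is_derive_eq; rewrite /D !charfun_ccos /GRing.scale/=.
ring.
Qed.

Lemma ode_right (xi th : R) : ccos (nu u) xi th @[u --> 0^'+] --> ccos (nu 0) xi th.
Proof.
rewrite (_ : (fun u => ccos (nu u) xi th) = (fun u => cos th * complex.Re (charfun (nu u) xi) - sin th * complex.Im (charfun (nu u) xi))); last first.
  by apply/funext => u; rewrite charfun_ccos.
rewrite charfun_ccos Hinit; have [h1 h2] := Hcont xi.
by apply: cvgB; apply: cvgM => //; exact: cvg_cst.
Qed.

Lemma ode_within (xi th a b : R) : 0 <= a -> a < b -> {within `[a, b], continuous (fun u => ccos (nu u) xi th)}.
Proof.
move=> a0 ab; have pt (x : R) : 0 < x -> {for x, continuous (fun u => ccos (nu u) xi th)}.
  by move=> /(ode_ccos xi th) [/derivable1_diffP /differentiable_continuous].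
apply/continuous_within_itvP => //; split.
- by move=> x; rewrite in_itv/= => /andP[ax _]; apply: pt; exact: le_lt_trans ax.
- move: a0; rewrite le_eqVlt => /predU1P[<-|a0]; first exact: ode_right.
  exact/cvg_at_right_filter/pt.
- by apply/cvg_at_left_filter/pt; exact: le_lt_trans ab.
Qed.

Lemma D_le2 (t xi th : R) : `|D t xi th| <= 2.
Proof. by rewrite (le_trans (ler_normB _ _))// -[leRHS]/(1 + 1) lerD// ccos_le1. Qed.

Lemma ode_lip (a b : R) : 0 <= a -> a <= b -> cosnear (nu b) (nu a) (2 * (b - a)).
Proof.
move=> a0 ab xi th; move: ab; rewrite le_eqVlt => /predU1P[<-|ab]; first by rewrite !subrr normr0 mulr0.
have [|c _ ->] := @MVT _ (fun u => ccos (nu u) xi th) (fun u => D u xi th) _ _ ab _ (ode_within a0 ab).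
  by move=> x; rewrite in_itv/= => /andP[ax _]; apply: ode_ccos; exact: le_lt_trans ax.
have ba : 0 <= b - a by rewrite subr_ge0 ltW.
by rewrite normrM (ger0_norm ba) ler_wpM2r// D_le2.
Qed.

(** The mean value theorem is applied to [ccos (nu u) xi th - u * D t xi th], whose derivative at
    [c] is [D c - D t]. By [ode_lip] and [cosnear_sm], [D] is Lipschitz in time with the constant of
    the statement, so no second derivative of the flow occurs. *)
Lemma ode_consistent : consistent P mA s nu (2 * (1 + (size s)%:R)).
Proof.
split; first by nneg.
move=> t h xi th t0 /andP[h0 h1]; move: h0; rewrite le_eqVlt => /predU1P[<-|h0].
  by rewrite addr0 subr0 mul1r mul0r addr0 subrr normr0 expr0n mulr0.
have th' : t < t + h by rewrite ltrDl.
pose g u := ccos (nu u) xi th - u * D t xi th.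
have dg (x : R) : x \in `]t, t + h[ -> is_derive x 1 g (D x xi th - D t xi th).
  rewrite in_itv/= => /andP[tx _]; have := ode_ccos xi th (le_lt_trans t0 tx) => dc.
  by rewrite /g; apply: is_derive_eq; rewrite /GRing.scale/=; ring.
have cg : {within `[t, t + h], continuous g}.
  have := @ode_within xi th _ _ t0 th'.
  move=> /(continuous_within_itvP _ th')[c1 c2 c3]; apply/continuous_within_itvP => //.
  have cu (F : set_system R) (FF : Filter F) (x : R) : F --> x -> u * D t xi th @[u --> F] --> x * D t xi th.
    by move=> Fx; apply: cvgM => //; exact: cvg_cst.
  split.
  - by move=> x xt; apply: cvgB; [exact: c1|exact: cu].
  - by apply: cvgB => //; apply: cu; apply: cvg_at_right_filter; exact: cvg_id.
  - by apply: cvgB => //; apply: cu; apply: cvg_at_left_filter; exact: cvg_id.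
have [c] := MVT th' dg cg; rewrite in_itv/= => /andP[tc ch].
have hE : t + h - t = h by ring.
rewrite hE /g => E.
have -> : ccos (nu (t + h)) xi th - ((1 - h) * ccos (nu t) xi th + h * ccos (S (nu t)) xi th) =
   (D c xi th - D t xi th) * h.
  by rewrite -E /D; ring.
rewrite normrM (gtr0_norm h0) expr2 mulrA (ler_wpM2r (ltW h0))//.
have ln := ode_lip t0 (ltW tc).
have sn := cosnear_sm P mA A0 s ln.
have cth : c - t <= h by lra.
apply: (@le_trans _ _ (2 * (c - t) + (size s)%:R * (2 * (c - t)))).
  have -> : D c xi th - D t xi th = ccos (S (nu c)) xi th - ccos (S (nu t)) xi th - (ccos (nu c) xi th - ccos (nu t) xi th) by rewrite /D; ring.
  by apply: (le_trans (ler_normB _ _)); rewrite [leRHS]addrC; apply: lerD.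
have N0 : 0 <= (size s)%:R :> R by [].
move: (_%:R) N0 => m m0; have := ler_wpM2l m0 cth; lra.
Qed.

End ode_flow.

(** * The Euler scheme approximates the dilations of the limit law *)

Section self_similar_flow.
Context (R : realType) (I : Type).
Context d (T : measurableType d) (P : probability T R).
Variables (A : I -> T -> R) (mA : forall i, measurable_fun setT (A i)) (A0 : forall i x, 0 <= A i x).
Variable s : seq I.
Local Notation S nu := (sm P mA nu s).
Local Notation U01 := (@U01 R).

Definition fixpt (mu : R) (nu : probability R R) : Prop :=
  forall f : R -> R, bdm f -> \int[nu]_v f v = \int[U01]_tau \int[S nu]_w f (tau `^ mu * w).

Definition dilate (a : R) (nu : probability R R) : probability R R := law nu (mulrl_measurable a).

Lemma int_dilate a nu (f : R -> R) : bdm f -> \int[dilate a nu]_v f v = \int[nu]_v f (a * v).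
Proof. by move=> bf; rewrite bdm_law. Qed.

Lemma ccos_dilate a nu xi th : ccos (dilate a nu) xi th = ccos nu (a * xi) th.
Proof.
rewrite /ccos int_dilate; last exact: bdm_cos_affine.
by apply: eq_Rintegral => v _; congr cos; ring.
Qed.

Lemma ccos_sm_dilate a nu xi th : ccos (S (dilate a nu)) xi th = ccos (S nu) (a * xi) th.
Proof.
rewrite /ccos (@sm_scale _ _ _ _ P A mA nu (dilate a nu) a s); last 2 first.
- by move=> g bg; rewrite int_dilate.
- exact: bdm_cos_affine.
by apply: eq_Rintegral => v _; congr cos; ring.
Qed.

Variables (mu : R) (nu : probability R R).
Hypothesis fp : fixpt mu nu.

Definition ssflow (t : R) := dilate (expR (mu * t)) nu.

Lemma bdm_powR_int (xi th : R) : bdm (fun u : R => ccos (S nu) (u `^ mu * xi) th).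
Proof.
have bH : bdm (fun z : R * R => cos (z.1 `^ mu * xi * z.2 + th)).
  apply: bdm_cos; apply: measurable_funD => //; apply: measurable_funM => //.
  apply: measurable_funM => //; apply: (measurableT_comp (measurable_powR mu)); exact: measurable_fst.
exact: (bdm_fubini_F nu (S nu) bH).
Qed.

Lemma fp_ccos (xi th : R) : ccos nu xi th = \int[U01]_tau ccos (S nu) (tau `^ mu * xi) th.
Proof.
rewrite /ccos fp; last exact: bdm_cos_affine.
by apply: eq_Rintegral => tau _; apply: eq_Rintegral => w _; congr cos; ring.
Qed.

Lemma int_U01_itv (f g : R -> R) : bdm f -> bdm g -> (forall x, 0 <= x <= 1 -> f x = g x) ->
  \int[U01]_x f x = \int[U01]_x g x.
Proof.
move=> bf bg fg; have [mf [M fM]] := bf; have [mg [K gK]] := bg.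
have b1 : bdm (fun x => f x + (M + K)) by apply: bdmD => //; exact: bdm_cst.
have b2 : bdm (fun x => g x + (M + K)) by apply: bdmD => //; exact: bdm_cst.
apply: (addIr (M + K)).
have E (h : R -> R) : bdm h -> \int[U01]_x h x + (M + K) = \int[U01]_x (h x + (M + K)).
  by move=> bh; rewrite bdm_RintD ?Rint_cst//; exact: bdm_cst.
rewrite !E//; apply: EFin_inj; rewrite -!bdm_EFin// !ge0_int_U01//.
- apply: eq_integral => x; by rewrite inE/= in_itv/= => x01; rewrite fg.
- by apply/measurable_EFinP; case: b2.
- move=> x; rewrite lee_fin; have := fM x; have := gK x; rewrite !ler_norml => /andP[? ?] /andP[? ?]; lra.
- by apply/measurable_EFinP; case: b1.
- move=> x; rewrite lee_fin; have := fM x; have := gK x; rewrite !ler_norml => /andP[? ?] /andP[? ?]; lra.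
Qed.

(** Absorbed into [tau^mu], the factor [expR (mu * h)] makes [tau] uniform on [[0, e^h]]. Cut at 1,
    the first piece reproduces [nu]; the second has weight [1 - e^(-h)] and [tau] close to 1, hence
    is nearly one smoothing step. *)
Lemma fp_split (h xi th : R) : 0 <= h ->
  ccos nu (expR (mu * h) * xi) th = expR (- h) * ccos nu xi th +
   (1 - expR (- h)) * \int[U01]_tau ccos (S nu) ((1 + (expR h - 1) * tau) `^ mu * xi) th.
Proof.
move=> h0; have bG := bdm_powR_int xi th.
have e1 : 1 <= expR h by rewrite -[leLHS](@expR0 R) ler_expR.
pose G u := ccos (S nu) (u `^ mu * xi) th.
have U : \int[U01]_x G (expR h * x) = (expR h)^-1 * ccos nu xi th + (1 - (expR h)^-1) * \int[U01]_x G (1 + (expR h - 1) * x).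
  by rewrite (fp_ccos xi th); exact: U01_split.
rewrite expRN; transitivity (\int[U01]_x G (expR h * x)); last exact: U.
rewrite fp_ccos; apply: int_U01_itv.
- exact: bdm_powR_int.
- by apply: (bdm_comp bG); exact: mulrl_measurable.
move=> x /andP[x0 _].
have eh : expR h `^ mu = expR (mu * h) by rewrite /powR (gt_eqF (expR_gt0 h)) expRK.
rewrite /G; have -> // : (expR h * x) `^ mu * xi = x `^ mu * (expR (mu * h) * xi).
by rewrite powRM ?expR_ge0// eh; ring.
Qed.

Lemma ssflow0 (f : R -> R) : bdm f -> \int[ssflow 0]_v f v = \int[nu]_v f v.
Proof. by move=> bf; rewrite int_dilate//; apply: eq_Rintegral => v _; rewrite mulr0 expR0 mul1r. Qed.

Lemma expRN_le (h : R) : 0 <= h -> 0 <= expR (- h) - (1 - h) <= h ^+ 2 /\ 0 <= 1 - expR (- h) <= h.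
Proof.
move=> h0; have e1 := expR_ge1Dx (- h); have e2 := expR_ge1Dx h.
have e0 := expR_gt0 h; have ei : expR (- h) <= (1 + h)^-1.
  by rewrite expRN lef_pV2 ?posrE//; lra.
have hi : (1 + h)^-1 <= 1 - h + h ^+ 2.
  rewrite -[leLHS]mul1r ler_pdivrMr; last by lra.
  have := mulr_ge0 h0 (sqr_ge0 h); nra.
have : expR (- h) <= 1 by rewrite -[leRHS](@expR0 R) ler_expR; lra.
by move=> ?; split; apply/andP; split; lra.
Qed.

Lemma fp_lip (h : R) : 0 <= h -> cosnear (dilate (expR (mu * h)) nu) nu (2 * h).
Proof.
move=> h0 xi th; rewrite ccos_dilate fp_split//.
set B := \int[U01]_tau _.
have B1 : `|B| <= 1.
  apply: bdm_norm_le => [|x]; last exact: ccos_le1.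
  apply: (bdm_comp (bdm_powR_int xi th)); apply: measurable_funD => //; exact: mulrl_measurable.
have [_ /andP[p0 ph]] := expRN_le h0.
have -> : expR (- h) * ccos nu xi th + (1 - expR (- h)) * B - ccos nu xi th = (1 - expR (- h)) * (B - ccos nu xi th) by ring.
rewrite normrM (ger0_norm p0) mulrC ler_pM//.
by rewrite (le_trans (ler_normB _ _))// -[leRHS]/(1 + 1) lerD// ccos_le1.
Qed.

Lemma ssflow_consistent : consistent P mA s ssflow (2 * (1 + (size s)%:R)).
Proof.
split; first by nneg.
move=> t h xi0 th t0 /andP[h0 h1].
rewrite /ssflow !ccos_dilate ccos_sm_dilate.
set xi := expR (mu * t) * xi0.
have -> : expR (mu * (t + h)) * xi0 = expR (mu * h) * xi by rewrite mulrDr expRD /xi; ring.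
rewrite fp_split//.
set B := \int[U01]_tau _; set c := ccos nu xi th; set g := ccos (S nu) xi th.
have bB : bdm (fun tau => ccos (S nu) ((1 + (expR h - 1) * tau) `^ mu * xi) th).
  apply: (bdm_comp (bdm_powR_int xi th)); apply: measurable_funD => //; exact: mulrl_measurable.
have Bg : `|B - g| <= (size s)%:R * (2 * h).
  (* [U01] sees only [[0, 1]]; clipping makes the estimate below valid for every real [tau], as the
     bound on the integral asks. *)
  pose clip tau : R := Num.min 1 (Num.max 0 tau).
  have mclip : measurable_fun setT clip by apply: measurable_minr => //; exact: measurable_maxr.
  have clip01 tau : 0 <= clip tau <= 1.
    by rewrite /clip le_min ler01 le_max lexx ge_min lexx.
  have bBc : bdm (fun tau => ccos (S nu) ((1 + (expR h - 1) * clip tau) `^ mu * xi) th).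
    exact: (bdm_comp bB mclip).
  have -> : B = \int[U01]_tau ccos (S nu) ((1 + (expR h - 1) * clip tau) `^ mu * xi) th.
    apply: (int_U01_itv bB bBc) => x /andP[x0 x1].
    have -> // : clip x = x by rewrite /clip (max_r x0) (min_r x1).
  rewrite -(Rint_cst U01 g) -bdm_RintB//; last exact: bdm_cst.
  apply: bdm_norm_le => [|tau]; first by apply: bdmB => //; exact: bdm_cst.
  have /andP[c0 c1] := clip01 tau.
  set v := 1 + (expR h - 1) * clip tau.
  have e1 : 0 <= expR h - 1 by have := expR_ge1Dx h; lra.
  have v1 : 1 <= v by rewrite /v lerDl mulr_ge0.
  have ve : v <= expR h by rewrite /v; have := ler_wpM2l e1 c1; lra.
  have v0 : 0 < v by exact: lt_le_trans v1.
  have lv0 : 0 <= ln v by exact: ln_ge0.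
  have lvh : ln v <= h by rewrite -[leRHS](@expRK R) ler_ln ?posrE// expR_gt0.
  (* [v^mu = expR (mu * ln v)] is a dilation of the flow over the time [ln v <= h], to which
     [fp_lip] applies. *)
  rewrite {1}/powR (gt_eqF v0) -ccos_sm_dilate.
  apply: (le_trans (cosnear_sm P mA A0 s (fp_lip lv0) xi th)).
  by rewrite ler_wpM2l// ler_wpM2l.
have c1 : `|c| <= 1 by exact: ccos_le1.
have g1 : `|g| <= 1 by exact: ccos_le1.
have [/andP[a0 ah] /andP[p0 ph]] := expRN_le h0.
have -> : expR (- h) * c + (1 - expR (- h)) * B - ((1 - h) * c + h * g) =
  (expR (- h) - (1 - h)) * (c - g) + (1 - expR (- h)) * (B - g) by ring.
rewrite (le_trans (ler_normD _ _))// !normrM (ger0_norm a0) (ger0_norm p0).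
have cg : `|c - g| <= 2 by rewrite (le_trans (ler_normB _ _))// -[leRHS]/(1 + 1) lerD.
have := ler_pM a0 (normr_ge0 _) ah cg.
have := ler_pM p0 (normr_ge0 _) ph Bg.
lra.
Qed.

End self_similar_flow.

(** * Truncation of Zolotarev test functions *)

Section symbols.
Context (R : realType).
Implicit Types (x y z r c k a al e K : R) (u v f : R -> R).

(* Powers of the Japanese bracket. *)
Definition jap r x := (1 + `|x|) `^ r.

Lemma jap1_gt0 x : 0 < 1 + `|x|. Proof. by have := normr_ge0 x; lra. Qed.

Lemma jap1_ge1 x : 1 <= 1 + `|x|. Proof. by rewrite lerDl. Qed.

Lemma jap_gt0 r x : 0 < jap r x. Proof. by rewrite powR_gt0// jap1_gt0. Qed.

Lemma jap_ge0 r x : 0 <= jap r x. Proof. exact: powR_ge0. Qed.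

Hint Resolve jap_ge0 jap_gt0 jap1_gt0 jap1_ge1 : core.

Lemma japM r s x : jap r x * jap s x = jap (r + s) x.
Proof. by rewrite /jap powRD// (gt_eqF (jap1_gt0 x)) implybT. Qed.

Lemma jap0 x : jap 0 x = 1. Proof. exact: powRr0. Qed.

Lemma jap1 x : jap 1 x = 1 + `|x|. Proof. by rewrite /jap powRr1// ltW. Qed.

Lemma jap_le r s x : r <= s -> jap r x <= jap s x.
Proof. by move=> rs; rewrite /jap ler_powR. Qed.

Lemma jap_ge1 r x : 0 <= r -> 1 <= jap r x.
Proof. by move=> r0; rewrite -(jap0 x) jap_le. Qed.

Lemma jap_homo r x z : 0 <= r -> `|z| <= `|x| -> jap r z <= jap r x.
Proof. by move=> r0 zx; rewrite /jap ge0_ler_powR ?nnegrE ?(ltW (jap1_gt0 _))// lerD2l. Qed.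

Lemma normr_powR_jap r x : 0 <= r -> `|x| `^ r <= jap r x.
Proof. by move=> r0; rewrite /jap ge0_ler_powR ?nnegrE ?(ltW (jap1_gt0 _))// lerDr. Qed.

Lemma mvt_pt u v x y : (forall z, is_derive z 1 u (v z)) ->
  exists th, 0 <= th <= 1 /\ u x - u y = v (y + th * (x - y)) * (x - y).
Proof.
move=> d.
have cu a b : {within `[a, b], continuous u}.
  by apply: continuous_subspaceT => z; apply/differentiable_continuous/derivable1_diffP; case: (d z).
have [xy|yx|->] := ltgtP x y; last by exists 0; rewrite lexx ler01 !subrr mulr0.
- have [z + E] := MVT xy (fun z _ => d z) (cu _ _); rewrite in_itv/= => /andP[xz zy].
  exists ((y - z) / (y - x)); have yx0 : 0 < y - x by rewrite subr_gt0.
  split; first by apply/andP; split; [rewrite divr_ge0 ?subr_ge0// ltW|rewrite ler_pdivrMr//; lra].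
  have -> : y + (y - z) / (y - x) * (x - y) = z by field; rewrite gt_eqF.
  by rewrite -opprB E -mulrN opprB.
- have [z + E] := MVT yx (fun z _ => d z) (cu _ _); rewrite in_itv/= => /andP[xz zy].
  exists ((z - y) / (x - y)); have yx0 : 0 < x - y by rewrite subr_gt0.
  split; first by apply/andP; split; [rewrite divr_ge0 ?subr_ge0// ltW|rewrite ler_pdivrMr//; lra].
  have -> // : y + (z - y) / (x - y) * (x - y) = z by field; rewrite gt_eqF.
Qed.

(* Symbol class: the [i]-th derivative is [O(<x>^(r - i))] for [i <= j]. *)
Fixpoint Sym (j : nat) r c u : Prop :=
  (forall x, `|u x| <= c * jap r x) /\
  if j is j'.+1 then exists v, (forall x, is_derive x 1 u (v x)) /\ Sym j' (r - 1) c v else True.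

Lemma Sym_bound j r c u : Sym j r c u -> forall x, `|u x| <= c * jap r x.
Proof. by case: j => [|j] []. Qed.

Lemma Sym_c0 j r c u : Sym j r c u -> 0 <= c.
Proof.
move=> /Sym_bound /(_ 0) h; have := le_trans (normr_ge0 _) h.
by rewrite pmulr_lge0.
Qed.

Lemma Sym_down j r c u : Sym j.+1 r c u -> Sym j r c u.
Proof.
elim: j r u => [|j IH] r u; first by case.
move=> [b [v [d s]]]; split => //; exists v; split => //; exact: IH.
Qed.

Lemma Sym_le j r s c k u : r <= s -> c <= k -> Sym j r c u -> Sym j s k u.
Proof.
move=> rs ck; elim: j r s u rs => [|j IH] r s u rs [b t].
  split=> // x; rewrite (le_trans (b x))// ler_pM//; last exact: jap_le.
  have := le_trans (normr_ge0 _) (b x); by rewrite pmulr_lge0.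
split.
  move=> x; rewrite (le_trans (b x))// ler_pM//; last exact: jap_le.
  have := le_trans (normr_ge0 _) (b x); by rewrite pmulr_lge0.
by have [v [d h]] := t; exists v; split => //; apply: (IH (r - 1)) => //; rewrite lerD2r.
Qed.

Lemma SymD j r c k u v : Sym j r c u -> Sym j r k v -> Sym j r (c + k) (fun x => u x + v x).
Proof.
elim: j r u v => [|j IH] r u v [b t] [b' t'].
  by split=> // x; rewrite mulrDl (le_trans (ler_normD _ _))// lerD.
split; first by move=> x; rewrite mulrDl (le_trans (ler_normD _ _))// lerD.
have [p [d h]] := t; have [q [d' h']] := t'; exists (fun x => p x + q x); split; last exact: IH.
by move=> x; apply: is_deriveD.
Qed.

Lemma SymZ j r c k u : Sym j r c u -> Sym j r (`|k| * c) (fun x => k * u x).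
Proof.
elim: j r u => [|j IH] r u [b t].
  by split=> // x; rewrite normrM -mulrA ler_wpM2l.
split; first by move=> x; rewrite normrM -mulrA ler_wpM2l.
have [p [d h]] := t; exists (fun x => k * p x); split; last exact: IH.
by move=> x; apply: is_deriveZ.
Qed.

Lemma SymM j r s c k u v : Sym j r c u -> Sym j s k v -> Sym j (r + s) (2 ^+ j * (c * k)) (fun x => u x * v x).
Proof.
elim: j r s u v => [|j IH] r s u v su sv.
  case: su => b _; case: sv => b' _; split=> // x.
  by rewrite expr0 mul1r normrM -japM mulrACA ler_pM.
have c0 := Sym_c0 su; have k0 := Sym_c0 sv.
have [b [p [d h]]] := su; have [b' [q [d' h']]] := sv; split.
  move=> x; rewrite normrM -japM (le_trans (ler_pM _ _ (b x) (b' x)))// mulrACA.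
  rewrite ler_wpM2r//; first by rewrite mulr_ge0.
  by rewrite ler_peMl ?mulr_ge0// exprn_ege1// ler1n.
exists (fun x => u x * q x + v x * p x); split.
  by move=> x; apply: is_deriveM.
rewrite exprS -mulrA mulr_natl mulr2n; apply: SymD.
  by have := IH _ _ _ _ (Sym_down su) h'; rewrite addrA.
have := IH _ _ _ _ h (Sym_down sv).
by rewrite addrAC (_ : (fun x => v x * p x) = (fun x => p x * v x))//; apply/funext => x; rewrite mulrC.
Qed.

Lemma Sym_ext j r c u v : u =1 v -> Sym j r c u -> Sym j r c v.
Proof. by move=> /funext ->. Qed.

Lemma Sym0 j r : Sym j r 0 (fun _ => 0).
Proof.
elim: j r => [|j IH] r; first by split=> // x; rewrite normr0 mul0r.
by split; [move=> x; rewrite normr0 mul0r|exists (fun _ => 0); split => // x; exact: is_derive_cst].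
Qed.

Lemma Sym_cst j : Sym j 0 1 (fun _ => 1).
Proof.
have b x : `|1 : R| <= 1 * jap 0 x by rewrite jap0 mulr1 normr1.
case: j => [//|j]; split => //; exists (fun _ => 0); split; first by move=> x; exact: is_derive_cst.
by apply: Sym_le (Sym0 _ _) => //.
Qed.

Lemma Sym_id j : Sym j 1 1 id.
Proof.
have b x : `|x| <= 1 * jap 1 x by rewrite jap1 mul1r lerDr.
case: j => [//|j]; split => //; exists (fun _ => 1); split; first by move=> x; exact: is_derive_id.
by rewrite subrr; exact: Sym_cst.
Qed.

Definition sqp1 x := 1 + x ^+ 2.

Lemma sqp1_ge1 x : 1 <= sqp1 x. Proof. by rewrite /sqp1 lerDl sqr_ge0. Qed.

Lemma sqp1_gt0 x : 0 < sqp1 x. Proof. exact: lt_le_trans (sqp1_ge1 x). Qed.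

Lemma is_derive_sqp1 x : is_derive x 1 sqp1 (2 * x).
Proof. by rewrite /sqp1; apply: is_derive_eq; rewrite /GRing.scale/= ?expr1; ring. Qed.

Lemma Sym_inv j : exists c, Sym j (- 2) c (fun x => (sqp1 x)^-1).
Proof.
have b x : `|(sqp1 x)^-1| <= 2 * jap (- 2) x.
  have q0 := sqp1_gt0 x.
  rewrite ger0_norm ?invr_ge0 ?(ltW q0)// /jap powRN -[2 in X in _ `^ X]/(2%:R) powR_mulrn ?(ltW (jap1_gt0 _))//.
  rewrite -[X in X <= _]mul1r ler_pdivrMr// mulrAC ler_pdivlMr ?exprn_gt0//.
  have := real_normK (num_real x); have := sqr_ge0 (1 - `|x|); rewrite /sqp1; nra.
elim: j => [|j [c IH]]; first by exists 2.
have si := Sym_id j.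
have := SymZ (- 2) (SymM (SymM si IH) IH).
set K := `|_| * _ => sK.
have c0 := Sym_c0 sK.
exists (2 + K); split; first by move=> x; rewrite (le_trans (b x))// ler_wpM2r// lerDl.
exists (fun x => - 2 * (x * (sqp1 x)^-1 * (sqp1 x)^-1)); split.
  move=> x; have n0 : sqp1 x != 0 by rewrite gt_eqF// sqp1_gt0.
  have dx := is_derive_sqp1 x.
  apply: (is_derive_eq (is_deriveV n0 dx)); rewrite /GRing.scale/=.
  by field.
by apply: Sym_le sK; lra.
Qed.

Definition lnq x := ln (sqp1 x).

Lemma lnq_ge0 x : 0 <= lnq x. Proof. by rewrite ln_ge0// sqp1_ge1. Qed.

Lemma is_derive_lnq x : is_derive x 1 lnq (2 * x * (sqp1 x)^-1).
Proof.
have := is_derive1_comp (is_derive1_ln (sqp1_gt0 x)) (is_derive_sqp1 x).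
by rewrite mulrC.
Qed.

Lemma Sym_dlnq j : exists c, Sym j (- 1) c (fun x => 2 * x * (sqp1 x)^-1).
Proof.
have [c s] := Sym_inv j; have := SymZ 2 (SymM (Sym_id j) s).
set K := `|_| * _ => sK; exists K.
have e : (1 + - 2 : R) = - 1 by ring.
rewrite e in sK; apply: (@Sym_ext _ _ _ (fun x => 2 * (x * (sqp1 x)^-1))) => // x.
by rewrite mulrA.
Qed.

(** A family of bounded functions closed under differentiation up to linear combinations; every
    derivative of the cutoff is expressed in it. *)
Definition gau (n : nat) y := y ^+ n * expR (- y ^+ 2).

Lemma gau_bounded n : exists c, 0 <= c /\ forall y, `|gau n y| <= c.
Proof.
exists (expR (n%:R ^+ 2)); split; first exact: expR_ge0.
move=> y; rewrite /gau normrM normrX (ger0_norm (expR_ge0 _)).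
have h : `|y| ^+ n <= expR (n%:R * `|y|).
  rewrite expRM_natl lerXn2r ?nnegrE ?expR_ge0//.
  by have := expR_ge1Dx `|y|; lra.
apply: (le_trans (ler_wpM2r (expR_ge0 _) h)); rewrite -expRD ler_expR.
have := real_normK (num_real y); have := sqr_ge0 (n%:R - `|y|).
move: (n%:R) (normr_ge0 y) (ler0n R n) => m; nra.
Qed.

Lemma is_derive_gau n y : is_derive y 1 (gau n) (n%:R * gau n.-1 y - 2 * gau n.+1 y).
Proof.
have d2 : is_derive y 1 (fun y => - y ^+ 2) (- (2 * y)).
  by apply: is_derive_eq; rewrite /GRing.scale/= ?expr1; ring.
have d3 : is_derive y 1 (fun y => expR (- y ^+ 2)) (expR (- y ^+ 2) * - (2 * y)).
  exact: is_derive1_comp.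
have d1 : is_derive y 1 (fun y => y ^+ n) ((n%:R * y ^+ n.-1) *: 1).
  have := @is_deriveX R R id n y 1 1 (is_derive_id _ _).
  by rewrite (_ : id ^+ n = (fun y => y ^+ n))//; apply/funext => z; rewrite exprfctE.
apply: (is_derive_eq (is_deriveM d1 d3)); rewrite /GRing.scale/= /gau !exprS.
by move: (y ^+ n) (y ^+ n.-1) (expR _) => p q e; ring.
Qed.

(** The constant is uniform in [s]: each differentiation produces other members of the family, times
    [s] and the derivative of [ln (1 + x^2)], a symbol of order [-1]. *)
Lemma Sym_gau j n : exists c, forall s, 0 <= s <= 1 -> Sym j 0 c (fun x => gau n (s * lnq x)).
Proof.
elim: j n => [|j IH] n; have [c0 [c00 b]] := gau_bounded n.
  by exists c0 => s s01; split=> // x; rewrite jap0 mulr1.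
have [c1 h1] := IH n.-1; have [c2 h2] := IH n.+1; have [cl hl] := Sym_dlnq j.
have s1 := h1 1; have s2 := h2 1.
pose K := 2 ^+ j * ((n%:R * c1 + 2 * c2) * cl).
have e1 : 0 <= (1 : R) <= 1 by rewrite ler01 lexx.
have c10 := Sym_c0 (s1 e1); have c20 := Sym_c0 (s2 e1); have cl0 := Sym_c0 hl.
have K0 : 0 <= K by rewrite /K; nneg.
exists (c0 + K) => s s01; have /andP[s0 sl1] := s01; split.
  by move=> x; rewrite jap0 mulr1 (le_trans (b _))// lerDl.
exists (fun x => s * ((n%:R * gau n.-1 (s * lnq x) + (- 2) * gau n.+1 (s * lnq x)) * (2 * x * (sqp1 x)^-1))); split.
  move=> x; have dl := is_derive_lnq x.
  have dsl : is_derive x 1 (fun x => s * lnq x) (s * (2 * x * (sqp1 x)^-1)) by exact: is_deriveZ.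
  have D : is_derive x 1 (fun x => gau n (s * lnq x)) _ := @is_derive1_comp R (gau n) (fun x => s * lnq x) x _ _ (is_derive_gau n (s * lnq x)) dsl.
  by apply: (is_derive_eq D); ring.
have := SymZ s (SymM (SymD (SymZ n%:R (h1 _ s01)) (SymZ (- 2) (h2 _ s01))) hl).
apply: Sym_le; first by lra.
rewrite normrN !ger0_norm// -/K.
have : s * K <= K by rewrite ler_piMl.
rewrite /K; lra.
Qed.

(* Slowly varying cutoff: its derivatives gain a factor [s] and its decay beats every power. *)
Definition chi s x := gau 0 (s * lnq x).

Lemma chiE s x : chi s x = expR (- (s * lnq x) ^+ 2).
Proof. by rewrite /chi /gau expr0 mul1r. Qed.

Lemma Sym_chi j : exists c, forall s, 0 <= s <= 1 -> exists v,
  (forall x, is_derive x 1 (chi s) (v x)) /\ Sym j (- 1) (s * c) v.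
Proof.
have [c h] := Sym_gau j 1; have [cl hl] := Sym_dlnq j.
exists (2 * (2 ^+ j * (c * cl))) => s s01; have /andP[s0 s1] := s01.
exists (fun x => (- 2 * s) * (gau 1 (s * lnq x) * (2 * x * (sqp1 x)^-1))); split.
  move=> x; have dl := is_derive_lnq x.
  have dsl : is_derive x 1 (fun x => s * lnq x) (s * (2 * x * (sqp1 x)^-1)) by exact: is_deriveZ.
  have D : is_derive x 1 (fun x => gau 0 (s * lnq x)) _ := @is_derive1_comp R (gau 0) (fun x => s * lnq x) x _ _ (is_derive_gau 0 (s * lnq x)) dsl.
  by apply: (is_derive_eq D); rewrite mul0r; ring.
have := SymZ (- 2 * s) (SymM (h _ s01) hl).
by rewrite normrM normrN !ger0_norm// add0r; apply: Sym_le; rewrite ?lexx//; lra.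
Qed.

Lemma powRDp a r k : 0 < a -> a `^ (r + k) = a `^ r * a `^ k.
Proof. by move=> a0; rewrite powRD// (gt_eqF a0) implybT. Qed.

(* [K] times the Zolotarev class of order [m + al]. *)
Fixpoint Zc (m : nat) al K f : Prop :=
  if m is m'.+1 then exists g, (forall x, is_derive x 1 f (g x)) /\ Zc m' al K g
  else forall x y, `|f x - f y| <= K * `|x - y| `^ al.

Lemma Zc_le m al K e f : K <= e -> Zc m al K f -> Zc m al e f.
Proof.
move=> Ke; elim: m f => [|m IH] f /=.
  by move=> h x y; rewrite (le_trans (h x y))// ler_wpM2r// powR_ge0.
by move=> [g [d h]]; exists g; split => //; exact: IH.
Qed.

Lemma ZcD m al K e f u : Zc m al K f -> Zc m al e u -> Zc m al (K + e) (fun x => f x + u x).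
Proof.
elim: m f u => [|m IH] f u /=.
  move=> h k x y; rewrite mulrDl (_ : f x + u x - (f y + u y) = (f x - f y) + (u x - u y)); last by ring.
  by rewrite (le_trans (ler_normD _ _))// lerD.
move=> [g [d h]] [v [d' h']]; exists (fun x => g x + v x); split; last exact: IH.
by move=> x; apply: is_deriveD.
Qed.

Lemma ZcZ m al K k f : Zc m al K f -> Zc m al (`|k| * K) (fun x => k * f x).
Proof.
elim: m f => [|m IH] f /=.
  by move=> h x y; rewrite -mulrBr normrM -mulrA ler_wpM2l.
move=> [g [d h]]; exists (fun x => k * g x); split; last exact: IH.
by move=> x; apply: is_deriveZ.
Qed.

Lemma Zc_affine m al K a b f : 0 < a -> Zc m al K f -> Zc m al (a `^ (m%:R + al) * K) (fun x => f (b + a * x)).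
Proof.
move=> a0; elim: m f => [|m IH] f /=.
  move=> h x y; rewrite add0r; have := h (b + a * x) (b + a * y).
  rewrite (_ : b + a * x - (b + a * y) = a * (x - y)); last by ring.
  by rewrite normrM (gtr0_norm a0) powRM ?(ltW a0)// [K * _]mulrCA mulrA.
move=> [g [d h]]; exists (fun x => a * g (b + a * x)); split; last first.
  have := ZcZ a (IH _ h); rewrite (gtr0_norm a0) mulrA.
  by rewrite -{1}(powRr1 (ltW a0)) -powRDp// addrA [1 + _]addrC natr1.
move=> x; have dx : is_derive x 1 (fun x => b + a * x) a.
  by apply: is_derive_eq; rewrite /GRing.scale/=; ring.
have D : is_derive x 1 (fun x => f (b + a * x)) _ := @is_derive1_comp R f (fun x => b + a * x) x _ _ (d (b + a * x)) dx.
by apply: (is_derive_eq D); rewrite mulrC.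
Qed.

Lemma Zc_growth m al K f : 0 < al -> 0 <= K -> Zc m al K f -> exists c, Sym m (m%:R + al) c f.
Proof.
move=> al0 K0; elim: m f => [|m IH] f /=.
  move=> h; exists (`|f 0| + K); split=> // x; rewrite add0r.
  have := h x 0; rewrite subr0 => hx.
  have := ler_normD (f x - f 0) (f 0); rewrite subrK => t.
  have j1 := jap_ge1 x (ltW al0); have j2 := normr_powR_jap x (ltW al0).
  have := ler_wpM2l K0 j2; have := ler_wpM2l (normr_ge0 (f 0)) j1; lra.
move=> [g [d h]]; have [c s] := IH _ h; have c0 := Sym_c0 s; exists (`|f 0| + c); split; last first.
  exists g; split => //; rewrite -natr1 addrAC addrK; apply: Sym_le s; rewrite ?lexx//.
  by rewrite lerDr.
move=> x; have [th [/andP[t0 t1] E]] := mvt_pt x 0 d; move: E.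
rewrite !subr0 add0r => E.
have m0 : 0 <= m%:R + al by rewrite addr_ge0// ltW.
have tx : `|th * x| <= `|x| by rewrite normrM (ger0_norm t0) ler_piMl.
have gb := le_trans (Sym_bound s (th * x)) (ler_wpM2l c0 (jap_homo m0 tx)).
have : `|f x - f 0| <= c * jap (m.+1%:R + al) x.
  rewrite E normrM -natr1 addrAC -japM jap1 mulrA ler_pM//.
  by rewrite lerDr.
have := ler_normD (f x - f 0) (f 0); rewrite subrK.
have j1 : 1 <= jap (m.+1%:R + al) x by apply: jap_ge1; rewrite addr_ge0// ltW.
have := ler_wpM2l (normr_ge0 (f 0)) j1; lra.
Qed.

Lemma powR_le_neg r a e : r <= 0 -> 0 < a -> a <= e -> e `^ r <= a `^ r.
Proof.
move=> r0 a0 ae; have e0 := lt_le_trans a0 ae.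
rewrite -(opprK r) !(powRN _ (- r)) lef_pV2 ?posrE ?powR_gt0//.
by rewrite ge0_ler_powR ?nnegrE ?(ltW a0) ?(ltW e0)// oppr_ge0.
Qed.

(** If [|x - y|] is small compared with [1 + |y|], the mean value theorem applies with a derivative
    of nonpositive order [al - 1]. Otherwise [u x] and [u y] are separately [O(|x - y|^al)]. The
    constant 6 covers [2 + 3] from the far case. *)
Lemma Sym_holder al c u : 0 < al <= 1 -> Sym 1 al c u -> forall x y, `|u x - u y| <= 6 * c * `|x - y| `^ al.
Proof.
move=> /andP[al0 al1] s x y; have c0 := Sym_c0 s; have [b [v [d [bv _]]]] := s.
have [->|xy] := eqVneq x y.
  by rewrite !subrr normr0 powR0 ?gt_eqF// mulr0.
have D0 : 0 < `|x - y| by rewrite normr_gt0 subr_eq0.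
set D := `|x - y| in D0 *.
have [near|far] := leP D ((1 + `|y|) / 2).
  have [th [/andP[t0 t1] ->]] := mvt_pt x y d.
  set z := y + _.
  have zy : `|z - y| <= D by rewrite /z addrAC subrr add0r normrM (ger0_norm t0) ler_piMl.
  have zD : D <= 1 + `|z|.
    have := ler_normD z (y - z); rewrite (_ : z + (y - z) = y); last by ring.
    by rewrite (distrC y); lra.
  have : jap (al - 1) z <= D `^ (al - 1) by apply: powR_le_neg => //; rewrite subr_le0.
  move=> jz; rewrite normrM -/D.
  apply: (@le_trans _ _ (c * D `^ (al - 1) * D)).
    by rewrite (ler_wpM2r (ltW D0))// (le_trans (bv z))// ler_wpM2l.
  rewrite -mulrA -{2}(powRr1 (ltW D0)) -powRDp// subrK.
  by rewrite ler_wpM2r ?powR_ge0//; lra.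
have p (k : R) : 1 <= k -> k `^ al <= k by move=> k1; exact: ler1_powR.
have jy : jap al y <= 2 * D `^ al.
  apply: (@le_trans _ _ ((2 * D) `^ al)).
    by rewrite /jap ge0_ler_powR ?nnegrE ?(ltW al0) ?(ltW (jap1_gt0 _))//; lra.
  by rewrite powRM ?(ltW D0)// ler_wpM2r ?powR_ge0// p// ler1n.
have jx : jap al x <= 3 * D `^ al.
  apply: (@le_trans _ _ ((3 * D) `^ al)).
    rewrite /jap ge0_ler_powR ?nnegrE ?(ltW al0) ?(ltW (jap1_gt0 _))//; first by lra.
    by have := ler_normD (x - y) y; rewrite subrK -/D; lra.
  by rewrite powRM ?(ltW D0)// ler_wpM2r ?powR_ge0// p// ler1n.
rewrite (le_trans (ler_normB _ _))//.
have := ler_wpM2l c0 jx; have := ler_wpM2l c0 jy; have := b x; have := b y.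
have : 0 <= c * D `^ al by rewrite mulr_ge0// powR_ge0.
lra.
Qed.

Lemma Sym_Zc m al c u : 0 < al <= 1 -> Sym m.+1 (m%:R + al) c u -> Zc m al (6 * c) u.
Proof.
move=> al01; elim: m u => [|m IH] u s.
  by rewrite add0r in s; apply: Sym_holder.
have [b [v [d h]]] := s; exists v; split => //; apply: IH.
by move: h; rewrite -natr1 addrAC addrK.
Qed.

Lemma ln1_powR al e : 0 < al <= 1 -> 0 <= e -> ln (1 + e) <= (1 + al^-1) * e `^ al.
Proof.
move=> /andP[al0 al1] e0; have p0 := powR_ge0 e al.
have ai : 0 <= al^-1 * e `^ al by rewrite mulr_ge0// invr_ge0 ltW.
have [e1|e1] := leP e 1.
  have : ln (1 + e) <= e by apply: le_ln1Dx; lra.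
  have [->|en0] := eqVneq e 0; first by rewrite addr0 ln1 mulr_ge0// ?powR_ge0// addr_ge0// invr_ge0 ltW.
  have : e <= e `^ al by apply: ger1_powR => //; rewrite e1 lt_neqAle eq_sym en0 e0.
  lra.
have h1 : ln (1 + e) <= ln (2 * e) by rewrite ler_ln ?posrE//; lra.
have ep : 0 < e by lra.
have h2 : ln (2 * e) <= 1 + al^-1 * e `^ al.
  rewrite lnM ?posrE// lerD//.
    by rewrite -[X in ln X]/(1 + 1); apply: (@le_ln1Dx _ 1).
  rewrite ler_pdivlMl// -ln_powR.
  have pe := powR_gt0 al ep.
  have := @le_ln1Dx _ (e `^ al - 1); rewrite (_ : 1 + (e `^ al - 1) = e `^ al); last by ring.
  by move=> l; have := l _; lra.
have : 1 <= e `^ al by rewrite -[X in X <= _](powRr0 e) ler_powR ?(ltW e1)// ltW.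
lra.
Qed.

(** With [r = |x - y| / (1 + |y|)] the upper bound is [1 + x^2 <= (1 + 2 r)^2 (1 + y^2)]: the
    logarithm sees only relative increments. *)
Lemma lnq_diff x y : `|y| <= `|x| -> 0 <= lnq x - lnq y <= 2 * ln (1 + 2 * (`|x - y| / (1 + `|y|))).
Proof.
move=> yx; have s0 := jap1_gt0 y; set r := _ / _.
have r0 : 0 <= r by rewrite divr_ge0// ltW.
have rE : `|x - y| = r * (1 + `|y|) by rewrite /r mulfVK// gt_eqF.
have xr : `|x| <= `|y| + r * (1 + `|y|) by have := ler_normD (x - y) y; rewrite subrK rE; lra.
have nx := normr_ge0 x; have ny := normr_ge0 y.
have qx := real_normK (num_real x); have qy := real_normK (num_real y).
apply/andP; split.
  by rewrite subr_ge0 ler_ln ?posrE ?sqp1_gt0// /sqp1 lerD2l -qx -qy lerXn2r ?nnegrE.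
rewrite lerBlDl -[2 * ln _]/(2%:R * _) mulr_natl -lnXn; last by lra.
rewrite -lnM ?posrE ?sqp1_gt0// ?exprn_gt0//; last by lra.
have p1 : 0 < 1 + 2 * r by lra.
rewrite ler_ln ?posrE ?sqp1_gt0// ?mulr_gt0 ?sqp1_gt0 ?exprn_gt0//.
rewrite /sqp1 -qx -qy; move: (`|x|) (`|y|) nx ny xr => X Y X0 Y0 XY.
have : X ^+ 2 <= (Y + r * (1 + Y)) ^+ 2 by rewrite lerXn2r ?nnegrE//; nra.
have : 0 <= r * (1 - Y) ^+ 2 by rewrite mulr_ge0// sqr_ge0.
have : 0 <= r ^+ 2 * (1 - Y) ^+ 2 by rewrite mulr_ge0// sqr_ge0.
have : 0 <= r * Y by rewrite mulr_ge0.
have : 0 <= r ^+ 2 by rewrite sqr_ge0.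
have : 0 <= r ^+ 2 * Y ^+ 2 by rewrite mulr_ge0// sqr_ge0.
lra.
Qed.

Lemma chi01 s x : 0 <= chi s x <= 1.
Proof.
rewrite chiE expR_ge0/= -[leRHS](@expR0 R) ler_expR oppr_le0.
exact: sqr_ge0.
Qed.

Lemma chi_diff s x y : 0 <= s -> `|chi s x - chi s y| <= s * `|lnq x - lnq y|.
Proof.
move=> s0; rewrite /chi; have [th [_ ->]] := mvt_pt (s * lnq x) (s * lnq y) (is_derive_gau 0).
rewrite -mulrBr normrM (normrM s) (ger0_norm s0) ler_piMl ?mulr_ge0//.
move: (s * lnq y + _) => y0; rewrite [0%:R]/(0 : R) mul0r add0r normrN /gau expr1 normrM normrM (ger0_norm (expR_ge0 _)) ger0_norm//.
rewrite expRN mulrA ler_pdivrMr ?expR_gt0// mul1r.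
have := expR_ge1Dx (y0 ^+ 2); have := real_normK (num_real y0); have := sqr_ge0 (1 - `|y0|); nra.
Qed.

(** In the product rule, the increment of the cutoff is [O(s r^al)] in the relative increment
    [r = |x - y| / (1 + |y|)], while [f y] is [O((1 + |y|)^al)]; their product is [O(s |x - y|^al)],
    without loss at infinity. *)
Lemma holder_chi al K c f : 0 < al <= 1 -> (forall x y, `|f x - f y| <= K * `|x - y| `^ al) ->
  (forall x, `|f x| <= c * jap al x) -> forall s, 0 <= s -> forall x y,
  `|f x * chi s x - f y * chi s y| <= (K + s * (4 * (1 + al^-1) * c)) * `|x - y| `^ al.
Proof.
move=> /[dup] al01 /andP[al0 al1] h b s s0.
(* By symmetry the growth bound is used at the point nearer to the origin, the one relative to which
   the increment is measured. *)
suff key x y : `|y| <= `|x| -> `|f x * chi s x - f y * chi s y| <= (K + s * (4 * (1 + al^-1) * c)) * `|x - y| `^ al.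
  by move=> x y; case/orP: (le_total `|y| `|x|) => /key //; rewrite distrC (distrC y).
move=> yx; have /andP[d0 d1] := lnq_diff yx.
have cd := chi_diff x y s0; rewrite (ger0_norm d0) in cd.
rewrite (_ : _ - _ = (f x - f y) * chi s x + f y * (chi s x - chi s y)); last by ring.
apply: (le_trans (ler_normD _ _)); rewrite [leRHS]mulrDl lerD//.
  have /andP[c0 c1] := chi01 s x.
  by rewrite normrM (ger0_norm c0) (le_trans _ (h x y))// ler_piMr.
rewrite normrM; set r := _ / _ in d1.
have r0 : 0 <= r by rewrite divr_ge0// ltW.
have l1 := ln1_powR al01 (mulr_ge0 (ler0n _ 2) r0).
have l2 : (2 * r) `^ al <= 2 * r `^ al.
  by rewrite powRM// ler_wpM2r ?powR_ge0// ler1_powR// ler1n.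
have ai : 0 <= 1 + al^-1 by rewrite addr_ge0// invr_ge0 ltW.
have l3 := ler_wpM2l ai l2.
have l4 : lnq x - lnq y <= 4 * (1 + al^-1) * r `^ al by lra.
apply: (le_trans (ler_pM _ _ (b y) (le_trans cd (ler_wpM2l s0 l4)))) => //.
rewrite le_eqVlt; apply/orP; left; apply/eqP.
have -> : `|x - y| `^ al = r `^ al * jap al y.
  by rewrite /jap -powRM ?(ltW (jap1_gt0 _))// /r mulfVK// gt_eqF.
by ring.
Qed.

(** By Leibniz, [f' chi] is treated by induction, and [f chi'] is a symbol of order [m + al] with
    coefficient [O(s)], hence of small class constant by [Sym_Zc]. The leading constant stays [K],
    so nothing is lost as [s] tends to 0. *)
Lemma Zc_chi m al K f : 0 < al <= 1 -> 0 <= K -> Zc m al K f ->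
  exists C, forall s, 0 <= s <= 1 -> Zc m al (K + s * C) (fun x => f x * chi s x).
Proof.
move=> /[dup] al01 /andP[al0 al1] K0; elim: m f => [|m IH] f h.
  have [c sc] := Zc_growth al0 K0 h; rewrite add0r in sc.
  exists (4 * (1 + al^-1) * c) => s /andP[s0 _].
  exact: (holder_chi al01 h (Sym_bound sc)).
have [c sc] := Zc_growth al0 K0 h.
have [g [d hg]] := h; have [C hC] := IH _ hg.
have [e he] := Sym_chi m.+1.
pose E := 2 ^+ m.+1 * (c * e).
exists (C + 6 * E) => s s01; have [v [dv sv]] := he s s01.
exists (fun x => g x * chi s x + f x * v x); split.
  move=> x; apply: (is_derive_eq (is_deriveM (d x) (dv x))).
  by rewrite /GRing.scale/= addrC mulrC.
have -> : K + s * (C + 6 * E) = K + s * C + 6 * (s * E) by ring.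
apply: ZcD; first exact: hC.
apply: Sym_Zc => //; have := SymM sc sv.
have -> : m.+1%:R + al - 1 = m%:R + al by rewrite -natr1 addrAC addrK.
by rewrite /E; apply: Sym_le => //; rewrite le_eqVlt; apply/orP; left; apply/eqP; ring.
Qed.

(** Completing the square in [l = ln (1 + x^2)]: [r l <= s^2 l^2 + r^2 / (4 s^2)]. The constant
    explodes as [s] tends to 0 and is used for fixed [s] only. *)
Lemma chi_decay s r : 0 < s -> 0 <= r -> exists C, 0 <= C /\ forall x, chi s x <= C * jap (- r) x.
Proof.
move=> s0 r0; exists (expR (r + r ^+ 2 / (4 * s ^+ 2))); split=> [|x]; first exact: expR_ge0.
rewrite chiE /jap powRN ler_pdivlMr ?powR_gt0//.
rewrite /powR (gt_eqF (jap1_gt0 x)) -expRD ler_expR.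
have l1 : ln (1 + `|x|) <= 1 + lnq x.
  have : ln (1 + `|x|) <= ln (2 * sqp1 x).
    rewrite ler_ln ?posrE ?mulr_gt0 ?sqp1_gt0// /sqp1.
    have := real_normK (num_real x); have := sqr_ge0 (1 - 2 * `|x|); have := normr_ge0 x; lra.
  rewrite lnM ?posrE ?sqp1_gt0//.
  have : ln (1 + 1) <= (1 : R) by apply: (@le_ln1Dx _ 1).
  by rewrite /lnq => a1 a2; rewrite (_ : 1 + 1 = 2 :> R) in a1; lra.
have := ler_wpM2l r0 l1.
have s2 : 0 < s ^+ 2 by rewrite exprn_gt0.
have : 0 <= (s * lnq x - r / (2 * s)) ^+ 2 by rewrite sqr_ge0.
have -> : (s * lnq x - r / (2 * s)) ^+ 2 = (s * lnq x) ^+ 2 - r * lnq x + r ^+ 2 / (4 * s ^+ 2).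
  by field; rewrite gt_eqF.
lra.
Qed.

Lemma is_derive_cont u v : (forall z, is_derive z 1 u (v z)) -> continuous u.
Proof. by move=> d z; apply/differentiable_continuous/derivable1_diffP; case: (d z). Qed.

Lemma holder_unif al K u : 0 < al -> 0 <= K -> (forall x y, `|u x - u y| <= K * `|x - y| `^ al) ->
  forall e, 0 < e -> exists2 d, 0 < d & forall x y, `|x - y| <= d -> `|u x - u y| <= e.
Proof.
move=> al0 K0 h e e0; have K1 : 0 < K + 1 by lra.
have q0 : 0 < e / (K + 1) by rewrite divr_gt0.
exists ((e / (K + 1)) `^ al^-1) => [|x y xy]; first exact: powR_gt0.
apply: (le_trans (h x y)).
have : `|x - y| `^ al <= e / (K + 1).
  apply: (@le_trans _ _ (((e / (K + 1)) `^ al^-1) `^ al)).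
    by rewrite ge0_ler_powR ?nnegrE ?powR_ge0// (ltW al0).
  by rewrite -powRrM mulVf ?(gt_eqF al0)// powRr1// ltW.
rewrite ler_pdivlMr//; have := powR_ge0 `|x - y| al; nra.
Qed.

Lemma unif_continuous u : (forall e, 0 < e -> exists2 d, 0 < d & forall x y, `|x - y| <= d -> `|u x - u y| <= e) ->
  continuous u.
Proof.
move=> h z; apply/cvgrPdist_le => e e0; have [d d0 hd] := h e e0.
near=> t; apply: hd; near: t; apply/nbhs_ballP; exists d => //= t.
by rewrite /ball/= => /ltW.
Unshelve. all: end_near. Qed.

Lemma Zc_cont m al K f : 0 < al -> 0 <= K -> Zc m al K f -> continuous f.
Proof.
move=> al0 K0; case: m => [|m] /=; first by move=> /(holder_unif al0 K0)/unif_continuous.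
by move=> [g [/is_derive_cont]].
Qed.

(* The regularity under which cosines control the test function. *)
Definition nice f := [/\ measurable_fun setT f, (exists F, forall z, `|f z| <= F),
  (\int[@lebesgue_measure R]_y `|f y|%:E < +oo)%E &
  forall e, 0 < e -> exists2 d, 0 < d & forall z w, `|z - w| <= d -> `|f z - f w| <= e].

Lemma decay_int u c : measurable_fun setT u -> (forall x, `|u x| <= c * jap (- 2) x) ->
  (\int[@lebesgue_measure R]_y `|u y|%:E < +oo)%E.
Proof.
move=> mu b.
have c0 : 0 <= c by have := le_trans (normr_ge0 _) (b 0); rewrite pmulr_lge0.
apply: (@le_lt_trans _ _ (\int[@lebesgue_measure R]_y (c * ck 1 (0 - y))%:E)%E); last first.
  rewrite (@int_ckZ R) //; exact: ltry.
apply: ge0_le_integral => //.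
- by apply/measurable_EFinP; exact: measurableT_comp.
- by apply/measurable_EFinP; apply: measurable_funM => //; exact: measurable_ck_argR.
move=> x _; rewrite lee_fin (le_trans (b x))// ler_wpM2l//.
rewrite /ck /jap powRN -[2 in X in _ `^ X]/(2%:R) powR_mulrn ?(ltW (jap1_gt0 _))//.
rewrite lef_pV2 ?posrE ?exprn_gt0//; last by rewrite ltr_pwDl// sqr_ge0.
rewrite mul1r sub0r sqrrN.
have := real_normK (num_real x); have := normr_ge0 x; nra.
Qed.

Lemma chi_deriv s x : is_derive x 1 (chi s) (- 2 * s * (gau 1 (s * lnq x) * (2 * x * (sqp1 x)^-1))).
Proof.
have dl := is_derive_lnq x.
have dsl : is_derive x 1 (fun x => s * lnq x) (s * (2 * x * (sqp1 x)^-1)) by exact: is_deriveZ.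
have D : is_derive x 1 (fun x => gau 0 (s * lnq x)) _ := @is_derive1_comp R (gau 0) (fun x => s * lnq x) x _ _ (is_derive_gau 0 (s * lnq x)) dsl.
by apply: (is_derive_eq D); rewrite mul0r; ring.
Qed.

Lemma continuous_chi s : continuous (chi s).
Proof. by apply: is_derive_cont => z; exact: chi_deriv. Qed.

Lemma nice_chi m al K f s : 0 < al <= 1 -> 0 <= K -> Zc m al K f -> 0 < s <= 1 ->
  nice (fun x => f x * chi s x).
Proof.
move=> /[dup] al01 /andP[al0 al1] K0 h /andP[s0 s1].
have [c sc] := Zc_growth al0 K0 h; have c0 := Sym_c0 sc.
have fb := Sym_bound sc; set r := m%:R + al in fb.
have r0 : 0 <= r by rewrite addr_ge0// ltW.
have cf := Zc_cont al0 K0 h.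
have dec k : 0 <= k -> exists C, 0 <= C /\ forall x, `|chi s x| <= C * jap (- k) x.
  move=> k0; have [C [C0 hC]] := chi_decay s0 k0; exists C; split=> // x.
  by have /andP[p0 _] := chi01 s x; rewrite ger0_norm.
have r20 : 0 <= r + 2 by lra.
have [C [C0 hC]] := dec _ r20.
have b2 x : `|f x * chi s x| <= c * C * jap (- 2) x.
  rewrite normrM (le_trans (ler_pM _ _ (fb x) (hC x)))// mulrACA japM.
  by rewrite (_ : r + - (r + 2) = - 2)//; ring.
have mfx : measurable_fun setT (fun x => f x * chi s x).
  by apply: continuous_measurable_fun => z; apply: cvgM; [exact: cf|exact: continuous_chi].
split=> //.
- exists (c * C) => z; rewrite (le_trans (b2 z))// ler_piMr ?mulr_ge0//.
  by rewrite -[leRHS](jap0 z) jap_le// oppr_le0.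
- exact: decay_int b2.
have [C1 hC1] := Zc_chi al01 K0 h.
have s01 : 0 <= s <= 1 by rewrite s1 ltW.
have := hC1 s s01; case: m @r h hC1 sc fb r0 r20 C C0 hC b2 => [|m] r h hC1 sc fb r0 r20 C C0 hC b2 /= H.
  apply: (@holder_unif al `|K + s * C1|) => // x y; apply: (le_trans (H x y)).
  by rewrite ler_wpM2r ?powR_ge0// ler_norm.
have [_ [g [dg sg]]] := sc; have gb := Sym_bound sg.
have [e se] := Sym_dlnq 0; have eb := Sym_bound se; have e0 := Sym_c0 se.
apply: (@holder_unif 1 (c * C + c * (2 * s * (s * C * e)))) => //.
  by nneg; exact: ltW.
move=> x y; rewrite powRr1//.
pose v x := - 2 * s * (gau 1 (s * lnq x) * (2 * x * (sqp1 x)^-1)).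
have dfx z : is_derive z 1 (fun x => f x * chi s x) (g z * chi s z + f z * v z).
  apply: (is_derive_eq (is_deriveM (dg z) (chi_deriv s z))).
  by rewrite /GRing.scale/= addrC mulrC.
have [th [_ ->]] := mvt_pt x y dfx; move: (y + _) => z.
rewrite normrM ler_wpM2r// (le_trans (ler_normD _ _))// lerD//.
  rewrite normrM (le_trans (ler_pM _ _ (gb z) (hC z)))// mulrACA japM.
  apply: ler_piMr; first by rewrite mulr_ge0.
  by rewrite -[leRHS](jap0 z); apply: jap_le; rewrite -/r; lra.
have lb : lnq z <= jap 2 z.
  have : lnq z <= z ^+ 2 by apply: le_ln1Dx; have := sqr_ge0 z; lra.
  rewrite /jap -[2 in X in _ `^ X]/(2%:R) powR_mulrn ?(ltW (jap1_gt0 _))//.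
  have := real_normK (num_real z); have := normr_ge0 z; nra.
have l0 := lnq_ge0 z.
have gb1 : `|gau 1 (s * lnq z)| <= s * C * jap (- r) z.
  rewrite /gau expr1 normrM -chiE normrM (ger0_norm (ltW s0)) (ger0_norm l0) -!mulrA ler_wpM2l ?(ltW s0)//.
  apply: (le_trans (ler_pM _ _ lb (hC z))) => //.
  by rewrite mulrCA japM (_ : 2 + - (r + 2) = - r)//; ring.
rewrite normrM /v !normrM normrN (ger0_norm (ltW s0)) (ger0_norm (ler0n _ 2)).
have eb1 : `|2 * z / sqp1 z| <= e.
  by rewrite (le_trans (eb z))// ler_piMr// -[leRHS](jap0 z) jap_le//; lra.
have := ler_pM (normr_ge0 _) (normr_ge0 _) gb1 eb1; rewrite !normrM.
move=> p; apply: (@le_trans _ _ (c * jap r z * (2 * s * (s * C * jap (- r) z * e)))).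
  rewrite ler_pM//; first by nneg; exact: ltW.
  apply: ler_wpM2l; first by rewrite mulr_ge0// ltW.
  by move: p; rewrite (ger0_norm (ltW s0)) (ger0_norm (ler0n _ 2)).
rewrite le_eqVlt; apply/orP; left; apply/eqP.
have : jap r z * jap (- r) z = 1 by rewrite japM subrr jap0.
move: (jap r z) (jap (- r) z) => p1 p2 p12.
by transitivity (c * (2 * s * (s * C * e)) * (p1 * p2)); [ring|rewrite p12 mulr1].
Qed.

Lemma Zc_derive1n m al K f : Zc m al K f ->
  (forall (k : nat) x, (k < m)%N -> derivable (derive1n k f) x 1) /\
  (forall x y, `|derive1n m f x - derive1n m f y| <= K * `|x - y| `^ al).
Proof.
elim: m f => [|m IH] f /=; first by move=> h.
move=> [g [d /IH [h1 h2]]].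
have gE : derive1 f = g by apply/funext => x; rewrite derive1E; exact: derive_val.
have sw (k : nat) : derive1n k.+1 f = derive1n k g by rewrite /derive1n iterSr gE.
split; last by move=> x y; rewrite -derive1nS sw.
move=> [|k] x; first by move=> _; case: (d x).
by rewrite ltnS sw => km; exact: h1.
Qed.

Lemma Zc_zol m al f : 0 < al <= 1 -> Zc m al 1 f -> zol_class (m%:R + al) f.
Proof.
move=> al01 /Zc_derive1n [h1 h2]; exists m, al; split => // x y.
by rewrite -[leRHS]mul1r.
Qed.

Lemma zol_Zc s f : zol_class s f -> exists m al, [/\ s = m%:R + al, 0 < al <= 1 & Zc m al 1 f].
Proof.
move=> [m [al [sE al01 d h]]]; exists m, al; split => //.
elim: m f d h {sE} => [|m IH] f d h /=; first by move=> x y; rewrite mul1r; exact: h.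
have sw (k : nat) : derive1n k.+1 f = derive1n k (derive1 f) by rewrite /derive1n iterSr.
exists (derive1 f); split.
  by move=> x; apply: DeriveDef; [exact: (d 0%N)|rewrite derive1E].
apply: IH.
  by move=> k x km; rewrite -sw; exact: d.
by move=> x y; rewrite -sw; exact: h.
Qed.

End symbols.

(** * Contraction up to integrability *)

Section truncation_limits.
Context (R : realType).
Implicit Types (m : probability R R) (f h : R -> R).

Definition negp f x := Num.max (- f x) 0.

Definition posp f x := Num.max (f x) 0.

Lemma negp_ge0 f x : 0 <= negp f x. Proof. by rewrite le_max lexx orbT. Qed.

Lemma posp_ge0 f x : 0 <= posp f x. Proof. by rewrite le_max lexx orbT. Qed.

Lemma pospB f x : f x = posp f x - negp f x.
Proof. by rewrite /posp /negp; case: (leP (f x) 0) => h; case: (leP (- f x) 0) => k; lra. Qed.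

Lemma measurable_negp f : measurable_fun setT f -> measurable_fun setT (negp f).
Proof. by move=> mf; apply: measurable_maxr => //; exact: measurableT_comp. Qed.

Lemma measurable_posp f : measurable_fun setT f -> measurable_fun setT (posp f).
Proof. by move=> mf; apply: measurable_maxr. Qed.

Lemma int_pospB m f : (\int[m]_x (f x)%:E = \int[m]_x (posp f x)%:E - \int[m]_x (negp f x)%:E)%E.
Proof.
rewrite integralE; congr (_ - _)%E; apply: eq_integral => x _.
  by rewrite funepos.unlock EFin_max.
by rewrite funeneg.unlock EFin_max.
Qed.

Lemma fin_integrable m f : measurable_fun setT f -> (\int[m]_x (f x)%:E \is a fin_num)%E -> m.-integrable setT (EFin \o f).
Proof.
move=> mf; rewrite int_pospB => fin.
have p0 : (0 <= \int[m]_x (posp f x)%:E)%E by apply: integral_ge0 => x _; rewrite lee_fin posp_ge0.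
have n0 : (0 <= \int[m]_x (negp f x)%:E)%E by apply: integral_ge0 => x _; rewrite lee_fin negp_ge0.
have mp := measurable_posp mf; have mn := measurable_negp mf.
apply/integrableP; split; first exact/measurable_EFinP.
have -> : (\int[m]_x `|(EFin \o f) x| = \int[m]_x (posp f x)%:E + \int[m]_x (negp f x)%:E)%E.
  rewrite -ge0_integralD//; last 4 first.
  - by move=> x _; rewrite lee_fin posp_ge0.
  - exact/measurable_EFinP.
  - by move=> x _; rewrite lee_fin negp_ge0.
  - exact/measurable_EFinP.
  apply: eq_integral => x _ /=; rewrite -EFinD; congr EFin.
  rewrite /posp /negp; have [h|h] := lerP 0 (f x).
    have -> : Num.max (- f x) 0 = 0 by apply: max_r; rewrite oppr_le0.
    by rewrite addr0 ger0_norm.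
  have -> : Num.max (- f x) 0 = - f x by apply: max_l; rewrite oppr_ge0 ltW.
  by rewrite add0r ltr0_norm.
move: fin p0 n0; case: (\int[m]_x (posp f x)%:E)%E => [a||]//; case: (\int[m]_x (negp f x)%:E)%E => [b||]//.
by rewrite -EFinD ltry.
Qed.

Lemma int_scale m f (k : R) : 0 < k -> measurable_fun setT f -> (\int[m]_x (k * f x)%:E = k%:E * \int[m]_x (f x)%:E)%E.
Proof.
move=> k0 mf; have mp := measurable_posp mf; have mn := measurable_negp mf.
rewrite (int_pospB m (fun x => k * f x)) (int_pospB m f).
have pE x : posp (fun x => k * f x) x = k * posp f x.
  by rewrite /posp maxr_pMr ?mulr0// ltW.
have nE x : negp (fun x => k * f x) x = k * negp f x.
  by rewrite /negp maxr_pMr ?mulr0 ?mulrN// ltW.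
have p0 : (0 <= \int[m]_x (posp f x)%:E)%E by apply: integral_ge0 => x _; rewrite lee_fin posp_ge0.
have n0 : (0 <= \int[m]_x (negp f x)%:E)%E by apply: integral_ge0 => x _; rewrite lee_fin negp_ge0.
have -> : (\int[m]_x (posp (fun x => k * f x) x)%:E = k%:E * \int[m]_x (posp f x)%:E)%E.
  rewrite -ge0_integralZl_EFin ?ltW//; last 2 first.
  - by move=> x _; rewrite lee_fin posp_ge0.
  - exact/measurable_EFinP.
  by apply: eq_integral => x _; rewrite pE.
have -> : (\int[m]_x (negp (fun x => k * f x) x)%:E = k%:E * \int[m]_x (negp f x)%:E)%E.
  rewrite -ge0_integralZl_EFin ?ltW//; last 2 first.
  - by move=> x _; rewrite lee_fin negp_ge0.
  - exact/measurable_EFinP.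
  by apply: eq_integral => x _; rewrite nE.
move: p0 n0; case: (\int[m]_x (posp f x)%:E)%E => [a||]//; case: (\int[m]_x (negp f x)%:E)%E => [b||]// _ _;
  rewrite ?gt0_muley ?gt0_muleNy ?lte_fin//=.
by rewrite -!EFinM -!EFinB mulrBr.
Qed.

Lemma posp_abs f x : posp f x <= `|f x|.
Proof. by rewrite ge_max ler_norm normr_ge0. Qed.

Lemma negp_abs f x : negp f x <= `|f x|.
Proof. by rewrite ge_max normr_ge0 -normrN ler_norm. Qed.

Lemma nice_negp f : nice f -> nice (negp f).
Proof.
move=> [mf [F hF] fi fu]; have mn := measurable_negp mf; split => //.
- by exists F => z; rewrite ger0_norm ?negp_ge0// (le_trans (negp_abs f z)).
- apply: le_lt_trans fi; apply: ge0_le_integral => //.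
  + by apply/measurable_EFinP; exact: measurableT_comp.
  + by apply/measurable_EFinP; exact: measurableT_comp.
  + by move=> x _; rewrite lee_fin ger0_norm ?negp_ge0// negp_abs.
- move=> e /fu [d d0 hd]; exists d => // z w /hd; apply: le_trans.
  rewrite /negp; have n1 := ler_norm (f z - f w); have n2 := ler_norm (f w - f z).
  rewrite distrC in n2.
  by case: (leP (- f z) 0) => a; case: (leP (- f w) 0) => b; rewrite ler_norml; apply/andP; split; lra.
Qed.

Definition sn (n : nat) : R := n.+1%:R^-1.

Lemma sn01 n : 0 < sn n <= 1.
Proof. by rewrite invr_gt0 ltr0n/= invf_le1 ?ltr0n// ler1n. Qed.

Lemma sn_cvg : sn n @[n --> \oo] --> 0.
Proof. exact: cvg_harmonic. Qed.

Lemma chi_cvg x : chi (sn n) x @[n --> \oo] --> (1 : R).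
Proof.
have c : sn n * lnq x @[n --> \oo] --> 0 * lnq x by apply: cvgM; [exact: sn_cvg|exact: cvg_cst].
have <- : gau 0 (0 * lnq x) = 1 :> R by rewrite /gau mul0r expr0 mul1r expr0n oppr0 expR0.
rewrite (_ : (fun n => chi (sn n) x) = (gau 0 \o (fun n => sn n * lnq x)))//.
by apply: (cvg_comp _ _ c); exact: (is_derive_cont (is_derive_gau 0)).
Qed.

Lemma chi_mono x (i j : nat) : (i <= j)%N -> chi (sn i) x <= chi (sn j) x.
Proof.
move=> ij; rewrite !chiE ler_expR lerN2 lerXn2r ?nnegrE ?mulr_ge0 ?lnq_ge0 ?invr_ge0//.
by rewrite ler_wpM2r ?lnq_ge0// lef_pV2 ?posrE ?ltr0n// ler_nat ltnS.
Qed.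

Lemma measurable_chi s : measurable_fun setT (chi s : R -> R).
Proof. by apply: continuous_measurable_fun; exact: continuous_chi. Qed.

Lemma chi_mct m h : measurable_fun setT h -> (forall x, 0 <= h x) ->
  (\int[m]_x (h x * chi (sn n) x)%:E)%E @[n --> \oo] --> (\int[m]_x (h x)%:E)%E.
Proof.
move=> mh h0.
have := @cvg_monotone_convergence _ _ _ m setT measurableT (fun n x => (h x * chi (sn n) x)%:E) _ _ _.
have E x : limn (fun n => (h x * chi (sn n) x)%:E) = (h x)%:E.
  apply/cvg_lim => //; apply: cvg_EFin; first exact: nearW.
  by rewrite -[X in _ --> X]mulr1; apply: cvgM; [exact: cvg_cst|exact: chi_cvg].
have -> : (\int[m]_x (h x)%:E = \int[m]_x limn (fun n => (h x * chi (sn n) x)%:E))%E.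
  by apply: eq_integral => x _; rewrite E.
apply.
- by move=> n; apply/measurable_EFinP; apply: measurable_funM => //; exact: measurable_chi.
- by move=> n x _; rewrite lee_fin mulr_ge0//; have /andP[] := chi01 (sn n) x.
- by move=> x _ i j ij; rewrite lee_fin ler_wpM2l// chi_mono.
Qed.

Lemma chi_mct_le m h (B : \bar R) : measurable_fun setT h -> (forall x, 0 <= h x) ->
  (forall s, 0 < s <= 1 -> (\int[m]_x (h x * chi s x)%:E <= B)%E) -> (\int[m]_x (h x)%:E <= B)%E.
Proof.
move=> mh h0 hB; have /cvge_to_le := @chi_mct m h mh h0; apply; apply: nearW => n; exact/hB/sn01.
Qed.

(** Under [m2] the limit is by dominated convergence. Under [m1], where [f] may fail to be
    integrable, only the positive part passes to the limit, by monotone convergence; if the negative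
    part has infinite integral, the left side is [-oo]. *)
Lemma chi_limit m1 m2 f (B C : R) : measurable_fun setT f ->
  (\int[m2]_x (f x)%:E \is a fin_num)%E -> (forall s, 0 < s <= 1 -> bdm (fun x => f x * chi s x)) ->
  (forall s, 0 < s <= 1 -> \int[m1]_x (f x * chi s x) <= \int[m2]_x (f x * chi s x) + B * (1 + s * C)) ->
  (\int[m1]_x (f x)%:E <= \int[m2]_x (f x)%:E + B%:E)%E.
Proof.
move=> mf fin bf hB.
have mp := measurable_posp mf; have mn := measurable_negp mf.
have in2 : m2.-integrable setT (EFin \o f).
  exact: fin_integrable.
have [oo|noo] := eqVneq (\int[m1]_x (negp f x)%:E)%E +oo%E.
  by rewrite int_pospB oo addeNy leNye.
have n0 : (0 <= \int[m1]_x (negp f x)%:E)%E by apply: integral_ge0 => x _; rewrite lee_fin negp_ge0.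
have nfin : (\int[m1]_x (negp f x)%:E \is a fin_num)%E by rewrite ge0_fin_numE// ltey.
have c2 : \int[m2]_x (f x * chi (sn n) x) @[n --> \oo] --> \int[m2]_x f x.
  have [|||||_ //] := @Rint_dct _ _ _ m2 (fun n x => f x * chi (sn n) x) f (fun x => `|f x|).
  - by move=> n; apply: measurable_funM => //; exact: measurable_chi.
  - exact: mf.
  - exact: (integrable_abse in2).
  - move=> n x; have /andP[p0 p1] := chi01 (sn n) x.
    by rewrite normrM (ger0_norm p0) ler_piMr.
  - by move=> x; rewrite -[X in _ --> X]mulr1; apply: cvgM; [exact: cvg_cst|exact: chi_cvg].
rewrite int_pospB leeBlDr//.
have -> : (\int[m2]_x (f x)%:E + B%:E + \int[m1]_x (negp f x)%:E = (\int[m2]_x f x + B * (1 + 0 * C) + fine (\int[m1]_x (negp f x)%:E))%:E)%E.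
  by rewrite mul0r addr0 mulr1 !EFinD fineK// /Rintegral fineK.
have cB : (\int[m2]_x (f x * chi (sn n) x) + B * (1 + sn n * C) + fine (\int[m1]_x (negp f x)%:E))%:E @[n --> \oo] -->
   (\int[m2]_x f x + B * (1 + 0 * C) + fine (\int[m1]_x (negp f x)%:E))%:E.
  apply: cvg_EFin; first exact: nearW.
  apply: cvgD; last exact: cvg_cst.
  apply: cvgD => //; apply: cvgM; first exact: cvg_cst.
  apply: cvgD; first exact: cvg_cst.
  by apply: cvgM; [exact: sn_cvg|exact: cvg_cst].
have := lee_cvg_to (@chi_mct m1 _ mp (posp_ge0 f)) cB; apply; apply: nearW => n.
have s01 := sn01 n; have b := bf _ s01.
have /(_ _)/andP c01 := @chi01 R (sn n).
have -> : (\int[m1]_x (posp f x * chi (sn n) x)%:E = \int[m1]_x (f x * chi (sn n) x)%:E + \int[m1]_x (negp f x * chi (sn n) x)%:E)%E.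
  have [mfc [F hF]] := b; have mc := measurable_chi (sn n).
  have bn : bdm (fun x => negp f x * chi (sn n) x).
    split; first exact: measurable_funM.
    exists F => x; have [p0 _] := c01 x; apply: le_trans (hF x).
    by rewrite !normrM ler_wpM2r// ger0_norm ?negp_ge0// negp_abs.
  have bp : bdm (fun x => posp f x * chi (sn n) x).
    split; first exact: measurable_funM.
    exists F => x; have [p0 _] := c01 x; apply: le_trans (hF x).
    by rewrite !normrM ler_wpM2r// ger0_norm ?posp_ge0// posp_abs.
  rewrite !bdm_EFin// -EFinD -bdm_RintD//; congr EFin; apply: eq_Rintegral => x _.
  by have := pospB f x; move: (posp f x) (negp f x) (f x) (chi (sn n) x) => p q r e ->; ring.
rewrite !EFinD leeD//.
  by rewrite bdm_EFin// -EFinD lee_fin hB.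
rewrite fineK//; apply: ge0_le_integral => //.
- by move=> x _; rewrite lee_fin mulr_ge0 ?negp_ge0//; have [] := c01 x.
- by apply/measurable_EFinP; apply: measurable_funM => //; exact: measurable_chi.
- exact/measurable_EFinP.
- by move=> x _; rewrite lee_fin ler_piMr ?negp_ge0//; have [] := c01 x.
Qed.

End truncation_limits.

(** * Contraction for a single test function of the class *)

Section zolotarev_contraction.
Context (R : realType) (I : Type).
Context d (T : measurableType d) (P : probability T R).
Variables (A : I -> T -> R) (mA : forall i, measurable_fun setT (A i)) (A0 : forall i x, 0 <= A i x).
Variable s : seq I.
Variables (nu : R -> probability R R) (K : R) (nuinf : probability R R) (mu delta Z : R) (W : I -> R).
Implicit Types (f : R -> R) (k t al : R).
Hypotheses (cons : consistent P mA s nu K) (fp : fixpt P mA s mu nuinf).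
Hypothesis hW : forall i, (\int[P]_x (A i x `^ delta)%:E = (W i)%:E)%E.
Hypotheses (delta0 : 0 < delta) (Z0 : 0 <= Z).
Hypothesis hZ : forall f, zol_class delta f -> (\int[nu 0]_x (f x)%:E - \int[nuinf]_x (f x)%:E <= Z%:E)%E.
Hypothesis lossless : forall (h : R -> R) (c t : R), measurable_fun setT h -> (forall x, 0 <= h x <= c * jap delta x) ->
  0 <= t -> (\int[nuinf]_x (h (expR (- mu * t) * x))%:E < +oo)%E -> (\int[nuinf]_x (h x)%:E < +oo)%E.

Lemma Zc_bound m al k f : delta = m%:R + al -> 0 < al <= 1 -> 0 < k -> Zc m al k f ->
  (\int[nu 0]_x (f x)%:E - \int[nuinf]_x (f x)%:E <= (k * Z)%:E)%E.
Proof.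
move=> dE al01 k0 h; have /andP[al0 _] := al01.
have mf : measurable_fun setT f by apply: continuous_measurable_fun; exact: (Zc_cont al0 (ltW k0) h).
have k1 : 0 < k^-1 by rewrite invr_gt0.
have := ZcZ k^-1 h; rewrite gtr0_norm// mulVf ?gt_eqF// => /(Zc_zol al01); rewrite -dE => /hZ.
have E (m' : probability R R) : (\int[m']_x (k^-1 * f x)%:E = k^-1%:E * \int[m']_x (f x)%:E)%E.
  exact: int_scale.
rewrite !E.
case: (\int[nu 0]_x (f x)%:E)%E => [a||]; case: (\int[nuinf]_x (f x)%:E)%E => [b||]; rewrite ?gt0_muley ?gt0_muleNy ?lte_fin//= ?leNye//.
rewrite -!EFinM -!EFinB !lee_fin -mulrBr.
by rewrite ler_pdivrMl.
Qed.

Lemma Zc_bdm m al k f : delta = m%:R + al -> 0 < al <= 1 -> 0 < k -> Zc m al k f -> bdm f ->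
  `|\int[nu 0]_x f x - \int[nuinf]_x f x| <= k * Z.
Proof.
move=> dE al01 k0 h bf; rewrite ler_norml; apply/andP; split.
  have hN : Zc m al k (fun x => - 1 * f x) by have := ZcZ (- 1) h; rewrite normrN normr1 mul1r.
  have := Zc_bound dE al01 k0 hN; have b := bdmZ (- 1) bf.
  rewrite !bdm_EFin// -EFinB lee_fin !bdm_RintZ//; lra.
by have := Zc_bound dE al01 k0 h; rewrite !bdm_EFin// -EFinB lee_fin.
Qed.

(** The affine images of [f] lie in the class with factor [a^delta] and are bounded with [f]; this
    supplies the property [good] at time 0. *)
Lemma flow_nice m al k f t : delta = m%:R + al -> 0 < al <= 1 -> 0 < k -> Zc m al k f -> nice f -> 0 <= t ->
  `|\int[nu t]_x f x - \int[ssflow mu nuinf t]_x f x| <= expR (t * (\sum_(i <- s) W i - 1)) * (k * Z).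
Proof.
move=> dE al01 k0 h [mf [F hF] fi fu] t0.
have bf : bdm f by split => //; exists F.
suff gf : good delta (k * Z) (nu 0) (ssflow mu nuinf 0) f.
  have kZ : 0 <= k * Z by rewrite mulr_ge0// ltW.
  exact: (flow_contract A0 cons (ssflow_consistent A0 fp) hW t0 kZ mf hF fi fu gf).
(* For [a = 0] the test function is constant and both integrals coincide. *)
move=> a b; rewrite le_eqVlt => /predU1P[<-|a0].
  under eq_Rintegral do rewrite mul0r addr0.
  under [X in _ - X]eq_Rintegral do rewrite mul0r addr0.
  by rewrite !Rint_cst subrr normr0 powR0 ?mul0r// gt_eqF.
rewrite ssflow0; last exact: bdm_affine.
have := Zc_bdm (k := a `^ (m%:R + al) * k) dE al01 _ (Zc_affine b a0 h) (bdm_affine a b bf).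
by rewrite -dE mulrA; apply; rewrite mulr_gt0// powR_gt0.
Qed.

Lemma int_ssflow t f : measurable_fun setT f -> (forall x, 0 <= f x) ->
  (\int[ssflow mu nuinf t]_x (f x)%:E = \int[nuinf]_x (f (expR (mu * t) * x))%:E)%E.
Proof.
move=> mf f0; rewrite ge0_int_law//; exact/measurable_EFinP.
Qed.

Lemma int_ssflow_gen t f : measurable_fun setT f ->
  (\int[ssflow mu nuinf t]_x (f x)%:E = \int[nuinf]_x (f (expR (mu * t) * x))%:E)%E.
Proof.
move=> mf; rewrite int_pospB !int_ssflow; last 4 first.
- exact: measurable_negp.
- exact: negp_ge0.
- exact: measurable_posp.
- exact: posp_ge0.
by rewrite [RHS]int_pospB.
Qed.

Lemma int_ge0_negp (m : probability R R) f : (0 <= \int[m]_x (negp f x)%:E)%E.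
Proof. by apply: integral_ge0 => x _; rewrite lee_fin negp_ge0. Qed.

Lemma int_ge0_posp (m : probability R R) f : (0 <= \int[m]_x (posp f x)%:E)%E.
Proof. by apply: integral_ge0 => x _; rewrite lee_fin posp_ge0. Qed.

Lemma int_eqNy (m : probability R R) f : (\int[m]_x (f x)%:E = -oo)%E <-> (\int[m]_x (negp f x)%:E = +oo)%E.
Proof.
rewrite int_pospB; have := int_ge0_negp m f; have := int_ge0_posp m f.
by case: (\int[m]_x (negp f x)%:E)%E => [a||]//; case: (\int[m]_x (posp f x)%:E)%E => [b||]//.
Qed.

(** [nu t] dominates [exp (-2 t)] times [nu 0], so integrability of a nonnegative function passes
    back to time 0. As the domination is known for regular test functions only, it is applied to
    truncations, and the cutoff is removed by monotone convergence. *)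
Lemma flow_negp f m al k t : 0 < al <= 1 -> 0 <= k -> Zc m al k f -> 0 <= t ->
  (\int[nu t]_x (negp f x)%:E < +oo)%E -> (\int[nu 0]_x (negp f x)%:E < +oo)%E.
Proof.
move=> al01 k0 h t0 fin; have /andP[al0 _] := al01.
have mf : measurable_fun setT f by apply: continuous_measurable_fun; exact: Zc_cont h.
have mn := measurable_negp mf.
have nfin : (\int[nu t]_x (negp f x)%:E \is a fin_num)%E by rewrite ge0_fin_numE// int_ge0_negp.
suff : (\int[nu 0]_x (negp f x)%:E <= (expR (2 * t))%:E * \int[nu t]_x (negp f x)%:E)%E.
  by move=> /le_lt_trans; apply; rewrite -(fineK nfin) -EFinM ltry.
apply: chi_mct_le => // [x|e e01]; first exact: negp_ge0.
have ni : nice (fun x => negp f x * chi e x).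
  have := nice_negp (nice_chi al01 k0 h e01).
  rewrite (_ : negp (fun x => f x * chi e x) = (fun x => negp f x * chi e x))//.
  apply/funext => x; have /andP[c0 _] := chi01 e x.
  by rewrite /negp -mulNr -{1}(mul0r (chi e x)) maxr_pMl.
have [mc [F hF] ic uc] := ni.
have bc : bdm (fun x => negp f x * chi e x) by split => //; exists F.
have p0 x : 0 <= negp f x * chi e x by rewrite mulr_ge0 ?negp_ge0//; have /andP[] := chi01 e x.
have := @flow_lower _ _ _ _ P A mA A0 s nu K cons t (fun x => negp f x * chi e x) F t0 mc.
have hF' z : 0 <= negp f z * chi e z <= F by rewrite p0/= (le_trans _ (hF z))// ler_norm.
have ic' : (\int[@lebesgue_measure R]_y (negp f y * chi e y)%:E < +oo)%E.
  by move: ic; under eq_integral do rewrite ger0_norm//.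
move=> /(_ hF' ic' uc) L.
apply: (@le_trans _ _ ((expR (2 * t))%:E * \int[nu t]_x (negp f x * chi e x)%:E)%E); last first.
  rewrite lee_wpmul2l ?lee_fin ?expR_ge0//; apply: ge0_le_integral => //.
  - by move=> x _; rewrite lee_fin.
  - exact/measurable_EFinP.
  - exact/measurable_EFinP.
  - by move=> x _; rewrite lee_fin ler_piMr ?negp_ge0//; have /andP[] := chi01 e x.
rewrite !bdm_EFin// -EFinM lee_fin -ler_pdivrMl ?expR_gt0// -expRN -mulNr.
exact: L.
Qed.

(* [oo - oo = -oo] in [\bar R], so only an infinite negative part under [nuinf] alone can break the inequality. *)
Lemma contraction_class f t : zol_class delta f -> 0 <= t ->
  (\int[nu t]_x (f (expR (- mu * t) * x))%:E - \int[nuinf]_x (f x)%:E <=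
   (Z * expR (t * (\sum_(i <- s) W i - 1 - delta * mu)))%:E)%E.
Proof.
move=> cf t0; have [m [al [dE al01 h]]] := zol_Zc cf; have /andP[al0 al1] := al01.
set lam := expR (- mu * t); have lam0 : 0 < lam by exact: expR_gt0.
(* The dilation is moved into the test function, which multiplies its class constant by [lam^delta];
   this gives the term [- delta * mu] of the rate. *)
pose f1 x := f (lam * x).
pose k := lam `^ delta.
have k0 : 0 < k by exact: powR_gt0.
have h1 : Zc m al k f1.
  have := Zc_affine 0 lam0 h; rewrite -dE mulr1.
  by rewrite (_ : (fun x => f (0 + lam * x)) = f1)//; apply/funext => x; rewrite add0r.
have mf : measurable_fun setT f by apply: continuous_measurable_fun; exact: Zc_cont h.
have mf1 : measurable_fun setT f1 by apply: (measurableT_comp mf); exact: mulrl_measurable.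
have [c sc] := Zc_growth al0 ler01 h; have fb := Sym_bound sc; rewrite -dE in fb.
have winf : (\int[ssflow mu nuinf t]_x (f1 x)%:E = \int[nuinf]_x (f x)%:E)%E.
  rewrite int_ssflow_gen//; apply: eq_integral => x _; rewrite /f1 mulrA -expRD.
  by rewrite mulNr addNr expR0 mul1r.
have [fin|nfin] := boolP (\int[nuinf]_x (f x)%:E \is a fin_num)%E.
  rewrite leeBlDl//.
  have [C hC] := Zc_chi al01 (ltW k0) h1.
  have := @chi_limit R (nu t) (ssflow mu nuinf t) f1 (expR (t * (\sum_(i <- s) W i - 1)) * (k * Z)) (`|C| / k) mf1.
  rewrite winf.
  have kE : expR (t * (\sum_(i <- s) W i - 1)) * (k * Z) = Z * expR (t * (\sum_(i <- s) W i - 1 - delta * mu)).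
    have -> : k = expR (delta * (- mu * t)) by rewrite /k /lam /powR gt_eqF ?expR_gt0// expRK.
    rewrite mulrCA mulrC mulrAC -expRD mulrC; congr (_ * expR _); ring.
  rewrite kE.
  apply => // [e e01|e e01].
    by have [mc [F hF] _ _] := nice_chi al01 (ltW k0) h1 e01; split => //; exists F.
  have /andP[e0 e1] := e01; have e01' : 0 <= e <= 1 by rewrite e1 ltW.
  have k1 : 0 < k + e * `|C| by rewrite ltr_wpDr// mulr_ge0// ltW.
  have hc : Zc m al (k + e * `|C|) (fun x => f1 x * chi e x).
    by apply: Zc_le (hC e e01'); rewrite lerD2l ler_wpM2l ?(ltW e0)// ler_norm.
  have := flow_nice dE al01 k1 hc (nice_chi al01 (ltW k0) h1 e01) t0.
  rewrite ler_norml => /andP[_]; rewrite lerBlDl => /le_trans; apply.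
  rewrite lerD2l le_eqVlt; apply/orP; left; apply/eqP.
  rewrite -kE.
  by field; rewrite gt_eqF.
(* Subtracting [+oo] gives [-oo] whatever the first term is, so this case is immediate. *)
have [ioo|inoo] := eqVneq (\int[nuinf]_x (f x)%:E)%E +oo%E; first by rewrite ioo /= addeNy leNye.
have iNy : (\int[nuinf]_x (f x)%:E = -oo)%E.
  by move: nfin inoo; case: (\int[nuinf]_x (f x)%:E)%E.
have [tNy|tn] := eqVneq (\int[nu t]_x (f1 x)%:E)%E -oo%E; first by rewrite tNy leNye.
have lt_of (m' : probability R R) u : (\int[m']_x (u x)%:E != -oo)%E -> (\int[m']_x (negp u x)%:E < +oo)%E.
  by move=> /eqP n; rewrite ltey; apply/eqP => /int_eqNy.
(* The remaining case is contradictory. The negative part of [f1] is integrable at time [t], hence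
   at time 0; the finite distance then makes it integrable under [nuinf], and [lossless] removes the
   dilation, against [iNy]. *)
have n0 := flow_negp al01 (ltW k0) h1 t0 (lt_of _ _ tn).
have n0' : (\int[nu 0]_x (f1 x)%:E != -oo)%E by apply/eqP => /int_eqNy E; rewrite E ltxx in n0.
have i1 : (\int[nuinf]_x (f1 x)%:E != -oo)%E.
  apply/eqP => E; have := Zc_bound dE al01 k0 h1; rewrite E.
  by move: n0'; case: (\int[nu 0]_x (f1 x)%:E)%E.
have := lossless (h := negp f) (c := c) (t := t) (measurable_negp mf) _ t0 (lt_of _ _ i1).
have -> // : (\int[nuinf]_x (negp f x)%:E = +oo)%E by apply/int_eqNy.
by move=> /(_ _)/=; rewrite ltxx => H; exfalso; apply: notF; apply: H => x; rewrite negp_ge0 (le_trans (negp_abs _ _)).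
Qed.

End zolotarev_contraction.

Local Notation Re := complex.Re.
Local Notation Im := complex.Im.

Lemma complex_split (R : realType) (a b c e : R) : a = c -> b = e -> a +i* b = c +i* e.
Proof. by move=> -> ->. Qed.

(** * Fixed point equations of the limit laws *)

Section uniform_mixture.
Context (R : realType).
Local Notation U01 := (@U01 R).
Implicit Types (nu m : probability R R) (f : R -> R).

Lemma int_U01_leb f : measurable_fun setT f ->
  \int[U01]_x f x = \int[@lebesgue_measure R]_(x in `[0, 1]) f x.
Proof.
move=> mf; rewrite /Rintegral; congr fine; rewrite integralE [RHS]integralE.
by congr (_ - _)%E; apply: ge0_int_U01 => //; [apply: measurable_funepos|apply: measurable_funeneg]; exact/measurable_EFinP.
Qed.

Lemma measurable_powM (q : R) : measurable_fun setT (fun z : R * R => z.1 `^ q * z.2).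
Proof.
apply: measurable_funM; last exact: measurable_snd.
by apply: (measurableT_comp (measurable_powR q)); exact: measurable_fst.
Qed.

Lemma mixture_charfun (q : R) nu m :
  (forall xi, charfun nu xi = (\int[U01]_tau Re (charfun m (tau `^ q * xi))) +i*
                              (\int[U01]_tau Im (charfun m (tau `^ q * xi)))) ->
  forall f, bdm f -> \int[nu]_v f v = \int[U01]_tau \int[m]_w f (tau `^ q * w).
Proof.
move=> h f bf.
pose nu' : probability R R := law (U01 \x m)%E (measurable_powM q).
have E u : bdm u -> \int[nu']_v u v = \int[U01]_tau \int[m]_w u (tau `^ q * w).
  by move=> bu; rewrite bdm_law// bdm_fubini//; exact: (bdm_comp bu (measurable_powM q)).
rewrite -E// /Rintegral; congr fine; apply: eq_measure_integral => S mS _.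
apply: charfun_inj mS => xi; rewrite h /charfun /cexpect /cint.
have [b1 b2] : cbdm (fun x : R => cexpi (xi * x)) by apply: cbdm_cexpi; exact: measurable_funM.
have hE (tau w : R) : tau `^ q * xi * w = xi * (tau `^ q * w) by ring.
rewrite (E _ b1) (E _ b2); apply: complex_split; apply: eq_Rintegral => tau _.
  rewrite -[LHS]/(\int[m]_x Re (cexpi (tau `^ q * xi * x))).
  by apply: eq_Rintegral => w _; rewrite hE.
rewrite -[LHS]/(\int[m]_x Im (cexpi (tau `^ q * xi * x))).
by apply: eq_Rintegral => w _; rewrite hE.
Qed.

(** Makes the almost sure sign of the variable pointwise, so that identities valid for nonnegative
    arguments only can be used under the integral. *)
Lemma int_abs nu f : nu `]-oo, 0[%classic = 0%E -> measurable_fun setT f ->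
  \int[nu]_v f v = \int[nu]_v f `|v|.
Proof.
move=> n0 mf; rewrite /Rintegral; congr fine; apply: ae_eq_integral => //.
- exact/measurable_EFinP.
- by apply/measurable_EFinP; exact: (measurableT_comp mf).
exists `]-oo, 0[%classic; split => // x /=; rewrite in_itv/=.
by apply: contra_notP => /negP; rewrite -leNgt => x0 _; rewrite ger0_norm.
Qed.

End uniform_mixture.

Section multiplicative.
Context (R : realType) (I : Type) d (T : measurableType d) (P : probability T R).
Variables (B : I -> T -> R) (mB : forall i, measurable_fun setT (B i)) (B0 : forall i x, 0 <= B i x).
Variable zeta : probability R R.
Hypothesis zabs : forall f, bdm f -> \int[zeta]_v f v = \int[zeta]_v f `|v|.

Lemma bdm_absr (F : T * R -> R) : bdm F -> bdm (fun z : T * R => F (z.1, `|z.2 : R|)).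
Proof.
move=> bF; apply: (bdm_comp bF); apply: measurable_fun_pair; first exact: measurable_fst.
by apply: (measurableT_comp (@normr_measurable R setT)); exact: measurable_snd.
Qed.

Lemma smk_abs s (F : T * R -> R) : bdm F ->
  \int[smk P mB zeta s]_z F z = \int[smk P mB zeta s]_z F (z.1, `|z.2|).
Proof.
elim: s F => [|i s IH] F bF.
  by rewrite !int_smk_nil//; [by under [RHS]eq_Rintegral do rewrite normr0|exact: bdm_absr].
have bz (z : T * R) (H : T * R -> R) : bdm H -> bdm (fun v : R => H (z.1, z.2 + B i z.1 * v)).
  by move=> bH; exact: (bdm_slice (bdm_shift mB i bH) z).
have key (H : T * R -> R) : bdm H -> \int[smk P mB zeta (i :: s)]_z H z =
    \int[smk P mB zeta s]_z \int[zeta]_v H (z.1, `|z.2| + B i z.1 * `|v|).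
  move=> bH; apply: etrans (@int_smk_cons _ _ _ _ P B mB zeta i s H bH) _.
  apply: etrans (IH _ (bdm_avg P mB zeta i bH)) _.
  apply: eq_Rintegral => z _ /=.
  exact: (zabs (bz (z.1, `|z.2|) H bH)).
rewrite key// key; last exact: bdm_absr.
apply: eq_Rintegral => z _; apply: eq_Rintegral => v _ /=.
by rewrite (ger0_norm (addr_ge0 _ _))// mulr_ge0.
Qed.

Variable G : R -> R[i].
Hypotheses (cG : cbdm G) (G0 : G 0 = 1) (GD : forall w v, 0 <= w -> 0 <= v -> G (w + v) = G w * G v).

Definition cfac i x : R[i] := cexpect zeta (fun v => G (B i x * v)).

Lemma cbdm_comp d1 d2 (T1 : measurableType d1) (T2 : measurableType d2) (H : T2 -> R[i]) (h : T1 -> T2) :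
  cbdm H -> measurable_fun setT h -> cbdm (fun x => H (h x)).
Proof. by move=> [b1 b2] mh; split; [exact: (bdm_comp b1 mh)|exact: (bdm_comp b2 mh)]. Qed.

Lemma cbdm_cfac i : cbdm (cfac i).
Proof.
have mH : measurable_fun setT (fun z : T * R => B i z.1 * z.2).
  apply: measurable_funM => //; apply: (measurableT_comp (mB i)); exact: measurable_fst.
have [b1 b2] := cbdm_comp cG mH.
by split; [exact: (bdm_fubini_F P zeta b1)|exact: (bdm_fubini_F P zeta b2)].
Qed.

(** The induction of [smk_cexpi], for a [G] that is multiplicative on nonnegative arguments only:
    the variables are replaced by their absolute values before [GD] is applied. *)
Lemma smk_mult s (H : T -> R[i]) : cbdm H ->
  \int[smk P mB zeta s]_z Re (H z.1 * G z.2) = \int[P]_x Re (H x * \prod_(i <- s) cfac i x).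
Proof.
elim: s H => [|i s IH] H cH.
  have c1 : cbdm (fun z : T * R => H z.1 * G z.2).
    by apply: cbdmM; [apply: (cbdm_comp cH)|apply: (cbdm_comp cG)].
  rewrite int_smk_nil//; last exact: proj1 c1.
  by apply: eq_Rintegral => x _ /=; rewrite G0 big_nil.
have cK : cbdm (fun x => H x * cfac i x) by apply: cbdmM => //; exact: cbdm_cfac.
have c1 (L : T -> R[i]) : cbdm L -> cbdm (fun z : T * R => L z.1 * G z.2).
  by move=> cL; apply: cbdmM; [apply: (cbdm_comp cL)|apply: (cbdm_comp cG)].
rewrite int_smk_cons//; last exact: proj1 (c1 _ cH).
under [RHS]eq_Rintegral do rewrite big_cons mulrA.
rewrite -IH// smk_abs; last exact: (bdm_avg P mB zeta i (proj1 (c1 _ cH))).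
rewrite [RHS]smk_abs; last exact: (proj1 (c1 _ cK)).
apply: eq_Rintegral => z _ /=.
have mv : measurable_fun setT (fun v : R => B i z.1 * v) by exact: measurable_funM.
have mv' : measurable_fun setT (fun v : R => `|z.2| + B i z.1 * v) by exact: measurable_funD.
have mw : measurable_fun setT (fun v : R => B i z.1 * `|v|) by exact: (measurableT_comp mv).
set a := H z.1 * G `|z.2|.
rewrite [H z.1 * _ * _]mulrAC -/a.
have cHz : cbdm (fun _ : R => H z.1) by split; exact: bdm_cst.
rewrite zabs; last exact: (proj1 (cbdmM cHz (cbdm_comp cG mv'))).
transitivity (\int[zeta]_v (Re a * Re (G (B i z.1 * `|v|)) - Im a * Im (G (B i z.1 * `|v|)))).
  apply: eq_Rintegral => v _; rewrite -ReM; congr Re.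
  by rewrite /a -mulrA GD// mulr_ge0.
have [b1 b2] := cbdm_comp cG mw.
rewrite bdm_RintB; [|exact: bdmZ|exact: bdmZ].
rewrite (bdm_RintZ zeta (Re a) b1) (bdm_RintZ zeta (Im a) b2) [RHS]ReM.
have [e1 e2] := cbdm_comp cG mv.
rewrite -[Re (cfac i z.1)]/(\int[zeta]_v Re (G (B i z.1 * v))) -[Im (cfac i z.1)]/(\int[zeta]_v Im (G (B i z.1 * v))).
by rewrite (zabs e1) (zabs e2).
Qed.

Lemma sm_mult s : \int[sm P mB zeta s]_w Re (G w) +i* \int[sm P mB zeta s]_w Im (G w) =
  cexpect P (fun x => \prod_(i <- s) cfac i x).
Proof.
have c1 : cbdm (fun _ : T => 1 : R[i]) by split; exact: bdm_cst.
have c2 : cbdm (fun _ : T => - 'i : R[i]) by split; exact: bdm_cst.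
have [b1 b2] := cG.
rewrite /cexpect /cint; apply: complex_split.
  rewrite int_sm//; have := smk_mult s c1.
  by under eq_Rintegral do rewrite mul1r; move=> ->; apply: eq_Rintegral => x _; rewrite mul1r.
have hI (z : R[i]) : Re (- 'i * z) = Im z by case: z => a b /=; ring.
rewrite int_sm//; have := smk_mult s c2.
by under eq_Rintegral do rewrite hI; move=> ->; apply: eq_Rintegral => x _; rewrite hI.
Qed.

End multiplicative.

Section fixed_points.
Context (R : realType) (I : Type) d (T : measurableType d) (P : probability T R).
Variables (A : I -> T -> R) (mA : forall i, measurable_fun setT (A i)) (A0 : forall i x, 0 <= A i x).
Variables (s : seq I) (gamma Q : R) (zeta nuinf : probability R R) (g : R -> R[i]).
Local Notation U01 := (@U01 R).

(* What the proof needs to know of [\hat g_gamma]. *)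
Definition stab (gamma : R) (g : R -> R[i]) : Prop := [/\ cbdm g, g 0 = 1 &
  forall xi y z, 0 <= y -> 0 <= z ->
    g (xi * (y + z) `^ gamma^-1) = g (xi * y `^ gamma^-1) * g (xi * z `^ gamma^-1)].

Hypotheses (gamma0 : 0 < gamma) (zsupp : zeta `]-oo, 0[%classic = 0%E) (hg : stab gamma g).
Hypothesis hz : forall xi, charfun zeta xi =
  cint (@lebesgue_measure R) `[0, 1]%classic (fun tau =>
    cexpect P (fun x => \prod_(i <- s) charfun zeta (xi * pw (A i x) gamma * tau `^ Q))).
Hypothesis hinf : forall xi, charfun nuinf xi = cexpect zeta (fun z => g (xi * z `^ gamma^-1)).

Let B i x := A i x `^ gamma.

Lemma measurable_powA i : measurable_fun setT (B i).
Proof. exact: (measurableT_comp (measurable_powR gamma)). Qed.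

Local Notation mB := measurable_powA.

Lemma zeta_fixed f : bdm f -> \int[zeta]_v f v = \int[U01]_tau \int[sm P mB zeta s]_w f (tau `^ Q * w).
Proof.
apply: mixture_charfun => xi; rewrite hz /cint.
have mh : measurable_fun setT (fun tau : R => tau `^ Q * xi) by apply: measurable_funM => //; exact: measurable_powR.
have [b1 b2] := cbdm_charfun (sm P mB zeta s) U01 mh.
have E tau : cexpect P (fun x => \prod_(i <- s) charfun zeta (xi * pw (A i x) gamma * tau `^ Q)) =
   charfun (sm P mB zeta s) (tau `^ Q * xi).
  rewrite charfun_sm; congr (cexpect P _); apply/funext => x; apply: eq_bigr => i _.
  (* The conventions for a zero weight agree, since [gamma] is positive. *)
  congr (charfun zeta _); rewrite /B /pw; case: eqP => [->|_]; last by ring.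
  by rewrite powR0 ?gt_eqF//; ring.
rewrite !int_U01_leb; [|by case: b2|by case: b1].
by apply: complex_split; apply: eq_Rintegral => tau _; rewrite E.
Qed.

Lemma zeta_abs f : bdm f -> \int[zeta]_v f v = \int[zeta]_v f `|v|.
Proof. by move=> [mf _]; exact: int_abs. Qed.

Lemma B_ge0 i x : 0 <= B i x. Proof. exact: powR_ge0. Qed.

Lemma cbdm_groot xi : cbdm (fun z : R => g (xi * z `^ gamma^-1)).
Proof.
have [cg _ _] := hg; apply: (cbdm_comp cg); exact: measurable_funM.
Qed.

Lemma cfac_charfun xi i x : cfac B zeta (fun z => g (xi * z `^ gamma^-1)) i x = charfun nuinf (A i x * xi).
Proof.
have mB' : measurable_fun setT (fun v : R => B i x * v) by exact: measurable_funM.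
have [b1 b2] := cbdm_comp (cbdm_groot xi) mB'.
have [e1 e2] := cbdm_groot (A i x * xi).
have E (v : R) : xi * (B i x * `|v|) `^ gamma^-1 = A i x * xi * `|v| `^ gamma^-1.
  rewrite powRM ?B_ge0// /B -powRrM mulfV ?gt_eqF// powRr1//; ring.
rewrite hinf.
transitivity ((\int[zeta]_v Re (g (xi * (B i x * v) `^ gamma^-1))) +i* (\int[zeta]_v Im (g (xi * (B i x * v) `^ gamma^-1)))); first by [].
rewrite (zeta_abs b1) (zeta_abs b2).
transitivity ((\int[zeta]_v Re (g (A i x * xi * v `^ gamma^-1))) +i* (\int[zeta]_v Im (g (A i x * xi * v `^ gamma^-1)))); last by [].
rewrite (zeta_abs e1) (zeta_abs e2).
by apply: complex_split; apply: eq_Rintegral => v _; rewrite E.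
Qed.

(** The equation of [zeta] has weights [A_i^gamma] and factor [tau^Q]. Integrating
    [z |-> g (xi z^(1/gamma))] takes their [gamma]-th roots: the factor of index [i] becomes
    [charfun nuinf (A_i xi)], and [tau^Q] becomes [tau^(Q / gamma)]. *)
Lemma nuinf_fixed : fixpt P mA s (Q / gamma) nuinf.
Proof.
apply: mixture_charfun => xi; rewrite hinf.
have [cg g0 gD] := hg.
have [b1 b2] := cbdm_groot xi.
have root (tau w : R) : xi * (tau `^ Q * `|w|) `^ gamma^-1 = tau `^ (Q / gamma) * xi * `|w| `^ gamma^-1.
  by rewrite powRM ?powR_ge0// -powRrM; ring.
have mq tau : measurable_fun setT (fun w : R => tau `^ Q * w) by exact: measurable_funM.
have key tau : (\int[sm P mB zeta s]_w Re (g (xi * (tau `^ Q * w) `^ gamma^-1))) +i*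
    (\int[sm P mB zeta s]_w Im (g (xi * (tau `^ Q * w) `^ gamma^-1))) =
    charfun (sm P mA nuinf s) (tau `^ (Q / gamma) * xi).
  rewrite charfun_sm.
  set x0 := tau `^ (Q / gamma) * xi.
  transitivity (cexpect P (fun x => \prod_(i <- s) cfac B zeta (fun z => g (x0 * z `^ gamma^-1)) i x)); last first.
    congr (cexpect P _); apply/funext => x; apply: eq_bigr => i _; exact: cfac_charfun.
  rewrite -(sm_mult P mB B_ge0 zeta_abs (cbdm_groot x0)); last 2 first.
  - by rewrite powR0 ?invr_eq0 ?gt_eqF// mulr0.
  - by move=> w v w0 v0; exact: gD.
  have absm (u : R -> R) : bdm u -> \int[sm P mB zeta s]_w u w = \int[sm P mB zeta s]_w u `|w|.
    move=> bu; have bu' : bdm (fun w : R => u `|w|) by apply: (bdm_comp bu).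
    rewrite !int_sm// (smk_abs P mB B_ge0 zeta_abs)//; exact: bdm_snd.
  have [a1 a2] := cbdm_comp (cbdm_groot xi) (mq tau).
  have [c1 c2] := cbdm_groot x0.
  by apply: complex_split; [rewrite (absm _ a1) (absm _ c1)|rewrite (absm _ a2) (absm _ c2)]; apply: eq_Rintegral => w _; rewrite root.
rewrite /cexpect /cint (zeta_fixed b1) (zeta_fixed b2).
by apply: complex_split; apply: eq_Rintegral => tau _; rewrite -key.
Qed.

End fixed_points.

(** * Factorization of the limit functions *)

Section Hgamma_stab.
Context (R : realType).
Implicit Types (xi y z gamma : R).

Lemma Gamma_ge0 gamma : 0 <= Gamma gamma.
Proof.
by apply: Rintegral_ge0 => x _; rewrite mulr_ge0 ?powR_ge0 ?expR_ge0.
Qed.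

Lemma cbdm_real (h : R -> R) : measurable_fun setT h -> (forall x, 0 <= h x <= 1) -> cbdm (fun x => (h x)%:C).
Proof.
move=> mh h01; split; last exact: bdm_cst.
by split => //; exists 1 => x; have /andP[h0 h1] := h01 x; rewrite ger0_norm.
Qed.

Lemma expRN01 (x : R) : 0 <= x -> 0 <= expR (- x) <= 1.
Proof. by move=> x0; rewrite expR_ge0/= -[leRHS](@expR0 R) ler_expR oppr_le0. Qed.

Lemma realcD (a b : R) : (a * b)%:C = a%:C * b%:C :> R[i].
Proof. by rewrite /GRing.mul/= !mulr0 mul0r subr0 addr0. Qed.

Lemma polarM (a b c e : R) : (expR (a + b))%:C * cexpi (c + e) = (expR a)%:C * cexpi c * ((expR b)%:C * cexpi e) :> R[i].
Proof. by rewrite expRD realcD cexpiD mulrACA. Qed.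

Lemma measurable_sgr : measurable_fun setT (fun x : R => Num.sg x).
Proof.
rewrite (_ : (fun x => _) = (fun x => \1_`]0%R, +oo[ x - \1_`]-oo, 0%R[ x)).
  by apply: measurable_funB; exact: measurable_indic.
apply/funext => x; rewrite !indicE !mem_setE/= !in_itv/= andbT.
case: (ltgtP x 0) => [x0|x0|->].
- by rewrite ltr0_sg// sub0r.
- by rewrite gtr0_sg// subr0.
- by rewrite sgr0 subrr.
Qed.

(** In each case the exponent of [g] is positively homogeneous of degree [gamma], so
    [y |-> g (xi y^(1/gamma))] is the exponential of a linear function on [y >= 0]. Boundedness
    rests on [k0 >= 0], where [gamma <= 2] keeps the sine nonnegative. *)
Lemma Hgamma_stab (mu0 : probability R R) gamma (g : R -> R[i]) :
  0 < gamma <= 2 -> Hgamma mu0 gamma g -> stab gamma g.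
Proof.
move=> /andP[g0 g2]; case=> [[gE]|[[gE [s2 [_ _ s20 _ ->]]]|[[/andP[_ gl2] gn1] [c0p [c0m /= [_ _ cp _ ->]]]]]].
- rewrite /stab gE invr1; case=> [[_ ->]|[c [_ _ _ c0 ->]]]; split.
  + by apply: cbdm_cexpi; exact: measurable_funM.
  + by rewrite mulr0 /cexpi cos0 sin0.
  + by move=> xi y z y0 z0; rewrite -cexpiD !powRr1 ?addr_ge0//; congr cexpi; ring.
  + apply: cbdm_real => [|x].
      apply: (measurableT_comp (@measurable_expR R)); apply: measurable_funM => //.
    by rewrite !mulNr; apply: expRN01; rewrite !mulr_ge0 ?pi_ge0// ltW.
  + by rewrite normr0 mulr0 expR0.
  + move=> xi y z y0 z0; rewrite -realcD -expRD !powRr1 ?addr_ge0//; congr (expR _)%:C.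
    by rewrite !normrM (ger0_norm y0) (ger0_norm z0) (ger0_norm (addr_ge0 y0 z0)); ring.
- rewrite /stab gE; split.
  + apply: cbdm_real => [|x].
      apply: (measurableT_comp (@measurable_expR R)); apply: measurable_funM => //.
      by apply: measurable_funM => //; apply: measurable_funX.
    by rewrite !mulNr; apply: expRN01; rewrite divr_ge0// mulr_ge0 ?sqr_ge0// ltW.
  + by rewrite expr0n mulr0 mul0r expR0.
  + move=> xi y z y0 z0; rewrite -realcD -expRD; congr (expR _)%:C.
    have sq w : 0 <= w -> (w `^ 2^-1) ^+ 2 = w.
      by move=> w0; rewrite -powR_mulrn ?powR_ge0// -powRrM mulVf// powRr1.
    by rewrite !exprMn !sq ?addr_ge0//; field.
set k0 := (c0p + c0m) * _; set eta := (c0p - c0m) / _; set tn := tan _.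
have k00 : 0 <= k0.
  rewrite mulr_ge0 ?(ltW cp)// divr_ge0 ?pi_ge0// !mulr_ge0 ?Gamma_ge0//.
  have p0 := pi_ge0 R.
  apply: sin_ge0_pi; rewrite divr_ge0 ?mulr_ge0 ?(ltW g0)//=.
  by rewrite ler_pdivrMr// ler_wpM2l.
have nE xi y : 0 <= y -> `|xi * y `^ gamma^-1| `^ gamma = `|xi| `^ gamma * y.
  move=> y0; rewrite normrM (ger0_norm (powR_ge0 _ _)) powRM ?powR_ge0//.
  by rewrite -powRrM mulVf ?gt_eqF// powRr1.
(* The factor [y] covers [y = 0], where the sign on the left vanishes. *)
have sE xi y : 0 <= y -> y * Num.sg (xi * y `^ gamma^-1) = y * Num.sg xi.
  rewrite le_eqVlt => /predU1P[<-|y0]; first by rewrite !mul0r.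
  by rewrite sgrM (gtr0_sg (powR_gt0 _ y0)) mulr1.
split.
- apply: cbdmM; first apply: cbdm_real => [|x].
  + apply: (measurableT_comp (@measurable_expR R)); apply: measurable_funM => //.
    by apply: (measurableT_comp (measurable_powR gamma)); exact: normr_measurable.
  + by rewrite mulNr; apply: expRN01; rewrite mulr_ge0// powR_ge0.
  + apply: cbdm_cexpi; apply: measurable_funM; last exact: measurable_sgr.
    apply: measurable_funM => //; apply: measurable_funM => //; apply: measurable_funM => //.
    by apply: (measurableT_comp (measurable_powR gamma)); exact: normr_measurable.
- by rewrite normr0 powR0 ?gt_eqF// !mulr0 !mul0r expR0 /cexpi cos0 sin0 mulr1.
- move=> xi y z y0 z0; rewrite -polarM.
  rewrite !nE ?addr_ge0//; set a := `|xi| `^ gamma.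
  have -> : - k0 * (a * (y + z)) = - k0 * (a * y) + - k0 * (a * z) by ring.
  suff -> : k0 * (a * (y + z)) * eta * tn * Num.sg (xi * (y + z) `^ gamma^-1) =
    k0 * (a * y) * eta * tn * Num.sg (xi * y `^ gamma^-1) + k0 * (a * z) * eta * tn * Num.sg (xi * z `^ gamma^-1) by [].
  transitivity (k0 * a * eta * tn * ((y + z) * Num.sg (xi * (y + z) `^ gamma^-1))); first by ring.
  transitivity (k0 * a * eta * tn * (y * Num.sg (xi * y `^ gamma^-1)) + k0 * a * eta * tn * (z * Num.sg (xi * z `^ gamma^-1))); last by ring.
  by rewrite !sE ?addr_ge0//; ring.
Qed.

End Hgamma_stab.

(** * Moments of a fixed point with a light tail *)

Section power_inequalities.
Context (R : realType).
Implicit Types (a b c p q t K v w : R).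

(** Weighted arithmetic-geometric inequality, read off from the tangent of the exponential at
    [p ln b]. *)
Lemma powR_interp (g p e b : R) : 0 < g -> g < p -> p <= e -> 0 <= b ->
  b `^ p <= (e - p) / (e - g) * b `^ g + (p - g) / (e - g) * b `^ e.
Proof.
move=> g0 gp pe; have eg : 0 < e - g by lra.
have p0 : 0 < p by lra.
have e0 : 0 < e by lra.
rewrite le_eqVlt => /predU1P[<-|b0]; first by rewrite !powR0 ?gt_eqF// !mulr0 addr0.
rewrite /powR gt_eqF//; set l := ln b.
have t1 := expR_ge1Dx (g * l - p * l); have t2 := expR_ge1Dx (e * l - p * l).
have -> : expR (g * l) = expR (p * l) * expR (g * l - p * l) by rewrite -expRD; congr expR; ring.
have -> : expR (e * l) = expR (p * l) * expR (e * l - p * l) by rewrite -expRD; congr expR; ring.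
rewrite [_ / _ * _]mulrCA [X in _ <= _ + X]mulrCA -mulrDr ler_peMr ?expR_ge0//.
have th1 : 0 <= (e - p) / (e - g) by rewrite divr_ge0//; lra.
have th2 : 0 <= (p - g) / (e - g) by rewrite divr_ge0//; lra.
have := ler_wpM2l th1 t1; have := ler_wpM2l th2 t2.
have : (e - p) / (e - g) * (1 + (g * l - p * l)) + (p - g) / (e - g) * (1 + (e * l - p * l)) = 1.
  by field; rewrite gt_eqF.
lra.
Qed.

Lemma bernoulli_pow (n : nat) t : 0 <= t <= 1 -> (1 + t) ^+ n <= 1 + (2 ^+ n - 1) * t.
Proof.
move=> /andP[t0 t1]; elim: n => [|n IH]; first by rewrite !expr0 subrr mul0r addr0.
have t10 : 0 <= 1 + t by lra.
have n1 : 1 <= 2 ^+ n :> R by rewrite exprn_ege1// ler1n.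
rewrite !exprS (le_trans (ler_wpM2l t10 IH))//.
move: (2 ^+ n) n1 => m m1; have : 0 <= (m - 1) * (t * (1 - t)) by rewrite !mulr_ge0//; lra.
lra.
Qed.

Lemma powR_split p a : 0 < a -> a `^ p = a * a `^ (p - 1).
Proof. by move=> a0; rewrite -{2}(powRr1 (ltW a0)) -powRD ?(gt_eqF a0) ?implybT//; congr powR; ring. Qed.

(** For [p <= 1] this is subadditivity, and the value [c = 0] is recorded because no cross moment
    then has to be finite. For [p > 1] the larger term is factored out and Bernoulli's inequality is
    applied with an integer exponent above [p]. *)
Lemma powR_add p : 0 < p -> exists c, [/\ 0 <= c, p <= 1 -> c = 0 & forall a b, 0 <= a -> 0 <= b ->
  (a + b) `^ p <= a `^ p + b `^ p + c * (a `^ (p - 1) * b + a * b `^ (p - 1))].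
Proof.
move=> p0; have [p1|p1] := leP p 1.
  exists 0; split=> // a b a0 b0; rewrite mul0r addr0.
  move: a0; rewrite le_eqVlt => /predU1P[<-|a0]; first by rewrite add0r lerDr powR_ge0.
  have ab : 0 < a + b by lra.
  have fa : a / (a + b) <= (a / (a + b)) `^ p.
    by apply: ger1_powR => //; rewrite divr_gt0// ler_pdivrMr// mul1r lerDl.
  have fb : b / (a + b) <= (b / (a + b)) `^ p.
    move: b0; rewrite le_eqVlt => /predU1P[<-|b0]; first by rewrite mul0r powR_ge0.
    by apply: ger1_powR => //; rewrite divr_gt0// ler_pdivrMr// mul1r lerDr ltW.
  have E x : 0 <= x -> (x / (a + b)) `^ p * (a + b) `^ p = x `^ p.
    by move=> x0; rewrite -powRM ?divr_ge0 ?(ltW ab)// divfK// gt_eqF.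
  rewrite -(E a (ltW a0)) -(E b b0) -mulrDl ler_peMl ?powR_ge0//.
  apply: le_trans (lerD fa fb); rewrite -mulrDl divff// gt_eqF//.
pose n := Num.bound p; pose c : R := 2 ^+ n - 1.
have pn : p <= n%:R by rewrite ltW// archi_boundP// ltW.
have c0 : 0 <= c by rewrite subr_ge0 exprn_ege1// ler1n.
have key a b : 0 <= b -> b <= a -> (a + b) `^ p <= a `^ p + b `^ p + c * (a `^ (p - 1) * b + a * b `^ (p - 1)).
  move=> b0 ba; have a0 : 0 <= a by exact: le_trans ba.
  move: (a0); rewrite le_eqVlt => /predU1P[az|a1].
    have -> : b = 0 by apply/eqP; rewrite eq_le b0 az ba.
    by rewrite addr0 mulr0 add0r !powR0 ?gt_eqF ?subr_gt0// !mulr0 !addr0.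
  have t01 : 0 <= b / a <= 1 by rewrite divr_ge0//= ler_pdivrMr// mul1r.
  have aE : a + b = a * (1 + b / a) by field; rewrite gt_eqF.
  have /andP[t0 t1] := t01.
  have B : (1 + b / a) `^ p <= 1 + c * (b / a).
    apply: le_trans (bernoulli_pow n t01); rewrite -powR_mulrn; last by lra.
    by apply: ler_powR => //; lra.
  rewrite aE powRM//; last by lra.
  apply: (le_trans (ler_wpM2l (powR_ge0 _ _) B)).
  have -> : a `^ p * (1 + c * (b / a)) = a `^ p + c * (a `^ (p - 1) * b).
    by rewrite (powR_split p a1); field; rewrite gt_eqF.
  have := powR_ge0 b p; have := mulr_ge0 c0 (mulr_ge0 a0 (powR_ge0 b (p - 1))); lra.
exists c; split=> // a b a0 b0.
have [ba|ab] := leP b a; first exact: key.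
have := key b a a0 (ltW ab); rewrite (addrC b a) => /le_trans; apply.
by rewrite le_eqVlt; apply/orP; left; apply/eqP; ring.
Qed.

Lemma powR_add2 q a b : 0 <= q -> 0 <= a -> 0 <= b -> (a + b) `^ q <= 2 `^ q * (a `^ q + b `^ q).
Proof.
move=> q0 a0 b0.
have key (u v : R) : 0 <= u -> u <= v -> (u + v) `^ q <= 2 `^ q * (u `^ q + v `^ q).
  move=> u0 uv; have v0 : 0 <= v by exact: le_trans uv.
  apply: (@le_trans _ _ ((2 * v) `^ q)).
    by apply: ge0_ler_powR => //; rewrite ?nnegrE ?addr_ge0 ?mulr_ge0//; lra.
  by rewrite powRM// ler_wpM2l ?powR_ge0// lerDr powR_ge0.
have [ab|/ltW ba] := leP a b; first exact: key.
by rewrite addrC [X in _ * X]addrC; exact: key.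
Qed.

Lemma powR_young p a b : 1 < p -> 0 <= a -> 0 <= b -> a * b `^ (p - 1) <= a `^ p + b `^ p.
Proof.
move=> p1 a0 b0; have pm : 0 <= p - 1 by lra.
have p0 : 0 < p by lra.
have [ab|/ltW ba] := leP a b.
  move: b0; rewrite le_eqVlt => /predU1P[<-|b0]; first by rewrite powR0 ?mulr0 ?addr_ge0 ?powR_ge0// gt_eqF//; lra.
  by rewrite (powR_split p b0) (le_trans (ler_wpM2r (powR_ge0 _ _) ab))// lerDr powR_ge0.
move: a0; rewrite le_eqVlt => /predU1P[<-|a0]; first by rewrite mul0r addr_ge0 ?powR_ge0.
rewrite (powR_split p a0) (@le_trans _ _ (a * a `^ (p - 1)))//; last by rewrite lerDl powR_ge0.
rewrite ler_wpM2l ?(ltW a0)//; apply: ge0_ler_powR => //; rewrite nnegrE ltW//.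
Qed.

Definition pos v := Num.max v 0.

(** Truncation from above makes all moments finite before any is known to be. It suits the fixed
    point equation because it is subadditive and a scaling only moves the level, as in [cutM]. *)
Definition cut K v := Num.min (pos v) K.

Lemma pos_ge0 v : 0 <= pos v. Proof. by rewrite le_max lexx orbT. Qed.

Lemma posD v w : pos (v + w) <= pos v + pos w.
Proof.
by rewrite ge_max lerD ?le_max ?lexx//= addr_ge0 ?pos_ge0.
Qed.

Lemma posM b v : 0 <= b -> pos (b * v) = b * pos v.
Proof. by move=> b0; rewrite /pos maxr_pMr// mulr0. Qed.

Lemma cut_ge0 K v : 0 <= K -> 0 <= cut K v.
Proof. by move=> K0; rewrite le_min pos_ge0. Qed.

Lemma cut_le K v : cut K v <= K. Proof. by rewrite ge_min lexx orbT. Qed.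

Lemma cut_pos K v : cut K v <= pos v. Proof. by rewrite ge_min lexx. Qed.

Lemma cutD K v w : 0 <= K -> cut K (v + w) <= cut K v + cut K w.
Proof.
move=> K0; have := posD v w; have := pos_ge0 v; have := pos_ge0 w.
rewrite {1}/cut ge_min /cut; move: (pos (v + w)) (pos v) (pos w) => a b c c0 b0 abc.
by case: (leP b K) => bK; case: (leP c K) => cK; apply/orP; [left|right|right|right]; lra.
Qed.

Lemma cutM K b v : 0 < b -> cut K (b * v) = b * cut (K / b) v.
Proof.
move=> b0; rewrite /cut posM ?(ltW b0)// minr_pMr ?(ltW b0)//; congr Num.min.
by rewrite mulrCA divff ?mulr1// gt_eqF.
Qed.

Lemma measurable_pos : measurable_fun setT pos.
Proof. by apply: measurable_maxr. Qed.

Lemma measurable_cut K : measurable_fun setT (cut K).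
Proof. by apply: measurable_minr => //; exact: measurable_pos. Qed.

Lemma bdm_cut K p : 0 <= K -> 0 <= p -> bdm (fun v => cut K v `^ p).
Proof.
move=> K0 p0; split; first exact: (measurableT_comp (measurable_powR p) (measurable_cut K)).
exists (K `^ p) => v; rewrite ger0_norm ?powR_ge0//.
by rewrite ge0_ler_powR ?nnegrE ?cut_ge0// cut_le.
Qed.

End power_inequalities.

Lemma int_prob_cst (R : realType) d (T : measurableType d) (P : probability T R) (c : R) : (\int[P]_x c%:E = c%:E)%E.
Proof. by rewrite bdm_EFin ?Rint_cst//; exact: bdm_cst. Qed.

Section nonneg_integrals.
Context (R : realType) d (T : measurableType d) (m : {measure set T -> \bar R}).
Implicit Types (f g : T -> R).

Lemma ge0_intD f g : measurable_fun setT f -> measurable_fun setT g -> (forall x, 0 <= f x) -> (forall x, 0 <= g x) ->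
  (\int[m]_x (f x + g x)%:E = \int[m]_x (f x)%:E + \int[m]_x (g x)%:E)%E.
Proof.
move=> mf mg f0 g0; rewrite -ge0_integralD//; try exact/measurable_EFinP.
- by move=> x _; rewrite lee_fin.
- by move=> x _; rewrite lee_fin.
Qed.

Lemma ge0_intZ k f : 0 <= k -> measurable_fun setT f -> (forall x, 0 <= f x) ->
  (\int[m]_x (k * f x)%:E = k%:E * \int[m]_x (f x)%:E)%E.
Proof.
move=> k0 mf f0; rewrite -ge0_integralZl_EFin//; first by move=> x _; rewrite lee_fin.
exact/measurable_EFinP.
Qed.

Lemma ge0_intle f g : measurable_fun setT f -> measurable_fun setT g -> (forall x, 0 <= f x <= g x) ->
  (\int[m]_x (f x)%:E <= \int[m]_x (g x)%:E)%E.
Proof.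
move=> mf mg fg; apply: ge0_le_integral => //; try exact/measurable_EFinP.
- by move=> x _; rewrite lee_fin; have /andP[] := fg x.
- by move=> x _; rewrite lee_fin; have /andP[] := fg x.
Qed.

Lemma int_ge0 f : (forall x, 0 <= f x) -> (0 <= \int[m]_x (f x)%:E)%E.
Proof. by move=> f0; apply: integral_ge0 => x _; rewrite lee_fin. Qed.

End nonneg_integrals.

Lemma ge0_int_prodM (R : realType) d1 d2 (T1 : measurableType d1) (T2 : measurableType d2)
  (P : probability T1 R) (Q : probability T2 R) (f : T1 -> R) (g : T2 -> R) :
  measurable_fun setT f -> measurable_fun setT g -> (forall x, 0 <= f x) -> (forall x, 0 <= g x) ->
  (\int[(P \x Q)%E]_z (f z.1 * g z.2)%:E = \int[P]_x (f x)%:E * \int[Q]_y (g y)%:E)%E.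
Proof.
move=> mf mg f0 g0.
have mfg : measurable_fun setT (fun z : T1 * T2 => (f z.1 * g z.2)%:E).
  apply/measurable_EFinP; apply: measurable_funM.
  - by apply: (measurableT_comp mf); exact: measurable_fst.
  - by apply: (measurableT_comp mg); exact: measurable_snd.
rewrite fubini_tonelli1//; last by move=> z; rewrite lee_fin mulr_ge0.
rewrite muleC -ge0_integralZl//; last 3 first.
- exact/measurable_EFinP.
- by move=> x _; rewrite lee_fin.
- exact: int_ge0.
by apply: eq_integral => x _; rewrite /fubini_F/= ge0_intZ// muleC.
Qed.

(** * Truncated moments of the positive part of a fixed point *)

Section truncated_moments.
Context (R : realType) (I : Type) d (T : measurableType d) (P : probability T R).
Variables (B : I -> T -> R) (mB : forall i, measurable_fun setT (B i)) (B0 : forall i x, 0 <= B i x).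
Variable nu : probability R R.
Implicit Types (p q K v w : R).

Definition pmom q : \bar R := (\int[nu]_v (pos v `^ q)%:E)%E.

Lemma pmom_ge0 q : (0 <= pmom q)%E.
Proof. by apply: integral_ge0 => v _; rewrite lee_fin powR_ge0. Qed.

Lemma measurable_posX q : measurable_fun setT (fun v : R => (pos v `^ q)%:E).
Proof. by apply/measurable_EFinP; apply: (measurableT_comp (measurable_powR q)); exact: measurable_pos. Qed.

Lemma pmom_le q p : 0 <= q -> q <= p -> (pmom p < +oo)%E -> (pmom q < +oo)%E.
Proof.
move=> q0 qp fin; apply: (@le_lt_trans _ _ (1 + pmom p)%E); last first.
  by move: fin (pmom_ge0 p); case: (pmom p) => // r _ _; rewrite ltry.
have <- : (\int[nu]_v (1 : R)%:E = 1)%E by exact: int_prob_cst.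
rewrite /pmom -ge0_integralD//; last 2 first.
- by move=> v _; rewrite lee_fin powR_ge0.
- exact: measurable_posX.
apply: ge0_le_integral => //.
- by move=> v _; rewrite lee_fin powR_ge0.
- exact: measurable_posX.
- by apply: emeasurable_funD => //; exact: measurable_posX.
move=> v _; rewrite -EFinD lee_fin.
have [v1|v1] := leP (pos v) 1.
  have : pos v `^ q <= 1 `^ q by rewrite ge0_ler_powR ?nnegrE ?pos_ge0.
  by rewrite powR1; have := powR_ge0 (pos v) p; lra.
have := ler_powR (ltW v1) qp; lra.
Qed.

Lemma measurable_powB i q : measurable_fun setT (fun x => B i x `^ q).
Proof. exact: (measurableT_comp (measurable_powR q)). Qed.

Lemma measurable_posq q : measurable_fun setT (fun v : R => pos v `^ q).
Proof. by apply: (measurableT_comp (measurable_powR q)); exact: measurable_pos. Qed.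

Lemma ge0_int_smk_prod i s (F : T * R -> R) : measurable_fun setT F -> (forall z, 0 <= F z) ->
  (\int[smk P mB nu (i :: s)]_z (F z)%:E =
   \int[(smk P mB nu s \x nu)%E]_z (F (z.1.1, z.1.2 + B i z.1.1 * z.2)%R)%:E)%E.
Proof.
by move=> mF F0; rewrite /= ge0_int_law//; exact/measurable_EFinP.
Qed.

Lemma measurable_F1 (f : T * R -> R) (g : R -> R) : measurable_fun setT f -> measurable_fun setT g ->
  measurable_fun setT (fun z : (T * R) * R => f z.1 * g z.2).
Proof.
move=> mf mg; apply: measurable_funM.
- by apply: (measurableT_comp mf); exact: measurable_fst.
- by apply: (measurableT_comp mg); exact: measurable_snd.
Qed.

Lemma measurable_Hpos (H : T -> R) q : measurable_fun setT H ->
  measurable_fun setT (fun z : T * R => H z.1 * pos z.2 `^ q).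
Proof.
move=> mH; apply: measurable_funM.
- by apply: (measurableT_comp mH); exact: measurable_fst.
- by apply: (measurableT_comp (measurable_posq q)); exact: measurable_snd.
Qed.

Lemma ge0_int_fst_smk (H : T -> R) s : measurable_fun setT H -> (forall x, 0 <= H x) ->
  (\int[smk P mB nu s]_z (H z.1)%:E = \int[P]_x (H x)%:E)%E.
Proof.
move=> mH H0; apply: (@ge0_int_smk_fst _ _ _ _ P B mB nu s (fun x => (H x)%:E)) => //.
exact/measurable_EFinP.
Qed.

Lemma lty_mul (a b : \bar R) : (0 <= a)%E -> (a < +oo)%E -> (0 <= b)%E -> (b < +oo)%E -> (a * b < +oo)%E.
Proof. by case: a => [a||]//; case: b => [b||]// _ _ _ _; rewrite -EFinM ltry. Qed.

Lemma smk_pos_fin (H : T -> R) q s : measurable_fun setT H -> (forall x, 0 <= H x) -> 0 < q ->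
  (forall i, (\int[P]_x (H x * B i x `^ q)%:E < +oo)%E) -> (pmom q < +oo)%E ->
  (\int[smk P mB nu s]_z (H z.1 * pos z.2 `^ q)%:E < +oo)%E.
Proof.
move=> mH H0 q0 hH hq; have mHp := measurable_Hpos q mH.
have Hp0 (z : T * R) : 0 <= H z.1 * pos z.2 `^ q by rewrite mulr_ge0// powR_ge0.
elim: s => [|i s IH].
  rewrite ge0_int_smk_nil//; last exact/measurable_EFinP.
  under eq_integral do rewrite /= /pos maxxx powR0 ?gt_eqF// mulr0.
  by rewrite integral0 ltry.
rewrite ge0_int_smk_prod//.
pose k := 2 `^ q; have k0 : 0 <= k by exact: powR_ge0.
have mHB : measurable_fun setT (fun x => H x * B i x `^ q) by apply: measurable_funM => //; exact: measurable_powB.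
have mHB1 : measurable_fun setT (fun z : T * R => H z.1 * B i z.1 `^ q).
  by apply: (measurableT_comp mHB); exact: measurable_fst.
have HB0 x : 0 <= H x * B i x `^ q by rewrite mulr_ge0// powR_ge0.
pose f1 (z : (T * R) * R) := H z.1.1 * pos z.1.2 `^ q * 1.
pose f2 (z : (T * R) * R) := H z.1.1 * B i z.1.1 `^ q * pos z.2 `^ q.
have mf1 : measurable_fun setT f1 by apply: (measurable_F1 (g := fun=> 1) mHp).
have mf2 : measurable_fun setT f2 by apply: (measurable_F1 mHB1 (measurable_posq q)).
have f10 z : 0 <= f1 z by rewrite mulr_ge0.
have f20 z : 0 <= f2 z by rewrite mulr_ge0// powR_ge0.
apply: (@le_lt_trans _ _ (\int[(smk P mB nu s \x nu)%E]_z (k * (f1 z + f2 z))%:E)%E).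
  apply: ge0_intle.
  - exact: (measurableT_comp mHp (measurable_sstep mB i)).
  - by apply: measurable_funM => //; exact: measurable_funD.
  move=> [[x w] v]; rewrite Hp0/= /f1 /f2/= mulr1.
  have pv : pos (w + B i x * v) <= pos w + B i x * pos v by rewrite -posM//; exact: posD.
  have h1 : pos (w + B i x * v) `^ q <= (pos w + B i x * pos v) `^ q.
    by rewrite ge0_ler_powR ?nnegrE ?pos_ge0 ?addr_ge0 ?mulr_ge0 ?pos_ge0// ltW.
  have h2 := @powR_add2 _ q (pos w) (B i x * pos v) (ltW q0) (pos_ge0 _) (mulr_ge0 (B0 i x) (pos_ge0 v)).
  rewrite powRM ?pos_ge0// in h2.
  have := ler_wpM2l (H0 x) (le_trans h1 h2); rewrite /k; lra.
rewrite ge0_intZ//; [|exact: measurable_funD|by move=> z; rewrite addr_ge0].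
apply: lty_mul; rewrite ?lee_fin ?ltry//; first by apply: int_ge0 => z; rewrite addr_ge0.
have E1 : (\int[(smk P mB nu s \x nu)%E]_z (f1 z)%:E = \int[smk P mB nu s]_z (H z.1 * pos z.2 `^ q)%:E)%E.
  by rewrite /f1 (ge0_int_prodM _ _ (g := fun=> 1) mHp)// int_prob_cst mule1.
have E2 : (\int[(smk P mB nu s \x nu)%E]_z (f2 z)%:E = (\int[P]_x (H x * B i x `^ q)%:E) * pmom q)%E.
  rewrite /f2 (ge0_int_prodM _ _ mHB1 (measurable_posq q))//; last by move=> v; rewrite powR_ge0.
  by rewrite (@ge0_int_fst_smk (fun x => H x * B i x `^ q)).
rewrite ge0_intD// E1 E2 lte_add_pinfty// lty_mul//; first exact: int_ge0.
exact: pmom_ge0.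
Qed.

(** The cross terms of [powR_add] involve only the moments of order [p - 1] and 1 of [nu] and mixed
    moments of the weights, finite by [powR_young]. Hence [C] does not depend on the level [K]. *)
Lemma trunc_sum p c s : 0 < p -> 0 <= c ->
  (forall a b, 0 <= a -> 0 <= b -> (a + b) `^ p <= a `^ p + b `^ p + c * (a `^ (p - 1) * b + a * b `^ (p - 1))) ->
  c = 0 \/ [/\ 1 < p, (pmom (p - 1) < +oo)%E, (pmom 1 < +oo)%E & forall i, (\int[P]_x (B i x `^ p)%:E < +oo)%E] ->
  exists C, [/\ 0 <= C, c = 0 -> C = 0 & forall K, 0 < K ->
   (\int[smk P mB nu s]_z (cut K z.2 `^ p)%:E <=
    \sum_(i <- s) \int[(P \x nu)%E]_z (cut K (B i z.1 * z.2) `^ p)%:E + C%:E)%E].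
Proof.
move=> p0 c0 hc cr.
have mcp K : measurable_fun setT (fun z : T * R => cut K z.2 `^ p).
  by apply: (measurableT_comp (measurable_powR p)); apply: (measurableT_comp (measurable_cut K)); exact: measurable_snd.
elim: s => [|i s [C [C0 cC0 hC]]].
  exists 0; split => // K K0; rewrite big_nil adde0 ge0_int_smk_nil.
  - under eq_integral do rewrite /= /cut /pos maxxx (min_l (ltW K0)) powR0 ?gt_eqF//.
    by rewrite integral0.
  - exact/measurable_EFinP.
  - by move=> z; rewrite lee_fin powR_ge0.
(* The cross term bounded without truncation; it is set to 0 when [c = 0], where no finiteness is
   available. *)
pose X (z : (T * R) * R) := if c == 0 then 0 else
  B i z.1.1 * pos z.1.2 `^ (p - 1) * pos z.2 `^ 1 + B i z.1.1 `^ (p - 1) * pos z.1.2 `^ 1 * pos z.2 `^ (p - 1).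
have X0 z : 0 <= X z by rewrite /X; case: ifP => // _; rewrite addr_ge0// !mulr_ge0 ?powR_ge0.
have mX1 := measurable_F1 (measurable_Hpos (p - 1) (mB i)) (measurable_posq 1).
have mX2 := measurable_F1 (measurable_Hpos 1 (measurable_powB i (p - 1))) (measurable_posq (p - 1)).
have mX : measurable_fun setT X by rewrite /X; case: (c == 0) => //; exact: measurable_funD.
have Xfin : (\int[(smk P mB nu s \x nu)%E]_z (X z)%:E < +oo)%E.
  rewrite /X; case: eqP => [|cn0]; first by rewrite integral0 ltry.
  case: cr => // [[p1 m1 m2 mBp]].
  have pm : 0 < p - 1 by lra.
  have young j k : (\int[P]_x (B j x * B k x `^ (p - 1))%:E < +oo)%E.
    apply: (@le_lt_trans _ _ (\int[P]_x (B j x `^ p + B k x `^ p)%:E)%E).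
      apply: ge0_intle.
      - by apply: measurable_funM => //; exact: measurable_powB.
      - by apply: measurable_funD; exact: measurable_powB.
      by move=> x; rewrite mulr_ge0 ?powR_ge0//=; exact: powR_young.
    rewrite ge0_intD; [exact: lte_add_pinfty|exact: measurable_powB|exact: measurable_powB|..].
    - by move=> x; exact: powR_ge0.
    - by move=> x; exact: powR_ge0.
  have E1 : (\int[(smk P mB nu s \x nu)%E]_z (B i z.1.1 * pos z.1.2 `^ (p - 1) * pos z.2 `^ 1)%:E =
      \int[smk P mB nu s]_z (B i z.1 * pos z.2 `^ (p - 1))%:E * pmom 1)%E.
    apply: (ge0_int_prodM _ _ (measurable_Hpos (p - 1) (mB i)) (measurable_posq 1)) => z; last exact: powR_ge0.
    by rewrite mulr_ge0 ?powR_ge0.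
  have E2 : (\int[(smk P mB nu s \x nu)%E]_z (B i z.1.1 `^ (p - 1) * pos z.1.2 `^ 1 * pos z.2 `^ (p - 1))%:E =
      \int[smk P mB nu s]_z (B i z.1 `^ (p - 1) * pos z.2 `^ 1)%:E * pmom (p - 1))%E.
    apply: (ge0_int_prodM _ _ (measurable_Hpos 1 (measurable_powB i (p - 1))) (measurable_posq (p - 1))) => z; last exact: powR_ge0.
    by rewrite mulr_ge0 ?powR_ge0.
  rewrite ge0_intD//; last 2 first.
  - by move=> z; rewrite !mulr_ge0 ?powR_ge0.
  - by move=> z; rewrite !mulr_ge0 ?powR_ge0.
  rewrite E1 E2 lte_add_pinfty//.
    apply: lty_mul => //; [|exact: smk_pos_fin|exact: pmom_ge0].
    by apply: int_ge0 => z; rewrite mulr_ge0 ?powR_ge0.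
  have young' j : (\int[P]_x (B i x `^ (p - 1) * B j x `^ 1)%:E < +oo)%E.
    have := young j i; rewrite (_ : (fun x => (B j x * B i x `^ (p - 1))%:E) = (fun x => (B i x `^ (p - 1) * B j x `^ 1)%:E))//.
    by apply/funext => x; rewrite powRr1// mulrC.
  have S := @smk_pos_fin (fun x => B i x `^ (p - 1)) 1 s (measurable_powB i (p - 1)) (fun x => powR_ge0 _ _) ltr01 young' m2.
  apply: lty_mul => //; [|exact: pmom_ge0].
  by apply: int_ge0 => z; rewrite mulr_ge0 ?powR_ge0.
have XE0 : (0 <= \int[(smk P mB nu s \x nu)%E]_z (X z)%:E)%E by exact: int_ge0.
pose x0 := fine (\int[(smk P mB nu s \x nu)%E]_z (X z)%:E)%E.
have xE : (\int[(smk P mB nu s \x nu)%E]_z (X z)%:E = x0%:E)%E by rewrite fineK// ge0_fin_numE.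
have x00 : 0 <= x0 by rewrite fine_ge0.
exists (C + c * x0); split=> [|cz|K K0].
- by rewrite addr_ge0// mulr_ge0.
- by rewrite cC0// cz mul0r addr0.
pose f1 (z : (T * R) * R) := cut K z.1.2 `^ p * 1.
pose f2 (z : (T * R) * R) := cut K (B i z.1.1 * z.2) `^ p.
have mf1 : measurable_fun setT f1 by apply: (measurable_F1 (g := fun=> 1) (mcp K)).
have mf2T : measurable_fun setT (fun z : T * R => cut K (B i z.1 * z.2) `^ p).
  apply: (measurableT_comp (measurable_powR p)); apply: (measurableT_comp (measurable_cut K)).
  apply: measurable_funM; last exact: measurable_snd.
  by apply: (measurableT_comp (mB i)); exact: measurable_fst.
have mf2 : measurable_fun setT f2.
  apply: (measurableT_comp (measurable_powR p)); apply: (measurableT_comp (measurable_cut K)).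
  apply: measurable_funM; last exact: measurable_snd.
  by apply: (measurableT_comp (mB i)); apply: (measurableT_comp (@measurable_fst _ _ T R)); exact: measurable_fst.
rewrite ge0_int_smk_prod//; last by move=> z; exact: powR_ge0.
apply: (@le_trans _ _ (\int[(smk P mB nu s \x nu)%E]_z (f1 z + f2 z + c * X z)%:E)%E).
  apply: ge0_intle.
  - exact: (measurableT_comp (mcp K) (measurable_sstep mB i)).
  - by apply: measurable_funD; [exact: measurable_funD|exact: measurable_funM].
  move=> [[x w] v]; rewrite powR_ge0/= /f1 /f2/= mulr1.
  set a := cut K w; set b := cut K (B i x * v).
  have a0 : 0 <= a by exact/cut_ge0/ltW.
  have b0 : 0 <= b by exact/cut_ge0/ltW.
  have h1 : cut K (w + B i x * v) `^ p <= (a + b) `^ p.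
    by rewrite ge0_ler_powR ?nnegrE ?(ltW p0) ?addr_ge0 ?cut_ge0 ?(ltW K0)// cutD// ltW.
  apply: (le_trans h1); apply: (le_trans (hc a b a0 b0)); rewrite lerD2l /X.
  case: eqP => [->|cn0]; first by rewrite !mul0r.
  case: cr => // [[p1 _ _ _]]; rewrite ler_wpM2l//=.
  have pm : 0 <= p - 1 by lra.
  have aw : a <= pos w by exact: cut_pos.
  have bv : b <= B i x * pos v by rewrite -posM//; exact: cut_pos.
  have Bv0 : 0 <= B i x * pos v by exact: le_trans bv.
  have mono (y z : R) : 0 <= y -> y <= z -> y `^ (p - 1) <= z `^ (p - 1).
    by move=> y0 yz; rewrite ge0_ler_powR// nnegrE// (le_trans y0).
  rewrite !powRr1 ?pos_ge0// lerD//.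
    rewrite -mulrA [B i x * _]mulrC -mulrA [pos v * _]mulrC ler_pM ?powR_ge0//; exact: mono.
  rewrite [B i x `^ _ * _]mulrC -mulrA -powRM ?pos_ge0// ler_pM ?powR_ge0//; exact: mono.
rewrite ge0_intD//; last 4 first.
- exact: measurable_funD.
- exact: measurable_funM.
- by move=> z; rewrite addr_ge0 ?mulr_ge0 ?powR_ge0.
- by move=> z; rewrite mulr_ge0.
rewrite ge0_intZ// xE ge0_intD//; last 2 first.
- by move=> z; rewrite mulr_ge0 ?powR_ge0.
- by move=> z; rewrite powR_ge0.
have E1 : (\int[(smk P mB nu s \x nu)%E]_z (f1 z)%:E = \int[smk P mB nu s]_z (cut K z.2 `^ p)%:E)%E.
  rewrite /f1 (ge0_int_prodM _ _ (g := fun=> 1) (mcp K))// ?int_prob_cst ?mule1//.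
  by move=> z; rewrite powR_ge0.
have E2 : (\int[(smk P mB nu s \x nu)%E]_z (f2 z)%:E = \int[(P \x nu)%E]_z (cut K (B i z.1 * z.2) `^ p)%:E)%E.
  rewrite fubini_tonelli1//; last 2 first.
  - exact/measurable_EFinP.
  - by move=> z; rewrite lee_fin powR_ge0.
  rewrite [RHS]fubini_tonelli1//; last 2 first.
  - exact/measurable_EFinP.
  - by move=> z; rewrite lee_fin powR_ge0.
  apply: (@ge0_int_smk_fst _ _ _ _ P B mB nu s (fun x => \int[nu]_v (cut K (B i x * v) `^ p)%:E)%E).
  - apply: (@measurable_fun_fubini_tonelli_F _ _ _ _ R nu (fun z => (cut K (B i z.1 * z.2) `^ p)%:E)).
    + exact/measurable_EFinP.
    + by move=> z; rewrite lee_fin powR_ge0.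
  - by move=> x; apply: int_ge0 => v; rewrite powR_ge0.
rewrite E1 E2 big_cons EFinD EFinM addeA leeD2r//.
by rewrite addeC -addeA leeD2l// hC.
Qed.

Definition tmom p K : R := \int[nu]_v (cut K v `^ p).

Lemma tmom_le p K : 0 <= p -> 0 <= K -> tmom p K <= K `^ p.
Proof.
move=> p0 K0; rewrite -(Rint_cst nu (K `^ p)); apply: bdm_le; [exact: bdm_cut|exact: bdm_cst|].
by move=> v; rewrite ge0_ler_powR ?nnegrE ?cut_ge0 ?cut_le.
Qed.

Lemma tmom_double p K t : 0 < p -> 0 < K -> (nu `]K, +oo[%classic <= t%:E)%E ->
  tmom p (2 * K) <= tmom p K + (2 * K) `^ p * t.
Proof.
move=> p0 K0 ht; have K20 : 0 < 2 * K by rewrite mulr_gt0.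
have bI : bdm (\1_(`]K, +oo[%classic) : R -> R).
  split; first exact: measurable_indic.
  by exists 1 => x; rewrite indicE; case: (_ \in _); rewrite ?normr1 ?normr0.
have bK := bdm_cut (ltW K0) (ltW p0).
have It : \int[nu]_v (\1_(`]K, +oo[%classic) v : R) <= t.
  by rewrite -lee_fin -bdm_EFin// integral_indic// setIT.
apply: (@le_trans _ _ (\int[nu]_v (cut K v `^ p + (2 * K) `^ p * \1_(`]K, +oo[%classic) v))).
  apply: bdm_le; [exact: bdm_cut (ltW K20) (ltW p0)|by apply: bdmD => //; exact: bdmZ|].
  move=> v; rewrite indicE mem_setE/= in_itv/= andbT.
  case: (ltP K v) => [vK|vK]; rewrite ?mulr1 ?mulr0 ?addr0.
    have : cut (2 * K) v `^ p <= (2 * K) `^ p.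
      by rewrite ge0_ler_powR ?nnegrE ?cut_ge0 ?cut_le ?(ltW p0) ?(ltW K20).
    by have := powR_ge0 (cut K v) p; lra.
  have pK : pos v <= K by rewrite ge_max vK ltW.
  by rewrite /cut !min_l//; lra.
rewrite bdm_RintD//; last exact: bdmZ.
by rewrite bdm_RintZ// lerD2l ler_wpM2l// powR_ge0.
Qed.

(** The base covers []0, 2 * s0]], so that halving any larger [K] lands where the step applies. *)
Lemma doubling_ind (s0 : R) (Q : R -> Prop) : 0 < s0 -> (forall K, 0 < K -> K <= 2 * s0 -> Q K) ->
  (forall K, s0 <= K -> Q K -> Q (2 * K)) -> forall K, 0 < K -> Q K.
Proof.
move=> s00 base step K K0.
have key n : forall K, 0 < K -> K <= 2 ^+ n * (2 * s0) -> Q K.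
  elim: n => [|n IH] k k0; first by rewrite expr0 mul1r => kle; exact: base.
  rewrite exprS -mulrA => kle; have [ks|ks] := leP k (2 * s0); first exact: base.
  have -> : k = 2 * (k / 2) by rewrite mulrCA divff ?mulr1.
  by apply: step; [rewrite ler_pdivlMr// mulrC ltW|apply: IH; [rewrite divr_gt0|rewrite ler_pdivrMr// mulrC]].
pose n := Num.bound (K / (2 * s0)).
apply: (key n) => //; rewrite -ler_pdivrMr ?mulr_gt0//.
apply: (@le_trans _ _ n%:R); first by rewrite ltW// archi_boundP// divr_ge0 ?(ltW K0)// mulr_ge0// ltW.
by rewrite -natrX ler_nat ltnW// ltn_expl.
Qed.

Lemma powRBK g p k : 0 < k -> k `^ p * k `^ (- g) = k `^ (p - g).
Proof. by move=> k0; rewrite -powRD// (gt_eqF k0) implybT. Qed.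

Lemma tmom_small g p : 0 < p -> g < p ->
  (forall e, 0 < e -> exists2 s0, 0 < s0 & forall x, s0 <= x -> (nu `]x, +oo[%classic <= (e * x `^ (- g))%:E)%E) ->
  forall e : R, 0 < e -> exists2 C, 0 <= C & forall K, 0 < K -> tmom p K <= e * K `^ (p - g) + C.
Proof.
move=> p0 gp tail e e0; have q0 : 0 < p - g by lra.
have r1 : 1 < 2 `^ (p - g).
  by have := @gt0_ltr_powR R _ q0 1 2; rewrite powR1; apply; rewrite ?nnegrE ?ltr1n.
have tp : 0 < 2 `^ p :> R by exact: powR_gt0.
(* With this value the increment of [tmom] from [K] to [2 K] is at most that of [e K^(p - g)], so
   the bound reproduces itself on dyadic scales. *)
pose e1 := e * (2 `^ (p - g) - 1) / 2 `^ p.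
have e10 : 0 < e1 by rewrite divr_gt0// mulr_gt0// subr_gt0.
have [s0 s00 hs] := tail e1 e10; exists ((2 * s0) `^ p); first exact: powR_ge0.
apply: (doubling_ind s00) => [K K0 Ks|K Ks IH].
  apply: (le_trans (tmom_le (ltW p0) (ltW K0))).
  apply: (@le_trans _ _ ((2 * s0) `^ p)); last by rewrite lerDr mulr_ge0 ?powR_ge0 ?ltW.
  by rewrite ge0_ler_powR ?nnegrE ?(ltW p0) ?(ltW K0)// mulr_ge0// ltW.
have K0 : 0 < K by exact: lt_le_trans Ks.
apply: (le_trans (tmom_double p0 K0 (hs K Ks))).
rewrite powRM ?(ltW K0)// [in leRHS]powRM ?(ltW K0)//.
have E : 2 `^ p * K `^ p * (e1 * K `^ (- g)) = e * (2 `^ (p - g) - 1) * K `^ (p - g).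
  by rewrite -(powRBK _ _ K0) /e1; field; rewrite gt_eqF.
rewrite E; lra.
Qed.

Lemma tmom_bounded g p c s0 : 0 < p -> p < g -> 0 < s0 -> 0 <= c ->
  (forall x, s0 <= x -> (nu `]x, +oo[%classic <= (c * x `^ (- g))%:E)%E) ->
  exists C, forall K, 0 < K -> tmom p K <= C.
Proof.
move=> p0 pg s00 c0 tail; have q0 : 0 < g - p by lra.
have tp : 0 < 2 `^ p :> R by exact: powR_gt0.
have r1 : 2 `^ (p - g) < 1 :> R.
  rewrite -opprB powRN invf_lt1 ?powR_gt0//.
  by have := @gt0_ltr_powR R _ q0 1 2; rewrite powR1; apply; rewrite ?nnegrE ?ltr1n.
(* [D K^(p - g)] decreases under doubling by exactly the bound on the increment of [tmom]; the bound
   [C - D K^(p - g)] is therefore inductive, a closed form of summing the geometric series. *)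
pose D := 2 `^ p * c / (1 - 2 `^ (p - g)).
have D0 : 0 <= D by rewrite divr_ge0 ?mulr_ge0 ?(ltW tp)// subr_ge0 ltW.
have DE : D * (1 - 2 `^ (p - g)) = 2 `^ p * c by rewrite divfK// subr_eq0 gt_eqF.
have s20 : 0 <= 2 * s0 by rewrite mulr_ge0// ltW.
pose C := (2 * s0) `^ p + D * s0 `^ (p - g).
suff key K : 0 < K -> s0 <= K -> tmom p K <= C - D * K `^ (p - g).
  exists C => K K0; have [Ks|Ks] := leP s0 K.
    by have := key K K0 Ks; have := mulr_ge0 D0 (powR_ge0 K (p - g)); lra.
  apply: (le_trans (tmom_le (ltW p0) (ltW K0))).
  apply: (@le_trans _ _ ((2 * s0) `^ p)).
    by rewrite ge0_ler_powR ?nnegrE ?(ltW p0) ?(ltW K0)//; lra.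
  by rewrite lerDl mulr_ge0// powR_ge0.
move: K; apply: (doubling_ind s00) => [K K0 Ks sK|K Ks IH _].
  apply: (le_trans (tmom_le (ltW p0) (ltW K0))).
  have h1 : K `^ p <= (2 * s0) `^ p by rewrite ge0_ler_powR ?nnegrE ?(ltW p0) ?(ltW K0).
  have h2 : K `^ (p - g) <= s0 `^ (p - g).
    rewrite -opprB !(powRN _ (g - p)) lef_pV2 ?posrE ?powR_gt0//.
    by rewrite ge0_ler_powR ?nnegrE ?(ltW q0) ?(ltW K0) ?(ltW s00).
  by have := ler_wpM2l D0 h2; rewrite /C; lra.
have K0 : 0 < K by exact: lt_le_trans Ks.
apply: (le_trans (tmom_double p0 K0 (tail K Ks))).
rewrite powRM ?(ltW K0)// [in leRHS]powRM ?(ltW K0)//.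
have E : 2 `^ p * K `^ p * (c * K `^ (- g)) = D * (1 - 2 `^ (p - g)) * K `^ (p - g).
  by rewrite DE -(powRBK _ _ K0); ring.
rewrite E; have := IH Ks; lra.
Qed.

Lemma pmom_bound p C : 0 < p -> (forall K, 0 < K -> tmom p K <= C) -> (pmom p <= C%:E)%E.
Proof.
move=> p0 hC.
have np n : 0 < n.+1%:R :> R by rewrite ltr0n.
have mono v : {homo (fun n => cut n.+1%:R v `^ p : R) : i j / (i <= j)%N >-> i <= j}.
  move=> i j ij; rewrite ge0_ler_powR ?nnegrE ?cut_ge0 ?(ltW p0)//.
  by rewrite /cut le_min !ge_min lexx/= ler_nat ltnS ij orbT.
have E v : limn (fun n => (cut n.+1%:R v `^ p)%:E) = (pos v `^ p)%:E :> \bar R.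
  apply/cvg_lim => //; apply: cvg_EFin; first exact: nearW.
  apply: cvg_near_cst; exists (Num.bound (pos v)) => // n /= nb.
  rewrite /cut min_l//; apply: (le_trans (ltW (archi_boundP (pos_ge0 v)))).
  by rewrite ler_nat leqW.
have := @cvg_monotone_convergence _ _ _ nu setT measurableT (fun n v => (cut n.+1%:R v `^ p)%:E) _ _ _.
have -> : (\int[nu]_v limn (fun n => (cut n.+1%:R v `^ p)%:E) = pmom p)%E by apply: eq_integral => v _; rewrite E.
move=> /(_ _ _ _)/cvge_to_le; apply.
- by move=> n; apply/measurable_EFinP; exact: (measurableT_comp (measurable_powR p) (measurable_cut _)).
- by move=> n v _; rewrite lee_fin powR_ge0.
- by move=> v _ i j ij; rewrite lee_fin; exact: mono.
apply: nearW => n; rewrite bdm_EFin ?lee_fin; first exact: hC.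
by apply: bdm_cut; rewrite ltW.
Qed.

Section smoothing_fixed.
Variable s : seq I.
Hypothesis fixB : forall f, bdm f -> \int[nu]_v f v = \int[sm P mB nu s]_v f v.
Variables (g : R) (Wg : I -> R).
Hypotheses (g0 : 0 < g) (hWg : forall i, (\int[P]_x (B i x `^ g)%:E = (Wg i)%:E)%E) (sWg : \sum_(i <- s) Wg i <= 1).
Hypothesis tail : forall e : R, 0 < e -> exists2 s0, 0 < s0 & forall x, s0 <= x -> (nu `]x, +oo[%classic <= (e * x `^ (- g))%:E)%E.
Variables (p : R) (Wp : I -> R).
Hypotheses (gp : g < p) (hWp : forall i, (\int[P]_x (B i x `^ p)%:E = (Wp i)%:E)%E) (sWp : \sum_(i <- s) Wp i < 1).

Let p0 : 0 < p. Proof. exact: lt_trans gp. Qed.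

(** Scaling replaces the level [K] by [K / B], and [B^p (K / B)^(p - g) = K^(p - g) B^g]: the
    growing term meets the weights at exponent [g], the constant one at exponent [p]. *)
Lemma tmom_scale i K e Gam : 0 < K -> 0 <= e -> 0 <= Gam -> (forall K, 0 < K -> tmom p K <= e * K `^ (p - g) + Gam) ->
  (\int[(P \x nu)%E]_z (cut K (B i z.1 * z.2) `^ p)%:E <= (e * K `^ (p - g) * Wg i + Gam * Wp i)%:E)%E.
Proof.
move=> K0 e0 Gam0 hG.
have mf : measurable_fun setT (fun z : T * R => cut K (B i z.1 * z.2) `^ p).
  apply: (measurableT_comp (measurable_powR p)); apply: (measurableT_comp (measurable_cut K)).
  apply: measurable_funM; last exact: measurable_snd.
  by apply: (measurableT_comp (mB i)); exact: measurable_fst.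
have mEf : measurable_fun setT (fun z : T * R => (cut K (B i z.1 * z.2) `^ p)%:E) by exact/measurable_EFinP.
have f0 z : (0 <= (cut K (B i z.1 * z.2) `^ p)%:E)%E by rewrite lee_fin powR_ge0.
rewrite fubini_tonelli1//.
have mb1 : measurable_fun setT (fun x => e * K `^ (p - g) * B i x `^ g) by apply: measurable_funM => //; exact: measurable_powB.
have mb2 : measurable_fun setT (fun x => Gam * B i x `^ p) by apply: measurable_funM => //; exact: measurable_powB.
have c0 : 0 <= e * K `^ (p - g) by rewrite mulr_ge0// powR_ge0.
apply: (@le_trans _ _ (\int[P]_x (e * K `^ (p - g) * B i x `^ g + Gam * B i x `^ p)%:E)%E); last first.
  rewrite ge0_intD//; last 2 first.
  - by move=> x; rewrite mulr_ge0// powR_ge0.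
  - by move=> x; rewrite mulr_ge0// powR_ge0.
  rewrite !ge0_intZ//; last 4 first.
  - exact: measurable_powB.
  - by move=> x; exact: powR_ge0.
  - exact: measurable_powB.
  - by move=> x; exact: powR_ge0.
  by rewrite hWg hWp -!EFinM.
apply: ge0_le_integral => //.
- by move=> x _; apply: integral_ge0.
- exact: (@measurable_fun_fubini_tonelli_F _ _ _ _ R nu _ mEf f0).
- by apply/measurable_EFinP; exact: measurable_funD.
move=> x _; rewrite /fubini_F/=.
have := B0 i x; rewrite le_eqVlt => /predU1P[bz|b0].
  rewrite -bz; under eq_integral do rewrite mul0r /cut /pos maxxx (min_l (ltW K0)) powR0 ?gt_eqF//.
  by rewrite integral0 lee_fin !powR0 ?gt_eqF// !mulr0 addr0.
have Kb : 0 < K / B i x by rewrite divr_gt0.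
under eq_integral do rewrite cutM// powRM ?(ltW b0) ?cut_ge0 ?(ltW Kb)//.
have bc := bdm_cut (ltW Kb) (ltW p0).
rewrite bdm_EFin; last exact: bdmZ.
rewrite bdm_RintZ// lee_fin -/(tmom p (K / B i x)).
apply: (le_trans (ler_wpM2l (powR_ge0 _ _) (hG _ Kb))).
rewrite mulrDr [B i x `^ p * Gam]mulrC lerD2r le_eqVlt; apply/orP; left; apply/eqP.
rewrite powRM ?invr_ge0 ?(ltW K0) ?(ltW b0)// -(powR_inv1 (ltW b0)) -powRrM mulN1r opprB.
have -> : B i x `^ g = B i x `^ p * B i x `^ (g - p) by rewrite -powRD ?(gt_eqF b0) ?implybT//; congr powR; ring.
by ring.
Qed.

(* Insert the bound [tmom p K <= e K^(p - g) + G] into the fixed point equation: the first term reproduces itself because [\sum Wg <= 1], the constant shrinks by [\sum Wp < 1]; iterate, then let [e -> 0]. *)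
Lemma light_bound c : 0 <= c ->
  (forall a b, 0 <= a -> 0 <= b -> (a + b) `^ p <= a `^ p + b `^ p + c * (a `^ (p - 1) * b + a * b `^ (p - 1))) ->
  c = 0 \/ (1 < p /\ (pmom (Num.max (p - 1) 1)%R < +oo)%E) ->
  exists C, [/\ 0 <= C, c = 0 -> C = 0 & forall K, 0 < K -> tmom p K <= C].
Proof.
move=> c0 hc cr.
have [|C0 [C00 cC0 hC0]] := trunc_sum s p0 c0 hc.
  case: cr => [cz|[p1 m1]]; [by left|right; split; first exact: p1].
  - by apply: pmom_le m1; [lra|rewrite le_max lexx].
  - by apply: pmom_le m1; rewrite // le_max lexx orbT.
  - by move=> i; rewrite hWp ltry.
pose rho := \sum_(i <- s) Wp i; have rho_lt : rho < 1 := sWp.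
have Wg0 i : 0 <= Wg i by rewrite -lee_fin -hWg; apply: int_ge0 => x; exact: powR_ge0.
have Wp0 i : 0 <= Wp i by rewrite -lee_fin -hWp; apply: int_ge0 => x; exact: powR_ge0.
have rho0 : 0 <= rho by rewrite sumr_ge0.
have rho1 : 0 < 1 - rho by lra.
have step e Gam : 0 <= e -> 0 <= Gam -> (forall K, 0 < K -> tmom p K <= e * K `^ (p - g) + Gam) ->
    forall K, 0 < K -> tmom p K <= e * K `^ (p - g) + (rho * Gam + C0).
  move=> e0 Gam0 hG K K0.
  have bK := bdm_cut (ltW K0) (ltW p0).
  have bS : bdm (fun z : T * R => cut K z.2 `^ p) := bdm_comp bK (@measurable_snd _ _ T R).
  have -> : tmom p K = \int[smk P mB nu s]_z (cut K z.2 `^ p) by rewrite /tmom fixB// int_sm.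
  rewrite -lee_fin -bdm_EFin//.
  apply: (le_trans (hC0 K K0)); rewrite addrA EFinD leeD2r//.
  apply: (@le_trans _ _ (\sum_(i <- s) (e * K `^ (p - g) * Wg i + Gam * Wp i)%:E)%E).
    by apply: lee_sum => i _; exact: tmom_scale.
  rewrite sumEFin lee_fin big_split/= -!mulr_sumr -/rho [Gam * rho]mulrC lerD2r.
  by rewrite ler_piMr// mulr_ge0// powR_ge0.
(* Fixed point of [Gam |-> rho * Gam + C0], the effect of one use of [step] on the constant. *)
pose C := C0 / (1 - rho); have C_0 : 0 <= C by rewrite divr_ge0// ltW.
exists C; split=> // [/cC0 cz|K K0]; first by rewrite /C cz mul0r.
have lim1 e : 0 < e -> forall K, 0 < K -> tmom p K <= e * K `^ (p - g) + C.
  move=> e0 {}K {}K0; have [G1 G10 hG1] := tmom_small p0 gp tail e0.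
  have it n : forall K, 0 < K -> tmom p K <= e * K `^ (p - g) + (rho ^+ n * G1 + C).
    elim: n => [|n IH] k k0.
      by rewrite expr0 mul1r; have := hG1 k k0; lra.
    have Gn0 : 0 <= rho ^+ n * G1 + C by rewrite addr_ge0// mulr_ge0// exprn_ge0.
    have := step e _ (ltW e0) Gn0 IH k k0.
    have -> // : rho * (rho ^+ n * G1 + C) + C0 = rho ^+ n.+1 * G1 + C.
    by rewrite exprS /C; field; rewrite gt_eqF.
  have cv : e * K `^ (p - g) + (rho ^+ n * G1 + C) @[n --> \oo] --> e * K `^ (p - g) + (0 * G1 + C).
    apply: cvgD; first exact: cvg_cst.
    apply: cvgD; last exact: cvg_cst.
    apply: cvgM; last exact: cvg_cst.
    by apply: cvg_expr; rewrite ger0_norm.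
  have := ler_cvg_to (cvg_cst (tmom p K)) cv; rewrite mul0r add0r; apply.
  by apply: nearW => n; exact: it.
apply/ler_addgt0Pr => e e0.
have kp : 0 < K `^ (p - g) by exact: powR_gt0.
have ek : 0 < e / K `^ (p - g) by rewrite divr_gt0.
by have := lim1 _ ek K K0; rewrite divfK ?gt_eqF// addrC.
Qed.

End smoothing_fixed.

End truncated_moments.

Section light_finite.
Context (R : realType) (I : Type) d (T : measurableType d) (P : probability T R).
Variables (B : I -> T -> R) (mB : forall i, measurable_fun setT (B i)) (B0 : forall i x, 0 <= B i x).
Variables (nu : probability R R) (s : seq I).
Hypothesis fixB : forall f, bdm f -> \int[nu]_v f v = \int[sm P mB nu s]_v f v.
Variables (g de : R) (Wg Wd : I -> R).
Hypotheses (g0 : 0 < g) (gde : g < de).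
Hypotheses (hWg : forall i, (\int[P]_x (B i x `^ g)%:E = (Wg i)%:E)%E) (sWg : \sum_(i <- s) Wg i <= 1).
Hypotheses (hWd : forall i, (\int[P]_x (B i x `^ de)%:E = (Wd i)%:E)%E) (sWd : \sum_(i <- s) Wd i < 1).
Hypothesis tail : forall e : R, 0 < e -> exists2 s0, 0 < s0 & forall x, s0 <= x -> (nu `]x, +oo[%classic <= (e * x `^ (- g))%:E)%E.

Let Wp p i := fine (\int[P]_x (B i x `^ p)%:E)%E.

Lemma interp_moment p i : g < p -> p <= de ->
  (\int[P]_x (B i x `^ p)%:E <= ((de - p) / (de - g) * Wg i + (p - g) / (de - g) * Wd i)%:E)%E.
Proof.
move=> gp pd; have t1 : 0 <= (de - p) / (de - g) by rewrite divr_ge0//; lra.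
have t2 : 0 <= (p - g) / (de - g) by rewrite divr_ge0//; lra.
apply: (@le_trans _ _ (\int[P]_x ((de - p) / (de - g) * B i x `^ g + (p - g) / (de - g) * B i x `^ de)%:E)%E).
  apply: ge0_intle.
  - exact: measurable_powB.
  - by apply: measurable_funD; apply: measurable_funM => //; exact: measurable_powB.
  - by move=> x; rewrite powR_ge0/=; exact: powR_interp.
rewrite ge0_intD//; last 4 first.
- by apply: measurable_funM => //; exact: measurable_powB.
- by apply: measurable_funM => //; exact: measurable_powB.
- by move=> x; rewrite mulr_ge0// powR_ge0.
- by move=> x; rewrite mulr_ge0// powR_ge0.
rewrite !ge0_intZ//; last 4 first.
- exact: measurable_powB.
- by move=> x; rewrite powR_ge0.
- exact: measurable_powB.
- by move=> x; rewrite powR_ge0.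
by rewrite hWg hWd.
Qed.

Lemma moment_fine p i : g < p -> p <= de -> (\int[P]_x (B i x `^ p)%:E = (Wp p i)%:E)%E.
Proof.
move=> gp pd; rewrite fineK// ge0_fin_numE; last by apply: int_ge0 => x; exact: powR_ge0.
exact: le_lt_trans (interp_moment i gp pd) (ltry _).
Qed.

Lemma moment_sum p : g < p -> p <= de -> \sum_(i <- s) Wp p i < 1.
Proof.
move=> gp pd; have dg : 0 < de - g by rewrite subr_gt0.
have t1 : 0 <= (de - p) / (de - g) by rewrite divr_ge0//; lra.
have t2 : 0 < (p - g) / (de - g) by rewrite divr_gt0//; lra.
have t12 : (de - p) / (de - g) + (p - g) / (de - g) = 1 by field; rewrite gt_eqF.
apply: (@le_lt_trans _ _ (\sum_(i <- s) ((de - p) / (de - g) * Wg i + (p - g) / (de - g) * Wd i))).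
  by apply: ler_sum => i _; rewrite -lee_fin -moment_fine//; exact: interp_moment.
rewrite big_split/= -!mulr_sumr.
have := ler_wpM2l t1 sWg; have : (p - g) / (de - g) * \sum_(i <- s) Wd i < (p - g) / (de - g) * 1 by rewrite ltr_pM2l.
lra.
Qed.

(** At some order [p <= 1] there are no cross terms and [light_bound] returns the constant 0. So the
    law has no mass on the positive axis, and the moment of order [de] on this side vanishes as
    well. *)
Lemma light_finite_sub : g < 1 -> (pmom nu de < +oo)%E.
Proof.
move=> g1; pose p := Num.min 1 de.
have gp : g < p by rewrite lt_min g1.
have pd : p <= de by rewrite ge_min lexx orbT.
have p1 : p <= 1 by rewrite ge_min lexx.
have p0 : 0 < p by exact: lt_trans gp.
have [c [c0 cz hc]] := powR_add p0.
have [C [_ Cz hC]] := light_bound B0 fixB g0 hWg sWg tail gp (fun i => moment_fine i gp pd) (moment_sum gp pd) c0 hc (or_introl (cz p1)).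
have z K : 0 < K -> tmom nu de K <= 0.
  move=> K0; rewrite (le_trans (y := K `^ (de - p) * tmom nu p K))//; last first.
    by rewrite -(mulr0 (K `^ (de - p))) ler_wpM2l ?powR_ge0// (le_trans (hC K K0))// Cz// cz.
  have d0 : 0 <= de by rewrite (le_trans _ pd)// ltW.
  rewrite /tmom -bdm_RintZ; last by apply: bdm_cut; exact: ltW.
  apply: bdm_le; [by apply: bdm_cut => //; exact: ltW|by apply: bdmZ; apply: bdm_cut; exact: ltW|].
  move=> v; have := cut_ge0 v (ltW K0); rewrite le_eqVlt => /predU1P[<-|v0].
    by rewrite !powR0 ?mulr0// gt_eqF// (lt_le_trans p0).
  have -> : cut K v `^ de = cut K v `^ (de - p) * cut K v `^ p.
    by rewrite -powRD ?(gt_eqF v0) ?implybT//; congr powR; ring.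
  rewrite ler_wpM2r ?powR_ge0// ge0_ler_powR ?nnegrE ?subr_ge0 ?(ltW v0) ?(ltW K0)//.
  exact: cut_le.
have d0 : 0 < de by exact: lt_le_trans pd.
exact: le_lt_trans (pmom_bound d0 z) (ltry _).
Qed.

(** Bootstrap: order [p] needs the moments of order [p - 1] and 1, so the order gained per round is
    1, up to [de]. The condition [g < q + 1] puts the first new order above [g], as [light_bound]
    requires. *)
Lemma light_finite_sup q : 1 <= g -> 1 <= q -> g < q + 1 -> (pmom nu q < +oo)%E -> (pmom nu de < +oo)%E.
Proof.
move=> g1 q1 gq hq; have d1 : 1 < de by exact: le_lt_trans gde.
have gd := gde.
have key (n : nat) : (pmom nu (Num.min de (q + n%:R))%R < +oo)%E.
  elim: n => [|n IH].
    rewrite addr0; apply: pmom_le hq; last by rewrite ge_min lexx orbT.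
    by rewrite le_min; apply/andP; split; lra.
  set p := Num.min _ _.
  have qn : q <= q + n%:R by rewrite lerDl.
  have gp : g < p by rewrite /p lt_min gde/= -natr1; lra.
  have pd : p <= de by rewrite ge_min lexx.
  have pq : p <= q + n.+1%:R by rewrite ge_min lexx orbT.
  rewrite -natr1 in pq.
  have p0 : 0 < p by exact: lt_trans gp.
  have [c [c0 cz hc]] := powR_add p0.
  have m1 : (pmom nu (Num.max (p - 1)%R 1%R) < +oo)%E.
    apply: pmom_le IH; first by rewrite le_max ler01 orbT.
    by rewrite ge_max !le_min; apply/andP; split; apply/andP; split; lra.
  have [|C [_ _ hC]] := light_bound B0 fixB g0 hWg sWg tail gp (fun i => moment_fine i gp pd) (moment_sum gp pd) c0 hc.
    by right; split => //; lra.
  exact: le_lt_trans (pmom_bound p0 hC) (ltry _).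
pose n := Num.bound de; have := key n.
have -> // : Num.min de (q + n%:R) = de.
apply: min_l; have : de < n%:R by apply: archi_boundP; lra.
by lra.
Qed.

End light_finite.

(** * Absorption of the uniform variable into the weights *)

Section uniform_power.
Context (R : realType).
Local Notation leb := (@lebesgue_measure R).
Local Notation U01 := (@U01 R).

Lemma int_powR_itv (a e : R) : 0 < a + 1 -> 0 < e -> e < 1 ->
  (\int[leb]_(x in `[e, 1%R]) (x `^ a)%:E = ((1 - e `^ (a + 1)) / (a + 1))%:E)%E.
Proof.
move=> a1 e0 e1; have an : a + 1 != 0 by rewrite gt_eqF.
have dp b (x : R) : 0 < x -> is_derive x 1 (fun y => y `^ b) (b * x `^ (b - 1)) by exact: is_derive1_powR.
have cp b (x : R) : 0 < x -> {for x, continuous (fun y : R => y `^ b)}.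
  by move=> x0; apply/differentiable_continuous/derivable1_diffP; case: (dp b x x0).
pose F (x : R) := (a + 1)^-1 * x `^ (a + 1).
have dF (x : R) : 0 < x -> is_derive x 1 F (x `^ a).
  move=> x0; have D := dp (a + 1) x x0.
  have D' : is_derive x 1 F _ := is_deriveZ (a + 1)^-1 D.
  by apply: (is_derive_eq D'); rewrite /GRing.scale/= addrK mulrA mulVf// mul1r.
have cF (x : R) : 0 < x -> {for x, continuous F}.
  by move=> x0; apply/differentiable_continuous/derivable1_diffP; case: (dF x x0).
rewrite (@continuous_FTC2 _ (fun x => x `^ a) F)//.
- by rewrite /F powR1 -EFinB; congr EFin; field.
- apply/continuous_within_itvP => //; split.
  + by move=> x; rewrite in_itv/= => /andP[ex _]; apply: cp; exact: lt_trans ex.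
  + exact/cvg_at_right_filter/cp.
  + by apply/cvg_at_left_filter/cp; exact: ltr01.
- split.
  + by move=> x; rewrite in_itv/= => /andP[ex _]; case: (dF x (lt_trans e0 ex)).
  + exact/cvg_at_right_filter/cF.
  + by apply/cvg_at_left_filter/cF; exact: ltr01.
- move=> x; rewrite in_itv/= => /andP[ex _].
  by have D := dF x (lt_trans e0 ex); rewrite derive1E; exact: derive_val.
Qed.

(** As [a] may be negative, the primitive is used on [[e n, 1]] only, and these intervals exhaust
    []0, 1]]. *)
Lemma int_U01_powR (a : R) : 0 < a + 1 -> (\int[U01]_x (x `^ a)%:E = ((a + 1)^-1)%:E)%E.
Proof.
move=> a1; have mp : measurable_fun setT (fun x : R => (x `^ a)%:E) by apply/measurable_EFinP; exact: measurable_powR.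
rewrite ge0_int_U01//; last by move=> x; rewrite lee_fin powR_ge0.
pose e (n : nat) : R := n.+2%:R^-1.
have e0 n : 0 < e n by rewrite invr_gt0.
have e1 n : e n < 1 by rewrite invf_lt1// ltr1n.
have U : \bigcup_n `[e n, 1]%classic = `]0%R, 1%R]%classic.
  apply/seteqP; split => [x [n _]|x]; rewrite /= !in_itv/= => /andP[x0 x1].
    by rewrite x1 (lt_le_trans _ x0).
  have [n _ hn] := near_infty_natSinv_lt (PosNum x0).
  exists n => //=; rewrite in_itv/= x1 andbT; have /= h := hn n (leqnn n).
  apply: le_trans (ltW h); rewrite /e lef_pV2 ?posrE// ler_nat//.
rewrite -integral_itv_obnd_cbnd//; last by apply: measurable_funS mp.
have ce : e n @[n --> \oo] --> 0^'+.
  have c0 : e n @[n --> \oo] --> 0.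
    have := @cvg_harmonic R; rewrite -(cvg_shiftS); exact.
  move=> S /= nS; have : \forall n \near \oo, 0 < e n -> S (e n) by exact: (c0 _ nS).
  by apply: filterS => n; apply; exact: e0.
have C1 : (\int[leb]_(x in `[e n, 1%R]) (x `^ a)%:E)%E @[n --> \oo] --> ((a + 1)^-1)%:E.
  rewrite (_ : (fun n => _) = (fun n => ((1 - e n `^ (a + 1)) / (a + 1))%:E)); last first.
    by apply/funext => n; rewrite int_powR_itv.
  apply: cvg_EFin; first exact: nearW.
  rewrite -[X in _ --> X]mul1r; apply: cvgM; last exact: cvg_cst.
  rewrite -[X in _ --> X]subr0; apply: cvgB; first exact: cvg_cst.
  exact: (cvg_comp _ _ ce (powR_cvg0 a1)).
rewrite -U; have := @ge0_nondecreasing_set_cvg_integral _ (measurableTypeR R) R (fun n => `[e n, 1]%classic) (fun x => (x `^ a)%:E) leb.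
move=> /(_ _ _ _ _)/cvg_lim => H; rewrite -(cvg_lim _ C1)//; apply/esym; apply: H => //.
- move=> i j ij; apply/subsetPset => x /=; rewrite !in_itv/= => /andP[h ->]; rewrite andbT.
  by apply: le_trans h; rewrite lef_pV2 ?posrE// ler_nat ltnS.
- by move=> i; apply: measurable_funS mp.
- by move=> i x _; rewrite lee_fin powR_ge0.
Qed.

End uniform_power.

Section extended_smoothing.
Context (R : realType) (I : Type) d (T : measurableType d) (P : probability T R).
Variables (A : I -> T -> R) (mA : forall i, measurable_fun setT (A i)) (A0 : forall i x, 0 <= A i x).
Variables (nu : probability R R) (mu : R).
Local Notation U01 := (@U01 R).

Definition extP : probability (R * T)%type R := (U01 \x P)%E.

(* The fixed point equation absorbs the uniform variable into the weights. *)
Definition extA i (z : R * T) := z.1 `^ mu * A i z.2.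

Lemma measurable_extA i : measurable_fun setT (extA i).
Proof.
apply: measurable_funM.
- by apply: (measurableT_comp (measurable_powR mu)); exact: measurable_fst.
- by apply: (measurableT_comp (mA i)); exact: measurable_snd.
Qed.

Lemma extA_ge0 i z : 0 <= extA i z. Proof. by rewrite mulr_ge0// powR_ge0. Qed.

(** [E tau^(mu q) = (mu q + 1)^-1]. For [mu = mu(gamma)] the weights of order [gamma] then sum to 1,
    and those of order [delta] to less than 1. *)
Lemma ext_moment i q W : 0 < mu * q + 1 -> (\int[P]_x (A i x `^ q)%:E = W%:E)%E ->
  (\int[extP]_z (extA i z `^ q)%:E = ((mu * q + 1)^-1 * W)%:E)%E.
Proof.
move=> m0 hW.
transitivity (\int[extP]_z (z.1 `^ (mu * q) * A i z.2 `^ q)%:E)%E.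
  by apply: eq_integral => z _; rewrite /extA powRM ?powR_ge0// -powRrM.
rewrite (ge0_int_prodM U01 P (f := fun t => t `^ (mu * q)) (g := fun x => A i x `^ q)).
- by rewrite hW int_U01_powR.
- exact: measurable_powR.
- exact: (measurableT_comp (measurable_powR q)).
- by move=> x; exact: powR_ge0.
- by move=> x; exact: powR_ge0.
Qed.

Lemma smk_ext s (F : (R * T) * R -> R) : bdm F ->
  \int[smk extP measurable_extA nu s]_z F z = \int[U01]_tau \int[smk P mA nu s]_z F ((tau, z.1), tau `^ mu * z.2).
Proof.
elim: s F => [|i s IH] F bF.
  have b1 : bdm (fun x : R * T => F (x, 0)) by exact: (bdm_slice2 bF 0).
  rewrite int_smk_nil// /extP bdm_fubini//; apply: eq_Rintegral => tau _.
  have b2 : bdm (fun z : T * R => F ((tau, z.1), tau `^ mu * z.2)).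
    apply: (bdm_comp bF); apply: measurable_fun_pair; last by apply: measurable_funM => //; exact: measurable_snd.
    by apply: measurable_fun_pair => //; exact: measurable_fst.
  by rewrite int_smk_nil//; apply: eq_Rintegral => x _; rewrite mulr0.
rewrite int_smk_cons// IH; last exact: (bdm_avg extP measurable_extA nu i bF).
apply: eq_Rintegral => tau _.
have b2 : bdm (fun z : T * R => F ((tau, z.1), tau `^ mu * z.2)).
  apply: (bdm_comp bF); apply: measurable_fun_pair; last by apply: measurable_funM => //; exact: measurable_snd.
  by apply: measurable_fun_pair => //; exact: measurable_fst.
rewrite (@int_smk_cons _ _ _ _ P A mA nu i s _ b2).
apply: eq_Rintegral => z _; apply: eq_Rintegral => v _.
by rewrite /= mulrDr mulrA.
Qed.

Lemma fixpt_ext s : fixpt P mA s mu nu ->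
  forall f, bdm f -> \int[nu]_v f v = \int[sm extP measurable_extA nu s]_v f v.
Proof.
move=> fp f bf; rewrite fp// int_sm// smk_ext; last exact: (bdm_comp bf (@measurable_snd _ _ (R * T)%type R)).
apply: eq_Rintegral => tau _; rewrite int_sm//.
by apply: (bdm_comp bf).
Qed.

End extended_smoothing.

(** * Density of a fixed point with a heavy tail *)

Section tails.
Context (R : realType).
Implicit Types (nu : probability R R) (g : R).

Definition light_tail g nu := forall e : R, 0 < e ->
  exists2 s0, 0 < s0 & forall x, s0 <= x -> (nu `]x, +oo[%classic <= (e * x `^ (- g))%:E)%E.

(** Two-sided bounds rather than a limit of [x^g] times the tail: only such bounds survive a
    comparison of tails up to constant factors. *)
Definition heavy_tail g nu := exists c1 c2 s0 : R, [/\ 0 < c1, 0 < s0 &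
  forall x, s0 <= x -> ((c1 * x `^ (- g))%:E <= nu `]x, +oo[%classic <= (c2 * x `^ (- g))%:E)%E].

Definition rpart (f : R -> R) x : R := if 0 < x then f x else 0.

Lemma measurable_rpart f : measurable_fun setT f -> measurable_fun setT (rpart f).
Proof.
move=> mf; apply: measurable_fun_ifT => //.
by apply: measurable_fun_ltr.
Qed.

Lemma rpart_ge0 f x : (forall y, 0 <= f y) -> 0 <= rpart f x.
Proof. by move=> f0; rewrite /rpart; case: ifP. Qed.

End tails.

Section decreasing_density.
Context (R : realType) (nu m : probability R R) (mu : R).
Local Notation leb := (@lebesgue_measure R).
Local Notation U01 := (@U01 R).
Hypothesis mix : forall f : R -> R, bdm f -> \int[nu]_v f v = \int[U01]_tau \int[m]_w f (tau `^ mu * w).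
Hypothesis mu0 : mu != 0.

Lemma ge0_mix (f : R -> \bar R) : measurable_fun setT f -> (forall x, 0 <= f x)%E ->
  (\int[nu]_v f v = \int[m]_w \int[U01]_tau f (tau `^ mu * w)%R)%E.
Proof.
move=> mf f0; pose nu' : probability R R := law (U01 \x m)%E (measurable_powM mu).
transitivity (\int[nu']_v f v)%E.
  apply: eq_measure_integral => S mS _.
  have bS : bdm (\1_S : R -> R).
    split; first exact: measurable_indic.
    by exists 1 => x; rewrite indicE; case: (_ \in _); rewrite ?normr1 ?normr0.
  have E : \int[nu]_v (\1_S v : R) = \int[nu']_v (\1_S v : R).
    have bM := bdm_comp bS (measurable_powM mu).
    by rewrite (mix bS) (bdm_law _ _ bS) (bdm_fubini _ _ bM).
  by have := f_equal EFin E; rewrite -!bdm_EFin// !integral_indic// !setIT.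
rewrite ge0_int_law// fubini_tonelli2//.
exact: (measurableT_comp mf (measurable_powM mu)).
Qed.

(* Density at [y] of [tau * w `^ mu^-1], [tau] uniform on [[0, 1]]; averaging over [w] gives the density [dens] of [V `^ mu^-1] on [V > 0]. *)
Definition kern (z : R * R) : R :=
  if (0 < z.1) && ((0 < z.2) && (z.2 <= z.1 `^ mu^-1)) then (z.1 `^ mu^-1)^-1 else 0.

Lemma kern_ge0 z : 0 <= kern z.
Proof. by rewrite /kern; case: ifP => // _; rewrite invr_ge0 powR_ge0. Qed.

Lemma measurable_kern : measurable_fun setT kern.
Proof.
have m1 : measurable_fun setT (fun z : R * R => z.1) by exact: measurable_fst.
have m2 : measurable_fun setT (fun z : R * R => z.2) by exact: measurable_snd.
have mp : measurable_fun setT (fun z : R * R => z.1 `^ mu^-1) by exact: (measurableT_comp (measurable_powR _) m1).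
apply: measurable_fun_ifT => //.
  apply: measurable_and; first exact: measurable_fun_ltr.
  by apply: measurable_and; [exact: measurable_fun_ltr|exact: measurable_fun_ler].
have -> : (fun z : R * R => (z.1 `^ mu^-1)^-1) = (fun z => z.1 `^ (- mu^-1)) by apply/funext => z; rewrite powRN.
exact: (measurableT_comp (measurable_powR _) m1).
Qed.

Definition dens (y : R) : \bar R := (\int[m]_w (kern (w, y))%:E)%E.

Lemma dens_ge0 y : (0 <= dens y)%E.
Proof. by apply: int_ge0 => w; exact: kern_ge0. Qed.

Lemma measurable_kernE : measurable_fun setT (fun z : R * R => (kern z)%:E).
Proof. by apply/measurable_EFinP; exact: measurable_kern. Qed.

Lemma measurable_dens : measurable_fun setT dens.
Proof.
apply: (@measurable_fun_fubini_tonelli_G _ _ _ _ R m _ measurable_kernE) => z.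
by rewrite lee_fin kern_ge0.
Qed.

Lemma measurable_kernw y : measurable_fun setT (fun w => kern (w, y)).
Proof. by apply: (measurableT_comp measurable_kern); exact: measurable_pair2. Qed.

Lemma dens_mono y z : 0 < y -> y <= z -> (dens z <= dens y)%E.
Proof.
move=> y0 yz; apply: ge0_intle; [exact: measurable_kernw|exact: measurable_kernw|] => w; rewrite kern_ge0/=.
rewrite /kern/=; case: (0 < w) => //=; rewrite y0 (lt_le_trans y0 yz)/=.
case: (leP z (w `^ mu^-1)) => zw; first by rewrite (le_trans yz zw).
by case: ifP => // _; rewrite invr_ge0 powR_ge0.
Qed.

(** For [w > 0] the variable [(tau^mu w)^(1/mu) = tau w^(1/mu)] is uniform on [[0, w^(1/mu)]],
    whatever the sign of [mu]; Tonelli then averages over [w]. That [F] vanishes at 0 settles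
    [tau = 0]. *)
Lemma dens_int (F : R -> \bar R) : measurable_fun setT F -> (forall y, 0 <= F y)%E -> (forall y, y <= 0 -> F y = 0%E) ->
  (\int[nu]_v (if (0 < v)%R then F (v `^ mu^-1)%R else 0%E) = \int[leb]_y (F y * dens y))%E.
Proof.
move=> mF F0 Fz; pose G (v : R) := (if 0 < v then F (v `^ mu^-1) else 0%E).
have G0 v : (0 <= G v)%E by rewrite /G; case: ifP.
have mG : measurable_fun setT G.
  apply: measurable_fun_ifT => //; first exact: measurable_fun_ltr.
  exact: (measurableT_comp mF (measurable_powR _)).
rewrite -[LHS]/(\int[nu]_v G v)%E ge0_mix//.
transitivity (\int[m]_w \int[leb]_y (F y * (kern (w, y))%:E))%E.
  apply: eq_integral => w _; have [w0|w0] := ltP 0 w; last first.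
    rewrite !integral0_eq// => y _.
      by rewrite /kern/= ltNge w0 mule0.
    by rewrite /G ltNge mulr_ge0_le0 ?powR_ge0.
  have u0 : 0 < w `^ mu^-1 by exact: powR_gt0.
  have mFa : measurable_fun setT (fun x => F (w `^ mu^-1 * x + 0)).
    by apply: (measurableT_comp mF); apply: measurable_funD => //; exact: mulrl_measurable.
  transitivity (\int[U01]_x F (w `^ mu^-1 * x + 0)%R)%E.
    rewrite !ge0_int_U01//; last first.
      by apply: (measurableT_comp mG); apply: measurable_funM => //; exact: measurable_powR.
    apply: eq_integral => x; rewrite mem_setE/= in_itv/= => /andP[x0 _]; rewrite addr0.
    move: x0; rewrite le_eqVlt => /predU1P[<-|x0].
      by rewrite mulr0 powR0// mul0r /G ltxx Fz.
    rewrite /G pmulr_lgt0// powR_gt0// powRM ?powR_ge0 ?(ltW w0)//.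
    by rewrite -powRrM divff// powRr1 ?(ltW x0)// mulrC.
  rewrite ge0_U01_affine// addr0 -ge0_integralZl//; last 3 first.
  - by apply: emeasurable_funM => //; apply/measurable_EFinP; exact: measurable_indic.
  - by move=> y _; rewrite mule_ge0// lee_fin.
  - by rewrite lee_fin invr_ge0 ltW.
  apply: eq_integral => y _; have [y0|y0] := leP y 0; first by rewrite Fz// !mul0e mule0.
  rewrite muleCA -EFinM; congr (_ * _%:E)%E.
  by rewrite /kern/= w0 y0 indicE mem_setE/= in_itv/= (ltW y0)/=; case: ifP; rewrite ?mulr1 ?mulr0.
pose H (z : R * measurableTypeR R) : \bar R := (F z.2 * (kern z)%:E)%E.
have mH : measurable_fun setT H.
  apply: emeasurable_funM; last exact: measurable_kernE.
  by apply: (measurableT_comp mF); exact: (@measurable_snd _ _ R (measurableTypeR R)).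
have H0 z : (0 <= H z)%E by rewrite mule_ge0// lee_fin kern_ge0.
transitivity (\int[(m \x (leb : {sigma_finite_measure set (measurableTypeR R) -> \bar R}))]_z H z)%E.
  by rewrite (fubini_tonelli1 _ mH H0).
rewrite (fubini_tonelli2 _ mH H0); apply: eq_integral => y _; rewrite /fubini_G/=.
rewrite -[LHS]/(\int[m]_w (F y * (kern (w, y))%:E))%E ge0_integralZl//; last first.
  by move=> w _; rewrite lee_fin kern_ge0.
by apply/measurable_EFinP; exact: measurable_kernw.
Qed.

(** The condition is put on [v^(1/mu)] itself, so that increasing and decreasing changes of variable
    are treated alike. *)
Definition ymass (a b : R) : \bar R := (\int[nu]_v (if (0 < v) && (a <= v `^ mu^-1 <= b) then 1 else 0 : R)%:E)%E.

Lemma ymass_dens a b : 0 < a -> a <= b ->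
  ((b - a)%:E * dens b <= ymass a b)%E /\ (ymass a b <= (b - a)%:E * dens a)%E.
Proof.
move=> a0 ab; pose F (y : R) : \bar R := (\1_(`[a, b]%classic) y : R)%:E.
have mF : measurable_fun setT F by apply/measurable_EFinP; exact: measurable_indic.
have F0 y : (0 <= F y)%E by rewrite lee_fin.
have Fi y : F y = (if a <= y <= b then 1%E else 0%E) by rewrite /F indicE mem_setE/= in_itv/=; case: ifP.
have Fz y : y <= 0 -> F y = 0%E by move=> y0; rewrite Fi leNgt (le_lt_trans y0 a0).
have -> : ymass a b = (\int[leb]_y (F y * dens y))%E.
  rewrite -dens_int//; apply: eq_integral => v _; rewrite Fi.
  by case: (0 < v) => //=; case: ifP.
have E k : (0 <= k)%E -> (\int[leb]_y (F y * k) = (b - a)%:E * k)%E.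
  move=> k0; transitivity (\int[leb]_y (k * F y))%E; first by apply: eq_integral => y _; rewrite muleC.
  rewrite ge0_integralZl// muleC; congr (_ * _)%E.
  have -> : (\int[leb]_x F x)%E = leb `[a, b]%classic by rewrite /F integral_indic// setIT.
  by rewrite lebesgue_measure_itv/= lte_fin; case: ltgtP ab => // -> _; rewrite subrr.
have mFd : measurable_fun setT (fun y => F y * dens y)%E by apply: emeasurable_funM => //; exact: measurable_dens.
rewrite -(E _ (dens_ge0 a)) -(E _ (dens_ge0 b)); split; apply: ge0_le_integral => //.
- by move=> y _; rewrite mule_ge0// dens_ge0.
- by apply: emeasurable_funM.
- move=> y _; rewrite Fi; case: ifP => [/andP[ay yb]|_]; last by rewrite !mul0e.
  by rewrite !mul1e dens_mono// (lt_le_trans a0).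
- by move=> y _; rewrite mule_ge0// dens_ge0.
- by apply: emeasurable_funM.
- move=> y _; rewrite Fi; case: ifP => [/andP[ay yb]|_]; last by rewrite !mul0e.
  by rewrite !mul1e dens_mono.
Qed.

Lemma ymass_le1 a b : (ymass a b <= 1)%E.
Proof.
rewrite -[leRHS](int_prob_cst nu 1); apply: ge0_intle => //.
  apply: measurable_fun_ifT => //; apply: measurable_and; first exact: measurable_fun_ltr.
  by apply: measurable_and; apply: measurable_fun_ler => //; exact: measurable_powR.
by move=> v; case: ifP; rewrite ?lexx ?ler01.
Qed.

Lemma ymass_ge (S : set R) a b : measurable S -> (forall v, S v -> (0 < v) && (a <= v `^ mu^-1 <= b)) -> (nu S <= ymass a b)%E.
Proof.
move=> mS SS; rewrite -[S]setIT -integral_indic//; apply: ge0_intle; first exact: measurable_indic.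
  apply: measurable_fun_ifT => //; apply: measurable_and; first exact: measurable_fun_ltr.
  by apply: measurable_and; apply: measurable_fun_ler => //; exact: measurable_powR.
move=> v; rewrite indicE; case: (boolP (v \in S)) => [|_]; last by case: ifP; rewrite ?lexx ?ler01.
by rewrite inE => /SS ->; rewrite ler01 lexx.
Qed.

Lemma ymass_le (S : set R) a b : measurable S -> (forall v, (0 < v) && (a <= v `^ mu^-1 <= b) -> S v) -> (ymass a b <= nu S)%E.
Proof.
move=> mS SS; rewrite -[S]setIT -integral_indic//; apply: ge0_intle; last first.
- move=> v; rewrite indicE; case: ifP => [/SS h|_]; last by rewrite lexx ler0n.
  by rewrite mem_set// ler01 lexx.
- exact: measurable_indic.
apply: measurable_fun_ifT => //; apply: measurable_and; first exact: measurable_fun_ltr.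
by apply: measurable_and; apply: measurable_fun_ler => //; exact: measurable_powR.
Qed.

Lemma dens_fin y : 0 < y -> dens y \is a fin_num.
Proof.
move=> y0; have y2 : 0 < y / 2 by rewrite divr_gt0.
have [|h _] := @ymass_dens (y / 2) y y2; first by lra.
have := le_trans h (ymass_le1 _ _); have := dens_ge0 y; case: (dens y) => // _.
by rewrite gt0_muley// lte_fin; lra.
Qed.

Lemma powR_rev (q a b : R) : q < 0 -> 0 < a -> a <= b -> b `^ q <= a `^ q.
Proof. by move=> q0 a0 ab; apply: powR_le_neg => //; exact: ltW. Qed.

Lemma powR_incr (q a b : R) : 0 < q -> 0 < a -> a <= b -> a `^ q <= b `^ q.
Proof. by move=> q0 a0 ab; rewrite ge0_ler_powR ?nnegrE ?(ltW q0) ?(ltW a0)// (le_trans (ltW a0)). Qed.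

Lemma powR_invK (q a : R) : q != 0 -> 0 < a -> (a `^ q) `^ q^-1 = a.
Proof. by move=> q0 a0; rewrite -powRrM divff// powRr1// ltW. Qed.

(** Together with [lower_scale] it translates windows for [v^(1/mu)] into windows for [v]; in the
    comparison of densities the two signs of [mu] are separated only there. *)
Lemma upper_scale : exists2 be : R, 0 < be & forall y v, 0 < y -> 0 < v -> y / 2 <= v `^ mu^-1 -> v `^ mu^-1 <= y -> be * y `^ mu <= v.
Proof.
have E v : 0 < v -> v = (v `^ mu^-1) `^ mu by move=> v0; rewrite -powRrM mulVf// powRr1// ltW.
case: (ltgtP mu 0) mu0 => // m0 _.
  exists 1 => // y v y0 v0 _ vy; rewrite mul1r (E v v0); apply: powR_rev => //.
  exact: powR_gt0.
exists (2^-1 `^ mu) => [|y v y0 v0 yv _]; first by rewrite powR_gt0// invr_gt0.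
rewrite -powRM ?invr_ge0 ?(ltW y0)// mulrC (E v v0); apply: powR_incr => //.
by rewrite divr_gt0.
Qed.

Lemma lower_scale (ka e : R) : 1 <= ka -> 0 < e -> exists L b : R, [/\ 1 < L, 0 < b &
  forall y v, 0 < y -> b * y `^ mu < v -> v <= ka * (b * y `^ mu) -> (0 < v) && (e * y <= v `^ mu^-1 <= L * (e * y))].
Proof.
move=> ka1 e0; have ka0 : 0 < ka by lra.
pose L := ka `^ `|mu^-1| + 1; have L0 : 0 < ka `^ `|mu^-1| by exact: powR_gt0.
exists L; case: (ltgtP mu 0) mu0 => // m0 _.
  have mi : mu^-1 < 0 by rewrite invr_lt0.
  exists (ka^-1 * e `^ mu); split; first by rewrite /L; lra.
    by rewrite mulr_gt0 ?invr_gt0 ?powR_gt0.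
  move=> y v y0; rewrite -[ka^-1 * _ * _]mulrA -powRM ?(ltW e0) ?(ltW y0)// [ka * _]mulrA divff ?gt_eqF// mul1r => h1 h2.
  have z0 : 0 < e * y by rewrite mulr_gt0.
  have p0 : 0 < (e * y) `^ mu by exact: powR_gt0.
  have k0 : 0 < ka^-1 * (e * y) `^ mu by rewrite mulr_gt0 ?invr_gt0.
  have v0 : 0 < v by exact: lt_trans h1.
  rewrite v0/=; apply/andP; split.
    by rewrite -{1}(powR_invK mu0 z0); apply: powR_rev.
  apply: (le_trans (powR_rev mi k0 (ltW h1))); have ki0 : 0 <= ka^-1 by rewrite invr_ge0 ltW.
  rewrite (powRM _ ki0 (ltW p0)) powR_invK//.
  rewrite -powR_inv1 ?(ltW ka0)// -powRrM mulN1r /L ler0_norm ?(ltW mi)//.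
  by rewrite ler_wpM2r ?(ltW z0)// lerDl.
have mi : 0 < mu^-1 by rewrite invr_gt0.
exists (e `^ mu); split; [by rewrite /L; lra|exact: powR_gt0|].
move=> y v y0; rewrite -powRM ?(ltW e0) ?(ltW y0)// => h1 h2.
have z0 : 0 < e * y by rewrite mulr_gt0.
have p0 : 0 < (e * y) `^ mu by exact: powR_gt0.
have v0 : 0 < v by exact: lt_trans h1.
rewrite v0/=; apply/andP; split.
  by rewrite -{1}(powR_invK mu0 z0); apply: powR_incr => //; exact: ltW.
apply: (le_trans (powR_incr mi v0 h2)); rewrite (powRM _ (ltW ka0) (ltW p0)) powR_invK//.
by rewrite /L gtr0_norm// ler_wpM2r ?(ltW z0)// lerDl.
Qed.

(** As [dens] is nonincreasing, [dens y] is at most its mean over [[y / 2, y]], and [dens (e y)] at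
    least its mean over [[e y, L e y]]. Up to constants both windows correspond to values of size
    [y^mu], whose masses compare with [(y^mu)^(-g)] by the heavy tail. *)
Lemma dens_compare g e : 0 < g -> 0 < e -> heavy_tail g nu -> exists K C : R, [/\ 0 < K, 0 <= C &
  forall y, 0 < y -> K <= y `^ mu -> (dens y <= C%:E * dens (e * y)%R)%E].
Proof.
move=> g0 e0 [c1 [c2 [s0 [c10 s00 ht]]]].
have c12 : c1 <= c2.
  have /andP[h1 h2] := ht s0 (lexx _).
  by have := le_trans h1 h2; rewrite lee_fin ler_pM2r// powR_gt0.
have c20 : 0 < c2 by exact: lt_le_trans c12.
(* Chosen so that the tail beyond [ka * x] is at most half of the lower bound [c1 x^(-g)]; the mass
   of []x, ka * x]] is then of full order. *)
pose k := 2 * c2 / c1 + 1; have k1 : 1 <= k by rewrite /k lerDr divr_ge0 ?mulr_ge0 ?(ltW c20) ?(ltW c10).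
have k0 : 0 < k by lra.
pose ka := k `^ g^-1; have ka0 : 0 < ka by exact: powR_gt0.
have ka1 : 1 <= ka by rewrite /ka -(powRr0 k); apply: ler_powR => //; rewrite invr_ge0 ltW.
have kag : ka `^ (- g) = k^-1 by rewrite /ka -powRrM mulrN mulVf ?gt_eqF// powR_inv1// ltW.
have kac : c2 * ka `^ (- g) <= c1 / 2.
  rewrite kag ler_pdivrMr// /k mulrDr mulr1.
  have -> : c1 / 2 * (2 * c2 / c1) = c2 by field; rewrite gt_eqF.
  by lra.
have [L [b [L1 b0 hlow]]] := lower_scale ka1 e0.
have [be be0 hup] := upper_scale.
pose U0 := c2 * (be / 2) `^ (- g); pose B := c1 / 2 * b `^ (- g).
have U00 : 0 < U0 by rewrite mulr_gt0// powR_gt0// divr_gt0.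
have B0 : 0 < B by rewrite mulr_gt0 ?powR_gt0// divr_gt0.
exists (Num.max (2 * s0 / be) (s0 / b)), (2 * (U0 / B) * ((L - 1) * e)); split.
- by rewrite lt_max divr_gt0// mulr_gt0.
- have L10 : 0 < L - 1 by lra.
  have UB : 0 < U0 / B by rewrite divr_gt0.
  by apply: ltW; apply: mulr_gt0; apply: mulr_gt0.
move=> y y0; rewrite ge_max => /andP[h1 h2].
set v := y `^ mu in h1 h2; have v0 : 0 < v by exact: powR_gt0.
rewrite ler_pdivrMr// in h1; rewrite ler_pdivrMr// in h2.
have vg : 0 < v `^ (- g) by exact: powR_gt0.
have yy' : y / 2 < y by rewrite ltr_pdivrMr// ltr_pMr// ltr1n.
have yy := ltW yy'.
have bb : be / 2 < be by rewrite ltr_pdivrMr// ltr_pMr// ltr1n.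
have [d1 _] := @ymass_dens (y / 2) y (divr_gt0 y0 (ltr0Sn _ 1)) yy.
have up : (ymass (y / 2) y <= (U0 * v `^ (- g))%:E)%E.
  apply: (@le_trans _ _ (nu `](be / 2 * v), +oo[%classic)).
    apply: ymass_le => // w /andP[w0 /andP[w1 w2]]; rewrite /= in_itv/= andbT.
    by apply: lt_le_trans (hup y w y0 w0 w1 w2); rewrite ltr_pM2r.
  have sl : s0 <= be / 2 * v by rewrite mulrAC ler_pdivlMr// mulrC [be * v]mulrC.
  have /andP[_ h] := ht _ sl; apply: (le_trans h).
  by rewrite powRM ?divr_ge0 ?(ltW be0) ?(ltW v0)// mulrA.
have ey0 : 0 < e * y by rewrite mulr_gt0.
have eL : e * y <= L * (e * y) by rewrite ler_peMl ?(ltW ey0)// ltW.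
have [_ d2] := ymass_dens ey0 eL.
have low : ((B * v `^ (- g))%:E <= ymass (e * y) (L * (e * y)))%E.
  have a0 : 0 < b * v by rewrite mulr_gt0.
  have sa : s0 <= b * v by rewrite mulrC.
  have ska : s0 <= ka * (b * v) by rewrite (le_trans sa)// ler_peMl// ltW.
  have /andP[l1 _] := ht _ sa; have /andP[_ l2] := ht _ ska.
  have sub : (nu `](b * v)%R, +oo[%classic <= nu `](b * v)%R, (ka * (b * v))%R]%classic + nu `](ka * (b * v))%R, +oo[%classic)%E.
    apply: le_trans (measureU2 _ _ _) => //; apply: le_measure; rewrite ?inE//; first exact: measurableU.
    move=> x /=; rewrite !in_itv/= !andbT => h; case: (leP x (ka * (b * v))) => hx; [left|right] => //.
    by rewrite h.
  have m2 : (nu `](b * v)%R, (ka * (b * v))%R]%classic <= ymass (e * y)%R (L * (e * y))%R)%E.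
    by apply: ymass_ge => // w; rewrite /= in_itv/= => /andP[w1 w2]; exact: hlow.
  have := le_trans l1 (le_trans sub (leeD m2 l2)).
  have -> : c2 * (ka * (b * v)) `^ (- g) = c2 * ka `^ (- g) * (b `^ (- g) * v `^ (- g)).
    by rewrite !powRM ?(ltW ka0) ?(ltW b0) ?(ltW v0) ?mulr_ge0 ?(ltW b0) ?(ltW v0)// mulrA.
  rewrite powRM ?(ltW b0) ?(ltW v0)//.
  have q0 : 0 < b `^ (- g) * v `^ (- g) by rewrite mulr_gt0// powR_gt0.
  rewrite -leeBlDr// -EFinB; apply: le_trans; rewrite lee_fin /B -mulrA -mulrBl ler_pM2r//.
  by rewrite lerBrDr [leRHS]splitr lerD2l.
have {d1 up} d1 := le_trans d1 up; have {d2 low} d2 := le_trans low d2.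
move: (dens_fin y0) (dens_fin ey0) d1 d2.
case: (dens y) => // D1 _; case: (dens (e * y)) => // D2 _; rewrite -!EFinM !lee_fin => d1 d2.
have y2 : 0 < y - y / 2 by rewrite subr_gt0.
rewrite -(ler_pM2l y2); apply: (le_trans d1).
have -> : (y - y / 2) * (2 * (U0 / B) * ((L - 1) * e) * D2) = U0 / B * ((L * (e * y) - e * y) * D2) by field; rewrite gt_eqF.
have -> : U0 * v `^ (- g) = U0 / B * (B * v `^ (- g)) by field; rewrite gt_eqF.
by rewrite ler_wpM2l// divr_ge0// ltW.
Qed.

(** In the variable [y = v^(1/mu)] the dilation of [v] by [e^(-mu)] is one of [y] by [e^-1]. A
    change of variable moves it to the density, and [dens_compare] bounds [dens y] by [dens (e y)].
    Values [v < K] only contribute a bounded amount. *)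
Lemma heavy_side g e (h : R -> R) (c de : R) : 0 < g -> heavy_tail g nu -> 0 < e -> 0 <= de ->
  measurable_fun setT h -> (forall x, 0 <= h x <= c * jap de x) ->
  (\int[nu]_x (rpart (fun x => h (e `^ (- mu) * x)) x)%:E < +oo)%E -> (\int[nu]_x (rpart h x)%:E < +oo)%E.
Proof.
move=> g0 ht e0 de0 mh hb fin.
have h0 x : 0 <= h x by have /andP[] := hb x.
have [K [C [K0 C0 hC]]] := dens_compare g0 e0 ht.
have c0 : 0 <= c by have /andP[a1 a2] := hb 0; move: (le_trans a1 a2); rewrite pmulr_lge0// jap_gt0.
pose M := c * jap de K.
pose F (y : R) : \bar R := (if (0 < y) && (K <= y `^ mu) then h (y `^ mu) else 0)%:E.
pose F1 (y : R) : \bar R := (if 0 < y then h (y `^ mu) else 0)%:E.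
have mhp : measurable_fun setT (fun y => h (y `^ mu)) by exact: (measurableT_comp mh (measurable_powR mu)).
have mF : measurable_fun setT F.
  apply/measurable_EFinP; apply: measurable_fun_ifT => //; apply: measurable_and; first exact: measurable_fun_ltr.
  by apply: measurable_fun_ler => //; exact: measurable_powR.
have mF1 : measurable_fun setT F1.
  by apply/measurable_EFinP; apply: measurable_fun_ifT => //; exact: measurable_fun_ltr.
have F0 y : (0 <= F y)%E by rewrite lee_fin; case: ifP.
have F10 y : (0 <= F1 y)%E by rewrite lee_fin; case: ifP.
have Fz y : y <= 0 -> F y = 0%E by move=> y0; rewrite /F ltNge y0.
have F1z y : y <= 0 -> F1 y = 0%E by move=> y0; rewrite /F1 ltNge y0.
pose G (v : R) : \bar R := (if 0 < v then F (v `^ mu^-1) else 0%E).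
have mG : measurable_fun setT G.
  apply: measurable_fun_ifT => //; first exact: measurable_fun_ltr.
  exact: (measurableT_comp mF (measurable_powR _)).
have G0 v : (0 <= G v)%E by rewrite /G; case: ifP.
have VK v : 0 < v -> (v `^ mu^-1) `^ mu = v by move=> v0; rewrite -powRrM mulVf// powRr1// ltW.
have mrh := measurable_rpart mh.
have mF1d : measurable_fun setT (fun y => F1 y * dens (e * y)%R)%E.
  apply: emeasurable_funM => //; apply: (measurableT_comp measurable_dens); exact: mulrl_measurable.
have bound : (\int[nu]_v G v <= C%:E * \int[leb]_y (F1 y * dens (e * y)%R))%E.
  rewrite dens_int// -ge0_integralZl//; last first.
    by move=> y _; rewrite mule_ge0// dens_ge0.
  apply: ge0_le_integral => //.
  - by move=> y _; rewrite mule_ge0// dens_ge0.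
  - by apply: emeasurable_funM => //; exact: measurable_dens.
  - exact: measurable_funeM.
  move=> y _; rewrite /F /F1; have [y0|y0] := ltP 0 y; rewrite ?mul0e ?mule0//=.
  case: ifP => [Ky|_]; last by rewrite mul0e mule_ge0 ?lee_fin// mule_ge0 ?lee_fin// dens_ge0.
  by rewrite muleCA lee_wpmul2l ?lee_fin// hC.
have eq1 : (\int[leb]_y (F1 y * dens (e * y)%R) = (e^-1)%:E * \int[nu]_x (rpart (fun x => h (e `^ (- mu) * x)) x)%:E)%E.
  pose F2 (y : R) := F1 (e^-1 * y).
  have mF2 : measurable_fun setT F2 by apply: (measurableT_comp mF1); exact: mulrl_measurable.
  have ei : 0 < e^-1 by rewrite invr_gt0.
  have F2z y : y <= 0 -> F2 y = 0%E by move=> y0; apply: F1z; rewrite pmulr_rle0.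
  transitivity ((e^-1)%:E * \int[leb]_y (F2 y * dens y))%E.
    rewrite (@ge0_int_lebesgue_affine _ e 0 (fun y => F2 y * dens y)%E e0); last 2 first.
    - by apply: emeasurable_funM => //; exact: measurable_dens.
    - by move=> y; apply: mule_ge0; [exact: F10|exact: dens_ge0].
    rewrite muleA -EFinM mulVf ?gt_eqF// mul1e; apply: eq_integral => y _.
    by rewrite addr0 /F2 mulrA mulVf ?gt_eqF// mul1r.
  rewrite -dens_int//; last by move=> y; exact: F10.
  congr (_ * _)%E; apply: eq_integral => v _; rewrite /rpart; have [v0|v0] := ltP 0 v => //.
  rewrite /F2 /F1 mulr_gt0 ?powR_gt0// powRM ?powR_ge0 ?(ltW ei)// VK//.
  by rewrite -(powR_inv1 (ltW e0)) -powRrM mulN1r.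
apply: (@le_lt_trans _ _ (\int[nu]_v (M%:E + G v))%E).
  apply: ge0_le_integral => //.
  - by move=> x _; rewrite lee_fin rpart_ge0.
  - exact/measurable_EFinP.
  - exact: emeasurable_funD.
  move=> x _; rewrite /rpart /G; case: ifP => x0; last first.
    by rewrite adde_ge0// lee_fin mulr_ge0// jap_ge0.
  rewrite /F powR_gt0//= VK//; case: (leP K x) => Kx.
    by rewrite -EFinD lee_fin lerDr mulr_ge0// jap_ge0.
  rewrite adde0 lee_fin; have /andP[_ hx] := hb x; apply: (le_trans hx); rewrite ler_wpM2l//.
  by apply: jap_homo => //; rewrite !gtr0_norm// ltW.
rewrite ge0_integralD//; last by move=> x _; rewrite lee_fin mulr_ge0// jap_ge0.
rewrite int_prob_cst lte_add_pinfty ?ltry//; apply: (le_lt_trans bound); rewrite eq1.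
have i0 : (0 <= \int[nu]_x (rpart (fun x => h (e `^ (- mu) * x)) x)%:E)%E by apply: int_ge0 => x; exact: rpart_ge0.
have ei0 : (0 <= (e^-1)%:E :> \bar R)%E by rewrite lee_fin invr_ge0 ltW.
by apply: lty_mul; rewrite ?lee_fin ?ltry// ?mule_ge0//; apply: lty_mul; rewrite ?ltry.
Qed.

End decreasing_density.

(** * Tails of the limit law *)

Section smooth_step.
Context (R : realType).
Implicit Types (x y h : R).

Lemma quad_is_derive (u : R -> R) x (k : R) : (forall h, `|u (x + h) - u x - k * h| <= h ^+ 2) -> is_derive x 1 u k.
Proof.
move=> hq.
have c : h^-1 *: (u (h *: 1 + x) - u x) @[h --> 0^'] --> k.
  apply/cvgrPdist_le => e e0; near=> h.
  have hn : h != 0 by near: h; exact: nbhs_dnbhs_neq.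
  have he : `|h| <= e by near: h; apply: dnbhs0_le.
  rewrite /GRing.scale/= mulr1 distrC [h + x]addrC.
  have -> : h^-1 * (u (x + h) - u x) - k = h^-1 * (u (x + h) - u x - k * h) by field.
  rewrite normrM (le_trans (ler_wpM2l (normr_ge0 _) (hq h)))//.
  by rewrite -(real_normK (num_real h)) normfV expr2 mulrA mulVf ?normr_eq0// mul1r.
have d : derivable u x 1 by apply/cvg_ex; exists k.
by apply: DeriveDef => //; apply: cvg_lim c.
Unshelve. all: by end_near.
Qed.

Lemma is_derive_pos2 x : is_derive x 1 (fun y => pos y ^+ 2) (2 * pos x).
Proof.
apply: quad_is_derive => h; rewrite ler_norml /pos.
by case: (ltP (x + h) 0) => a; case: (ltP x 0) => b; apply/andP; split; nra.
Qed.

Lemma is_derive_posX n x : is_derive x 1 (fun y => pos y ^+ n.+2) (n.+2%:R * pos x ^+ n.+1).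
Proof.
elim: n => [|n IH]; first exact: is_derive_pos2.
have E y (k : nat) : pos y ^+ k.+2 = y * pos y ^+ k.+1.
  by rewrite exprS /pos; case: (leP 0 y) => y0 //; rewrite exprS !mul0r mulr0.
have -> : (fun y : R => pos y ^+ n.+3) = (fun y => y * pos y ^+ n.+2) by apply/funext => y; rewrite E.
have D : is_derive x 1 (fun y => y * pos y ^+ n.+2) _ := is_deriveM (is_derive_id x 1) IH.
apply: (is_derive_eq D); rewrite /GRing.scale/= mulr1 mulrCA -E -[in RHS]natr1; ring.
Qed.

Lemma Sym_pos j n : (j < n)%N -> exists c, Sym j n%:R c (fun x => pos x ^+ n).
Proof.
have b k x : `|pos x ^+ k| <= 1 * jap k%:R x.
  rewrite mul1r normrX ger0_norm ?pos_ge0// /jap powR_mulrn ?(ltW (jap1_gt0 x))//.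
  rewrite lerXn2r ?nnegrE ?pos_ge0 ?(ltW (jap1_gt0 x))// (@le_trans _ _ `|x|)//; last by rewrite lerDr.
  by rewrite /pos ge_max ler_norm normr_ge0.
elim: j n => [|j IH] n; first by exists 1.
case: n => [//|[//|n]]; rewrite ltnS => jn; have [c hc] := IH n.+1 jn.
have := SymZ n.+2%:R hc; set K := _ * c => sK; have K0 := Sym_c0 sK.
exists (1 + K); split; first by move=> x; apply: (le_trans (b n.+2 x)); rewrite ler_wpM2r ?jap_ge0// lerDl.
exists (fun x => n.+2%:R * pos x ^+ n.+1); split; first by move=> x; exact: is_derive_posX.
apply: Sym_le sK; last by lra.
by rewrite -[n.+2%:R]natr1; lra.
Qed.

(* Smooth step: [0] on the negative axis, bounded below on [[1, +oo[], and in the Zolotarev classes. *)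
Definition step (k : nat) x := pos x ^+ (2 * k) * (sqp1 x)^-1 ^+ k.

Lemma Sym_step j k : (j < 2 * k)%N -> exists c, Sym j 0 c (step k).
Proof.
move=> jk; have [c hc] := Sym_pos jk; have [e he] := Sym_inv R j.
have [f hf] : exists f, Sym j (- 2 * k%:R) f (fun x => (sqp1 x)^-1 ^+ k).
  elim: k {jk c hc} => [|k [f hf]].
    by exists 1; rewrite mulr0; apply: (Sym_ext _ (Sym_cst R j)) => x; rewrite expr0.
  have := SymM he hf; move: (2 ^+ j * (e * f)) => K hK; exists K.
  have -> : - 2 * k.+1%:R = - 2 + - 2 * k%:R :> R by rewrite -natr1; ring.
  by apply: Sym_ext hK => x; rewrite exprS.
have := SymM hc hf; move: (2 ^+ j * (c * f)) => K; rewrite natrM (_ : 2 * k%:R + - 2 * k%:R = 0 :> R); last by ring.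
by exists K.
Qed.

Lemma step_frac k x : step k x = (pos x ^+ 2 / sqp1 x) ^+ k.
Proof. by rewrite /step exprM -exprMn. Qed.

Lemma step01 k x : 0 <= step k x <= 1.
Proof.
have q0 := sqp1_gt0 x.
have f0 : 0 <= pos x ^+ 2 / sqp1 x by rewrite divr_ge0 ?sqr_ge0// ltW.
rewrite step_frac exprn_ge0//= exprn_ile1// ler_pdivrMr// mul1r /pos /sqp1.
by case: (leP 0 x) => _; rewrite ?lerDr// expr0n/= addr_ge0// sqr_ge0.
Qed.

Lemma step_neg k x : (0 < k)%N -> x <= 0 -> step k x = 0.
Proof. by case: k => // k _ x0; rewrite step_frac /pos max_r// expr0n/= mul0r expr0n. Qed.

Lemma step_ge k x : 1 <= x -> 2^-1 ^+ k <= step k x.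
Proof.
move=> x1; have q0 := sqp1_gt0 x; rewrite step_frac lerXn2r ?nnegrE//.
  by rewrite divr_ge0 ?sqr_ge0// ltW.
rewrite ler_pdivlMr// /pos max_l /sqp1; last by lra.
by nra.
Qed.

Lemma measurable_step k : measurable_fun setT (step k).
Proof.
apply: measurable_funM; first by apply: measurable_funX; exact: measurable_pos.
rewrite (_ : (fun x => _) = (fun x : R => ck 1 x ^+ k)).
  by apply: measurable_funX; case: (bdm_ck (1 : R)).
by apply/funext => x; rewrite /ck mul1r.
Qed.

Lemma bdm_step k (a b : R) : bdm (fun x => step k (b + a * x)).
Proof.
split; last by exists 1 => x; have /andP[h0 h1] := step01 k (b + a * x); rewrite ger0_norm.
apply: (measurableT_comp (measurable_step k)); apply: measurable_funD => //; exact: mulrl_measurable.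
Qed.

Lemma exponent_split (de : R) : 0 < de -> exists m al, de = m%:R + al /\ 0 < al <= 1.
Proof.
move=> d0; have ex : exists n : nat, de <= n%:R by exists (Num.bound de); rewrite ltW// archi_boundP// ltW.
case: (ex_minnP ex) => -[|m] hm min; first by rewrite leNgt d0 in hm.
exists m, (de - m%:R); split; first by ring.
have : ~~ (de <= m%:R) by apply/negP => /min; rewrite ltnn.
by rewrite -ltNge => mde; rewrite -natr1 in hm; apply/andP; split; lra.
Qed.

End smooth_step.

(** * Comparison of the tails of two laws at finite distance *)

Section tail_comparison.
Context (R : realType).
Implicit Types (mu nu : probability R R) (de : R).

(** What the tails need from a finite Zolotarev distance: a two-sided bound on bounded functions,
    which is symmetric and stable under reflection. *)
Definition zclose de mu nu := exists2 Z : R, 0 <= Z & forall m al k f, de = m%:R + al -> 0 < al <= 1 -> 0 < k ->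
  Zc m al k f -> bdm f -> `|\int[mu]_x f x - \int[nu]_x f x| <= k * Z.

Lemma zclose_sym de mu nu : zclose de mu nu -> zclose de nu mu.
Proof. by move=> [Z Z0 h]; exists Z => // m al k f *; rewrite distrC; exact: (h m al). Qed.

Definition rt nu (s : R) : R := \int[nu]_v \1_(`]s, +oo[%classic) v.

Lemma bdm_indic (S : set R) : measurable S -> bdm (\1_S : R -> R).
Proof.
split; first exact: measurable_indic.
by exists 1 => x; rewrite indicE; case: (_ \in _); rewrite ?normr1 ?normr0.
Qed.

Lemma rtE nu s : nu `]s, +oo[%classic = (rt nu s)%:E.
Proof. by rewrite /rt -bdm_EFin ?integral_indic ?setIT//; exact: bdm_indic. Qed.

(** The test function [step k (v / s - 1)] vanishes for [v <= s] and is at least [2^-k] for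
    [v >= 2 s]; the dilation gives it a class constant [O(s^-de)]. *)
Lemma tail_transfer de mu nu : 0 < de -> zclose de mu nu ->
  exists c C : R, [/\ 0 < c, 0 <= C & forall s, 0 < s -> c * rt nu (2 * s) <= rt mu s + C * s `^ (- de)].
Proof.
move=> de0 [Z Z0 hz]; have [m [al [dE al01]]] := exponent_split de0.
(* The symbol bounds needed for a class of order [m + al] reach the derivative of order [m + 1], and
   [step k] has them because [m + 1 < 2 k]. *)
pose k := m.+1.
have mk : (m.+1 < 2 * k)%N by rewrite mul2n -addnn -[X in (X < _)%N]addn0 ltn_add2l.
have [c hc] := @Sym_step R m.+1 k mk.
have m0 : 0 <= m%:R + al by rewrite -dE ltW.
have h1 : Zc m al (6 * (1 + c)) (step k).
  by apply: Sym_Zc => //; apply: Sym_le hc; rewrite // lerDr.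
have c0 := Sym_c0 hc.
exists (2^-1 ^+ k), (6 * (1 + c) * Z); split; first by rewrite exprn_gt0.
  by rewrite !mulr_ge0// addr_ge0.
move=> s s0; have si : 0 < s^-1 by rewrite invr_gt0.
have bs := bdm_step k s^-1 (- 1).
have k0 : 0 < s^-1 `^ (m%:R + al) * (6 * (1 + c)) by rewrite mulr_gt0 ?powR_gt0// mulr_gt0//; lra.
have := hz _ _ _ _ dE al01 k0 (Zc_affine (- 1) si h1) bs.
rewrite -dE -(powR_inv1 (ltW s0)) -powRrM mulN1r => H.
have bI t : bdm (\1_(`]t, +oo[%classic) : R -> R) by exact: bdm_indic.
have u1 : 2^-1 ^+ k * rt nu (2 * s) <= \int[nu]_v step k (- 1 + s `^ (-1) * v).
  rewrite /rt -bdm_RintZ//; apply: bdm_le; [exact: bdmZ|by rewrite powR_inv1 ?(ltW s0)|] => v.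
  rewrite indicE mem_setE/= in_itv/= andbT powR_inv1 ?(ltW s0)//.
  case: (ltP (2 * s) v) => sv; rewrite ?mulr1 ?mulr0; last by have /andP[] := step01 k (- 1 + s^-1 * v).
  have : 2 <= s^-1 * v by rewrite mulrC ler_pdivlMr// ltW.
  by move=> ?; apply: step_ge; lra.
have u2 : \int[mu]_v step k (- 1 + s `^ (-1) * v) <= rt mu s.
  rewrite /rt; apply: bdm_le; [by rewrite powR_inv1 ?(ltW s0)|exact: bI|] => v.
  rewrite indicE mem_setE/= in_itv/= andbT powR_inv1 ?(ltW s0)//.
  case: (ltP s v) => sv; first by have /andP[] := step01 k (- 1 + s^-1 * v).
  rewrite step_neg//; have : s^-1 * v <= 1 by rewrite mulrC ler_pdivrMr// mul1r.
  by lra.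
rewrite distrC ler_norml in H; have /andP[_ H2] := H.
lra.
Qed.

Lemma powR_small (q e : R) : 0 < q -> 0 < e -> exists2 s0, 0 < s0 & forall x, s0 <= x -> x `^ (- q) <= e.
Proof.
move=> q0 e0; exists (e `^ (- q^-1)); first exact: powR_gt0.
move=> x hx; have p0 : 0 < e `^ (- q^-1) by exact: powR_gt0.
apply: (le_trans (powR_rev _ p0 hx)); first by rewrite oppr_lt0.
by rewrite -powRrM mulrNN mulVf ?gt_eqF// powRr1// ltW.
Qed.

(** The error [s^-de] of [tail_transfer] is negligible against [s^-g] because [g < de], and halving
    the argument costs only a constant factor. *)
Lemma light_transfer g de mu nu : 0 < g -> g < de -> zclose de mu nu -> light_tail g mu -> light_tail g nu.
Proof.
move=> g0 gd zc lt e e0; have de0 : 0 < de by exact: lt_trans gd.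
have [c [C [c0 C0 h]]] := tail_transfer de0 zc.
pose u := c * e / 2; have u0 : 0 < u by rewrite divr_gt0// mulr_gt0.
have P0 (r : R) : 0 < 2^-1 `^ r :> R by rewrite powR_gt0.
have [s1 s10 h1] := lt (u * 2^-1 `^ g) (mulr_gt0 u0 (P0 g)).
have q0 : 0 < de - g by lra.
have e20 : 0 < u * 2^-1 `^ de / (C + 1) by rewrite divr_gt0 ?mulr_gt0//; lra.
have [s2 s20 h2] := powR_small q0 e20.
exists (Num.max (2 * s1) s2); first by rewrite lt_max s20 orbT.
move=> x; rewrite ge_max => /andP[x1 x2]; have x0 : 0 < x by exact: lt_le_trans x2.
have xs : 0 < x / 2 by rewrite divr_gt0.
have x1' : s1 <= x / 2 by rewrite ler_pdivlMr// mulrC.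
have := h1 _ x1'; have := h _ xs; have {h2} := h2 _ x2.
rewrite !rtE !lee_fin mulrCA divff// mulr1 !powRM ?(ltW x0)// ?invr_ge0//.
have -> : x `^ (- de) = x `^ (- g) * x `^ (- (de - g)) by rewrite -powRD ?(gt_eqF x0) ?implybT//; congr powR; ring.
rewrite !(powRN 2^-1).
have X0 : 0 < x `^ (- g) by exact: powR_gt0.
have X1 : 0 <= x `^ (- (de - g)) by exact: powR_ge0.
move: (x `^ (- (de - g))) X1 (x `^ (- g)) X0 (2^-1 `^ g) (P0 g) (2^-1 `^ de) (P0 de) => X X0' Y Y0 G G0 D D0 a1 a2 a3.
have {a3} a3 : rt mu (x / 2) <= u * Y by rewrite (le_trans a3)// mulrACA divff ?gt_eqF// mulr1.
have C10 : 0 < C + 1 by lra.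
rewrite ler_pdivlMr// in a1.
have {a1} a4 : C * (Y * X / D) <= u * Y.
  rewrite (_ : C * (Y * X / D) = C * X * Y / D); last by field; rewrite gt_eqF.
  rewrite ler_pdivrMr// [leRHS]mulrAC ler_pM2r//; have := mulr_ge0 C0 X0'; lra.
have : c * rt nu x <= c * (e * Y) by rewrite /u in a3 a4; lra.
by rewrite ler_pM2l.
Qed.

(** The upper bound comes from [tail_transfer], the lower one from the same lemma with the laws
    exchanged; far enough out, the error term takes at most half of the lower bound. *)
Lemma heavy_transfer g de mu nu : 0 < g -> g < de -> zclose de mu nu -> heavy_tail g mu -> heavy_tail g nu.
Proof.
move=> g0 gd zc [c1 [c2 [s1 [c10 s10 ht]]]]; have de0 : 0 < de by exact: lt_trans gd.
have q0 : 0 < de - g by lra.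
have [c [C [c0 C0 h]]] := tail_transfer de0 zc.
have [k [K [k0 K0 h']]] := tail_transfer de0 (zclose_sym zc).
have P0 (a r : R) : 0 < a -> 0 < a `^ r by move=> a0; exact: powR_gt0.
pose u := k * c1 * 2 `^ (- g); have u0 : 0 < u by rewrite !mulr_gt0// P0.
have K10 : 0 < 2 * (K + 1) by rewrite mulr_gt0//; lra.
have [s2 s20 h2] := powR_small q0 (divr_gt0 u0 K10).
have [s3 s30 h3] := powR_small q0 (@ltr01 R).
exists (u / 2), (c^-1 * (c2 * 2^-1 `^ (- g) + C * 2^-1 `^ (- de))), (Num.max (2 * s1) (Num.max s2 s3)); split.
- by rewrite divr_gt0.
- by rewrite !lt_max s20 orbT.
move=> x; rewrite !ge_max => /and3P[x1 x2 x3]; have x0 : 0 < x by exact: lt_le_trans x2.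
have xs : 0 < x / 2 by rewrite divr_gt0.
have x1' : s1 <= x / 2 by rewrite ler_pdivlMr// mulrC.
have x1'' : s1 <= 2 * x by apply: (le_trans x1'); rewrite ler_pdivrMr//; lra.
have {h} h := h _ xs; have {h'} h' := h' _ x0; have {h2} h2 := h2 _ x2; have {h3} h3 := h3 _ x3.
have /andP[_ b2] := ht _ x1'; have /andP[b1 _] := ht _ x1''.
have E : x `^ (- de) = x `^ (- g) * x `^ (- (de - g)) by rewrite -powRD ?(gt_eqF x0) ?implybT//; congr powR; ring.
rewrite rtE !lee_fin; rewrite rtE lee_fin in b1; rewrite rtE lee_fin in b2.
rewrite mulrCA divff// mulr1 in h.
rewrite powRM ?(ltW x0)// ?invr_ge0// in b2; rewrite powRM ?(ltW x0)// in b1.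
rewrite powRM ?(ltW x0)// ?invr_ge0// E in h; rewrite E in h'.
have X1 : 0 <= x `^ (- (de - g)) by exact: powR_ge0.
have Y0 := P0 x (- g) x0.
have D0 := P0 2^-1 (- de) (ltac:(by rewrite invr_gt0)).
rewrite ler_pdivlMr// in h2.
rewrite /u in h2 *.
move: (x `^ (- (de - g))) (x `^ (- g)) (2^-1 `^ (- g)) (2^-1 `^ (- de)) (2 `^ (- g)) (rt nu x) (rt mu (x / 2)) (rt mu (2 * x)) h h' h2 h3 b1 b2 X1 Y0 D0 {E u u0} => X Y G D H n m1 m2 h h' h2 h3 b1 b2 X1 Y0 D0.
apply/andP; split.
  have t1 : K * (Y * X) <= k * c1 * H / 2 * Y.
    rewrite mulrCA [Y * _]mulrC ler_pM2r// ler_pdivlMr//; apply: le_trans h2.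
    by have := mulr_ge0 K0 X1; lra.
  have := ler_wpM2l (ltW k0) b1; lra.
rewrite -mulrA ler_pdivlMl//; apply: (le_trans h).
rewrite mulrDl; apply: lerD; first by rewrite -mulrA [G * Y]mulrC.
rewrite -[C * D * Y]mulrA ler_wpM2l// [D * Y]mulrC ler_pM2r//.
by rewrite -{2}[Y]mulr1 ler_pM2l.
Qed.

End tail_comparison.

Section reflection.
Context (R : realType).
Implicit Types (mu nu : probability R R).

(** Everything is proved for right tails; the left tail of a law is the right tail of its
    reflection. *)
Definition refl nu : probability R R := dilate (-1) nu.

Lemma int_refl nu f : bdm f -> \int[refl nu]_v f v = \int[nu]_v f (-1 * v).
Proof. exact: int_dilate. Qed.

Lemma ge0_int_refl nu (f : R -> R) : measurable_fun setT f -> (forall x, 0 <= f x) ->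
  (\int[refl nu]_v (f v)%:E = \int[nu]_v (f (- v))%:E)%E.
Proof.
move=> mf f0; rewrite /refl /dilate ge0_int_law//.
- by apply: eq_integral => v _; rewrite /= mulN1r.
- exact/measurable_EFinP.
Qed.

Lemma Zc_opp m al k f : Zc m al k f -> Zc m al k (fun x : R => f (- x)).
Proof.
elim: m f => [|m IH] f /=.
  by move=> h x y; rewrite (le_trans (h _ _))// -opprD normrN.
move=> [g [d h]]; exists (fun x => - 1 * g (- x)); split; last first.
  by have := ZcZ (- 1) (IH _ h); rewrite normrN normr1 mul1r.
move=> x; have D : is_derive x 1 (fun x => f (- x)) _ := @is_derive1_comp R f (fun x => - x) x _ _ (d (- x)) (is_deriveN (is_derive_id x 1)).
by apply: (is_derive_eq D); rewrite mulrC.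
Qed.

Lemma zclose_refl de mu nu : zclose de mu nu -> zclose de (refl mu) (refl nu).
Proof.
move=> [Z Z0 h]; exists Z => // m al k f dE al01 k0 hf bf; rewrite !int_refl//.
have E : (fun x => f (-1 * x)) = (fun x => f (- x)) by apply/funext => x; rewrite mulN1r.
apply: (h m al k (fun x => f (-1 * x))) => //; first by rewrite E; exact: Zc_opp.
by apply: (bdm_comp bf); exact: mulrl_measurable.
Qed.

Lemma fixpt_refl (I : Type) d (T : measurableType d) (P : probability T R) (A : I -> T -> R)
  (mA : forall i, measurable_fun setT (A i)) s (mu : R) nu : fixpt P mA s mu nu -> fixpt P mA s mu (refl nu).
Proof.
move=> fp f bf; rewrite int_refl// fp; last by apply: (bdm_comp bf); exact: mulrl_measurable.
apply: eq_Rintegral => tau _; rewrite (@sm_scale _ _ _ _ P A mA nu (refl nu) (-1) s).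
- by apply: eq_Rintegral => w _; congr f; ring.
- by move=> g bg; rewrite int_refl.
- by apply: (bdm_comp bf); exact: mulrl_measurable.
Qed.

Lemma abs_moments q nu : 0 <= q -> (\int[nu]_v (`|v| `^ q)%:E < +oo)%E ->
  (pmom nu q < +oo)%E /\ (pmom (refl nu) q < +oo)%E.
Proof.
move=> q0 fin.
have ma : measurable_fun setT (fun v : R => `|v| `^ q) by exact: (measurableT_comp (measurable_powR q)).
have mo : measurable_fun setT (fun v : R => pos (- v) `^ q).
  by apply: (measurableT_comp (measurable_posq q)); exact: oppr_measurable.
have key (v : R) : pos v `^ q <= `|v| `^ q.
  by rewrite ge0_ler_powR ?nnegrE ?pos_ge0// /pos ge_max ler_norm normr_ge0.
split; apply: le_lt_trans fin.
  by apply: ge0_intle => //; [exact: measurable_posq|move=> v; rewrite powR_ge0/=].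
rewrite /pmom ge0_int_refl; last 2 first.
- exact: measurable_posq.
- by move=> v; exact: powR_ge0.
by apply: ge0_intle => // v; rewrite powR_ge0/= -normrN.
Qed.

(** Markov's inequality for [pos v^g] restricted to [v > n], whose integral tends to 0 by dominated
    convergence; without the restriction it would give [O(x^-g)] only. *)
Lemma pmom_light g nu : 0 < g -> (pmom nu g < +oo)%E -> light_tail g nu.
Proof.
move=> g0 fin e e0.
have ip : nu.-integrable setT (EFin \o (fun v : R => pos v `^ g)).
  apply/integrableP; split; first exact: measurable_posX.
  by under eq_integral do rewrite /= ger0_norm ?powR_ge0//.
pose f n (v : R) := pos v `^ g * \1_(`]n%:R, +oo[%classic) v.
have mf n : measurable_fun setT (f n).
  by apply: measurable_funM; [exact: measurable_posq|exact: measurable_indic].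
have [|||_ c] := @Rint_dct R _ _ nu f (fun=> 0) _ mf _ ip.
- exact: measurable_cst.
- move=> n v; rewrite /f ger0_norm ?mulr_ge0 ?powR_ge0// indicE.
  by case: (_ \in _); rewrite ?mulr1 ?mulr0 ?powR_ge0.
- move=> v; apply: cvg_near_cst; exists (Num.bound `|v|) => // n /= nb.
  rewrite /f indicE mem_setE/= in_itv/= andbT ltNge.
  have -> : v <= n%:R; last by rewrite mulr0.
  apply: (le_trans (ler_norm v)); apply: (le_trans (ltW (archi_boundP (normr_ge0 v)))).
  by rewrite ler_nat.
rewrite Rint_cst in c.
have /cvgr0Pnorm_le /(_ e e0) [n _ hn] := c.
have {hn} hn : `|\int[nu]_x f n x| <= e := hn n (leqnn n).
exists n.+1%:R => // x nx; have x0 : 0 < x by exact: lt_le_trans nx.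
have xg : 0 < x `^ g by exact: powR_gt0.
have fi : nu.-integrable setT (EFin \o f n).
  apply: le_integrable ip => //; first exact/measurable_EFinP.
  move=> v _; rewrite /= lee_fin /f normrM ger0_norm ?powR_ge0// indicE.
  by case: (_ \in _); rewrite ?normr1 ?normr0 ?mulr1 ?mulr0 ?powR_ge0.
have h : (\int[nu]_v (f n v)%:E <= e%:E)%E.
  rewrite -[leLHS]fineK; last exact: integrable_fin_num fi.
  by rewrite lee_fin; exact: le_trans (ler_norm _) hn.
have bI : bdm (\1_(`]x, +oo[%classic) : R -> R) by exact: bdm_indic.
rewrite rtE lee_fin powRN ler_pdivlMr// mulrC -lee_fin /rt -bdm_RintZ// -bdm_EFin; last exact: bdmZ.
apply: le_trans h; apply: ge0_intle => //.
  by apply: measurable_funM => //; exact: measurable_indic.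
move=> v; rewrite /f !indicE !mem_setE/= !in_itv/= !andbT.
case: (ltP x v) => xv; last by rewrite !mulr0 lexx mulr_ge0 ?powR_ge0.
have nv : n%:R < v by apply: lt_trans xv; apply: lt_le_trans nx; rewrite ltr_nat.
rewrite nv !mulr1 powR_ge0/= ge0_ler_powR ?nnegrE ?pos_ge0 ?(ltW g0) ?(ltW x0)//.
by rewrite /pos le_max ltW.
Qed.

End reflection.

(** * Integrability on each half-line under dilation *)

Section sides.
Context (R : realType) (I : Type) d (T : measurableType d) (P : probability T R).
Variables (A : I -> T -> R) (mA : forall i, measurable_fun setT (A i)) (A0 : forall i x, 0 <= A i x).
Variables (s : seq I) (mu g de : R) (Wg Wd : I -> R).
Hypotheses (g0 : 0 < g) (gde : g < de) (mug0 : 0 < mu * g + 1) (mud0 : 0 < mu * de + 1).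
Hypotheses (hWg : forall i, (\int[P]_x (A i x `^ g)%:E = (Wg i)%:E)%E) (sWg : \sum_(i <- s) Wg i <= mu * g + 1).
Hypotheses (hWd : forall i, (\int[P]_x (A i x `^ de)%:E = (Wd i)%:E)%E) (sWd : \sum_(i <- s) Wd i < mu * de + 1).

(* Integrability of [h] over [x > 0] is not created by the dilation [x |-> expR (- mu * t) * x]. *)
Definition side_ok (nu : probability R R) := forall (h : R -> R) c t, measurable_fun setT h -> (forall x, 0 <= h x <= c * jap de x) -> 0 <= t ->
  (\int[nu]_x (rpart (fun x => h (expR (- mu * t) * x)%R) x)%:E < +oo)%E -> (\int[nu]_x (rpart h x)%:E < +oo)%E.

Lemma heavy_side_ok nu : fixpt P mA s mu nu -> heavy_tail g nu -> side_ok nu.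
Proof.
move=> fp ht h c t mh hb t0.
(* For [mu = 0] there is no dilation; the density argument, which uses [mu^-1], is reserved for the
   other case. *)
have [m0|m0] := eqVneq mu 0.
  have -> // : (fun x => h (expR (- mu * t) * x)) = h by apply/funext => x; rewrite m0 oppr0 mul0r expR0 mul1r.
have de0 : 0 <= de by rewrite ltW// (lt_trans g0).
have := heavy_side fp m0 g0 ht (expR_gt0 t) de0 mh hb.
have -> // : expR t `^ (- mu) = expR (- mu * t).
by rewrite /powR gt_eqF ?expR_gt0// expRK.
Qed.

Lemma light_side_ok nu : (pmom nu de < +oo)%E -> side_ok nu.
Proof.
move=> fin h c _ mh hb _ _.
have de0 : 0 <= de by rewrite ltW// (lt_trans g0).
have c0 : 0 <= c by have /andP[a1 a2] := hb 0; move: (le_trans a1 a2); rewrite pmulr_lge0// jap_gt0.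
pose k := c * 2 `^ de; have k0 : 0 <= k by rewrite mulr_ge0// powR_ge0.
apply: (@le_lt_trans _ _ (\int[nu]_x (k * (1 + pos x `^ de))%:E)%E).
  apply: ge0_intle; first exact: measurable_rpart.
    by apply: measurable_funM => //; apply: measurable_funD => //; exact: measurable_posq.
  move=> x; rewrite rpart_ge0/=; last by move=> y; have /andP[] := hb y.
  rewrite /rpart; case: ifP => x0; last by rewrite mulr_ge0// addr_ge0// powR_ge0.
  have /andP[_ hx] := hb x; apply: (le_trans hx); rewrite /k -mulrA ler_wpM2l// /jap.
  have px : pos x = x by rewrite /pos max_l// ltW.
  rewrite px gtr0_norm//; have := @powR_add2 R de 1 x de0 ler01 (ltW x0); by rewrite powR1.
rewrite ge0_intZ//; last 2 first.
- by apply: measurable_funD => //; exact: measurable_posq.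
- by move=> x; rewrite addr_ge0// powR_ge0.
rewrite ge0_intD//; last 2 first.
- exact: measurable_posq.
- by move=> x; exact: powR_ge0.
rewrite int_prob_cst; apply: lty_mul; rewrite ?lee_fin ?ltry//.
  by apply: adde_ge0 => //; exact: pmom_ge0.
by rewrite lte_add_pinfty ?ltry.
Qed.

Lemma light_pmom nu : fixpt P mA s mu nu -> light_tail g nu ->
  (1 <= g -> exists q, [/\ 1 <= q, g < q + 1 & (pmom nu q < +oo)%E]) -> (pmom nu de < +oo)%E.
Proof.
move=> fp lt hq.
have fB := fixpt_ext fp; have B0 := extA_ge0 A0 mu.
have mg i := @ext_moment _ _ _ _ P A mA A0 mu i g _ mug0 (hWg i).
have md i := @ext_moment _ _ _ _ P A mA A0 mu i de _ mud0 (hWd i).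
have sg : \sum_(i <- s) (mu * g + 1)^-1 * Wg i <= 1 by rewrite -mulr_sumr ler_pdivrMl// mulr1.
have sd : \sum_(i <- s) (mu * de + 1)^-1 * Wd i < 1 by rewrite -mulr_sumr ltr_pdivrMl// mulr1.
have [g1|g1] := ltP g 1; first exact: (light_finite_sub B0 fB g0 gde mg sg md sd lt).
have [q [q1 gq hp]] := hq g1.
exact: (light_finite_sup B0 fB g0 gde mg sg md sd lt g1 q1 gq hp).
Qed.

(** Two ways to secure a side: comparable densities, or a finite moment of order [de]. In the
    second, the moment of order [q] starts the bootstrap of [light_finite_sup]. *)
Definition tail_ok nu := heavy_tail g nu \/
  (light_tail g nu /\ (1 <= g -> exists q, [/\ 1 <= q, g < q + 1 & (pmom nu q < +oo)%E])).

Lemma tail_side_ok nu : fixpt P mA s mu nu -> tail_ok nu -> side_ok nu.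
Proof.
move=> fp [ht|[lt hq]]; first exact: heavy_side_ok.
by apply: light_side_ok; exact: light_pmom.
Qed.

Lemma sides_lossless (nu : probability R R) : side_ok nu -> side_ok (refl nu) ->
  forall (h : R -> R) (c t : R), measurable_fun setT h -> (forall x, 0 <= h x <= c * jap de x) -> 0 <= t ->
  (\int[nu]_x (h (expR (- mu * t) * x))%:E < +oo)%E -> (\int[nu]_x (h x)%:E < +oo)%E.
Proof.
move=> s1 s2 h c t mh hb t0 fin; set lam := expR (- mu * t) in fin *.
have h0 x : 0 <= h x by have /andP[] := hb x.
have mhl : measurable_fun setT (fun x : R => h (lam * x)) by apply: (measurableT_comp mh); exact: mulrl_measurable.
have mho : measurable_fun setT (fun x : R => h (- x)) by apply: (measurableT_comp mh); exact: oppr_measurable.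
have mhol : measurable_fun setT (fun x : R => h (- (lam * x))) by apply: (measurableT_comp mho); exact: mulrl_measurable.
have F1 : (\int[nu]_x (rpart h x)%:E < +oo)%E.
  apply: (s1 h c t mh hb t0); apply: le_lt_trans fin; apply: ge0_intle => //; first exact: measurable_rpart.
  by move=> x; rewrite rpart_ge0//= /rpart; case: ifP.
have F2 : (\int[refl nu]_x (rpart (fun x => h (- x)%R) x)%:E < +oo)%E.
  apply: (s2 (fun x => h (- x)) c t) => //.
    by move=> x; have := hb (- x); rewrite /jap normrN.
  rewrite ge0_int_refl; last 2 first.
  - exact: measurable_rpart.
  - by move=> x; exact: rpart_ge0.
  apply: le_lt_trans fin; apply: ge0_intle => //.
    by apply: (measurableT_comp (measurable_rpart mhol)); exact: oppr_measurable.
  by move=> x; rewrite rpart_ge0//= /rpart; case: ifP => // _; rewrite mulrN opprK.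
rewrite ge0_int_refl in F2; last 2 first.
- exact: measurable_rpart.
- by move=> x; exact: rpart_ge0.
have mr1 := measurable_rpart mh.
have mr2 : measurable_fun setT (fun x : R => rpart (fun x => h (- x)) (- x)).
  by apply: (measurableT_comp (measurable_rpart mho)); exact: oppr_measurable.
apply: (@le_lt_trans _ _ (\int[nu]_x (h 0 + (rpart h x + rpart (fun x => h (- x)) (- x)))%:E)%E).
  apply: ge0_intle => //; first by apply: measurable_funD => //; exact: measurable_funD.
  move=> x; rewrite h0/= /rpart oppr_gt0 opprK; have := h0 0; have := h0 x.
  by case: (ltgtP x 0) => [_|_|->]; lra.
rewrite ge0_intD//; last 2 first.
- exact: measurable_funD.
- by move=> x; rewrite addr_ge0// rpart_ge0.
rewrite ge0_intD//; last 2 first.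
- by move=> x; exact: rpart_ge0.
- by move=> x; exact: rpart_ge0.
rewrite int_prob_cst; apply: lte_add_pinfty; first exact: ltry.
exact: lte_add_pinfty.
Qed.

End sides.

(** * Tails read off from the distribution function *)

Section distribution_tails.
Context (R : realType).
Implicit Types (m nu : probability R R).

(** [S x] is [1 - F(x)] on the right and [F(-x)] on the left. The latter counts the endpoint while
    [rt] does not, hence the sandwich by [S (2 * x)] and [S x], which costs only a factor in the
    constants. *)
Lemma tail_dichotomy m g (c : R) (S : R -> R) :
  (forall e, 0 < e -> exists2 s0, 0 < s0 & forall x, s0 <= x -> `|c - x `^ g * S x| <= e) ->
  (forall x, 0 < x -> S (2 * x) <= rt m x <= S x) -> 0 <= c -> (c = 0 -> light_tail g m) /\ (0 < c -> heavy_tail g m).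
Proof.
move=> hS hm c0; split => [cz e e0|{}c0].
  have [s0 s00 h] := hS e e0; exists s0 => // x sx; have x0 : 0 < x by exact: lt_le_trans sx.
  have xg : 0 < x `^ g by exact: powR_gt0.
  have /andP[_ h2] := hm x x0; rewrite rtE lee_fin (le_trans h2)// powRN ler_pdivlMr// mulrC.
  by have := h x sx; rewrite cz sub0r normrN => /(le_trans (ler_norm _)).
have [s0 s00 h] := hS (c / 2) (divr_gt0 c0 (ltr0Sn _ 1)).
exists (c / 2 * 2 `^ (- g)), (c + c / 2), s0; split => //; first by rewrite mulr_gt0 ?powR_gt0// divr_gt0.
move=> x sx; have x0 : 0 < x by exact: lt_le_trans sx.
have x20 : 0 < 2 * x by rewrite mulr_gt0.
have sx2 : s0 <= 2 * x by rewrite (le_trans sx)// ler_peMl ?(ltW x0)// ler1n.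
have g1 : 0 < x `^ g by exact: powR_gt0.
have g2 : 0 < (2 * x) `^ g by exact: powR_gt0.
have /andP[h1 h2] := hm x x0; rewrite rtE !lee_fin; apply/andP; split.
  apply: le_trans h1; rewrite -mulrA -powRM ?(ltW x0)// powRN ler_pdivrMr// mulrC.
  by have := h _ sx2; rewrite ler_norml => /andP[_]; lra.
apply: (le_trans h2); rewrite powRN ler_pdivlMr// mulrC.
by have := h _ sx; rewrite ler_norml => /andP[+ _]; lra.
Qed.

Lemma cvgy_dist (f : R -> R) (c : R) : f @ +oo --> c ->
  forall e, 0 < e -> exists2 s0, 0 < s0 & forall x, s0 <= x -> `|c - f x| <= e.
Proof.
move=> /cvgrPdist_le h e /h [M [_ hM]]; exists (Num.max 1 (M + 1)); first by rewrite lt_max ltr01.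
by move=> x; rewrite ge_max => /andP[_ xM]; apply: hM; lra.
Qed.

Lemma distrfun_int m x : distrfun m x = \int[m]_v \1_(`]-oo, x]%classic) v.
Proof.
rewrite /distrfun; have bI : bdm (\1_(`]-oo, x]%classic) : R -> R) by exact: bdm_indic.
have := bdm_EFin m bI; rewrite integral_indic// setIT => ->//.
Qed.

Lemma distrfun_rt m x : 1 - distrfun m x = rt m x.
Proof.
have b1 : bdm (\1_(`]-oo, x]%classic) : R -> R) by exact: bdm_indic.
have b2 : bdm (fun _ : R => 1 : R) by exact: bdm_cst.
rewrite distrfun_int -(Rint_cst m 1) -bdm_RintB//; apply: eq_Rintegral => v _.
by rewrite !indicE !mem_setE/= !in_itv/= andbT leNgt; case: ltP; rewrite ?subr0 ?subrr.
Qed.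

Lemma cvg_right_tail m g (c : R) : (fun x => x `^ g * (1 - distrfun m x)) @ +oo --> c -> 0 <= c ->
  (c = 0 -> light_tail g m) /\ (0 < c -> heavy_tail g m).
Proof.
move=> /cvgy_dist h; apply: (@tail_dichotomy m g c (fun x => 1 - distrfun m x)) => // x x0.
rewrite !distrfun_rt lexx andbT; apply: bdm_le; [exact: bdm_indic|exact: bdm_indic|] => v.
rewrite !indicE !mem_setE/= !in_itv/= !andbT ler_nat; case: (ltP (2 * x) v) => // xv.
by rewrite (lt_trans _ xv)// ltr_pMl// ltr1n.
Qed.

Lemma cvg_left_tail m g (c : R) : (fun x => `|x| `^ g * distrfun m x) @ -oo --> c -> 0 <= c ->
  (c = 0 -> light_tail g (refl m)) /\ (0 < c -> heavy_tail g (refl m)).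
Proof.
move=> /cvgNy_compNP/cvgy_dist h; apply: (@tail_dichotomy _ g c (fun x => distrfun m (- x))) => [e e0|x x0].
  have [s0 s00 hs] := h e e0; exists s0 => // x sx; have x0 : 0 < x by exact: lt_le_trans sx.
  by have := hs x sx; rewrite /= normrN (gtr0_norm x0).
have bI (S : set R) : measurable S -> bdm (\1_S : R -> R) by exact: bdm_indic.
have bO : bdm (fun v : R => \1_(`]x, +oo[%classic) (-1 * v) : R).
  by apply: (bdm_comp (bI _ _)) => //; exact: mulrl_measurable.
rewrite /rt int_refl; last exact: bI.
rewrite !distrfun_int; apply/andP; split; apply: bdm_le => //; try exact: bI.
- move=> v; rewrite !indicE !mem_setE/= !in_itv/= !andbT ler_nat mulN1r.
  by case: (leP v (- (2 * x))) => // xv; rewrite (_ : x < - v)//; lra.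
- move=> v; rewrite !indicE !mem_setE/= !in_itv/= !andbT ler_nat mulN1r.
  by case: (ltP x (- v)) => // xv; rewrite (_ : v <= - x)//; lra.
Qed.

Lemma light_mean g nu : 1 < g -> light_tail g nu -> (pmom nu 1 < +oo)%E.
Proof.
move=> g1 /(_ 1 ltr01) [s0 s00 h].
have [C hC] := tmom_bounded ltr01 g1 s00 ler01 h.
exact: le_lt_trans (pmom_bound ltr01 hC) (ltry _).
Qed.

Lemma eint_abs nu f : nu `]-oo, 0[%classic = 0%E -> measurable_fun setT f ->
  (\int[nu]_v (f v)%:E = \int[nu]_v (f `|v|)%:E)%E.
Proof.
move=> n0 mf; apply: ae_eq_integral => //.
- exact/measurable_EFinP.
- by apply/measurable_EFinP; exact: (measurableT_comp mf).
exists `]-oo, 0[%classic; split => // x /=; rewrite in_itv/=.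
by apply: contra_notP => /negP; rewrite -leNgt => x0 _; rewrite ger0_norm.
Qed.

End distribution_tails.

(** * Second moment of a Gaussian mixture *)

Section gaussian_mixture.
Context (R : realType) (zeta nu : probability R R) (s2 : R).
Hypotheses (s20 : 0 < s2) (zmean : (\int[zeta]_z `|z|%:E = 1)%E).
Hypothesis hcos : forall xi, \int[nu]_v cos (xi * v) = \int[zeta]_z expR (- (s2 * xi ^+ 2 / 2 * `|z|)).

Lemma normr_sin_le (x : R) : `|sin x| <= `|x|.
Proof.
have [th [_ E]] := mvt_pt x 0 (fun z => is_derive_sin z); move: E; rewrite sin0 !subr0 => ->.
by rewrite normrM ler_piMl// ler_norml cos_geN1 cos_le1.
Qed.

Lemma one_subr_cos (x : R) : 0 <= 1 - cos x <= x ^+ 2 / 2.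
Proof.
rewrite subr_ge0 cos_le1/=.
have -> : cos x = 1 - sin (x / 2) ^+ 2 *+ 2.
  have -> : x = (x / 2) *+ 2 by rewrite -mulr_natr divfK.
  by rewrite cos_mulr2n cos2sin2 -[x / 2 *+ 2]mulr_natr divfK//; ring.
have := normr_sin_le (x / 2); rewrite -ler_sqr ?nnegrE// !real_normK ?num_real// [sin _ ^+ 2 *+ 2]mulr2n.
have -> : x ^+ 2 / 2 = 2 * (x / 2) ^+ 2 by field.
by move=> h; lra.
Qed.

Lemma cos_taylor (x : R) : `|x ^+ 2 / 2 + cos x - 1| <= `|x| ^+ 4.
Proof.
have d1 (z : R) : is_derive z 1 (fun x : R => x - sin x) (1 - cos z).
  by apply: is_deriveB.
have d2 (z : R) : is_derive z 1 (fun x : R => x ^+ 2 / 2 + cos x - 1) (z - sin z).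
  by apply: is_derive_eq; rewrite // /GRing.scale/= ?expr1; field.
have [th [/andP[t0 t1] E]] := mvt_pt x 0 d2; move: E; rewrite cos0 !subr0 expr0n/= mul0r add0r subrr subr0 add0r => ->.
have [th' [/andP[t0' t1'] E]] := mvt_pt (th * x) 0 d1; move: E; rewrite sin0 !subr0 add0r => ->.
have /andP[c0 c1] := one_subr_cos (th' * (th * x)).
rewrite !normrM (ger0_norm c0) (ger0_norm t0).
have h : 1 - cos (th' * (th * x)) <= `|x| ^+ 2.
  have a1 : th' ^+ 2 <= 1 by rewrite exprn_ile1.
  have a2 : th ^+ 2 <= 1 by rewrite exprn_ile1.
  apply: (le_trans c1); rewrite !exprMn real_normK ?num_real//.
  have b1 : th ^+ 2 * x ^+ 2 <= x ^+ 2 by rewrite ler_piMl// sqr_ge0.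
  have b0 : 0 <= th ^+ 2 * x ^+ 2 by rewrite mulr_ge0 ?sqr_ge0.
  have := ler_piMl b0 a1; lra.
have -> : `|x| ^+ 4 = `|x| ^+ 2 * `|x| * `|x| by ring.
rewrite ler_wpM2r// ler_pM//; first by rewrite mulr_ge0.
by rewrite -[leRHS]mul1r ler_wpM2r.
Qed.

Lemma sn_bound_cvg (f : nat -> R) (l C : R) : (forall n, `|f n - l| <= C * sn R n) -> f n @[n --> \oo] --> l.
Proof.
move=> h; apply/cvgrPdist_le => e e0.
have C0 : 0 < `|C| + 1 by rewrite ltr_wpDl.
have /cvgr0Pnorm_le /(_ (e / (`|C| + 1)) (divr_gt0 e0 C0)) := @sn_cvg R.
apply: filterS => n /= hn; rewrite distrC (le_trans (h n))// (le_trans (ler_norm _))// normrM.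
apply: (@le_trans _ _ ((`|C| + 1) * `|sn R n|)); first by rewrite ler_wpM2r// lerDl.
by rewrite mulrC -ler_pdivlMr.
Qed.

(** Second difference quotient at 0 of the cosine transform, increasing no faster than its limit
    [v^2]. Its integral under [nu] is that of [r] under [zeta], so the second moment of [nu] is read
    off from the mean of [zeta]. *)
Let q n (v : R) := 2 * (1 - cos (sn R n * v)) / sn R n ^+ 2.

Let r n (z : R) := 2 * (1 - expR (- (s2 * sn R n ^+ 2 / 2 * `|z|))) / sn R n ^+ 2.

Let sn0 n : 0 < sn R n. Proof. by have /andP[] := @sn01 R n. Qed.

Let sn2_0 n : 0 < sn R n ^+ 2. Proof. by rewrite exprn_gt0. Qed.

Let dv n (a : R) : 0 <= a -> 0 <= a / sn R n ^+ 2. Proof. by move=> a0; apply: divr_ge0 => //; exact: ltW. Qed.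

Let y0 n (z : R) : 0 <= s2 * sn R n ^+ 2 / 2 * `|z|.
Proof. by apply: mulr_ge0 => //; apply: divr_ge0 => //; apply: mulr_ge0; exact: ltW. Qed.

Let sn2_le n : sn R n ^+ 2 <= sn R n.
Proof. by have /andP[h0 h1] := @sn01 R n; rewrite expr2 ler_piMr// ltW. Qed.

Lemma q_bound n v : 0 <= q n v <= v ^+ 2.
Proof.
have /andP[c0 c1] := one_subr_cos (sn R n * v); rewrite /q dv ?mulr_ge0//=.
by rewrite ler_pdivrMr//; rewrite exprMn in c1; lra.
Qed.

Lemma q_rate n v : `|q n v - v ^+ 2| <= 2 * `|v| ^+ 4 * sn R n.
Proof.
have h := cos_taylor (sn R n * v); have s0 := sn2_0 n.
have -> : q n v - v ^+ 2 = - ((sn R n * v) ^+ 2 / 2 + cos (sn R n * v) - 1) * (2 / sn R n ^+ 2).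
  by rewrite /q; field; rewrite gt_eqF// sn0.
rewrite normrM normrN [X in _ * X]ger0_norm ?dv//.
apply: (le_trans (ler_wpM2r _ h)); first exact: dv.
rewrite normrM (gtr0_norm (sn0 n)).
have -> : (sn R n * `|v|) ^+ 4 * (2 / sn R n ^+ 2) = 2 * `|v| ^+ 4 * sn R n ^+ 2 by field; rewrite gt_eqF// sn0.
by rewrite ler_wpM2l// mulr_ge0// exprn_ge0.
Qed.

Lemma q_cvg v : q n v @[n --> \oo] --> v ^+ 2.
Proof. by apply: sn_bound_cvg => n; exact: q_rate. Qed.

Lemma r_bound n z : 0 <= r n z <= s2 * `|z|.
Proof.
have [_ /andP[e0 e1]] := expRN_le (y0 n z); rewrite /r dv ?mulr_ge0//=.
by rewrite ler_pdivrMr//; move: e1; lra.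
Qed.

Lemma r_cvg z : r n z @[n --> \oo] --> s2 * `|z|.
Proof.
apply: (@sn_bound_cvg _ _ ((s2 * `|z|) ^+ 2 / 2)) => n; have s0 := sn2_0 n.
have [/andP[e0 e1] _] := expRN_le (y0 n z).
have -> : r n z - s2 * `|z| = - ((expR (- (s2 * sn R n ^+ 2 / 2 * `|z|)) - (1 - s2 * sn R n ^+ 2 / 2 * `|z|)) * (2 / sn R n ^+ 2)).
  by rewrite /r; field; rewrite gt_eqF// sn0.
rewrite normrN ger0_norm; last by apply: mulr_ge0 => //; exact: dv.
apply: (le_trans (ler_wpM2r _ e1)); first exact: dv.
have -> : (s2 * sn R n ^+ 2 / 2 * `|z|) ^+ 2 * (2 / sn R n ^+ 2) = (s2 * `|z|) ^+ 2 / 2 * sn R n ^+ 2 by field; rewrite gt_eqF// sn0.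
by rewrite ler_wpM2l// divr_ge0// sqr_ge0.
Qed.

Lemma bdm_q n : bdm (q n).
Proof.
have b : bdm (fun v : R => cos (sn R n * v)) by apply: bdm_cos; exact: mulrl_measurable.
have := bdmZ (2 / sn R n ^+ 2) (bdmB (bdm_cst _ 1) b).
rewrite (_ : (fun x : R => _) = q n)//; apply/funext => v; rewrite /q; ring.
Qed.

Lemma bdm_gauss n : bdm (fun z : R => expR (- (s2 * sn R n ^+ 2 / 2 * `|z|))).
Proof.
split.
  rewrite (_ : (fun z => _) = (fun z : R => expR (- (s2 * sn R n ^+ 2 / 2) * `|z|))).
    by apply: (measurableT_comp (@measurable_expR R)); exact: measurable_funM.
  by apply/funext => z; rewrite mulNr.
by exists 1 => z; rewrite ger0_norm ?expR_ge0//; have /andP[] := expRN01 (y0 n z).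
Qed.

Lemma bdm_r n : bdm (r n).
Proof.
have b := bdm_gauss n.
have := bdmZ (2 / sn R n ^+ 2) (bdmB (bdm_cst _ 1) b).
rewrite (_ : (fun x : R => _) = r n)//; apply/funext => v; rewrite /r; ring.
Qed.

Lemma int_qr n : \int[nu]_v q n v = \int[zeta]_z r n z.
Proof.
have b : bdm (fun v : R => cos (sn R n * v)) by apply: bdm_cos; exact: mulrl_measurable.
have br : bdm (fun z : R => expR (- (s2 * sn R n ^+ 2 / 2 * `|z|))) := bdm_gauss n.
have E (m : probability R R) (f : R -> R) : bdm f ->
    \int[m]_v (2 * (1 - f v) / sn R n ^+ 2) = 2 / sn R n ^+ 2 * (1 - \int[m]_v f v).
  move=> bf; rewrite -[X in X - _](Rint_cst m 1) -(bdm_RintB m (bdm_cst _ 1) bf) -(bdm_RintZ m _ (bdmB (bdm_cst _ 1) bf)).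
  by apply: eq_Rintegral => v _; ring.
by rewrite /q /r (E nu _ b) (E zeta _ br) hcos.
Qed.

Lemma eint_z : (\int[zeta]_z (s2 * `|z|)%:E = s2%:E)%E.
Proof. by rewrite ge0_intZ ?(ltW s20)// zmean mule1. Qed.

Lemma zint : zeta.-integrable setT (EFin \o (fun z => s2 * `|z|)).
Proof.
apply/integrableP; split; first by apply/measurable_EFinP; exact: measurable_funM.
have -> : (\int[zeta]_x `|(EFin \o (fun z : R => s2 * `|z|)%R) x| = \int[zeta]_z (s2 * `|z|)%:E)%E.
  by apply: eq_integral => z _; rewrite /= ger0_norm// mulr_ge0// ltW.
by rewrite eint_z ltry.
Qed.

Lemma int_z : \int[zeta]_z (s2 * `|z|) = s2.
Proof. by rewrite /Rintegral eint_z. Qed.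

Lemma int_q_le n : \int[nu]_v q n v <= s2.
Proof.
rewrite int_qr -lee_fin -bdm_EFin; last exact: bdm_r.
apply: (@le_trans _ _ (\int[zeta]_z (s2 * `|z|)%:E)%E).
  apply: ge0_intle; [by case: (bdm_r n)|exact: measurable_funM|] => z; exact: r_bound.
by rewrite eint_z.
Qed.

(** Integrability of [v^2] is not known yet, so the limit of the quotients is taken after truncation
    at [K^2]; the bound [s2] is uniform in [K]. *)
Lemma mixture_pmom2 : (pmom nu 2 < +oo)%E.
Proof.
apply: (@le_lt_trans _ _ s2%:E); last exact: ltry.
apply: pmom_bound => // K K0.
pose f n v := Num.min (q n v) (K ^+ 2); pose F (v : R) := Num.min (v ^+ 2) (K ^+ 2).
have mf n : measurable_fun setT (f n) by apply: measurable_minr => //; case: (bdm_q n).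
have mF : measurable_fun setT F by apply: measurable_minr => //; exact: exprn_measurable.
have k2 : 0 <= K ^+ 2 by exact: sqr_ge0.
have f01 n v : 0 <= f n v <= K ^+ 2.
  by have /andP[a _] := q_bound n v; rewrite /f le_min a k2 ge_min lexx orbT.
have F01 v : 0 <= F v <= K ^+ 2 by rewrite /F le_min sqr_ge0 k2 ge_min lexx orbT.
have fK n v : `|f n v| <= K ^+ 2 by have /andP[a b] := f01 n v; rewrite ger0_norm.
have bf n : bdm (f n) by split => //; exists (K ^+ 2) => v.
have bF : bdm F by split => //; exists (K ^+ 2) => v; have /andP[a b] := F01 v; rewrite ger0_norm.
have cf v : f n v @[n --> \oo] --> F v.
  apply: sn_bound_cvg => n; apply: le_trans (q_rate n v); rewrite /f /F ler_norml.
  move: (q n v) (v ^+ 2) (K ^+ 2) => a b k.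
  have h1 := ler_norm (a - b); have h2 : - (a - b) <= `|a - b| by rewrite -normrN ler_norm.
  by case: (leP a k) => ak; case: (leP b k) => bk; apply/andP; split; lra.
have c := @bdm_dct R _ _ nu f F (K ^+ 2) mf mF fK cf.
apply: (@le_trans _ _ (\int[nu]_v F v)).
  apply: bdm_le => //; first by apply: bdm_cut => //; exact: ltW.
  move=> v; rewrite powR_mulrn ?cut_ge0 ?(ltW K0)// /F le_min; apply/andP; split.
    rewrite -[leRHS]real_normK ?num_real// lerXn2r ?nnegrE ?cut_ge0 ?(ltW K0)//.
    by apply: (le_trans (cut_pos K v)); rewrite /pos ge_max ler_norm normr_ge0.
  by rewrite lerXn2r ?nnegrE ?cut_ge0 ?(ltW K0)// cut_le.
apply: (ler_cvg_to c (cvg_cst s2)); apply: nearW => n.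
apply: le_trans (int_q_le n); apply: bdm_le => //; first exact: bdm_q.
by move=> v; rewrite /f ge_min lexx.
Qed.

Lemma mixture_variance : nu.-integrable setT (EFin \o (fun v => v ^+ 2)) -> \int[nu]_v v ^+ 2 = s2.
Proof.
move=> iv.
have [||||_ c1] := @Rint_dct R _ _ nu q (fun v => v ^+ 2) (fun v => v ^+ 2) _ _ iv.
- by move=> n; case: (bdm_q n).
- exact: exprn_measurable.
- by move=> n v; have /andP[a b] := q_bound n v; rewrite ger0_norm.
- exact: q_cvg.
have [||||_ c2] := @Rint_dct R _ _ zeta r (fun z => s2 * `|z|) (fun z => s2 * `|z|) _ _ zint.
- by move=> n; case: (bdm_r n).
- exact: measurable_funM.
- by move=> n z; have /andP[a b] := r_bound n z; rewrite ger0_norm.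
- exact: r_cvg.
rewrite int_z in c2; apply: cvg_unique c1 _; first exact: Rhausdorff.
by rewrite (_ : (fun n => _) = (fun n => \int[zeta]_z r n z))//; apply/funext => n; rewrite int_qr.
Qed.

End gaussian_mixture.

Section limit_tails.
Context (R : realType) (mu0 zeta nuinf : probability R R) (gamma : R) (g : R -> R[i]).
Hypotheses (zsupp : zeta `]-oo, 0[%classic = 0%E) (zmean : (\int[zeta]_z (z : R)%:E = 1)%E).
Hypothesis hinf : forall xi, charfun nuinf xi = cexpect zeta (fun z => g (xi * z `^ gamma^-1)).

Lemma zeta_mean_abs : (\int[zeta]_z (`|z : R|)%:E = 1)%E.
Proof. by rewrite -zmean; apply/esym; exact: (eint_abs (f := id)). Qed.

(** Here [nuinf] is the law of [m0 * z] under [zeta], whose mean is 1. *)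
Lemma limit_mean_fin (m0 : R) : gamma = 1 -> g = (fun xi => cexpi (m0 * xi)) -> (\int[nuinf]_v (`|v| `^ 1)%:E < +oo)%E.
Proof.
move=> g1 gE.
have mX : measurable_fun setT (fun z : R => m0 * z `^ gamma^-1) by apply: measurable_funM => //; exact: measurable_powR.
have E : forall S : set R, measurable S -> nuinf S = law zeta mX S.
  apply: charfun_inj => xi; rewrite hinf gE /charfun /cexpect /cint.
  have [b1 b2] : cbdm (fun x : R => cexpi (xi * x)) by apply: cbdm_cexpi; exact: measurable_funM.
  rewrite (bdm_law zeta mX b1) (bdm_law zeta mX b2).
  by apply: complex_split; apply: eq_Rintegral => z _; rewrite (_ : m0 * (xi * z `^ gamma^-1) = xi * (m0 * z `^ gamma^-1))//; ring.
have mf : measurable_fun setT (fun v : R => `|v| `^ 1) by exact: (measurableT_comp (measurable_powR 1)).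
rewrite (eq_measure_integral (law zeta mX)); last by move=> S mS _; exact: E.
rewrite ge0_int_law//; last exact/measurable_EFinP.
rewrite (eint_abs (f := fun z => `|m0 * z `^ gamma^-1| `^ 1))//; last exact: (measurableT_comp mf mX).
have -> : (\int[zeta]_v (`|m0 * `|v| `^ gamma^-1| `^ 1)%:E = \int[zeta]_v (`|m0| * `|v|)%:E)%E.
  by apply: eq_integral => v _; rewrite g1 invr1 (powRr1 (normr_ge0 _)) (powRr1 (normr_ge0 v)) normrM normr_id.
by rewrite ge0_intZ// zeta_mean_abs mule1 ltry.
Qed.

Lemma limit_cos (s2 : R) : gamma = 2 -> g = (fun xi => (expR (- s2 * xi ^+ 2 / 2))%:C) ->
  forall xi, \int[nuinf]_v cos (xi * v) = \int[zeta]_z expR (- (s2 * xi ^+ 2 / 2 * `|z|)).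
Proof.
move=> g2 gE xi; rewrite -[LHS]/(complex.Re (charfun nuinf xi)) hinf gE /cexpect /cint.
rewrite -[LHS]/(\int[zeta]_z expR (- s2 * (xi * z `^ gamma^-1) ^+ 2 / 2)).
have mf : measurable_fun setT (fun z : R => expR (- s2 * (xi * z `^ gamma^-1) ^+ 2 / 2)).
  apply: (measurableT_comp (@measurable_expR R)); apply: measurable_funM => //; apply: measurable_funM => //.
  by apply: measurable_funX; apply: measurable_funM => //; exact: measurable_powR.
rewrite (int_abs zsupp mf); apply: eq_Rintegral => z _; congr expR.
rewrite exprMn -(powR_mulrn 2 (powR_ge0 `|z| gamma^-1)) -powRrM g2 mulVf// powRr1//.
by ring.
Qed.

Lemma limit_cos_refl (s2 : R) : gamma = 2 -> g = (fun xi => (expR (- s2 * xi ^+ 2 / 2))%:C) ->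
  forall xi, \int[refl nuinf]_v cos (xi * v) = \int[zeta]_z expR (- (s2 * xi ^+ 2 / 2 * `|z|)).
Proof.
move=> g2 gE xi; rewrite -limit_cos// int_refl; last by apply: bdm_cos; exact: mulrl_measurable.
by apply: eq_Rintegral => v _; rewrite mulN1r mulrN cosN.
Qed.

(** With a finite mean at [gamma = 1], and at [gamma = 2], the moment of order [gamma] of [nuinf] is
    computed directly and makes both tails light. Otherwise the tails of [mu0] are transferred, side
    by side: light where the limiting constant is 0, heavy where it is positive. *)
Lemma Hgamma_tail_ok de : 0 < gamma <= 2 -> Hgamma mu0 gamma g -> gamma < de -> zclose de mu0 nuinf ->
  tail_ok gamma nuinf /\ tail_ok gamma (refl nuinf).
Proof.
move=> /andP[g0 g2] H gd zc; have zc' := zclose_refl zc.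
have moment q (nu : probability R R) : 1 <= q -> gamma = q -> (pmom nu q < +oo)%E -> tail_ok gamma nu.
  move=> q1 gq hp; right; split; first by apply: pmom_light => //; rewrite gq.
  by move=> _; exists q; split=> //; lra.
have heavy (nu nu' : probability R R) : zclose de nu nu' -> heavy_tail gamma nu -> tail_ok gamma nu'.
  by move=> z h; left; exact: heavy_transfer z h.
have light (nu nu' : probability R R) : gamma != 1 -> zclose de nu nu' -> gamma < 2 -> light_tail gamma nu -> tail_ok gamma nu'.
  move=> gn z gl h; have h' := light_transfer g0 gd z h; right; split => // g1.
  exists 1; split => //.
  by apply: light_mean h'; rewrite lt_neqAle eq_sym gn.
case: H => [[gE [[_ /= gg]|[c [sym h1 h2 c0 _]]]]|[[gE [s2 [_ _ s20 _ gg]]]|[[/andP[_ gl2] gn1] [c [c' /= [h1 h2 cc _ _]]]]]].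
- have [p1 p2] := abs_moments ler01 (limit_mean_fin gE gg).
  by split; apply: (moment 1).
- have h1' : (fun x => x `^ gamma * (1 - distrfun mu0 x)) @ +oo --> c.
    apply: cvg_trans h1; apply: near_eq_cvg; exists 0; split => // x x0.
    by rewrite gE powRr1// ltW.
  have h2' : (fun x => `|x| `^ gamma * distrfun mu0 x) @ -oo --> c.
    apply: cvg_trans h2; apply: near_eq_cvg; exists 0; split => // x x0.
    by rewrite gE powRr1.
  split; apply: heavy.
  + exact: zc.
  + by have [_] := cvg_right_tail h1' (ltW c0); apply.
  + exact: zc'.
  + by have [_] := cvg_left_tail h2' (ltW c0); apply.
- split; apply: (moment 2) => //; first by rewrite ler1n.
  + exact: mixture_pmom2 s20 zeta_mean_abs (limit_cos gE gg).
  + by rewrite ler1n.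
  + exact: mixture_pmom2 s20 zeta_mean_abs (limit_cos_refl gE gg).
- have F01 x : 0 <= distrfun mu0 x <= 1.
    have bI : bdm (\1_(`]-oo, x]%classic) : R -> R) by exact: bdm_indic.
    rewrite distrfun_int; apply/andP; split.
      by rewrite -(Rint_cst mu0 0); apply: bdm_le => //; exact: bdm_cst.
    by rewrite -[leRHS](Rint_cst mu0 1); apply: (bdm_le mu0 bI (bdm_cst _ 1)) => v; rewrite indicE lern1 leq_b1.
  have c0 : 0 <= c.
    apply: (ler_cvg_to (cvg_cst 0) h1).
    by apply: nearW => x; rewrite mulr_ge0 ?powR_ge0// subr_ge0; have /andP[] := F01 x.
  have c0' : 0 <= c'.
    apply: (ler_cvg_to (cvg_cst 0) h2).
    by apply: nearW => x; rewrite mulr_ge0 ?powR_ge0//; have /andP[] := F01 x.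
  have [l1 v1] := cvg_right_tail h1 c0; have [l2 v2] := cvg_left_tail h2 c0'.
  split.
    move: c0; rewrite le_eqVlt => /predU1P[/esym/l1|/v1]; [exact: light|exact: heavy].
  move: c0'; rewrite le_eqVlt => /predU1P[/esym/l2|/v2]; [exact: light|exact: heavy].
Qed.

End limit_tails.

(** * Moments in the case gamma = 2 *)

Section gamma_function.
Context (R : realType) (a : R).
Local Notation leb := (@lebesgue_measure R).
Hypothesis a01 : 0 < a <= 1.

Let a0 : 0 < a. Proof. by case/andP: a01. Qed.
Let a1 : a <= 1. Proof. by case/andP: a01. Qed.
Let K := (1 + a) * (2 + a).

Lemma powR_le_affine (x : R) : 0 < x -> x `^ a <= (1 - a) + a * x.
Proof.
move=> x0; rewrite /powR gt_eqF//; set l := ln x.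
have t1 := expR_ge1Dx (- (a * l)); have t2 := expR_ge1Dx ((1 - a) * l).
have E1 : expR (a * l) * expR (- (a * l)) = 1 by rewrite expRN divff// gt_eqF ?expR_gt0.
have E2 : expR (a * l) * expR ((1 - a) * l) = x by rewrite -expRD (_ : a * l + (1 - a) * l = l) ?lnK//; ring.
have p0 := expR_ge0 (a * l).
have s1 := ler_wpM2l p0 t1; have s2 := ler_wpM2l p0 t2; rewrite E1 in s1; rewrite E2 in s2.
have h := a0; have h' : 0 <= 1 - a by rewrite subr_ge0.
have u1 := ler_wpM2l h' s1; have u2 := ler_wpM2l (ltW h) s2.
have := lerD u1 u2; rewrite mulr1; apply: le_trans; rewrite le_eqVlt; apply/orP; left; apply/eqP; ring.
Qed.

Let F (x : R) := - (expR (- x) * (x `^ (2 + a) + (2 + a) * x `^ (1 + a) + K * (1 + a * x))).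

Let f (x : R) := expR (- x) * (x `^ (2 + a) - K * x `^ a + K * (1 - a + a * x)).

(* Two integrations by parts, then [x^a <= (1 - a) + a x]. *)
Lemma gamma_primitive (x : R) : 0 < x -> is_derive x 1 F (f x).
Proof.
move=> x0.
have p2 : is_derive x 1 (fun y => y `^ (2 + a)) ((2 + a) * x `^ (1 + a)).
  by apply: (is_derive_eq (is_derive1_powR (2 + a) x0)); congr (_ * _ `^ _); ring.
have p1 : is_derive x 1 (fun y => y `^ (1 + a)) ((1 + a) * x `^ a).
  by apply: (is_derive_eq (is_derive1_powR (1 + a) x0)); congr (_ * _ `^ _); ring.
have pe : is_derive x 1 (fun y : R => expR (- y)) (- expR (- x)).
  have D : is_derive x 1 (fun y : R => expR (- y)) _ := @is_derive1_comp R expR (fun y => - y) x _ _ (is_derive_expR (- x)) (is_deriveN (is_derive_id x 1)).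
  by apply: (is_derive_eq D); ring.
have pl : is_derive x 1 (fun y : R => K * (1 + a * y)) (K * a).
  by apply: is_derive_eq; rewrite // /GRing.scale/=; ring.
have ps : is_derive x 1 (fun y : R => (2 + a) * y `^ (1 + a)) ((2 + a) * ((1 + a) * x `^ a)) := is_deriveZ (2 + a) p1.
have D : is_derive x 1 F _ := is_deriveN (is_deriveM pe (is_deriveD (is_deriveD p2 ps) pl)).
by apply: (is_derive_eq D); rewrite /GRing.scale/= ?fctE /f /K; ring.
Qed.

Lemma continuous_powR_pos b (x : R) : 0 < x -> {for x, continuous (fun y : R => y `^ b)}.
Proof.
by move=> x0; apply/differentiable_continuous/derivable1_diffP; case: (is_derive1_powR b x0).
Qed.

Lemma continuous_expRN (x : R) : {for x, continuous (fun y : R => expR (- y))}.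
Proof.
by apply: (@continuous_comp _ _ _ (fun y : R => - y) expR); [exact: opp_continuous|exact: continuous_expR].
Qed.

Lemma continuous_gamma_bound (x : R) : 0 < x -> {for x, continuous f}.
Proof.
move=> x0; apply: cvgM; first exact: continuous_expRN.
apply: cvgD.
  apply: cvgB; first exact: continuous_powR_pos.
  by apply: cvgM; [exact: cvg_cst|exact: continuous_powR_pos].
apply: cvgM; first exact: cvg_cst.
by apply: cvgD; [exact: cvg_cst|apply: cvgM; [exact: cvg_cst|exact: cvg_id]].
Qed.

Let h (x : R) := x `^ (2 + a) * expR (- x).

Let mh : measurable_fun setT h.
Proof.
apply: measurable_funM; first exact: measurable_powR.
apply: (measurableT_comp (@measurable_expR R)); exact: oppr_measurable.
Qed.

Let h0 x : 0 <= h x. Proof. by rewrite mulr_ge0 ?powR_ge0 ?expR_ge0. Qed.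

Let K0 : 0 <= K. Proof. by rewrite mulr_ge0// addr_ge0// ltW. Qed.

Lemma gamma_itv_le (e b : R) : 0 < e -> e < b -> (\int[leb]_(x in `[e, b]) (h x)%:E <= (- F e)%:E)%E.
Proof.
move=> e0 eb; have b0 : 0 < b by exact: lt_trans eb.
apply: (@le_trans _ _ (\int[leb]_(x in `[e, b]) (f x)%:E)%E).
  have hf x : e <= x -> h x <= f x.
    move=> ex; have x0 : 0 < x by exact: lt_le_trans ex.
    rewrite /h /f [leLHS]mulrC ler_wpM2l ?expR_ge0// -[leLHS]addr0 -[leRHS]addrA lerD2l addrC subr_ge0 ler_wpM2l//.
    exact: powR_le_affine.
  apply: ge0_le_integral => //.
  - by move=> x _; rewrite lee_fin.
  - by apply/measurable_EFinP; apply: measurable_funS mh.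
  - apply/measurable_EFinP; apply: (@measurable_funS _ _ _ _ setT) => //.
    apply: measurable_funM; first by apply: (measurableT_comp (@measurable_expR R)); exact: oppr_measurable.
    apply: measurable_funD.
      by apply: measurable_funB; [exact: measurable_powR|apply: measurable_funM => //; exact: measurable_powR].
    by apply: measurable_funM => //; apply: measurable_funD => //; exact: measurable_funM.
  - by move=> x /=; rewrite in_itv/= => /andP[ex _]; rewrite lee_fin hf.
have cF (x : R) : 0 < x -> {for x, continuous F}.
  by move=> x0; apply/differentiable_continuous/derivable1_diffP; case: (gamma_primitive x0).
rewrite (@continuous_FTC2 _ f F)//.
- rewrite -EFinB lee_fin -[leRHS]add0r lerD2r /F oppr_le0 mulr_ge0 ?expR_ge0//.
  by rewrite !addr_ge0 ?mulr_ge0 ?powR_ge0 ?addr_ge0 ?mulr_ge0// ltW.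
- apply/continuous_within_itvP => //; split.
  + by move=> x; rewrite in_itv/= => /andP[ex _]; apply: continuous_gamma_bound; exact: lt_trans ex.
  + exact/cvg_at_right_filter/continuous_gamma_bound.
  + exact/cvg_at_left_filter/continuous_gamma_bound.
- split.
  + by move=> x; rewrite in_itv/= => /andP[ex _]; case: (gamma_primitive (lt_trans e0 ex)).
  + exact/cvg_at_right_filter/cF.
  + exact/cvg_at_left_filter/cF.
- move=> x; rewrite in_itv/= => /andP[ex _].
  by have D := gamma_primitive (lt_trans e0 ex); rewrite derive1E; exact: derive_val.
Qed.

Lemma gamma_primitive0 : - F e @[e --> 0^'+] --> K.
Proof.
have pw0 b : 0 < b -> (e : R) `^ b @[e --> 0^'+] --> 0 by exact: powR_cvg0.
have id0 : (e : R) @[e --> 0^'+] --> 0 by apply: cvg_at_right_filter; exact: cvg_id.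
have KE : K = expR (- 0) * (0 + (2 + a) * 0 + K * (1 + a * 0)) by rewrite oppr0 expR0; ring.
rewrite [X in _ --> X]KE.
have -> : (fun e => - F e) = (fun e => expR (- e) * (e `^ (2 + a) + (2 + a) * e `^ (1 + a) + K * (1 + a * e))).
  by apply/funext => e; rewrite /F opprK.
apply: cvgM; first by apply: cvg_at_right_filter; exact: continuous_expRN.
apply: cvgD.
  apply: cvgD; first by apply: pw0; rewrite addr_gt0.
  by apply: cvgM; [exact: cvg_cst|apply: pw0; rewrite addr_gt0].
apply: cvgM; first exact: cvg_cst.
by apply: cvgD; [exact: cvg_cst|apply: cvgM; [exact: cvg_cst|exact: id0]].
Qed.

Lemma gamma_int_le : (\int[leb]_(x in `]0%R, +oo[) (h x)%:E <= K%:E)%E.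
Proof.
pose e (n : nat) : R := n.+2%:R^-1.
have e0 n : 0 < e n by rewrite invr_gt0.
have e1 n : e n < 1 by rewrite invf_lt1// ltr1n.
have n1 n : 1 < n.+2%:R :> R by rewrite ltr1n.
have U : \bigcup_n `[e n, n.+2%:R]%classic = `]0%R, +oo[%classic.
  apply/seteqP; split => [x [n _]|x]; rewrite /= !in_itv/= ?andbT; first by move=> /andP[xe _]; exact: lt_le_trans xe.
  move=> x0; have [n _ hn] := near_infty_natSinv_lt (PosNum x0).
  pose k := Num.bound x; exists (n + k)%N => //=; rewrite in_itv/=; apply/andP; split.
    have /= hh := hn n (leqnn n); apply: le_trans (ltW hh).
    by rewrite /e lef_pV2 ?posrE// ler_nat !ltnS leqW// leq_addr.
  apply: (le_trans (ltW (archi_boundP (ltW x0)))); rewrite ler_nat -/k.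
  by rewrite leqW// leqW// leq_addl.
rewrite -U; have := @ge0_nondecreasing_set_cvg_integral _ (measurableTypeR R) R (fun n => `[e n, n.+2%:R]%classic) (fun x => (h x)%:E) leb.
move=> /(_ _ _ _ _) H.
have ce : e n @[n --> \oo] --> 0^'+.
  have c0 : e n @[n --> \oo] --> 0.
    have := @cvg_harmonic R; rewrite -(cvg_shiftS); exact.
  move=> S /= nS; have : \forall n \near \oo, 0 < e n -> S (e n) by exact: (c0 _ nS).
  by apply: filterS => n; apply; exact: e0.
have cK : (- F (e n))%:E @[n --> \oo] --> K%:E.
  by apply: cvg_EFin; [exact: nearW|exact: (cvg_comp _ _ ce gamma_primitive0)].
apply: (lee_cvg_to (H _ _ _ _) cK); last first.
  by apply: nearW => n; apply: (gamma_itv_le (e0 n)); exact: lt_trans (e1 n) (n1 n).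
- by move=> i x _; rewrite lee_fin.
- by move=> i; apply/measurable_EFinP; apply: measurable_funS mh.
- by move=> i; exact: measurable_itv.
- move=> i j ij; apply/subsetPset => x /=; rewrite !in_itv/= => /andP[h1 h2]; apply/andP; split.
    by apply: le_trans h1; rewrite lef_pV2 ?posrE// ler_nat ltnS.
  by apply: (le_trans h2); rewrite ler_nat !ltnS.
Qed.

(** Behind the upper bound is [Gamma (3 + a) = (2 + a) (1 + a) Gamma (1 + a)] with
    [Gamma (1 + a) <= 1], as [(1 - a) + a x] has integral 1 against [e^(-x)]. Positivity needs the
    finiteness just obtained, because [fine] sends an infinite integral to 0. *)
Lemma Gamma_bounds : 0 < Gamma (3 + a) <= K.
Proof.
have E : Gamma (3 + a) = fine (\int[leb]_(x in `]0%R, +oo[) (h x)%:E).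
  by rewrite /Gamma /Rintegral; congr fine; apply: eq_integral => x _; rewrite /h; congr ((_ `^ _ * _)%:E); ring.
have I0 : (0 <= \int[leb]_(x in `]0%R, +oo[) (h x)%:E)%E by apply: integral_ge0 => x _; rewrite lee_fin.
have fin : (\int[leb]_(x in `]0%R, +oo[) (h x)%:E)%E \is a fin_num.
  by rewrite ge0_fin_numE// (le_lt_trans gamma_int_le) ?ltry.
rewrite E -lte_fin -lee_fin !fineK// gamma_int_le andbT {E fin I0}.
apply: (@lt_le_trans _ _ (\int[leb]_(x in `[1%R, 2%R]) (h x)%:E)%E); last first.
  apply: ge0_subset_integral => //.
  - by apply/measurable_EFinP; apply: measurable_funS mh.
  - by move=> x _; rewrite lee_fin.
  - by move=> x /=; rewrite !in_itv/= andbT => /andP[x1 _]; exact: lt_le_trans x1.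
apply: (@lt_le_trans _ _ (\int[leb]_(x in `[1%R, 2%R]) (cst (expR (- 2))%:E x))%E).
  have L : leb `[1%R, 2%R]%classic = 1%:E.
    by rewrite lebesgue_measure_itv/= lte_fin ltr1n -EFinB; congr EFin; ring.
  rewrite integral_cst// -[X in (_ * X)%E]/(leb `[1%R, 2%R]%classic) L mule1 lte_fin.
  exact: expR_gt0.
apply: ge0_le_integral => //.
- by move=> x _; rewrite lee_fin expR_ge0.
- by apply/measurable_EFinP; apply: measurable_funS mh.
move=> x /=; rewrite in_itv/= => /andP[x1 x2]; rewrite lee_fin /h -[leLHS]mul1r ler_pM ?expR_ge0//.
  have := @ge0_ler_powR R (2 + a) (ltac:(by rewrite addr_ge0// ltW)) 1 x; rewrite powR1 !nnegrE.
  by apply => //; lra.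
by rewrite ler_expR lerN2.
Qed.

End gamma_function.

(** * Second order Taylor expansion with a power remainder *)

Section taylor.
Context (R : realType).
Implicit Types (u du f : R -> R) (x z p k al : R).

(** The power is differentiated on []0, +oo[] only, so the mean value theorem is used on [[0, x]]
    with mere continuity at 0. *)
Lemma powR_compare u du p k x : 0 < p -> (forall z, is_derive z 1 u (du z)) ->
  (forall z, 0 < z -> du z <= k * z `^ (p - 1)) -> 0 <= x -> u x - u 0 <= k * x `^ p / p.
Proof.
move=> p0 d hd; rewrite le_eqVlt => /predU1P[<-|x0]; first by rewrite subrr powR0 ?gt_eqF// mulr0 mul0r.
have pn : p != 0 by rewrite gt_eqF.
pose w (z : R) := k / p * z `^ p - u z.
have dw (z : R) : 0 < z -> is_derive z 1 w (k * z `^ (p - 1) - du z).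
  move=> z0; have D := is_derive1_powR p z0.
  have D' : is_derive z 1 w _ := is_deriveB (is_deriveZ (k / p) D) (d z).
  by apply: (is_derive_eq D'); rewrite /GRing.scale/=; field.
have cw (z : R) : 0 < z -> {for z, continuous w}.
  by move=> z0; apply/differentiable_continuous/derivable1_diffP; case: (dw z z0).
have c0 : w z @[z --> 0^'+] --> w 0.
  rewrite /w powR0// mulr0; apply: cvgB; last first.
    by apply: cvg_at_right_filter; exact: (is_derive_cont d).
  by rewrite -[X in _ --> X](mulr0 (k / p)); apply: cvgM; [exact: cvg_cst|exact: powR_cvg0].
have dI z : z \in `]0, x[ -> is_derive z 1 w (k * z `^ (p - 1) - du z).
  by rewrite in_itv/= => /andP[z0 _]; exact: dw.
have cI : {within `[0, x], continuous w}.
  apply/continuous_within_itvP => //; split => //.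
    by move=> z; rewrite in_itv/= => /andP[z0 _]; exact: cw.
  exact/cvg_at_left_filter/cw.
have [z + E] := MVT x0 dI cI; rewrite in_itv/= => /andP[z0 _].
have : 0 <= w x - w 0 by rewrite E subr0 mulr_ge0 ?(ltW x0)// subr_ge0 hd.
rewrite /w powR0// mulr0; have -> : k * x `^ p / p = k / p * x `^ p by field.
lra.
Qed.

Lemma taylor_upper f (g1 g2 : R -> R) al x : 0 < al -> (forall z, is_derive z 1 f (g1 z)) -> (forall z, is_derive z 1 g1 (g2 z)) ->
  (forall z, `|g2 z - g2 0| <= `|z| `^ al) -> 0 <= x ->
  f x - f 0 - g1 0 * x - g2 0 * (x ^+ 2 / 2) <= x `^ (2 + al) / ((1 + al) * (2 + al)).
Proof.
move=> al0 d1 d2 h x0; have a1 : 0 < 1 + al by rewrite addr_gt0.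
have a2 : 0 < 2 + al by rewrite addr_gt0.
have s1 z : 0 <= z -> g1 z - g1 0 - g2 0 * z <= 1 * z `^ (1 + al) / (1 + al).
  move=> z0; pose u (y : R) := g1 y - g2 0 * y.
  have du (y : R) : is_derive y 1 u (g2 y - g2 0).
    have D : is_derive y 1 u _ := is_deriveB (d2 y) (is_deriveZ (g2 0) (is_derive_id y 1)).
    by apply: (is_derive_eq D); rewrite /GRing.scale/= mulr1.
  have := @powR_compare u _ (1 + al) 1 z a1 du _ z0; rewrite /u mulr0.
  move=> H; rewrite (_ : g1 z - g1 0 - g2 0 * z = g1 z - g2 0 * z - (g1 0 - 0)); last by ring.
  apply: H => y y0; rewrite mul1r (_ : 1 + al - 1 = al); last by ring.
  by apply: (le_trans (ler_norm _)); have := h y; rewrite (gtr0_norm y0).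
pose u (y : R) := f y - g1 0 * y - g2 0 * (y ^+ 2 / 2).
have du (y : R) : is_derive y 1 u (g1 y - g1 0 - g2 0 * y).
  have dq : is_derive y 1 (fun y : R => y ^+ 2 / 2) y.
    by apply: is_derive_eq; rewrite // /GRing.scale/= ?expr1; field.
  have D : is_derive y 1 u _ := is_deriveB (is_deriveB (d1 y) (is_deriveZ (g1 0) (is_derive_id y 1))) (is_deriveZ (g2 0) dq).
  by apply: (is_derive_eq D); rewrite /GRing.scale/= mulr1.
have := @powR_compare u _ (2 + al) (1 + al)^-1 x a2 du _ x0.
rewrite {1 2}/u expr0n/= mul0r !mulr0 !subr0 => H.
rewrite (_ : f x - f 0 - g1 0 * x - g2 0 * (x ^+ 2 / 2) = f x - g1 0 * x - g2 0 * (x ^+ 2 / 2) - f 0); last by ring.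
have -> : x `^ (2 + al) / ((1 + al) * (2 + al)) = (1 + al)^-1 * x `^ (2 + al) / (2 + al) by field; rewrite !gt_eqF.
apply: H => z z0; rewrite (_ : 2 + al - 1 = 1 + al); last by ring.
by have := s1 z (ltW z0); rewrite mul1r [_ / _]mulrC.
Qed.

(** Two integrations of [|z|^al] produce the denominators [1 + al] and [2 + al]; negative [x] is
    reached by reflecting [f]. *)
Lemma taylor2 al f : 0 < al -> Zc 2 al 1 f -> exists b c : R,
  forall x, `|f x - (f 0 + b * x + c * x ^+ 2)| <= `|x| `^ (2 + al) / ((1 + al) * (2 + al)).
Proof.
move=> al0 [g1 [d1 [g2 [d2 h]]]]; exists (g1 0), (g2 0 / 2) => x.
have h0 z : `|g2 z - g2 0| <= `|z| `^ al by have := h z 0; rewrite subr0 mul1r.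
have key (f' g1' g2' : R -> R) y : (forall z, is_derive z 1 f' (g1' z)) -> (forall z, is_derive z 1 g1' (g2' z)) ->
    (forall z, `|g2' z - g2' 0| <= `|z| `^ al) -> 0 <= y ->
    `|f' y - (f' 0 + g1' 0 * y + g2' 0 / 2 * y ^+ 2)| <= `|y| `^ (2 + al) / ((1 + al) * (2 + al)).
  move=> e1 e2 h' y0; rewrite (ger0_norm y0) ler_norml; apply/andP; split.
    have dn1 z : is_derive z 1 (fun z => - f' z) (- g1' z) := is_deriveN (e1 z).
    have dn2 z : is_derive z 1 (fun z => - g1' z) (- g2' z) := is_deriveN (e2 z).
    have hn z : `|- g2' z - - g2' 0| <= `|z| `^ al by rewrite -opprD normrN; exact: h'.
    have := taylor_upper al0 dn1 dn2 hn y0; lra.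
  by have := taylor_upper al0 e1 e2 h' y0; lra.
have [x0|x0] := leP 0 x; first exact: key.
have dopp (z : R) : is_derive z 1 (fun y : R => - y) (- 1) := is_deriveN (is_derive_id z 1).
have dcomp (u du : R -> R) : (forall z, is_derive z 1 u (du z)) -> forall z, is_derive z 1 (fun z => u (- z)) (- du (- z)).
  move=> du' z; have D : is_derive z 1 (fun z => u (- z)) _ := @is_derive1_comp R u (fun y => - y) z _ _ (du' (- z)) (dopp z).
  by apply: (is_derive_eq D); rewrite mulrN1.
have e1 := dcomp _ _ d1.
have e2 z : is_derive z 1 (fun z => - g1 (- z)) (g2 (- z)).
  have D : is_derive z 1 (fun z => - g1 (- z)) _ := is_deriveN (dcomp _ _ d2 z).
  by apply: (is_derive_eq D); rewrite opprK.
have hx z : `|g2 (- z) - g2 (- 0)| <= `|z| `^ al by rewrite oppr0; have := h0 (- z); rewrite normrN.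
have nx : 0 <= - x by rewrite oppr_ge0 ltW.
have := key _ _ _ _ e1 e2 hx nx; rewrite /= opprK oppr0 normrN sqrrN.
by rewrite mulrNN.
Qed.

End taylor.

Section moment_expansion.
Context (R : realType) (m : probability R R) (de : R).
Hypotheses (de2 : 2 < de) (hM : (\int[m]_v (`|v| `^ de)%:E < +oo)%E).
Implicit Types (f h : R -> R).

Let mabs : measurable_fun setT (fun v : R => `|v| `^ de).
Proof. exact: (measurableT_comp (measurable_powR de)). Qed.

Lemma dominated_integrable h (C : R) : measurable_fun setT h -> (forall v, `|h v| <= C * (1 + `|v| `^ de)) ->
  m.-integrable setT (EFin \o h).
Proof.
move=> mh hb; have C0 : 0 <= C.
  have := le_trans (normr_ge0 _) (hb 0); rewrite normr0 powR0 ?addr0 ?mulr1// gt_eqF//.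
  exact: lt_trans de2.
apply/integrableP; split; first exact/measurable_EFinP.
apply: (@le_lt_trans _ _ (\int[m]_v (C * (1 + `|v| `^ de))%:E)%E).
  apply: ge0_le_integral => //.
  - by apply/measurable_EFinP; exact: (measurableT_comp _ mh).
  - by apply/measurable_EFinP; apply: measurable_funM => //; exact: measurable_funD.
  - by move=> v _; rewrite lee_fin.
rewrite ge0_intZ//; last exact: measurable_funD.
rewrite ge0_intD// int_prob_cst; apply: lty_mul; rewrite ?lee_fin ?ltry//.
  by apply: adde_ge0 => //; apply: int_ge0 => v; exact: powR_ge0.
by apply: lte_add_pinfty; rewrite ?ltry.
Qed.

Lemma square_le (v : R) : v ^+ 2 <= 1 + `|v| `^ de.
Proof.
rewrite -real_normK ?num_real//; have [v1|v1] := leP `|v| 1.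
  by rewrite (@le_trans _ _ 1) ?exprn_ile1// lerDl powR_ge0.
rewrite -powR_mulrn// (@le_trans _ _ (`|v| `^ de)) ?lerDr//.
by apply: ler_powR; exact: ltW.
Qed.

Lemma norm_le (v : R) : `|v| <= 2 * (1 + `|v| `^ de).
Proof.
have := square_le v; rewrite -real_normK ?num_real//; have := sqr_ge0 (`|v| - 1); have := powR_ge0 `|v| de.
by move: `|v| (`|v| `^ de) => x y; nra.
Qed.

Lemma integrable_id : m.-integrable setT (EFin \o (id : R -> R)).
Proof. by apply: (dominated_integrable (C := 2)) => //; exact: norm_le. Qed.

Lemma integrable_sqr : m.-integrable setT (EFin \o (fun v : R => v ^+ 2)).
Proof.
apply: (dominated_integrable (C := 1)); first exact: exprn_measurable.
by move=> v; rewrite mul1r ger0_norm ?sqr_ge0// square_le.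
Qed.

(** With mean 0 and variance [s2] the quadratic part integrates to [f 0 + c * s2], the same number
    for both laws, so it cancels in the difference and only the remainders are left. *)
Lemma moment_expansion f (b c k s2 : R) : measurable_fun setT f -> 0 <= k ->
  (forall x, `|f x - (f 0 + b * x + c * x ^+ 2)| <= k * `|x| `^ de) ->
  \int[m]_v v = 0 -> \int[m]_v v ^+ 2 = s2 ->
  m.-integrable setT (EFin \o f) /\ `|\int[m]_v f v - (f 0 + c * s2)| <= k * fine (\int[m]_v (`|v| `^ de)%:E).
Proof.
move=> mf k0 hf h1 h2; pose p (x : R) := f 0 + (b * x + c * x ^+ 2); pose r x := f x - p x.
have hr x : `|r x| <= k * `|x| `^ de by rewrite /r /p addrA; exact: hf.
have m2 : measurable_fun setT (fun x : R => x ^+ 2) by exact: exprn_measurable.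
have mp : measurable_fun setT p by apply: measurable_funD => //; apply: measurable_funD; exact: measurable_funM.
have mr : measurable_fun setT r by exact: measurable_funB.
have ir : m.-integrable setT (EFin \o r).
  by apply: (dominated_integrable (C := k)) => // v; rewrite (le_trans (hr v))// ler_wpM2l// lerDr.
have ib : m.-integrable setT (EFin \o (fun x => b * x)).
  apply: (dominated_integrable (C := `|b| * 2)); first exact: measurable_funM.
  by move=> v; rewrite normrM -mulrA ler_wpM2l// norm_le.
have ic : m.-integrable setT (EFin \o (fun x => c * x ^+ 2)).
  apply: (dominated_integrable (C := `|c|)); first exact: measurable_funM.
  by move=> v; rewrite normrM ler_wpM2l// ger0_norm ?sqr_ge0// square_le.
have i0 : m.-integrable setT (EFin \o (fun _ : R => f 0)) by apply: bdm_int; exact: bdm_cst.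
have ibc : m.-integrable setT (EFin \o (fun x => b * x + c * x ^+ 2)).
  apply: (dominated_integrable (C := `|b| * 2 + `|c|)); first by apply: measurable_funD; exact: measurable_funM.
  move=> v; rewrite (le_trans (ler_normD _ _))// mulrDl lerD//.
    by rewrite normrM -mulrA ler_wpM2l// norm_le.
  by rewrite normrM ler_wpM2l// ger0_norm ?sqr_ge0// square_le.
have ip : m.-integrable setT (EFin \o p).
  by rewrite (_ : EFin \o p = (fun x => (EFin \o (fun=> f 0%R)) x + (EFin \o (fun x => b * x + c * x ^+ 2)%R) x)%E)//; exact: integrableD.
have Ep : \int[m]_v p v = f 0 + c * s2.
  rewrite /p RintegralD// Rint_cst RintegralD// RintegralZl//; last exact: integrable_id.
  by rewrite RintegralZl//; [rewrite h1 h2 mulr0 add0r|exact: integrable_sqr].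
have fE : f = (fun x => p x + r x) by apply/funext => x; rewrite /r; ring.
have if_ : m.-integrable setT (EFin \o f).
  by rewrite (_ : EFin \o f = (fun x => (EFin \o p) x + (EFin \o r) x)%E) ?fE//; exact: integrableD.
split => //.
have -> : \int[m]_v f v = \int[m]_v p v + \int[m]_v r v by rewrite -RintegralD// {1}fE.
rewrite Ep addrAC subrr add0r; apply: (le_trans (le_normr_Rintegral _ ir)) => //.
have M0 : (0 <= \int[m]_v (`|v| `^ de)%:E)%E by apply: int_ge0 => v; exact: powR_ge0.
have iar : m.-integrable setT (EFin \o (fun x => `|r x|)).
  apply: (dominated_integrable (C := k)); first exact: (measurableT_comp _ mr).
  by move=> v; rewrite normr_id (le_trans (hr v))// ler_wpM2l// lerDr.
have fm : (\int[m]_v (`|v| `^ de)%:E)%E \is a fin_num by rewrite ge0_fin_numE.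
have fr : (\int[m]_v (`|r v|)%:E)%E \is a fin_num by exact: integrable_fin_num iar.
rewrite -lee_fin EFinM (fineK fm) /Rintegral (fineK fr).
rewrite -ge0_intZ//.
apply: ge0_intle; [exact: (measurableT_comp _ mr)|exact: measurable_funM|by move=> v; rewrite normr_ge0 hr].
Qed.

End moment_expansion.

Section symmetric.
Context (R : realType) (nu : probability R R).

(** Positive and negative parts have equal integrals; if both are infinite the difference is [-oo],
    which [fine] sends to 0. *)
Lemma symmetric_mean : (forall S, measurable S -> nu S = refl nu S) -> \int[nu]_v v = 0.
Proof.
move=> sym; rewrite /Rintegral (int_pospB nu id).
have -> : (\int[nu]_x (negp id x)%:E = \int[nu]_x (posp id x)%:E)%E.
  rewrite [RHS](eq_measure_integral (refl nu)); last by move=> S mS _; exact: sym.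
  by rewrite ge0_int_refl//; [exact: measurable_posp|move=> x; exact: posp_ge0].
have : (0 <= \int[nu]_x (posp id x)%:E)%E by apply: int_ge0 => x; exact: posp_ge0.
by case: (\int[nu]_x (posp id x)%:E)%E => //= r _; rewrite subrr.
Qed.

Lemma abs_moment_sides (de : R) : 0 < de -> (pmom nu de < +oo)%E -> (pmom (refl nu) de < +oo)%E ->
  (\int[nu]_v (`|v| `^ de)%:E < +oo)%E.
Proof.
move=> de0 p1 p2.
have mo : measurable_fun setT (fun v : R => pos (- v) `^ de).
  by apply: (measurableT_comp (measurable_posq de)); exact: oppr_measurable.
rewrite /pmom ge0_int_refl in p2; last 2 first.
- exact: measurable_posq.
- by move=> v; exact: powR_ge0.
apply: (@le_lt_trans _ _ (\int[nu]_v (pos v `^ de + pos (- v) `^ de)%:E)%E).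
  apply: ge0_intle.
  - exact: (measurableT_comp (measurable_powR de)).
  - by apply: measurable_funD => //; exact: measurable_posq.
  move=> v; rewrite powR_ge0/= /pos; have [v0|v0] := leP 0 v.
    by rewrite ger0_norm// lerDl powR_ge0.
  by rewrite ltr0_norm// max_l ?lerDr ?powR_ge0// oppr_ge0 ltW.
rewrite ge0_intD//; last 3 first.
- exact: measurable_posq.
- by move=> v; exact: powR_ge0.
- by move=> v; exact: powR_ge0.
exact: (lte_add_pinfty p1 p2).
Qed.

End symmetric.

(** * The theorem *)

Section weights.
Context (R : realType) (N : nat) d (T : measurableType d) (P : probability T R) (A : 'I_N -> T -> R).
Hypothesis mA : forall i, measurable_fun setT (A i).

Definition weight q i := fine (\int[P]_x (A i x `^ q)%:E).

Lemma pw_powR (q a : R) : q != 0 -> pw a q = a `^ q.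
Proof. by move=> q0; rewrite /pw; case: eqP => // ->; rewrite powR0. Qed.

Lemma Qfun_weight q : q != 0 -> (Qfun P A q < +oo)%E ->
  (forall i, (\int[P]_x (A i x `^ q)%:E = (weight q i)%:E)%E) /\ Qfun P A q = (\sum_i weight q i - 1)%:E.
Proof.
move=> q0; rewrite /Qfun.
have -> : (\int[P]_x (\sum_(j < N) pw (A j x) q)%:E = \sum_(j < N) \int[P]_x (A j x `^ q)%:E)%E.
  rewrite -ge0_integral_sum//; last 2 first.
  - by move=> i; apply/measurable_EFinP; exact: (measurableT_comp (measurable_powR q) (mA i)).
  - by move=> i x _; rewrite lee_fin powR_ge0.
  apply: eq_integral => x _; rewrite sumEFin; congr EFin; apply: eq_bigr => i _; exact: pw_powR.
have I0 i : (0 <= \int[P]_x (A i x `^ q)%:E)%E by apply: int_ge0 => x; exact: powR_ge0.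
move=> fin; have W i : (\int[P]_x (A i x `^ q)%:E = (weight q i)%:E)%E.
  rewrite /weight fineK// ge0_fin_numE//; apply: contraTT fin; rewrite -!leNgt !leye_eq => /eqP iy.
  rewrite (bigD1 i)//= iy addye//.
  by rewrite gt_eqF// (lt_le_trans (ltNyr 0))// sume_ge0.
by split => //; under eq_bigr do rewrite W; rewrite sumEFin.
Qed.

Lemma Qfun_ge q : (- 1%:E <= Qfun P A q)%E.
Proof.
rewrite /Qfun -[leLHS]add0e leeD2r// integral_ge0// => x _; rewrite lee_fin sumr_ge0// => i _.
by rewrite /pw; case: ifP => // _; exact: powR_ge0.
Qed.

Variables gamma delta : R.
Hypotheses (gamma0 : 0 < gamma) (gd : gamma < delta) (HQ : Qfun P A gamma \is a fin_num)
  (Hmu : (mufun P A delta < mufun P A gamma)%E).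

Let delta0 : 0 < delta. Proof. exact: lt_trans gd. Qed.

Lemma Qfun_delta : (Qfun P A delta < +oo)%E.
Proof.
rewrite ltey; apply/negP => /eqP Qy; move: Hmu; rewrite /mufun Qy gt0_mulye ?lte_fin ?invr_gt0//.
by rewrite ltNge leey.
Qed.

Lemma weights_mu : let mug := fine (mufun P A gamma) in let mud := fine (mufun P A delta) in
  [/\ mug = fine (Qfun P A gamma) / gamma, \sum_i weight gamma i = mug * gamma + 1,
      \sum_i weight delta i = mud * delta + 1, mud < mug & 0 <= mud * delta + 1].
Proof.
have gn : gamma != 0 by rewrite gt_eqF.
have dn : delta != 0 by rewrite gt_eqF.
have Qg : (Qfun P A gamma < +oo)%E by rewrite ltey_eq HQ.
have [_ Eg] := Qfun_weight gn Qg; have [_ Ed] := Qfun_weight dn Qfun_delta.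
have q1 := Qfun_ge delta; rewrite Ed lee_fin in q1.
have lt : (\sum_i weight delta i - 1) / delta < (\sum_i weight gamma i - 1) / gamma.
  by have := Hmu; rewrite /mufun Eg Ed.
have -> : fine (mufun P A gamma) = (\sum_i weight gamma i - 1) / gamma by rewrite /mufun Eg.
have -> : fine (mufun P A delta) = (\sum_i weight delta i - 1) / delta by rewrite /mufun Ed.
rewrite Eg.
split => //.
- by rewrite divfK//; ring.
- by rewrite divfK//; ring.
- by rewrite divfK//; lra.
Qed.

(** For [mug < 0] one has [mug * gamma > mug * delta > mud * delta >= -1], the last inequality
    because [Q >= -1]. *)
Lemma exponents_pos : let mug := fine (mufun P A gamma) in 0 < mug * gamma + 1 /\ fine (mufun P A delta) * delta + 1 < mug * delta + 1.
Proof.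
have [_ _ _ lt d1] := weights_mu; set mug := fine (mufun P A gamma) in lt *; set mud := fine (mufun P A delta) in lt d1 *.
split; last by rewrite ltrD2r ltr_pM2r.
have [m0|m0] := leP 0 mug; first by rewrite ltr_wpDl// mulr_ge0// ltW.
have h : mug * delta < mug * gamma by rewrite ltr_nM2l.
have h' : mud * delta < mug * delta by rewrite ltr_pM2r.
lra.
Qed.

End weights.

Lemma integer_part_two (R : realType) (m : nat) (a : R) : 0 < a <= 1 -> 2 < m%:R + a <= 3 -> m = 2%N.
Proof.
move=> /andP[a0 a1] /andP[h2 h3]; apply/eqP; rewrite eqn_leq; apply/andP; split.
  by rewrite -ltnS -(ltr_nat R); lra.
by rewrite -ltnS -(ltr_nat R) -[m.+1%:R]natr1; lra.
Qed.

Lemma lerB_dist (R : realType) (x y z e k : R) : `|x - z| <= e -> `|y - z| <= k -> x - y <= e + k.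
Proof. by rewrite !ler_norml => /andP[_ h1] /andP[h2 _]; lra. Qed.

(** * Contraction of the distance and its bound by moments *)

Section contraction.
Context (R : realType) (N : nat) d (T : measurableType d) (P : probability T R) (A : 'I_N -> T -> R).
Hypotheses (Ameas : forall i, measurable_fun setT (A i)) (Anneg : forall i x, 0 <= A i x).
Variables (mu0 : probability R R) (gamma delta : R) (g : R -> R[i]).
Hypotheses (Hgamma_range : 0 < gamma <= 2) (HH : Hgamma mu0 gamma g)
  (HQfin : Qfun P A gamma \is a fin_num)
  (Hdelta : gamma < delta) (Hmu : (mufun P A delta < mufun P A gamma)%E).
Variable nu : R -> probability R R.
Hypotheses (Hinit : charfun (nu 0) = charfun mu0)
  (Hcont : forall xi,
      (complex.Re (charfun (nu t) xi) @[t --> 0^'+] --> complex.Re (charfun mu0 xi)) /\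
      (complex.Im (charfun (nu t) xi) @[t --> 0^'+] --> complex.Im (charfun mu0 xi)))
  (Hode : forall xi t, 0 < t ->
      let rhs := - charfun (nu t) xi
                 + cexpect P (fun x => \prod_(i < N) charfun (nu t) (A i x * xi)) in
      is_derive t 1 (fun s => complex.Re (charfun (nu s) xi)) (complex.Re rhs) /\
      is_derive t 1 (fun s => complex.Im (charfun (nu s) xi)) (complex.Im rhs)).
Variable zeta : probability R R.
Hypotheses (Hz_supp : zeta `]-oo, 0[%classic = 0%E) (Hz_mean : (\int[zeta]_z (z : R)%:E = 1)%E)
  (Hz_eq : forall xi, charfun zeta xi =
      cint (@lebesgue_measure R) `[0, 1]%classic (fun tau =>
        cexpect P (fun x => \prod_(i < N)
          charfun zeta (xi * pw (A i x) gamma * tau `^ fine (Qfun P A gamma))))).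
Variable nuinf : probability R R.
Hypothesis Hinf : forall xi, charfun nuinf xi = cexpect zeta (fun z => g (xi * z `^ gamma^-1)).

Local Notation mug := (fine (mufun P A gamma)).
Local Notation mud := (fine (mufun P A delta)).

Let gamma0 : 0 < gamma. Proof. by case/andP: Hgamma_range. Qed.
Let delta0 : 0 < delta. Proof. exact: lt_trans Hdelta. Qed.
Let Wg := weight P A gamma.
Let Wd := weight P A delta.

Lemma hWg i : (\int[P]_x (A i x `^ gamma)%:E = (Wg i)%:E)%E.
Proof.
have gn : gamma != 0 by rewrite gt_eqF.
have Qg : (Qfun P A gamma < +oo)%E by rewrite ltey_eq HQfin.
by have [h _] := Qfun_weight Ameas gn Qg; exact: h.
Qed.

Lemma hWd i : (\int[P]_x (A i x `^ delta)%:E = (Wd i)%:E)%E.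
Proof.
have dn : delta != 0 by rewrite gt_eqF.
by have [h _] := Qfun_weight Ameas dn (Qfun_delta gamma0 Hdelta Hmu); exact: h.
Qed.

Lemma limit_fixpt : fixpt P Ameas (index_enum 'I_N) mug nuinf.
Proof.
have [-> _ _ _ _] := weights_mu Ameas gamma0 Hdelta HQfin Hmu.
exact: (nuinf_fixed Ameas Anneg gamma0 Hz_supp (Hgamma_stab Hgamma_range HH) Hz_eq Hinf).
Qed.

Lemma initial_law f : (\int[nu 0]_x (f x)%:E = \int[mu0]_x (f x)%:E)%E.
Proof. by apply: eq_measure_integral => S mS _; apply: charfun_inj => // xi; rewrite Hinit. Qed.

Lemma zol_class0 : zol_class delta (fun _ : R => 0 : R).
Proof.
have [m [al [-> al01]]] := exponent_split delta0; apply: Zc_zol => //.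
have := Sym_Zc al01 (Sym0 m.+1 (m%:R + al)); rewrite mulr0; apply: Zc_le.
exact: ler01.
Qed.

Lemma zolotarev_ge0 : (0 <= zolotarev delta mu0 id nuinf id)%E.
Proof.
apply: ereal_sup_ubound; exists (fun=> 0); first exact: zol_class0.
by rewrite !integral0 sube0.
Qed.

Section finite_distance.
Variable Z : R.
Hypotheses (Z0 : 0 <= Z)
  (hZ : forall f, zol_class delta f -> (\int[nu 0]_x (f x)%:E - \int[nuinf]_x (f x)%:E <= Z%:E)%E).

Lemma zclose_initial : zclose delta mu0 nuinf.
Proof.
exists Z => // m al k f dE al01 k0 hf bf.
have := Zc_bdm hZ dE al01 k0 hf bf.
by rewrite /Rintegral initial_law.
Qed.

Lemma limit_lossless (h : R -> R) (c t : R) : measurable_fun setT h -> (forall x, 0 <= h x <= c * jap delta x) -> 0 <= t ->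
  (\int[nuinf]_x (h (expR (- mug * t) * x)%R)%:E < +oo)%E -> (\int[nuinf]_x (h x)%:E < +oo)%E.
Proof.
have [_ sg sd lt d1] := weights_mu Ameas gamma0 Hdelta HQfin Hmu.
have [e1 e2] := exponents_pos Ameas gamma0 Hdelta HQfin Hmu.
have [t1 t2] := Hgamma_tail_ok Hz_supp Hz_mean Hinf Hgamma_range HH Hdelta zclose_initial.
have sg' : \sum_(i <- index_enum 'I_N) Wg i <= mug * gamma + 1 by rewrite sg.
have sd' : \sum_(i <- index_enum 'I_N) Wd i < mug * delta + 1 by rewrite sd.
have e3 : 0 < mug * delta + 1 by exact: le_lt_trans e2.
have ok := tail_side_ok Anneg gamma0 Hdelta e1 e3 hWg sg' hWd sd'.
apply: sides_lossless; apply: ok => //; first exact: limit_fixpt.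
by apply: fixpt_refl; exact: limit_fixpt.
Qed.

Lemma contraction_bound f t : zol_class delta f -> 0 <= t ->
  (\int[nu t]_x (f (expR (- mug * t) * x)%R)%:E - \int[nuinf]_x (f x)%:E <= (Z * expR (- t * delta * (mug - mud)))%:E)%E.
Proof.
move=> cf t0; have cons := ode_consistent Ameas Anneg Hinit Hcont Hode.
have := contraction_class Anneg cons limit_fixpt hWd delta0 Z0 hZ limit_lossless cf t0.
have [_ _ sd _ _] := weights_mu Ameas gamma0 Hdelta HQfin Hmu.
rewrite -[\sum_(i <- _) Wd i]/(\sum_i weight P A delta i) sd.
by have -> : t * (mud * delta + 1 - 1 - delta * mug) = - t * delta * (mug - mud) by ring.
Qed.

End finite_distance.

Lemma zolotarev_contraction t : 0 <= t ->
  (zolotarev delta (nu t) (fun v => (expR (- mug * t) * v)%R) nuinf id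
   <= zolotarev delta mu0 id nuinf id * (expR (- t * delta * (mug - mud)))%:E)%E.
Proof.
(* The distance at time 0 is nonnegative; if it is infinite so is the right side, since the
   exponential is positive. *)
move=> t0; have := zolotarev_ge0; case E : (zolotarev delta mu0 id nuinf id) => [Z||]// Z0; last first.
  by rewrite gt0_mulye ?lte_fin ?expR_gt0// leey.
apply: ub_ereal_sup => _ [f cf <-]; rewrite -EFinM; apply: contraction_bound => // f' cf'.
by rewrite initial_law -E; apply: ereal_sup_ubound; exists f'.
Qed.

Lemma zolotarev_moment_bound : gamma = 2 -> delta <= 3 -> (\int[mu0]_v (`|v| `^ delta)%:E < +oo)%E ->
  let c := ((\int[mu0]_v (`|v| `^ delta)%:E + \int[nuinf]_v (`|v| `^ delta)%:E) * ((Gamma (1 + delta))^-1)%:E)%E in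
  (c < +oo)%E /\ (zolotarev delta mu0 id nuinf id <= c)%E.
Proof.
move=> g2 d3 M0 c.
have de2 : 2 < delta by rewrite -g2.
pose al := delta - 2; have al01 : 0 < al <= 1 by rewrite /al; apply/andP; split; lra.
have al0 : 0 < al by case/andP: al01.
have [s2 [i2 s2E s20 m1 gE]] : exists sigma2 : R,
    [/\ mu0.-integrable setT (fun v => (v ^+ 2 : R)%:E), sigma2 = \int[mu0]_v (v ^+ 2), 0 < sigma2,
        (\int[mu0]_v (v : R)%:E = 0)%E & g = fun xi => (expR (- sigma2 * xi ^+ 2 / 2))%:C].
  case: HH => [[g1 _]|[[_ //]|[[/andP[_ gl] _] _]]]; last by rewrite g2 ltxx in gl.
  by move: g2; rewrite g1 => /eqP; rewrite eq_sym (eqr_nat R 2 1).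
have zm := zeta_mean_abs Hz_supp Hz_mean.
have hc := limit_cos Hz_supp Hinf g2 gE.
have hc' := limit_cos_refl Hz_supp Hinf g2 gE.
have p2 := mixture_pmom2 s20 zm hc; have p2' := mixture_pmom2 s20 zm hc'.
have [_ sg sd lt d1] := weights_mu Ameas gamma0 Hdelta HQfin Hmu.
have [e1 e2] := exponents_pos Ameas gamma0 Hdelta HQfin Hmu.
have sg' : \sum_(i <- index_enum 'I_N) Wg i <= mug * gamma + 1 by rewrite sg.
have sd' : \sum_(i <- index_enum 'I_N) Wd i < mug * delta + 1 by rewrite sd.
have e3 : 0 < mug * delta + 1 by exact: le_lt_trans e2.
(* The second moment makes the tail light at [g = 2] and starts the bootstrap that ends at
   [delta]. *)
have pm nu' : fixpt P Ameas (index_enum 'I_N) mug nu' -> (pmom nu' 2 < +oo)%E -> (pmom nu' delta < +oo)%E.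
  move=> fp hp; apply: (light_pmom Anneg gamma0 Hdelta e1 e3 hWg sg' hWd sd' fp).
    by rewrite g2; apply: pmom_light.
  by move=> _; exists 2; split => //; [rewrite ler1n|rewrite g2 ltrDl].
have Minf : (\int[nuinf]_v (`|v| `^ delta)%:E < +oo)%E.
  exact: (abs_moment_sides delta0 (pm _ limit_fixpt p2) (pm _ (fixpt_refl limit_fixpt) p2')).
have M00 : (0 <= \int[mu0]_v (`|v| `^ delta)%:E)%E by apply: int_ge0 => v; exact: powR_ge0.
have Minf0 : (0 <= \int[nuinf]_v (`|v| `^ delta)%:E)%E by apply: int_ge0 => v; exact: powR_ge0.
have v2 := mixture_variance s20 zm hc (integrable_sqr de2 Minf).
have v1 : \int[nuinf]_v v = 0.
  (* [g] is real, so the characteristic function of [nuinf] is real and even, and the law is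
     symmetric. *)
  apply: symmetric_mean => S mS; apply: charfun_inj => // xi.
  have bs : bdm (fun v : R => sin (xi * v)).
    by have [] : cbdm (fun v : R => cexpi (xi * v)) by apply: cbdm_cexpi; exact: mulrl_measurable.
  have im0 : \int[nuinf]_v sin (xi * v) = 0.
    rewrite -[LHS]/(complex.Im (charfun nuinf xi)) Hinf gE /cexpect /cint.
    by rewrite -[LHS]/(\int[zeta]_z 0) Rint_cst.
  rewrite /charfun /cexpect /cint; apply: complex_split.
    by rewrite -[LHS]/(\int[nuinf]_v cos (xi * v)) -[RHS]/(\int[refl nuinf]_v cos (xi * v)) hc hc'.
  rewrite -[LHS]/(\int[nuinf]_v sin (xi * v)) -[RHS]/(\int[refl nuinf]_v sin (xi * v)) int_refl// im0.
  transitivity (-1 * \int[nuinf]_v sin (xi * v)); first by rewrite im0 mulr0.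
  by rewrite -bdm_RintZ//; apply: eq_Rintegral => v _; rewrite mulN1r mulrN sinN mulN1r.
have u1 : \int[mu0]_v v = 0 by rewrite /Rintegral m1.
have dE : 1 + delta = 3 + al by rewrite /al; ring.
have /andP[G0 G1] := Gamma_bounds al01; rewrite -dE in G0 G1.
have Gi : (0 <= ((Gamma (1 + delta))^-1)%:E :> \bar R)%E by rewrite lee_fin invr_ge0 ltW.
split.
  by apply: lty_mul => //; [exact: adde_ge0|exact: (lte_add_pinfty M0 Minf)|exact: ltry].
apply: ub_ereal_sup => _ [f cf <-].
have [m [a [dma /andP[a0 a1] hf]]] := zol_Zc cf.
(* [2 < delta <= 3] leaves only two derivatives and Hölder exponent [delta - 2]. *)
have m2 : m = 2%N by apply: (@integer_part_two R m a); [rewrite a0|rewrite -dma de2].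
have aE : a = al by rewrite /al dma m2; ring.
rewrite m2 aE in hf; have [b [cc ht]] := taylor2 al0 hf.
have mf : measurable_fun setT f by apply: continuous_measurable_fun; exact: Zc_cont al0 ler01 hf.
pose k := ((1 + al) * (2 + al))^-1.
have k0 : 0 <= k by rewrite invr_ge0 mulr_ge0// addr_ge0// ltW.
have ht' x : `|f x - (f 0 + b * x + cc * x ^+ 2)| <= k * `|x| `^ delta.
  have dE2 : 2 + al = delta by rewrite /al; ring.
  by have := ht x; rewrite [_ / _]mulrC -/k dE2.
have [i1 b1] := moment_expansion de2 M0 mf k0 ht' u1 (esym s2E).
have [i3 b3] := moment_expansion de2 Minf mf k0 ht' v1 v2.
have E (m' : probability R R) : m'.-integrable setT (EFin \o f) -> (\int[m']_x (f x)%:E = (\int[m']_x f x)%:E)%E.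
  by move=> i; rewrite /Rintegral fineK//; exact: integrable_fin_num i.
rewrite /= (E _ i1) (E _ i3) /c; move: b1 b3 M0 Minf M00 Minf0.
case: (\int[mu0]_v (`|v| `^ delta)%:E)%E => [A1||]//; case: (\int[nuinf]_v (`|v| `^ delta)%:E)%E => [A2||]//.
move=> b1 b3 _ _ A10 A20; rewrite lee_fin in A10; rewrite lee_fin in A20; rewrite -EFinB -EFinD -EFinM lee_fin.
apply: (@le_trans _ _ (k * (A1 + A2))).
  by rewrite mulrDr; exact: lerB_dist b1 b3.
(* The Taylor constant is replaced by [Gamma (1 + delta)^-1] through
   [Gamma (3 + al) <= (1 + al) (2 + al)]. *)
rewrite mulrC ler_wpM2l ?addr_ge0// /k lef_pV2 ?posrE// mulr_gt0// addr_gt0//.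
Qed.

End contraction.

Theorem theorem4
  (R : realType) (N : nat) (HN : (2 <= N)%N)
  (* the random vector (A_1,...,A_N) on a probability space (T, P) *)
  (d : measure_display) (T : measurableType d) (P : probability T R)
  (A : 'I_N -> T -> R)
  (Ameas : forall i, measurable_fun setT (A i))
  (Anneg : forall i x, 0 <= A i x)
  (HA1 : (P [set x | (\sum_(i < N) ((0 < A i x)%R : nat) <= 1)%N] < 1)%E)
  (HA2 : (1 < \int[P]_x (\sum_(i < N) (((0 < A i x)%R)%:R : R)%R)%:E)%E)
  (HA3 : (P [set x | forall i, A i x = 0%R \/ A i x = 1%R] < 1)%E)
  (* initial law mu0 (distribution function F0, law of X0) satisfying (H_gamma);
     g is the corresponding \hat g_gamma *)
  (mu0 : probability R R) (gamma delta : R) (g : R -> R[i])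
  (Hgamma_range : 0 < gamma <= 2) (HH : Hgamma mu0 gamma g)
  (HQfin : Qfun P A gamma \is a fin_num)
  (Hdelta : gamma < delta) (Hmu : (mufun P A delta < mufun P A gamma)%E)
  (* nu t = law of V_t; its characteristic function solves the Cauchy problem *)
  (nu : R -> probability R R)
  (Hinit : charfun (nu 0) = charfun mu0)
  (Hcont : forall xi,
      (complex.Re (charfun (nu t) xi) @[t --> 0^'+] --> complex.Re (charfun mu0 xi)) /\
      (complex.Im (charfun (nu t) xi) @[t --> 0^'+] --> complex.Im (charfun mu0 xi)))
  (Hode : forall xi t, 0 < t ->
      let rhs := - charfun (nu t) xi
                 + cexpect P (fun x => \prod_(i < N) charfun (nu t) (A i x * xi)) in
      is_derive t 1 (fun s => complex.Re (charfun (nu s) xi)) (complex.Re rhs) /\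
      is_derive t 1 (fun s => complex.Im (charfun (nu s) xi)) (complex.Im rhs))
  (* zeta = zeta_{infty,gamma} *)
  (zeta : probability R R)
  (Hz_supp : zeta `]-oo, 0[%classic = 0%E)
  (Hz_mean : (\int[zeta]_z (z : R)%:E = 1)%E)
  (Hz_eq : forall xi, charfun zeta xi =
      cint (@lebesgue_measure R) `[0, 1]%classic (fun tau =>
        cexpect P (fun x => \prod_(i < N)
          charfun zeta (xi * pw (A i x) gamma * tau `^ fine (Qfun P A gamma)))))
  (* nuinf = law of V_infty *)
  (nuinf : probability R R)
  (Hinf : forall xi, charfun nuinf xi =
      cexpect zeta (fun z => g (xi * z `^ gamma^-1))) :
  let mug := fine (mufun P A gamma) in
  let mud := fine (mufun P A delta) in
  (forall t, 0 <= t ->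
     (zolotarev delta (nu t) (fun v => (expR (- mug * t) * v)%R) nuinf id
      <= zolotarev delta mu0 id nuinf id * (expR (- t * delta * (mug - mud)))%:E)%E)
  /\
  (gamma = 2 -> delta <= 3 -> (\int[mu0]_v (`|v| `^ delta)%:E < +oo)%E ->
     let c := ((\int[mu0]_v (`|v| `^ delta)%:E + \int[nuinf]_v (`|v| `^ delta)%:E)
               * ((Gamma (1 + delta))^-1)%:E)%E in
     (c < +oo)%E /\
     forall t, 0 <= t ->
       (zolotarev delta (nu t) (fun v => (expR (- mug * t) * v)%R) nuinf id
        <= c * (expR (- t * delta * (mug - mud)))%:E)%E).
Proof.
move=> mug mud; split=> [t t0|g2 d3 M0 c]; first exact: (zolotarev_contraction Ameas Anneg Hgamma_range HH HQfin Hdelta Hmu Hinit Hcont Hode Hz_supp Hz_mean Hz_eq Hinf t0).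
have [cfin zc] := zolotarev_moment_bound Ameas Anneg Hgamma_range HH HQfin Hdelta Hmu Hz_supp Hz_mean Hz_eq Hinf g2 d3 M0.
split => // t t0; apply: le_trans (zolotarev_contraction Ameas Anneg Hgamma_range HH HQfin Hdelta Hmu Hinit Hcont Hode Hz_supp Hz_mean Hz_eq Hinf t0) _.
by rewrite lee_wpmul2r// lee_fin expR_ge0.
Qed.
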